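(* Let $\varepsilon\searrow 0$ be a sequence of positive reals and let $(\mu_\varepsilon)_\varepsilon\subset\mathcal M(\Omega;E)$ satisfy $\sup_\varepsilon|\mu_\varepsilon|(\Omega)<\infty$. Then, up to taking a subsequence of $(\mu_\varepsilon)_\varepsilon$ (not relabeled), there exists a two-scale* Young measure $\boldsymbol\nu=(\nu,\lambda,\rho,\nu^\infty)\in\mathbf Y^2(\Omega;E)$ with the following property. For every continuous integrand $f:\Omega\times Z\times E\to\mathbb R$ for which the recession function $$f^\infty(x,\xi,z):=\lim_{\substack{(x',\xi',z')\to(x,\xi,z)\\ t\to\infty}}\frac{f(x',\xi',tz')}{t}$$ exists (as a finite limit) for all $(x,\xi,z)\in\overline\Omega\times Z\times E$, there exists a Radon measure $\mu_f$ on $\overline\Omega$ such that $$f\big(\cdot,\cdot/\varepsilon,\mu_\varepsilon^{ac}\big)\,\mathscr L^d\llcorner\Omega+f^\infty\big(\cdot,\cdot/\varepsilon,(\mu_\varepsilon)_s\big)\,|\mu_\varepsilon^s|\ \overset{*}{\rightharpoonup}\ \mu_f\quad\text{as measures on }\overline\Omega,$$ and $\mu_f$ is characterized by $$\mu_f(\omega)=\int_{\omega\cap\Omega}\int_Z\int_E f(x,\xi,z)\,d\nu_{x,\xi}(z)\,d\xi\,dx+\int_{\omega}\int_Z\int_{\partial\mathbb B_E}f^\infty(x,\xi,z)\,d\nu^\infty_{x,\xi}(z)\,d\rho_x(\xi)\,d\lambda(x)$$ for all Borel sets $\omega\subset\overline\Omega$.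
   Context: $\Omega\subset\mathbb R^d$ is open and bounded with $\mathscr L^d(\partial\Omega)=0$; $Z=\mathbb T^d=\mathbb R^d/\mathbb Z^d$ with Lebesgue measure $d\xi$; $E$ is a finite-dimensional Euclidean space with open unit ball $\mathbb B_E$ and unit sphere $\partial\mathbb B_E$. When $x/\varepsilon$ is an argument in $Z$, it means the class of $x/\varepsilon$ in $Z$. For $\mu\in\mathcal M(\Omega;E)$ (bounded $E$-valued Radon measures) write the Radon–Nikodym–Lebesgue decomposition $\mu=\mu^{ac}\mathscr L^d+\mu^s=\mu^{ac}\mathscr L^d+\mu_s|\mu^s|$, with $\mu^{ac}\in L^1$, $|\mu^s|\perp\mathscr L^d$, $|\mu_s|=1$ $|\mu^s|$-a.e. A two-scale* Young measure on $\Omega$ with values in $E$ is a four-tuple $\boldsymbol\nu=(\nu,\lambda,\rho,\nu^\infty)$ where: (i) $(x,\xi)\mapsto\nu_{x,\xi}$ is a weak-* measurable (w.r.t. Lebesgue measure) map from $\overline\Omega\times Z$ to $\mathrm{Prob}(E)$ with $(x,\xi)\mapsto\int_E|z|\,d\nu_{x,\xi}(z)$ in $L^1(\overline\Omega\times Z)$; (ii) $\lambda$ is a bounded positive measure on $\overline\Omega$; (iii) $x\mapsto\rho_x$ is a weak-* $\lambda$-measurable map from $\overline\Omega$ to $\mathrm{Prob}(Z)$; (iv) $(x,\xi)\mapsto\nu^\infty_{x,\xi}$ is a weak-* $(\lambda\otimes\rho_x)$-measurable map from $\overline\Omega\times Z$ to $\mathrm{Prob}(\partial\mathbb B_E)$.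 Here $(\lambda\otimes\rho_x)(U)=\int\int\chi_U(x,\xi)\,d\rho_x(\xi)\,d\lambda(x)$, and a measure-valued map is weak-* measurable if its value on each Borel set is measurable. The set of all such four-tuples is $\mathbf Y^2(\Omega;E)$. *)

(* Defs.v *)
From HB Require Import structures.
From mathcomp Require Import all_boot all_order all_algebra.
From mathcomp Require Import generic_quotient.
From mathcomp Require Import all_classical all_reals all_analysis.
From mathcomp Require Import measurable_realfun.

Set Implicit Arguments.
Unset Strict Implicit.
Unset Printing Implicit Defensive.

Import Order.TTheory GRing.Theory Num.Theory.
Import numFieldNormedType.Exports.

Local Open Scope classical_set_scope.
Local Open Scope ring_scope.

(* Finite-dimensional real inner product spaces whose norm (hence topology) is
   the one induced by the inner product; definiteness follows from innerxx. *)
HB.mixin Record NormedVector_isEuclidean (R : realType) E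
    of NormedModule R E & Vector R E := {
  inner : E -> E -> R ;
  innerC : forall x y, inner x y = inner y x ;
  inner_linear : forall (a : R) x y z,
    inner (a *: x + y) z = a * inner x z + inner y z ;
  innerxx : forall x, inner x x = `|x| ^+ 2
}.

#[short(type="euclideanType")]
HB.structure Definition Euclidean (R : realType) :=
  {E of NormedModule R E & Vector R E & NormedVector_isEuclidean R E}.

Notation borel T := (g_sigma_algebraType (@open T)).

Definition unit_sphere (R : realType) (E : euclideanType R) : set E :=
  [set z | `|z| = 1].
Arguments unit_sphere {R} E.

Section lebesgue.
Context (R : realType).
Local Open Scope ereal_scope.

(* d-fold product of the one-dimensional Lebesgue measure *)
Fixpoint lebesgue_tuple (d : nat) : set (d.-tuple R) -> \bar R :=
  match d with
  | 0 => dirac [tuple]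
  | n.+1 => pushforward (lebesgue_measure \x @lebesgue_tuple n)
              (fun p : R * n.-tuple R => [tuple of p.1 :: p.2])
  end.

Definition lebesgue_rV (d : nat) : set (borel 'rV[R]_d) -> \bar R :=
  pushforward (@lebesgue_tuple d)
    (fun t => \row_(i < d) tnth t i : borel 'rV[R]_d).

End lebesgue.
Arguments lebesgue_rV : clear implicits.

Section torus.
Context (R : realType) (d : nat).
Local Open Scope quotient_scope.

Definition lattice_rel (x y : 'rV[R]_d) : bool := x - y \is a mxOver Num.int.

Lemma lattice_rel_refl : reflexive lattice_rel.
Proof. by move=> x; apply/mxOverP => i j; rewrite subrr mxE rpred0. Qed.

Lemma lattice_rel_sym : symmetric lattice_rel.
Proof.
by move=> x y; apply/mxOverP/mxOverP => xy i j; rewrite -opprB mxE rpredN.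
Qed.

Lemma lattice_rel_trans : transitive lattice_rel.
Proof.
move=> y x z /mxOverP xy /mxOverP yz; apply/mxOverP => i j.
by rewrite -(subrKA y) mxE rpredD.
Qed.

Canonical lattice_equiv :=
  EquivRel lattice_rel lattice_rel_refl lattice_rel_sym lattice_rel_trans.

Definition torus : Type := quotient_topology {eq_quot lattice_equiv}.
HB.instance Definition _ :=
  PointedTopological.copy torus (quotient_topology {eq_quot lattice_equiv}).

Definition torus_class (x : 'rV[R]_d) : torus :=
  \pi_(quotient_topology {eq_quot lattice_equiv}) x.

Definition lebesgue_torus : set (borel torus) -> \bar R := fun A =>
  lebesgue_rV R d ([set x : 'rV[R]_d | forall i, 0 <= x ord0 i < 1]
                   `&` torus_class @^-1` A).

End torus.
Arguments torus : clear implicits.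
Arguments lebesgue_torus : clear implicits.

Section weak_star_measurability.
Local Open Scope ereal_scope.
Context d1 d2 (X : measurableType d1) (Y : measurableType d2) (R : realType).

(* mu-measurability is measurability for the mu-completion of the sigma-algebra
   of X *)
Definition weak_star_measurable (mu : set X -> \bar R) (D : set X)
    (k : X -> set Y -> \bar R) : Prop :=
  forall B, measurable B ->
    measurable_fun (D : set (g_sigma_algebraType (completed_algebra_gen mu)))
      (fun x => k x B).

Definition semidirect_product (lambda : set X -> \bar R)
    (rho : X -> set Y -> \bar R) : set (X * Y) -> \bar R :=
  fun U => \int[lambda]_x \int[rho x]_xi (\1_U (x, xi))%:E.

End weak_star_measurability.

Section vector_measures.
Context (R : realType) (E : euclideanType R).
Context disp (T : measurableType disp).
Implicit Types (mu : set T -> E) (m : set T -> \bar R) (A D : set T).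

Definition variation_measure mu A : \bar R :=
  ereal_sup [set (\sum_(0 <= i <oo) `|mu (F i)|%:E)%E | F in
    [set F : (set T)^nat | [/\ forall i, measurable (F i), trivIset setT F
                             & \bigcup_i F i = A]]].

(* measures on D, extended by zero to T *)
Definition bounded_measure_on D mu : Prop :=
  [/\ forall F : (set T)^nat, (forall i, measurable (F i)) -> trivIset setT F ->
        series (mu \o F) @ \oo --> mu (\bigcup_i F i),
      forall A, measurable A -> mu A = mu (A `&` D)
    & (variation_measure mu D < +oo)%E].

(* componentwise integral *)
Definition vector_integral m A (g : T -> E) : E :=
  \sum_(i < \dim (fullv : {vspace E}))
    fine (\int[m]_(x in A) (coord (vbasis fullv) i (g x))%:E)
      *: (vbasis (fullv : {vspace E}))`_i.

Definition mutually_singular m1 m2 : Prop :=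
  exists N, [/\ measurable N, m1 (~` N) = 0%E & m2 N = 0%E].

(* mu = ac m + s and s = p |s| on D *)
Definition is_lebesgue_decomposition m D mu
    (ac : T -> E) (s : set T -> E) (p : T -> E) : Prop :=
  [/\ measurable_fun D (ac : T -> borel E) /\
        (\int[m]_(x in D) `|ac x|%:E < +oo)%E,
      bounded_measure_on D s /\ mutually_singular (variation_measure s) m,
      forall A, measurable A -> A `<=` D ->
        mu A = vector_integral m A ac + s A,
      measurable_fun D (p : T -> borel E) /\
        {ae variation_measure s, forall x, D x -> `|p x| = 1}
    & forall A, measurable A -> A `<=` D ->
        s A = vector_integral (variation_measure s) A p].

Definition lebesgue_decomposition m D mu : (T -> E) * (set T -> E) * (T -> E) :=
  xget (cst 0, cst 0, cst 0)
    [set w | is_lebesgue_decomposition m D mu w.1.1 w.1.2 w.2].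

Definition ac_density m D mu := (lebesgue_decomposition m D mu).1.1.
Definition singular_part m D mu := (lebesgue_decomposition m D mu).1.2.
Definition singular_polar m D mu := (lebesgue_decomposition m D mu).2.

End vector_measures.

Section charge_integral.
Context (R : realType) disp (T : measurableType disp).
Local Open Scope ereal_scope.

(* integral against a signed measure through its Jordan decomposition *)
Definition charge_integral (nu : {charge set T -> \bar R}) (D : set T)
    (f : T -> R) : \bar R :=
  let h := projT2 (cid (projT2 (cid (Hahn_decomposition nu)))) in
  \int[jordan_pos h]_(x in D) (f x)%:E - \int[jordan_neg h]_(x in D) (f x)%:E.

End charge_integral.

Section two_scale.
Context (R : realType) (d : nat) (E : euclideanType R).
Local Notation X := (borel 'rV[R]_d).
Local Notation Z := (borel (torus R d)).
Implicit Type Omega : set 'rV[R]_d.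

(* The maps are total; only their values over the closure of Omega matter. *)
Record two_scale_young_measure Omega := TwoScaleYoungMeasure {
  young_osc : X -> Z -> probability (borel E) R ;
  young_mass : {finite_measure set X -> \bar R} ;
  young_scale : X -> probability Z R ;
  young_conc : X -> Z -> probability (borel E) R ;
  young_osc_measurable :
    weak_star_measurable (lebesgue_rV R d \x lebesgue_torus R d)%E
      (closure Omega `*` setT) (fun p => young_osc p.1 p.2) ;
  young_osc_integrable :
    (\int[lebesgue_rV R d \x lebesgue_torus R d]_(p in closure Omega `*` setT)
       \int[young_osc p.1 p.2]_z `|z|%:E < +oo)%E ;
  young_mass_support : young_mass (~` closure Omega) = 0%E ;
  young_scale_measurable :
    weak_star_measurable young_mass (closure Omega) (fun x => young_scale x) ;
  young_conc_sphere : forall x xi, closure Omega x ->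
    young_conc x xi (unit_sphere E) = 1%E ;
  young_conc_measurable :
    weak_star_measurable
      (semidirect_product young_mass (fun x => young_scale x))
      (closure Omega `*` setT) (fun p => young_conc p.1 p.2)
}.

Implicit Type f : 'rV[R]_d * torus R d * E -> R.

Definition recession_filter Omega (x : 'rV[R]_d) (xi : torus R d) (z : E) :=
  filter_prod (within (Omega `*` setT `*` setT) (nbhs (x, xi, z)))
              (pinfty_nbhs R).

Definition recession_quotient f (q : 'rV[R]_d * torus R d * E * R) : R :=
  f (q.1.1.1, q.1.1.2, q.2 *: q.1.2) / q.2.

Definition has_recession Omega f : Prop :=
  forall x xi z, closure Omega x ->
    cvg (recession_quotient f @ recession_filter Omega x xi z).

Definition recession Omega f : 'rV[R]_d * torus R d * E -> R := fun p =>
  lim (recession_quotient f @ recession_filter Omega p.1.1 p.1.2 p.2).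

(* the measure f(., ./eps, mu^ac) L^d + f^oo(., ./eps, mu_s) |mu^s|, tested
   against phi *)
Definition two_scale_action Omega (eps : R) (mu : set X -> E) f
    (phi : 'rV[R]_d -> R) : \bar R :=
  let L := lebesgue_rV R d in
  (\int[L]_(x in Omega)
     (phi x * f (x, torus_class (eps^-1 *: x), ac_density L Omega mu x))%:E +
   \int[variation_measure (singular_part L Omega mu)]_(x in Omega)
     (phi x * recession Omega f (x, torus_class (eps^-1 *: x),
                                 singular_polar L Omega mu x))%:E)%E.

(* weak-* convergence on the compact set K of measures on K, each term of the
   sequence being given by its action on C(K) *)
Definition weak_star_cvg (K : set 'rV[R]_d)
    (l : nat -> ('rV[R]_d -> R) -> \bar R)
    (m : {charge set X -> \bar R}) : Prop :=
  forall phi : 'rV[R]_d -> R, {within K, continuous phi} ->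
    l n phi @[n --> \oo] --> charge_integral m K phi.

End two_scale.

(* Main.v *)
(* A vector measure mu is encoded, through a continuous surjection of the line
   onto a cube, by the positive measure on [0, 1] that carries the mass
   (1 + |mu^ac|) L + |mu^s| together with the position x, the fast variable
   x / eps and the direction mu^ac / (1 + |mu^ac|), resp. the polar density of
   mu^s, in the closed unit ball of E.  Helly's selection theorem then gives the
   limit M.  An integrand f with recession function becomes
   F = (1 - |w|) f(x, xi, w / (1 - |w|)) inside the ball and f^oo on the sphere;
   F is continuous up to an error controlled near the boundary of Omega by
   (1 - |w|), whose integral against the encoded measures is a Lebesgue integral.
   Equidistribution of x / eps shows that (1 - |w|) M projects to the product of
   the Lebesgue measures of Omega and of the torus.  Disintegrating M on the open
   ball over this product gives nu, and disintegrating M on the sphere gives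
   lambda, rho and nu^oo. *)
From HB Require Import structures.
Require Import Defs.
From mathcomp Require Import finmap.
From mathcomp Require Import all_boot all_order all_algebra.
From mathcomp Require Import generic_quotient.
From mathcomp Require Import all_classical all_reals all_analysis.
From mathcomp Require Import measurable_realfun ring lra.

Set Implicit Arguments.
Unset Strict Implicit.
Unset Printing Implicit Defensive.

Import Order.TTheory GRing.Theory Num.Theory.
Import numFieldNormedType.Exports.

Local Open Scope classical_set_scope.
Local Open Scope ring_scope.

(** The coding by the line serves twice. It gives compactness through distribution functions, and a
    conditional law on the line is the image of Lebesgue measure on [0, 1[ by its quantile function,
    so the kernels nu, rho and nu^oo are measurable maps in disguise and their measurability is
    Tonelli's theorem. The boundary of Omega shapes the rest: f may have no limit there, so F is not
    a test function. Subtracting the recession function, continuous up to the boundary, leaves a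
    remainder at most e + C (1 - |w|) for every e > 0, which can be cut off near the boundary. With
    a = mu^ac and w = a / (1 + |a|), the factor 1 - |w| is the inverse of the density 1 + |a|, so
    the cut costs the Lebesgue measure of a boundary layer, uniformly along the sequence. The fast
    variable is coded in the cube, where it jumps; equidistribution is therefore proved for bounded
    measurable functions of it, by averaging over translations. Signs enter only at the end, which
    is why the kernels are corrected on null sets to have finite moments at every point. *)

(** * Measures given by functionals on nonnegative measurable functions *)

Section measure_of_functional.
Local Open Scope ereal_scope.
Context d (T : measurableType d) (R : realType).

Definition nnmeasurable (h : T -> \bar R) :=
  measurable_fun setT h /\ forall x, 0 <= h x.

Lemma nnmeasurable_indic A : measurable A -> nnmeasurable (fun x => (\1_A x)%:E).
Proof.
move=> mA; split; last by move=> x; rewrite lee_fin indicE.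
exact/measurable_EFinP.
Qed.

Variable Phi : (T -> \bar R) -> \bar R.
Hypothesis I_ge0 : forall h, nnmeasurable h -> 0 <= Phi h.
Hypothesis ID : forall h1 h2, nnmeasurable h1 -> nnmeasurable h2 ->
  Phi (fun x => h1 x + h2 x) = Phi h1 + Phi h2.
Hypothesis IZ : forall (k : R) h, (0 <= k)%R -> nnmeasurable h ->
  Phi (fun x => k%:E * h x) = k%:E * Phi h.
Hypothesis I_monotone : forall (h : nat -> T -> \bar R),
  (forall n, nnmeasurable (h n)) ->
  (forall x, nondecreasing_seq (h^~ x)) ->
  Phi (h n) @[n --> \oo] --> Phi (fun x => limn (h^~ x)).

(** The absolute value keeps [m] nonnegative on nonmeasurable sets as well, where nothing is known
    about [Phi]. *)
Let m A := `|Phi (fun x => (\1_A x)%:E)|.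

Let mE A : measurable A -> m A = Phi (fun x => (\1_A x)%:E).
Proof. by move=> mA; rewrite /m gee0_abs//; exact/I_ge0/nnmeasurable_indic. Qed.

Let I0 : Phi (fun=> 0) = 0.
Proof.
rewrite -(_ : (fun x : T => 0%:E * 0) = fun=> 0); last by apply/funext => x; rewrite mul0e.
by rewrite IZ ?mul0e//; split => //.
Qed.

Let m0 : m set0 = 0.
Proof.
rewrite mE// -[RHS]I0; congr Phi; apply/funext => x.
by rewrite indicE in_set0.
Qed.

Let m_sum (F : nat -> set T) n : (forall i, measurable (F i)) -> trivIset setT F ->
  (\sum_(0 <= i < n) m (F i))%E = Phi (fun x => (\1_(\big[setU/set0]_(i < n) F i) x)%:E).
Proof.
move=> mF tF; elim: n => [|n IH].
  rewrite big_geq// big_ord0 -I0; congr Phi; apply/funext => x.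
  by rewrite indicE in_set0.
rewrite big_nat_recr//= IH mE// -ID; last 2 first.
- by apply: nnmeasurable_indic; exact: bigsetU_measurable.
- exact: nnmeasurable_indic.
congr Phi; apply/funext => x; rewrite -EFinD; congr EFin.
rewrite big_ord_recr/= !indicE in_setU.
have [xF|xF] := boolP (x \in F n); last by rewrite orbF addr0.
suff -> : x \in \big[setU/set0]_(i < n) F i = false by rewrite add0r.
apply/negbTE/negP; rewrite inE -bigcup_mkord => -[k /= kn Fk].
move: xF; rewrite inE => xF.
have := tF k n Logic.I Logic.I; rewrite /trivIset => H.
have /H : (F k `&` F n) !=set0 by exists x.
by move=> E; rewrite E ltnn in kn.
Qed.

Let m_sigma : semi_sigma_additive m.
Proof.
move=> F mF tF mU.
under eq_fun do rewrite (m_sum _ mF tF).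
rewrite mE//.
have mm n : nnmeasurable (fun x => (\1_(\big[setU/set0]_(i < n) F i) x)%:E).
  by apply: nnmeasurable_indic; exact: bigsetU_measurable.
have nd : forall x, nondecreasing_seq (fun n => (\1_(\big[setU/set0]_(i < n) F i) x)%:E : \bar R).
  move=> x p q pq; rewrite lee_fin !indicE ler_nat.
  have [|//] := boolP (x \in \big[setU/set0]_(i < p) F i).
  rewrite !inE -!bigcup_mkord => -[k /= kp Fk].
  by rewrite mem_set//; exists k => //=; exact: leq_trans kp pq.
have := I_monotone mm nd; congr (_ --> _); congr Phi; apply/funext => x.
apply/cvg_lim => //.
have [[k _ Fk]|nF] := pselect ((\bigcup_n F n) x).
- apply: cvg_near_cst; exists k.+1 => // n /= kn.
  rewrite !indicE !mem_set//; first by exists k.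
  by rewrite -bigcup_mkord; exists k.
- apply: cvg_near_cst; apply: nearW => n.
  rewrite !indicE !memNset// -bigcup_mkord.
  by move=> [k _ Fk]; apply: nF; exists k.
Qed.

Let M : {measure set T -> \bar R} :=
  HB.pack m (isMeasure.Build _ _ _ m m0 (fun A => abse_ge0 _) m_sigma).

Import HBNNSimple.

(** Additivity and homogeneity give the identity for simple functions, and monotone continuity of
    both sides carries it to increasing limits. *)
Lemma measure_of_functional : exists mu : {measure set T -> \bar R},
  forall h, nnmeasurable h -> \int[mu]_x h x = Phi h.
Proof.
exists M => h [mh h0].
pose f_ := nnsfun_approx measurableT mh.
have f_m n : nnmeasurable (fun x => (f_ n x)%:E).
  by split => [|x]; [exact/measurable_EFinP/measurable_funP|rewrite lee_fin].
have f_nd x : nondecreasing_seq (fun n => (f_ n x)%:E).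
  by move=> a b ab; rewrite lee_fin; exact/lefP/nd_nnsfun_approx.
have f_lim x : limn (fun n => (f_ n x)%:E) = h x.
  by apply/cvg_lim => //; apply: cvg_nnsfun_approx.
have := I_monotone f_m f_nd.
under [X in Phi X]eq_fun do rewrite f_lim.
have -> : (fun n => Phi (fun x => (f_ n x)%:E)) = (fun n => \int[M]_x (f_ n x)%:E).
  apply/funext => n.
  transitivity (\sum_(k \in range (f_ n)) k%:E * Phi (fun x => (\1_(f_ n @^-1` [set k]) x)%:E)).
    transitivity (Phi (fun x => \sum_(k \in range (f_ n)) k%:E * (\1_(f_ n @^-1` [set k]) x)%:E)).
      by congr Phi; apply/funext => x; rewrite fimfunE -fsumEFin.
    have fin := @fimfunP _ _ (f_ n).
    rewrite (fsbig_finite _ _ fin)/=.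
    under eq_fun do rewrite (fsbig_finite _ _ fin)/=.
    have : {in enum_fset (fset_set (range (f_ n))), forall k, (0 <= k)%R}.
      move=> k; rewrite -[_ \in _]/(k \in fset_set (range (f_ n))).
      by rewrite in_fset_set// inE => -[x _ <-].
    elim: (enum_fset _) => [|k s IH] ks.
      by under eq_fun do rewrite big_nil; rewrite big_nil I0.
    rewrite big_cons; under eq_fun do rewrite big_cons.
    have k0 : (0 <= k)%R by apply: ks; rewrite in_cons eqxx.
    have ks' : {in s, forall k, (0 <= k)%R}.
      by move=> i si; apply: ks; rewrite in_cons si orbT.
    have mi i : measurable (f_ n @^-1` [set i]) by exact: measurable_funPTI.
    rewrite ID; last 2 first.
    - split=> [|x]; last by rewrite mule_ge0// lee_fin.
      exact/measurable_funeM/measurable_EFinP.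
    - split=> [|x].
        by apply: emeasurable_sum => i; exact/measurable_funeM/measurable_EFinP.
      rewrite big_seq_cond sume_ge0// => i /andP[/ks' i0 _].
      by rewrite mule_ge0// lee_fin.
    by rewrite IZ// ?IH//; exact: nnmeasurable_indic.
  rewrite -[RHS]/(\int[M]_x (EFin \o f_ n) x).
  rewrite integral_nnsfun// patch_setT sintegralE; apply: eq_fsbigr => k _.
  by congr (_ * _); rewrite -mE//; exact: measurable_funPTI.
move=> cvI.
have := cvg_monotone_convergence (mu := M) measurableT (fun n => (f_m n).1)
  (fun n x _ => (f_m n).2 x) (fun x _ => f_nd x).
under [X in _ --> X -> _]eq_integral do rewrite f_lim.
by move=> /cvg_lim <-//; exact/cvg_lim.
Qed.

End measure_of_functional.

Section nnmeasurable_theory.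
Local Open Scope ereal_scope.
Context (R : realType).

Lemma nnmeasurable_comp d d' (T : measurableType d) (S : measurableType d')
    (f : T -> S) (h : S -> \bar R) :
  measurable_fun setT f -> nnmeasurable h -> nnmeasurable (fun x => h (f x)).
Proof.
by move=> mf [mh h0]; split => [|x]; [exact: measurableT_comp|exact: h0].
Qed.

Lemma nnmeasurableM d (T : measurableType d) (g h : T -> \bar R) :
  nnmeasurable g -> nnmeasurable h -> nnmeasurable (fun x => g x * h x).
Proof.
by move=> [mg g0] [mh h0]; split => [|x];
  [exact: emeasurable_funM|rewrite mule_ge0].
Qed.

Lemma nnmeasurableD d (T : measurableType d) (g h : T -> \bar R) :
  nnmeasurable g -> nnmeasurable h -> nnmeasurable (fun x => g x + h x).
Proof.
by move=> [mg g0] [mh h0]; split => [|x];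
  [exact: emeasurable_funD|rewrite adde_ge0].
Qed.

Lemma integral_monotone d (T : measurableType d)
    (mu : {measure set T -> \bar R}) (h : nat -> T -> \bar R) :
  (forall n, nnmeasurable (h n)) -> (forall x, nondecreasing_seq (h^~ x)) ->
  \int[mu]_x h n x @[n --> \oo] --> \int[mu]_x limn (h^~ x).
Proof.
move=> mh nd; apply: cvg_monotone_convergence => //.
- by move=> n; exact: (mh n).1.
- by move=> n x _; exact: (mh n).2.
Qed.

Lemma nnmeasurable_EFin d (T : measurableType d) (g : T -> R) :
  measurable_fun setT g -> (forall x, (0 <= g x)%R) ->
  nnmeasurable (fun x => (g x)%:E).
Proof. by move=> mg g0; split => [|x]; [exact/measurable_EFinP|rewrite lee_fin]. Qed.

(** The image under [f] of [g] times [mu], described by its integrals alone. Most auxiliary measures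
    below (coded measures, marginals, restrictions, kernels) are obtained in this form. *)
Lemma image_density d d' (T : measurableType d) (S : measurableType d')
    (mu : {measure set T -> \bar R}) (f : T -> S) (g : T -> R) :
  measurable_fun setT f -> measurable_fun setT g -> (forall x, (0 <= g x)%R) ->
  exists m : {measure set S -> \bar R}, forall h, nnmeasurable h ->
    \int[m]_y h y = \int[mu]_x (h (f x) * (g x)%:E).
Proof.
move=> mf mg g0.
have mhf h : nnmeasurable h -> nnmeasurable (fun x => h (f x) * (g x)%:E).
  move=> mh; apply: nnmeasurableM; first exact: nnmeasurable_comp.
  exact: nnmeasurable_EFin.
apply: (measure_of_functional (Phi := fun h => \int[mu]_x (h (f x) * (g x)%:E))).
- by move=> h [mh h0]; apply: integral_ge0 => x _; rewrite mule_ge0// lee_fin.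
- move=> h1 h2 mh1 mh2.
  have [? ?] := mhf _ mh1; have [? ?] := mhf _ mh2; rewrite -ge0_integralD//.
  by apply: eq_integral => x _; rewrite ge0_muleDl//; [exact: mh1.2|exact: mh2.2].
- move=> k h k0 mh; have [? ?] := mhf _ mh; rewrite -ge0_integralZl_EFin//.
  by apply: eq_integral => x _; rewrite muleA.
- move=> h mh nd.
  have -> : \int[mu]_x (limn (h^~ (f x)) * (g x)%:E) =
            \int[mu]_x limn (fun n => h n (f x) * (g x)%:E).
    apply: eq_integral => x _; apply/esym/cvg_lim => //.
    by apply: cvgeZr => //; exact: ereal_nondecreasing_is_cvgn.
  apply: integral_monotone => [n|x]; first exact: mhf.
  by move=> a b ab; rewrite lee_wpmul2r ?lee_fin//; exact: nd.
Qed.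

Lemma ex_measure_add d (T : measurableType d)
    (m1 m2 : {measure set T -> \bar R}) :
  exists m : {measure set T -> \bar R}, forall h, nnmeasurable h ->
    \int[m]_y h y = \int[m1]_y h y + \int[m2]_y h y.
Proof.
exists (measure_add m1 m2) => h [mh h0].
exact: ge0_integral_measure_add.
Qed.

End nnmeasurable_theory.

(** * Borel measurability *)

Section borel.
Context (R : realType).

Lemma borel_open (X : ptopologicalType) (U : set X) :
  open U -> measurable (U : set (borel X)).
Proof. exact: sub_sigma_algebra. Qed.

Lemma borel_closed (X : ptopologicalType) (U : set X) :
  closed U -> measurable (U : set (borel X)).
Proof.
move=> cU; rewrite -(setCK U); apply: measurableC; apply: borel_open.
exact: closed_openC.
Qed.

Lemma measurable_fun_borel d (T : measurableType d) (Y : ptopologicalType)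
    (D : set T) (f : T -> Y) :
  (forall U, open U -> measurable (D `&` f @^-1` U)) ->
  measurable_fun D (f : T -> borel Y).
Proof.
move=> fU; apply: (@measurability _ _ _ (borel Y) _ _ (@open Y)) => //.
by move=> _ [U oU <-]; exact: fU.
Qed.

Lemma open_preimage_within (X Y : topologicalType) (U : set X) (V : set Y)
    (f : X -> Y) :
  open U -> {in U, continuous f} -> open V -> open (U `&` f @^-1` V).
Proof.
move=> oU cf oV; rewrite openE => x [Ux Vx]; apply: filterI.
  exact: open_nbhs_nbhs.
by apply: (cf x); [rewrite inE|exact: open_nbhs_nbhs].
Qed.

Lemma borel_continuous (X Y : ptopologicalType) (f : X -> Y) :
  continuous f -> measurable_fun setT (f : borel X -> borel Y).
Proof.
move=> cf; apply: measurable_fun_borel => U oU; apply: borel_open.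
by apply: (@open_preimage_within X Y setT) => [|x _|//];
  [exact: openT|exact: cf].
Qed.

Lemma borel_continuous_real (X : ptopologicalType) (U : set X) (f : X -> R) :
  open U -> {in U, continuous f} -> measurable_fun (U : set (borel X)) f.
Proof.
move=> oU cf; apply: (measurability _ (RGenOInfty.measurableE R)).
move=> _ [_ [a ->] <-]; apply: borel_open.
by apply: open_preimage_within => //; exact: interval_open.
Qed.

Lemma borel_continuousT_real (X : ptopologicalType) (f : X -> R) :
  continuous f -> measurable_fun (setT : set (borel X)) f.
Proof. by move=> cf; apply: borel_continuous_real => [|x _]; [exact: openT|exact: cf]. Qed.

Lemma cvg_rV (T : Type) (F : set_system T) (n : nat) (u : T -> 'rV[R]_n)
    (v : 'rV[R]_n) : Filter F ->
  (forall i, u t ord0 i @[t --> F] --> v ord0 i) -> u t @[t --> F] --> v.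
Proof.
move=> FF uv A [P vP PA]; rewrite /nbhs/= in vP.
have : \forall t \near F, forall i : 'I_n, P ord0 i (u t ord0 i).
  apply: (@filter_forall _ _ (fun i t => P ord0 i (u t ord0 i))) => i.
  exact: (uv i (P ord0 i) (vP ord0 i)).
by apply: filterS => t Pt; apply: PA => i j; rewrite (ord1 i); exact: Pt.
Qed.

Lemma continuous_rV (X : topologicalType) (n : nat) (u : X -> 'rV[R]_n) :
  (forall i, continuous (fun x => u x ord0 i)) -> continuous u.
Proof. by move=> cu x; apply: cvg_rV => i; exact: cu. Qed.

Lemma ball_rV n (x y : 'rV[R]_n) (e : R) : 0 < e ->
  ball x e y <-> forall i, `|x ord0 i - y ord0 i| < e.
Proof.
move=> e0; split; first by move=> [_ xy] i; exact: xy.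
by move=> xy; split => // i j; rewrite (ord1 i); exact: xy.
Qed.

(** An open set is the union of the countably many balls of rational centre and radius 1 / (k + 1)
    that it contains, and a ball of the sup norm is an intersection of conditions on single
    coordinates. *)
Lemma measurable_fun_rV d (T : measurableType d) n (D : set T)
    (u : T -> 'rV[R]_n) :
  measurable D -> (forall i, measurable_fun D (fun t => u t ord0 i)) ->
  measurable_fun D (u : T -> borel 'rV[R]_n).
Proof.
move=> mD mu; apply: measurable_fun_borel => U oU.
pose r (k : nat) : R := k.+1%:R^-1.
have r0 k : 0 < r k by rewrite /r invr_gt0.
pose q' (q : 'rV[rat]_n) : 'rV[R]_n := map_mx ratr q.
pose F (p : 'rV[rat]_n * nat) : set T :=
  if pselect (ball (q' p.1) (r p.2) `<=` U) then D `&` u @^-1` ball (q' p.1) (r p.2)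
  else set0.
have -> : D `&` u @^-1` U = \bigcup_p F p.
  apply/seteqP; split=> [t [Dt Ut]|t [p _]]; last first.
    by rewrite /F; case: pselect => // sU [Dt tp]; split => //; exact: sU.
  have /nbhs_ballP[e /= e0 eU] : nbhs (u t) U by exact: open_nbhs_nbhs.
  have [k ke] : exists k, r k < e / 2.
    have e20 : 0 < e / 2 by rewrite divr_gt0.
    have [k _ kP] := near_infty_natSinv_lt (PosNum e20).
    by exists k; exact: (kP k (leqnn k)).
  have /choice[q qP] : forall i, exists q : rat, `|ratr q - u t ord0 i| < r k.
    move=> i; have /rat_in_itvoo[q] : u t ord0 i - r k < u t ord0 i + r k.
      by have := r0 k; lra.
    by rewrite in_itv/= => /andP[? ?]; exists q; rewrite ltr_norml; lra.
  exists (\row_i q i, k) => //; rewrite /F.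
  have tB : ball (q' (\row_i q i)) (r k) (u t).
    by apply/ball_rV => // i; rewrite !mxE; exact: qP.
  case: pselect => [sU|nsU]; first by split.
  exfalso; apply: nsU; apply: subset_trans eU => y /= qy.
  apply: (@le_ball _ _ _ (r k + r k)); first by lra.
  by apply: ball_triangle qy; exact: ball_sym.
apply: countable_bigcupT_measurable => // -[q k]; rewrite /F; case: pselect => sU; last exact: measurable0.
have -> : D `&` u @^-1` ball (q' q) (r k) =
    \bigcap_(i : 'I_n) (D `&` [set t | `|q' q ord0 i - u t ord0 i| < r k]) `&` D.
  apply/seteqP; split=> [t [Dt /ball_rV qt]|t [qt Dt]].
    by split => // i _; split => //; exact: qt.
  split => //; apply/ball_rV => // i; exact: (qt i I).2.
apply: measurableI => //; apply: fin_bigcap_measurable => [|i _].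
  by apply: finite_finset.
have -> : [set t | `|q' q ord0 i - u t ord0 i| < r k] =
    (fun t => u t ord0 i) @^-1` ball (q' q ord0 i) (r k) by [].
apply: mu => //; apply: open_measurable; apply: ball_open; exact: r0.
Qed.

Lemma rV_coord_measurable n (i : 'I_n) :
  measurable_fun setT (fun v : borel 'rV[R]_n => v ord0 i : R).
Proof. by apply: borel_continuousT_real; exact: coord_continuous. Qed.

(** Open sets generate the Borel sets and are stable under intersection. *)
Lemma measure_eq_open (X : ptopologicalType)
    (m1 m2 : {measure set (borel X) -> \bar R}) :
  (m1 setT < +oo)%E -> (forall U : set X, open U -> m1 U = m2 U) ->
  forall A, measurable A -> m1 A = m2 A.
Proof.
move=> m1oo m12 A mA.
have := @measure_unique _ R (borel X) (@open X) (fun=> setT).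
move=> /(_ _ _ _ _ m1 m2); apply => //.
- by move=> U V oU oV; exact: openI.
- by move=> _; exact: openT.
- by rewrite bigcup_const.
Qed.

End borel.

(** * The torus and its representatives in the half-open cube *)

Section torus_section.
Context (R : realType) (d : nat).
Local Open Scope quotient_scope.

Definition frac (y : 'rV[R]_d) : 'rV[R]_d :=
  \row_i (y ord0 i - (Num.floor (y ord0 i))%:~R).

Lemma torus_classP (x y : 'rV[R]_d) :
  torus_class x = torus_class y <-> x - y \is a mxOver Num.int.
Proof.
split => [|xy]; first by move/eqmodP.
by apply/eqmodP.
Qed.

Lemma frac_lattice y : frac y - y \is a mxOver Num.int.
Proof.
apply/mxOverP => i j; rewrite (ord1 i) !mxE addrAC subrr add0r rpredN.
exact: intr_int.
Qed.

Lemma torus_class_frac y : torus_class (frac y) = torus_class y.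
Proof. exact/torus_classP/frac_lattice. Qed.

Lemma frac_itv y i : 0 <= frac y ord0 i < 1.
Proof.
rewrite mxE; have /andP[] := floor_itv (y ord0 i).
by rewrite intrD; lra.
Qed.

Lemma frac_id (y : 'rV[R]_d) : (forall i, 0 <= y ord0 i < 1) -> frac y = y.
Proof.
move=> y01; apply/rowP => i; rewrite mxE (@floor_def R _ 0) ?subr0//.
Qed.

Lemma frac_congr x y : torus_class x = torus_class y -> frac x = frac y.
Proof.
move=> /torus_classP/mxOverP xy; apply/rowP => i; rewrite !mxE.
have := xy ord0 i; rewrite !mxE => /intrP[k xyk].
have -> : x ord0 i = y ord0 i + k%:~R by rewrite -xyk; ring.
by rewrite floorDrz ?intr_int// intrD intrKfloor; ring.
Qed.

Lemma torus_class_continuous : continuous (@torus_class R d).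
Proof. exact: pi_continuous. Qed.

Lemma torus_class_measurable :
  measurable_fun setT (@torus_class R d : borel 'rV[R]_d -> borel (torus R d)).
Proof. by apply: borel_continuous; exact: torus_class_continuous. Qed.

Definition torus_repr (xi : torus R d) : 'rV[R]_d :=
  frac (repr (xi : {eq_quot (lattice_equiv R d)})).

Lemma torus_reprK xi : torus_class (torus_repr xi) = xi.
Proof. by rewrite torus_class_frac; exact: reprK. Qed.

Lemma torus_repr_class y : torus_repr (torus_class y) = frac y.
Proof.
have /frac_congr : torus_class (torus_repr (torus_class y)) = torus_class y.
  exact: torus_reprK.
rewrite frac_id// => i; exact: frac_itv.
Qed.

(** [torus_repr] jumps, but for nonnegative [a] the points whose i-th representative exceeds [a]
    lift to the union of the open slabs between [k + a] and [k + 1], hence form an open set of the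
    quotient. *)
Lemma torus_repr_measurable :
  measurable_fun setT (torus_repr : borel (torus R d) -> borel 'rV[R]_d).
Proof.
apply: measurable_fun_rV => // i.
apply: (measurability _ (RGenOInfty.measurableE R)).
move=> _ [_ [a ->] <-]; rewrite setTI.
have [a0|a0] := ltP a 0.
  have -> : (fun xi : borel (torus R d) => torus_repr xi ord0 i) @^-1` `]a, +oo[ = setT.
    apply/seteqP; split => // xi _ /=; rewrite in_itv/= andbT.
    by have /andP[+ _] := frac_itv (repr (xi : {eq_quot (lattice_equiv R d)})) i; lra.
  exact: measurableT.
apply: borel_open.
suff : open (@torus_class R d @^-1` ((fun xi => torus_repr xi ord0 i) @^-1` `]a, +oo[)) by [].
have -> : @torus_class R d @^-1` ((fun xi => torus_repr xi ord0 i) @^-1` `]a, +oo[) =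
  \bigcup_(k : int) [set y : 'rV[R]_d | y ord0 i \in `]k%:~R + a, k%:~R + 1[ ].
  apply/seteqP; split=> [y /=|y [k _ /=]].
    rewrite torus_repr_class mxE !in_itv/= andbT => ay.
    exists (Num.floor (y ord0 i)) => //=; rewrite in_itv/=.
    have /andP[_] := floor_itv (y ord0 i).
    by rewrite intrD; lra.
  rewrite torus_repr_class mxE !in_itv/= andbT => /andP[ay yb].
  rewrite (@floor_def R _ k); first by lra.
  by rewrite intrD; lra.
apply: bigcup_open => k _.
have := @coord_continuous R 1 d ord0 i.
move=> /continuousP/(_ `]k%:~R + a, k%:~R + 1[%classic); apply.
exact: interval_open.
Qed.

End torus_section.

(** * Linear coordinates on [E] *)

Section euclidean_coords.
Context (R : realType) (E : euclideanType R).
Local Notation m := (\dim (fullv : {vspace E})).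

Definition of_coords (v : 'rV[R]_m) : E :=
  \sum_(i < m) v ord0 i *: (vbasis (fullv : {vspace E}))`_i.

Definition coords (z : E) : 'rV[R]_m :=
  \row_i coord (vbasis (fullv : {vspace E})) i z.

Lemma coordsK : cancel coords of_coords.
Proof.
move=> z; rewrite [RHS](coord_vbasis (memvf z)).
by apply: eq_bigr => i _; rewrite mxE.
Qed.

Lemma of_coordsK : cancel of_coords coords.
Proof.
move=> v; apply/rowP => i; rewrite mxE /of_coords.
rewrite (coord_sum_free (fun i => v ord0 i))//.
exact: basis_free (vbasisP _).
Qed.

Lemma of_coordsZ a v : of_coords (a *: v) = a *: of_coords v.
Proof.
by rewrite /of_coords scaler_sumr; apply: eq_bigr => i _; rewrite mxE scalerA.
Qed.

Lemma coordsB x y : coords (x - y) = coords x - coords y.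
Proof. by apply/rowP => i; rewrite !mxE linearB. Qed.

Lemma coordsZ a z : coords (a *: z) = a *: coords z.
Proof. by apply/rowP => i; rewrite !mxE linearZ. Qed.

Lemma of_coords_continuous : continuous of_coords.
Proof.
apply: (@continuous_big E _ +%R 0 xpredT) => [|i _ v]; first exact: add_continuous.
apply: (@cvgZr_tmp R E _ (nbhs v) _ (fun v : 'rV[R]_m => v ord0 i)).
exact: coord_continuous.
Qed.

(** Equivalence of norms: the norm of [of_coords] attains a positive minimum on the compact unit
    sphere of the row space, and [c] is its inverse. *)
Lemma coords_bounded : exists2 c : R, 0 < c & forall z : E, `|coords z| <= c * `|z|.
Proof.
(* In dimension 0 the unit sphere of rows is empty and there is no minimum to take. *)
have [m0|m0] := posnP m.
  exists 1 => // z; rewrite mul1r (_ : coords z = 0) ?normr0//.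
  by apply/rowP => -[i im]; exfalso; move: im; rewrite m0.
pose S : set 'rV[R]_m := [set v | `|v| = 1].
have cS : compact S.
  apply: bounded_closed_compact.
    by exists 1; split => // M M1 v /= ->; exact: ltW.
  have -> : S = (fun v : 'rV[R]_m => `|v|) @^-1` [set x | x = 1] by [].
  apply: closed_comp => [v _|]; last exact: closed_eq.
  exact: norm_continuous.
have S0 : S !=set0.
  exists (const_mx 1); rewrite /S/= [LHS]/Num.norm/= mx_normrE.
  apply/eqP; rewrite eq_le; apply/andP; split.
    by apply: bigmax_le => // -[i j] _ /=; rewrite mxE normr1.
  apply/bigmax_geP; right => /=; exists (ord0, Ordinal m0) => //=.
  by rewrite mxE normr1.
have cf : {within S, continuous (fun v => `|of_coords v| : R)}.
  apply: continuous_subspaceT => v.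
  by apply: continuous_comp; [exact: of_coords_continuous|exact: norm_continuous].
have [v0 Sv0 minv] := compact_EVT_min S0 cS cf.
have v0E : 0 < `|of_coords v0|.
  rewrite normr_gt0; apply/eqP => v00; move: Sv0; rewrite inE /S /=.
  rewrite -(of_coordsK v0) v00 => /eqP; rewrite (_ : coords 0 = 0) ?normr0.
    by rewrite eq_sym oner_eq0.
  by apply/rowP => i; rewrite !mxE linear0.
exists (`|of_coords v0|^-1); first by rewrite invr_gt0.
move=> z; have [->|z0] := eqVneq z 0.
  by rewrite (_ : coords 0 = 0) ?normr0 ?mulr0//; apply/rowP => i; rewrite !mxE linear0.
rewrite mulrC ler_pdivlMr//.
have cz : 0 < `|coords z|.
  rewrite normr_gt0; apply: contraNneq z0 => cz0.
  by rewrite -(coordsK z) cz0 /of_coords big1// => i _; rewrite mxE scale0r.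
have := minv (`|coords z|^-1 *: coords z).
rewrite inE /S/= normrZ normfV normr_id mulVf ?gt_eqF// => /(_ erefl).
rewrite of_coordsZ coordsK normrZ normfV normr_id mulrC ler_pdivlMr//.
by rewrite mulrC.
Qed.

Lemma coords_continuous : continuous coords.
Proof.
have [c c0 cP] := coords_bounded.
move=> z; apply/cvgrPdist_lt => e e0; near=> y.
rewrite -coordsB (le_lt_trans (cP _))// mulrC -ltr_pdivlMr//.
by near: y; apply: cvgr_dist_lt => //; rewrite divr_gt0.
Unshelve. all: by end_near. Qed.

Lemma coord_measurable i : measurable_fun setT (fun z : borel E => coords z ord0 i : R).
Proof.
apply: borel_continuousT_real => z.
apply: (@continuous_comp _ _ _ coords (fun v => v ord0 i)).
  exact: coords_continuous.
exact: coord_continuous.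
Qed.

Lemma measurable_fun_euclidean d (T : measurableType d) (D : set T) (u : T -> E) :
  measurable D -> (forall i, measurable_fun D (fun t => coords (u t) ord0 i)) ->
  measurable_fun D (u : T -> borel E).
Proof.
move=> mD mu; have -> : u = of_coords \o (fun t => coords (u t)).
  by apply/funext => t /=; rewrite coordsK.
apply: (@measurable_comp _ _ _ T (borel 'rV[R]_m) (borel E) setT) => //.
  by apply: borel_continuous; exact: of_coords_continuous.
exact: measurable_fun_rV.
Qed.

Lemma norm_measurable : measurable_fun setT (fun z : borel E => `|z| : R).
Proof. by apply: borel_continuousT_real; exact: norm_continuous. Qed.

(** The ball is the image under [of_coords] of a set of rows that is closed and, by
    [coords_bounded], bounded. *)
Lemma closed_ball_compact r : compact [set z : E | `|z| <= r].
Proof.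
have [c c0 cP] := coords_bounded.
have -> : [set z : E | `|z| <= r] =
    of_coords @` [set v | `|of_coords v| <= r].
  apply/seteqP; split=> [z zr|_ [v vr <-]//].
  by exists (coords z); rewrite /= ?coordsK.
apply: continuous_compact.
  by apply: continuous_subspaceT; exact: of_coords_continuous.
apply: bounded_closed_compact.
  exists (c * r); split => [|M rM v]; first exact: num_real.
  move=>  /= vr; rewrite -(of_coordsK v).
  by rewrite (le_trans (cP _))// (le_trans _ (ltW rM))// ler_pM2l.
have -> : [set v | `|of_coords v| <= r] =
    (fun v => `|of_coords v|) @^-1` [set x | x <= r] by [].
apply: closed_comp => [v _|]; last exact: closed_le.
by apply: continuous_comp; [exact: of_coords_continuous|exact: norm_continuous].
Qed.

Lemma unit_sphere_measurable : measurable (unit_sphere E : set (borel E)).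
Proof.
apply: borel_closed.
have -> : unit_sphere E = (fun v : E => `|v|) @^-1` [set x | x = 1] by [].
apply: closed_comp => [v _|]; last exact: closed_eq.
exact: norm_continuous.
Qed.

End euclidean_coords.

(** * Lebesgue measure on tuples, rows and the torus *)

Section lebesgue_tuple.
Context (R : realType).
Local Open Scope ereal_scope.

(** The product measure at each step asks for a sigma-finite right factor, so the measure structure
    and sigma-finiteness are obtained in one induction. *)
Lemma lebesgue_tuple_sigma_finite n :
  exists m : {sigma_finite_measure set (n.-tuple R) -> \bar R},
    @lebesgue_tuple R n = m.
Proof.
elim: n => [|n [m mE]].
  exists (dirac [tuple] : {sigma_finite_measure set (0.-tuple R) -> \bar R}).
  by [].
rewrite /= mE.
pose c (p : measurableTypeR R * n.-tuple R) : n.+1.-tuple R := [tuple of p.1 :: p.2].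
have mc : measurable_fun setT c by exact: measurable_cons.
pose c' : {mfun (measurableTypeR R * n.-tuple R)%type >-> n.+1.-tuple R} :=
  HB.pack c (isMeasurableFun.Build _ _ _ _ c mc).
pose P : {measure set (measurableTypeR R * n.-tuple R)%type -> \bar R} :=
  (@lebesgue_measure R \x m)%E.
have mP : sigma_finite setT (pushforward P c').
  have /sigma_finiteP[F [FT ndF Foo]] := sigma_finiteT (@lebesgue_measure R).
  have /sigma_finiteP[G [GT ndG Goo]] := sigma_finiteT m.
  (* These are the boxes [F k] times [G k]. Both exhaustions increase, so the index [maxn k l]
     serves head and tail together. *)
  exists (fun k => [set t : n.+1.-tuple R | F k (thead t) /\ G k [tuple of behead t]]).
    apply/seteqP; split => // t _.
    have [k _ Fk] : (\bigcup_i F i) (thead t) by rewrite -FT.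
    have [l _ Gl] : (\bigcup_i G i) [tuple of behead t] by rewrite -GT.
    exists (maxn k l) => //; split.
      by move: Fk; apply/subsetPset/ndF/leq_maxl.
    by move: Gl; apply/subsetPset/ndG/leq_maxr.
  move=> k; have [mFk Fkoo] := Foo k; have [mGk Gkoo] := Goo k; split.
    apply: measurableI.
      rewrite -[X in measurable X]setTI.
      exact: (@measurable_tnth _ (measurableTypeR R) n.+1 ord0).
    rewrite -[X in measurable X]setTI.
    exact: (@measurable_behead _ (measurableTypeR R) n).
  rewrite /pushforward; set A := (X in P X).
  have -> : A = F k `*` G k.
    apply/seteqP; split=> -[a t]; rewrite /A/= theadE => -[Fa Gt]; split => //=;
      by move: Gt; congr (G k); exact/val_inj.
  rewrite /P/= product_measure1E// lte_mul_pinfty//.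
  by rewrite ge0_fin_numE.
pose Q : {sigma_finite_measure set (n.+1.-tuple R) -> \bar R} :=
  HB.pack (pushforward P c') (Measure_isSigmaFinite.Build _ _ _ _ mP).
exists (Q mc mc mc).
by [].
Qed.

Let lebesgue_tuple0 n : @lebesgue_tuple R n set0 = 0.
Proof. by have [m ->] := lebesgue_tuple_sigma_finite n; exact: measure0. Qed.

Let lebesgue_tuple_ge0 n A : 0 <= @lebesgue_tuple R n A.
Proof. by have [m ->] := lebesgue_tuple_sigma_finite n; exact: measure_ge0. Qed.

Let lebesgue_tuple_sigma_additive n : semi_sigma_additive (@lebesgue_tuple R n).
Proof.
have [m ->] := lebesgue_tuple_sigma_finite n.
exact: measure_semi_sigma_additive.
Qed.

HB.instance Definition _ n := isMeasure.Build _ _ _ (@lebesgue_tuple R n)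
  (lebesgue_tuple0 n) (@lebesgue_tuple_ge0 n) (@lebesgue_tuple_sigma_additive n).

Let lebesgue_tuple_sigma n : sigma_finite setT (@lebesgue_tuple R n).
Proof. by have [m ->] := lebesgue_tuple_sigma_finite n; exact: sigma_finiteT. Qed.

HB.instance Definition _ n := Measure_isSigmaFinite.Build _ _ _
  (@lebesgue_tuple R n) (@lebesgue_tuple_sigma n).

Lemma measurable_tuple_cons n : measurable_fun setT
  (fun p : measurableTypeR R * n.-tuple R => [tuple of p.1 :: p.2]).
Proof. exact: measurable_cons. Qed.

Lemma integral_lebesgue_tuple0 (G : 0.-tuple R -> \bar R) : nnmeasurable G ->
  \int[@lebesgue_tuple R 0]_t G t = G [tuple].
Proof. by move=> [mG G0]; rewrite /= integral_dirac// diracT mul1e. Qed.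

Lemma nnmeasurable_tuple_cons n (G : n.+1.-tuple R -> \bar R) : nnmeasurable G ->
  nnmeasurable (fun p : measurableTypeR R * n.-tuple R => G [tuple of p.1 :: p.2]).
Proof. by apply: nnmeasurable_comp; exact: measurable_tuple_cons. Qed.

Lemma integral_lebesgue_tupleS n (G : n.+1.-tuple R -> \bar R) : nnmeasurable G ->
  \int[@lebesgue_tuple R n.+1]_t G t =
  \int[lebesgue_measure]_s \int[@lebesgue_tuple R n]_t G [tuple of s :: t].
Proof.
move=> nG; have [mG G0] := nG.
have := @ge0_integral_pushforward _ _ (measurableTypeR R * n.-tuple R)%type
  (n.+1.-tuple R) R _ (@measurable_tuple_cons n)
  (@lebesgue_measure R \x @lebesgue_tuple R n)%E setT G measurableT mG
  (fun y _ => G0 y).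
rewrite preimage_setT => ->.
have [mG' G0'] := nnmeasurable_tuple_cons nG.
by rewrite (fubini_tonelli1 _ mG').
Qed.

Variable w : R -> R.
Hypothesis mw : measurable_fun setT w.
Hypothesis w_ge0 : forall s, (0 <= w s)%R.

(** A product density: [w = 1] gives Lebesgue measure, the indicator of [0, 1[ gives the unit cube,
    that of [-M, M] a box. *)
Definition tuple_weight n (t : n.-tuple R) : R := (\prod_(i < n) w (tnth t i))%R.

Lemma tuple_weight_cons n s (t : n.-tuple R) :
  tuple_weight [tuple of s :: t] = (w s * tuple_weight t)%R.
Proof.
rewrite /tuple_weight big_ord_recl; congr (_ * _)%R.
by apply: eq_bigr => i _; rewrite tnthS.
Qed.

Lemma tuple_weight_ge0 n (t : n.-tuple R) : (0 <= tuple_weight t)%R.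
Proof. by apply: prodr_ge0. Qed.

Lemma nnmeasurable_tuple_weight n :
  nnmeasurable (fun t : n.-tuple R => (tuple_weight t)%:E).
Proof.
apply: nnmeasurable_EFin; last exact: tuple_weight_ge0.
apply: measurable_prod => i _; apply: measurableT_comp => //.
exact: measurable_tnth.
Qed.

Lemma integral_tuple_weight n c : \int[lebesgue_measure]_s (w s)%:E = c%:E ->
  \int[@lebesgue_tuple R n]_t (tuple_weight t)%:E = (c ^+ n)%:E.
Proof.
move=> wc; elim: n => [|n IH].
  rewrite integral_lebesgue_tuple0; last exact: nnmeasurable_tuple_weight.
  by rewrite /tuple_weight big_ord0.
rewrite integral_lebesgue_tupleS; last exact: nnmeasurable_tuple_weight.
under eq_integral do under eq_integral do rewrite tuple_weight_cons EFinM.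
have [mW W0] := nnmeasurable_tuple_weight n.
under eq_integral => s _.
  rewrite ge0_integralZl_EFin// IH muleC.
  over.
rewrite ge0_integralZl_EFin//.
- by rewrite wc -EFinM exprS mulrC.
- by move=> s _; rewrite lee_fin.
- exact/measurable_EFinP.
- rewrite exprn_ge0// -lee_fin -wc integral_ge0// => s _.
  by rewrite lee_fin.
Qed.

(** If each [theta i] preserves the measure [w ds] on the line, Tonelli and induction show that the
    coordinatewise map preserves the product. This is applied to translations with [w = 1] and to
    rotations of the circle with [w] the indicator of [0, 1[. *)
Lemma integral_tuple_coordwise n (theta : 'I_n -> R -> R) :
  (forall i, measurable_fun setT (theta i)) ->
  (forall i (g : R -> \bar R), nnmeasurable g ->
    \int[lebesgue_measure]_s (g (theta i s) * (w s)%:E) =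
    \int[lebesgue_measure]_s (g s * (w s)%:E)) ->
  forall G : n.-tuple R -> \bar R, nnmeasurable G ->
    \int[@lebesgue_tuple R n]_t
      (G [tuple theta i (tnth t i) | i < n] * (tuple_weight t)%:E) =
    \int[@lebesgue_tuple R n]_t (G t * (tuple_weight t)%:E).
Proof.
elim: n theta => [|n IH] theta mtheta wtheta G nG.
  apply: eq_integral => t _; congr (G _ * _).
  by apply: eq_from_tnth => -[].
have mth (k : nat) (th : 'I_k -> R -> R) : (forall i, measurable_fun setT (th i)) ->
    measurable_fun setT (fun t : k.-tuple R => [tuple th i (tnth t i) | i < k]).
  move=> mth; apply/measurable_fun_tnthP => i.
  rewrite (_ : _ \o _ = fun t : k.-tuple R => th i (tnth t i)); last first.
    by apply/funext => t /=; rewrite tnth_mktuple.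
  by apply: measurableT_comp => //; exact: measurable_tnth.
have nW k := nnmeasurable_tuple_weight k.
rewrite !integral_lebesgue_tupleS; last 2 first.
- by apply: nnmeasurableM => //.
- by apply: nnmeasurableM => //; apply: nnmeasurable_comp nG; exact: mth.
pose th' (i : 'I_n) := theta (lift ord0 i).
have consE s (t : n.-tuple R) :
    [tuple theta i (tnth [tuple of s :: t] i) | i < n.+1] =
    [tuple of theta ord0 s :: [tuple th' i (tnth t i) | i < n]].
  apply: eq_from_tnth => i; rewrite tnth_mktuple.
  case: (unliftP ord0 i) => [j ->|->]; last by rewrite !tnth0.
  by rewrite !tnthS tnth_mktuple.
have nGs s : nnmeasurable (fun t : n.-tuple R => G [tuple of s :: t]).
  apply: nnmeasurable_comp nG; exact: measurable_cons.
pose H s := \int[@lebesgue_tuple R n]_t (G [tuple of s :: t] * (tuple_weight t)%:E).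
have nH : nnmeasurable H.
  split=> [|s]; last first.
    by apply: integral_ge0 => t _; rewrite mule_ge0 ?lee_fin ?tuple_weight_ge0//; exact: nG.2.
  apply: (@measurable_fun_fubini_tonelli_F _ _ (measurableTypeR R) (n.-tuple R) R
    (@lebesgue_tuple R n) (fun p => G [tuple of p.1 :: p.2] * (tuple_weight p.2)%:E)).
    apply: (@emeasurable_funM _ (measurableTypeR R * n.-tuple R)%type).
      exact: (nnmeasurable_tuple_cons nG).1.
    by apply: (measurableT_comp (nW n).1).
  move=> p; rewrite mule_ge0 ?lee_fin ?tuple_weight_ge0//; exact: nG.2.
transitivity (\int[lebesgue_measure]_s (H (theta ord0 s) * (w s)%:E)).
  apply: eq_integral => s _; rewrite /H.
  have -> : \int[@lebesgue_tuple R n]_t (G [tuple of theta ord0 s :: t] * (tuple_weight t)%:E) =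
     \int[@lebesgue_tuple R n]_t (G [tuple of theta ord0 s :: [tuple th' i (tnth t i) | i < n]] * (tuple_weight t)%:E).
    exact/esym/(IH th' (fun i => mtheta _) (fun i => wtheta _) _ (nGs _)).
  rewrite muleC -ge0_integralZl_EFin//; last 2 first.
  - by move=> t _; rewrite mule_ge0 ?lee_fin ?tuple_weight_ge0//; exact: nG.2.
  - apply: emeasurable_funM; last exact: (nW n).1.
    exact: (measurableT_comp (nGs (theta ord0 s)).1 (mth _ th' (fun i => mtheta _))).
  apply: eq_integral => t _; rewrite consE tuple_weight_cons EFinM.
  by rewrite muleA [X in X * _]muleC muleA.
rewrite wtheta//; apply: eq_integral => s _; rewrite /H.
rewrite muleC -ge0_integralZl_EFin//; last 2 first.
- by move=> t _; rewrite mule_ge0 ?lee_fin ?tuple_weight_ge0//; exact: nG.2.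
- apply: emeasurable_funM; last exact: (nW n).1.
  exact: (nGs _).1.
apply: eq_integral => t _; rewrite tuple_weight_cons EFinM.
by rewrite muleA [X in X * _]muleC muleA.
Qed.

End lebesgue_tuple.

Section lebesgue_line.
Context (R : realType).
Local Open Scope ereal_scope.

(** The translated measure has the Lebesgue value on half-open intervals, and these values determine
    it. *)
Lemma integral_translate (g : R -> \bar R) (a : R) : nnmeasurable g ->
  \int[lebesgue_measure]_s g (s + a)%R = \int[lebesgue_measure]_s g s.
Proof.
move=> ng.
have mtr : measurable_fun setT (fun s : measurableTypeR R => (s + a)%R : measurableTypeR R).
  exact: measurable_funD.
have [m mE] := @image_density R _ _ _ _ (@lebesgue_measure R) _ (cst 1%R) mtr
  (measurable_cst _) (fun=> ler01).
transitivity (\int[m]_s g s).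
  by rewrite mE//; apply: eq_integral => s _; rewrite mule1.
apply: eq_measure_integral => /= A mA _; apply/esym.
apply: lebesgue_measure_unique => // X oX.
have mX : measurable (X : set (measurableTypeR R)).
  by apply: sub_sigma_algebra.
have := mE _ (nnmeasurable_indic R mX).
rewrite integral_indic// setIT => ->.
under eq_integral do rewrite mule1.
case: oX => -[b c] _ <-.
transitivity (\int[@lebesgue_measure R]_s (\1_(`](b - a)%R, (c - a)%R]%classic) s)%:E).
  rewrite integral_indic// setIT [LHS]lebesgue_measure_itv.
  rewrite [RHS]lebesgue_measure_itv/= !lte_fin.
  by rewrite ltrD2r -!EFinB; congr (if _ then _%:E else _); ring.
apply: eq_integral => s _; congr EFin; rewrite !indicE; congr (_%:R); congr nat_of_bool.
by apply/idP/idP; rewrite !inE/= !in_itv/=; lra.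
Qed.

Lemma measurable_floor : measurable_fun setT (fun s : R => (Num.floor s)%:~R : R)%R.
Proof.
apply: nondecreasing_measurable => //.
by move=> x y xy; rewrite ler_int; exact: le_floor.
Qed.

Definition unit_weight (s : R) : R := (0 <= s < 1)%R%:R.

Lemma unit_weight_measurable : measurable_fun setT unit_weight.
Proof.
rewrite (_ : unit_weight = \1_(`[0%R, 1%R[%classic)); first exact: measurable_indic.
by apply/funext => s; rewrite indicE /unit_weight mem_setE in_itv.
Qed.

Lemma unit_weight_ge0 s : (0 <= unit_weight s)%R.
Proof. by rewrite ler0n. Qed.

Lemma integral_unit_weight : \int[lebesgue_measure]_s (unit_weight s)%:E = 1%:E.
Proof.
rewrite (_ : unit_weight = \1_(`[0%R, 1%R[%classic)).
  by rewrite integral_indic// setIT [LHS]lebesgue_measure_itv/= lte_fin ltr01 oppr0 adde0.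
by apply/funext => s; rewrite indicE /unit_weight mem_setE in_itv.
Qed.

Let J (b c s : R) : R := (b <= s < c)%R%:R.

Let mJ b c : nnmeasurable (fun s => (J b c s)%:E).
Proof.
rewrite (_ : J b c = \1_(`[b, c[%classic)); first exact: nnmeasurable_indic.
by apply/funext => s; rewrite indicE /J mem_setE in_itv.
Qed.

(** [h] is the 1-periodic extension of [g]. Its integral over [a, a + 1[ is cut at [k + 1], with [k]
    the floor of [a]; shifting the piece [k + 1, a + 1[ back by one period completes [a, k + 1[ to
    [k, k + 1[. *)
Lemma integral_rotate (g : R -> \bar R) (a : R) : nnmeasurable g ->
  \int[lebesgue_measure]_s
    (g (s + a - (Num.floor (s + a))%:~R)%R * (unit_weight s)%:E) =
  \int[lebesgue_measure]_s (g s * (unit_weight s)%:E).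
Proof.
move=> ng; pose h s := g (s - (Num.floor s)%:~R)%R.
have nh : nnmeasurable h.
  apply: (nnmeasurable_comp _ ng); apply: measurable_funB => //.
  exact: measurable_floor.
have hk s (k : int) : h (s + k%:~R)%R = h s.
  by rewrite /h floorDrz ?intr_int// intrKfloor intrD; congr g; ring.
have nhJ b c : nnmeasurable (fun s => h s * (J b c s)%:E) by exact: nnmeasurableM.
have shift b c (k : int) :
    \int[lebesgue_measure]_s (h s * (J (b + k%:~R) (c + k%:~R) s)%:E) =
    \int[lebesgue_measure]_s (h s * (J b c s)%:E).
  rewrite -(integral_translate k%:~R (nhJ _ _)); apply: eq_integral => s _.
  by rewrite hk /J lerD2r ltrD2r.
have split b c e : (b <= c <= e)%R ->
    \int[lebesgue_measure]_s (h s * (J b e s)%:E) =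
    \int[lebesgue_measure]_s (h s * (J b c s)%:E) +
    \int[lebesgue_measure]_s (h s * (J c e s)%:E).
  move=> /andP[bc ce]; have [m1 p1] := nhJ b c; have [m2 p2] := nhJ c e.
  rewrite -ge0_integralD//; apply: eq_integral => s _.
  rewrite -ge0_muleDr ?lee_fin ?ler0n// -EFinD /J; congr (_ * _%:E).
  have [] := leP b s; have [] := leP c s; have [] := ltP s c; have [] := ltP s e => /=;
    rewrite ?addr0 ?add0r//; lra.
pose k := Num.floor a.
have /andP[ka ak] := floor_itv a; rewrite -/k intrD mulr1z in ka ak.
transitivity (\int[lebesgue_measure]_s (h s * (J a (a + 1) s)%:E)).
  rewrite -(integral_translate a (nhJ _ _)); apply: eq_integral => s _.
  by rewrite /h /J /unit_weight lerDr (addrC a 1%R) ltrD2r.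
rewrite (split a (k%:~R + 1)%R (a + 1)%R); last by lra.
have -> : \int[lebesgue_measure]_s (h s * (J (k%:~R + 1) (a + 1) s)%:E) =
          \int[lebesgue_measure]_s (h s * (J k%:~R a s)%:E) by rewrite -(shift k%:~R%R a 1%R) mulr1z.
rewrite addeC -split; last by lra.
have -> : \int[lebesgue_measure]_s (h s * (J k%:~R (k%:~R + 1) s)%:E) =
          \int[lebesgue_measure]_s (h s * (J 0 1 s)%:E).
  by rewrite -(shift 0%R 1%R k) add0r addrC.
apply: eq_integral => s _; rewrite /h /J /unit_weight.
have [s01|] := boolP (0 <= s < 1)%R; last by rewrite !mule0.
by rewrite (@floor_def R _ 0) ?subr0// add0r.
Qed.

End lebesgue_line.

Section lebesgue_rV.
Context (R : realType) (d : nat).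
Local Open Scope ereal_scope.
Local Notation L := (lebesgue_rV R d).

Let row_of (t : d.-tuple R) : borel 'rV[R]_d := \row_(i < d) tnth t i.

Let row_of_measurable : measurable_fun setT row_of.
Proof.
apply: measurable_fun_rV => // i.
rewrite (_ : (fun _ => _) = (fun t : d.-tuple R => tnth t i)).
  exact: measurable_tnth.
by apply/funext => t; rewrite mxE.
Qed.

Let lebesgue_rV0 : L set0 = 0.
Proof. by rewrite /lebesgue_rV /pushforward preimage_set0 measure0. Qed.

Let lebesgue_rV_ge0 A : 0 <= L A.
Proof. by rewrite /lebesgue_rV /pushforward. Qed.

Let lebesgue_rV_sigma_additive : semi_sigma_additive L.
Proof.
move=> F mF tF mUF; rewrite /lebesgue_rV /pushforward preimage_bigcup.
apply: measure_semi_sigma_additive.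
- by move=> n; rewrite -[X in measurable X]setTI; exact: row_of_measurable.
- by apply/trivIsetP => /= i j _ _ ij; rewrite -preimage_setI;
    move/trivIsetP : tF => /(_ _ _ _ _ ij) ->//; rewrite preimage_set0.
- by rewrite -preimage_bigcup -[X in measurable X]setTI; exact: row_of_measurable.
Qed.

HB.instance Definition _ := isMeasure.Build _ _ _ L
  lebesgue_rV0 lebesgue_rV_ge0 lebesgue_rV_sigma_additive.

Lemma integral_lebesgue_rV (G : borel 'rV[R]_d -> \bar R) : nnmeasurable G ->
  \int[L]_x G x = \int[@lebesgue_tuple R d]_t G (\row_i tnth t i).
Proof.
move=> [mG G0].
have := ge0_integral_pushforward row_of_measurable (@lebesgue_tuple R d) measurableT mG
  (fun y _ => G0 y).
by rewrite preimage_setT.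
Qed.

Lemma nnmeasurable_row_of (G : borel 'rV[R]_d -> \bar R) : nnmeasurable G ->
  nnmeasurable (fun t : d.-tuple R => G (\row_i tnth t i)).
Proof. exact: nnmeasurable_comp. Qed.

Lemma rV_translate_measurable (a : 'rV[R]_d) :
  measurable_fun setT (fun x : borel 'rV[R]_d => (x + a)%R : borel 'rV[R]_d).
Proof.
apply: measurable_fun_rV => // i.
rewrite (_ : (fun _ => _) = (fun x : borel 'rV[R]_d => x ord0 i + a ord0 i)%R).
  by apply: measurable_funD => //; exact: rV_coord_measurable.
by apply/funext => x; rewrite mxE.
Qed.

Lemma integral_rV_translate (G : borel 'rV[R]_d -> \bar R) (a : 'rV[R]_d) :
  nnmeasurable G -> \int[L]_x G (x + a)%R = \int[L]_x G x.
Proof.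
move=> nG.
have nGa : nnmeasurable (fun x : borel 'rV[R]_d => G (x + a)%R).
  exact: (nnmeasurable_comp (rV_translate_measurable a) nG).
rewrite !integral_lebesgue_rV//.
have := @integral_tuple_coordwise R (cst 1%R) (measurable_cst _) (fun=> ler01) d
  (fun i s => s + a ord0 i)%R.
have W1 (t : d.-tuple R) : tuple_weight (cst 1%R) t = 1%R.
  by rewrite /tuple_weight big1.
move=> /(_ _ _ _ (nnmeasurable_row_of nG)) H.
transitivity (\int[@lebesgue_tuple R d]_t (G (\row_i tnth t i) * (tuple_weight (cst 1%R) t)%:E)).
  rewrite -H.
  - apply: eq_integral => t _; rewrite W1 mule1; congr G.
    by apply/rowP => i; rewrite !mxE tnth_mktuple.
  - by move=> i; exact: measurable_funD.
  - move=> i g ng; under eq_integral do rewrite mule1.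
    by rewrite integral_translate//; apply: eq_integral => s _; rewrite mule1.
by apply: eq_integral => t _; rewrite W1 mule1.
Qed.

Definition cube : set 'rV[R]_d := [set x | forall i, (0 <= x ord0 i < 1)%R].

Lemma cube_measurable : measurable (cube : set (borel 'rV[R]_d)).
Proof.
have -> : cube = \bigcap_(i : 'I_d) ((fun x : borel 'rV[R]_d => x ord0 i : R) @^-1` `[0%R, 1%R[).
  apply/seteqP; split=> [x cx i _ /=|x cx i]; first by rewrite in_itv/= cx.
  by have /= := cx i Logic.I; rewrite in_itv/=.
apply: fin_bigcap_measurable => [|i _]; first exact: finite_finset.
rewrite -[X in measurable X]setTI; exact: rV_coord_measurable.
Qed.

Lemma indic_cube (t : d.-tuple R) :
  \1_cube (\row_i tnth t i)%R = tuple_weight (@unit_weight R) t.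
Proof.
rewrite indicE /tuple_weight /unit_weight.
have [tc|tc] := boolP (_ \in cube).
  rewrite big1// => i _; move: tc; rewrite inE => /(_ i).
  by rewrite mxE => ->.
apply/esym/eqP; rewrite prodf_seq_eq0/=; apply/hasP.
have [i ti] : exists i, ~~ (0 <= tnth t i < 1)%R.
  apply: contrapT => /forallNP H; move: tc; rewrite notin_setE; apply => i.
  by rewrite mxE; have /negP := H i; rewrite negbK.
by exists i; [rewrite mem_index_enum|rewrite (negbTE ti)].
Qed.

Lemma frac_measurable : measurable_fun setT (@frac R d : borel 'rV[R]_d -> borel 'rV[R]_d).
Proof.
apply: measurable_fun_rV => // i.
rewrite (_ : (fun _ => _) = (fun s : R => s - (Num.floor s)%:~R)%R \o
                            (fun y : borel 'rV[R]_d => y ord0 i)).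
  apply: measurableT_comp; last exact: rV_coord_measurable.
  by apply: measurable_funB => //; exact: measurable_floor.
by apply/funext => y /=; rewrite mxE.
Qed.

(** Translation invariance of Lebesgue measure on the torus, read on representatives. *)
Lemma integral_cube_rotate (G : borel 'rV[R]_d -> \bar R) (a : 'rV[R]_d) :
  nnmeasurable G ->
  \int[L]_y (G (frac (y + a)) * (\1_cube y)%:E) =
  \int[L]_y (G y * (\1_cube y)%:E).
Proof.
move=> nG.
have nC := nnmeasurable_indic R cube_measurable.
have nGa : nnmeasurable (fun x : borel 'rV[R]_d => G (frac (x + a))).
  apply: (nnmeasurable_comp _ nG).
  exact: (measurableT_comp frac_measurable (rV_translate_measurable a)).
rewrite !integral_lebesgue_rV; [|exact: nnmeasurableM|exact: nnmeasurableM].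
under eq_integral do rewrite indic_cube.
under [RHS]eq_integral do rewrite indic_cube.
have := @integral_tuple_coordwise R (@unit_weight R) (@unit_weight_measurable R)
  (@unit_weight_ge0 R) d (fun i s => s + a ord0 i - (Num.floor (s + a ord0 i))%:~R)%R.
move=> /(_ _ _ _ (nnmeasurable_row_of nG)) <-.
- apply: eq_integral => t _; congr (G _ * _).
  by apply/rowP => i; rewrite !mxE tnth_mktuple.
- move=> i; apply: measurable_funB; first exact: measurable_funD.
  apply: (measurableT_comp (@measurable_floor R)); exact: measurable_funD.
- by move=> i g ng; exact: integral_rotate.
Qed.

Lemma lebesgue_cube : L cube = 1.
Proof.
transitivity (\int[L]_x (\1_cube x)%:E).
  by rewrite integral_indic ?setIT//; exact: cube_measurable.
rewrite integral_lebesgue_rV; last exact: (nnmeasurable_indic R cube_measurable).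
under eq_integral do rewrite indic_cube.
rewrite (@integral_tuple_weight R _ (@unit_weight_measurable R) (@unit_weight_ge0 R) d 1%R).
  by rewrite expr1n.
exact: integral_unit_weight.
Qed.

Lemma lebesgue_bounded (A : set (borel 'rV[R]_d)) (M : R) : measurable A ->
  (forall x, A x -> forall i, `|x ord0 i| <= M)%R -> L A < +oo.
Proof.
move=> mA AM; pose w (s : R) : R := \1_(`[(- M)%R, M]%classic) s.
have mw : measurable_fun setT w by exact: measurable_indic.
have w0 s : (0 <= w s)%R by rewrite /w indicE.
have [c wc] : exists c, \int[lebesgue_measure]_s (w s)%:E = c%:E.
  exists (if (- M < M)%R then M + M else 0)%R.
  rewrite /w integral_indic// setIT [LHS]lebesgue_measure_itv/= lte_fin.
  by case: ifP => // _; rewrite opprK -EFinD.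
rewrite -[L A](_ : \int[L]_x (\1_A x)%:E = _); last by rewrite integral_indic ?setIT.
rewrite integral_lebesgue_rV; last exact: nnmeasurable_indic.
apply: (@le_lt_trans _ _ (\int[@lebesgue_tuple R d]_t (tuple_weight w t)%:E)).
  have [mI I0] := nnmeasurable_row_of (nnmeasurable_indic R mA).
  have [mW W0] := nnmeasurable_tuple_weight mw w0 d.
  apply: ge0_le_integral => // t _.
  rewrite lee_fin indicE; have [tA|_] := boolP (_ \in A); last exact: tuple_weight_ge0.
  rewrite /tuple_weight big1// => i _; rewrite /w indicE mem_set//=.
  move: tA; rewrite inE => /AM/(_ i); rewrite mxE => ti.
  by rewrite in_itv/= -ler_norml.
by rewrite (integral_tuple_weight mw w0 _ wc) ltry.
Qed.

Let lebesgue_rV_sigma : sigma_finite setT L.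
Proof.
exists (fun k => [set x : 'rV[R]_d | forall i, (`|x ord0 i| <= k%:R)%R]).
  apply/seteqP; split => // x _; exists (Num.truncn (`|x|%R)).+1 => // i.
  apply: (@le_trans _ _ `|x|%R); last exact: ltW (truncnS_gt _).
  by rewrite [leRHS]/Num.norm/= mx_normrE; apply/bigmax_geP; right => /=; exists (ord0, i).
move=> k.
have mk : measurable ([set x : 'rV[R]_d | forall i, (`|x ord0 i| <= k%:R)%R] : set (borel 'rV[R]_d)).
  have -> : [set x : 'rV[R]_d | forall i, (`|x ord0 i| <= k%:R)%R] =
    \bigcap_(i : 'I_d) ((fun x : borel 'rV[R]_d => x ord0 i : R) @^-1` `[(- k%:R)%R, k%:R]).
    apply/seteqP; split=> [x cx i _ /=|x cx i]; first by rewrite in_itv/= -ler_norml cx.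
    by have /= := cx i Logic.I; rewrite in_itv/= -ler_norml.
  apply: fin_bigcap_measurable => [|i _]; first exact: finite_finset.
  rewrite -[X in measurable X]setTI; exact: rV_coord_measurable.
by split => //; exact: (lebesgue_bounded mk).
Qed.

HB.instance Definition _ := Measure_isSigmaFinite.Build _ _ _ L lebesgue_rV_sigma.

End lebesgue_rV.

Section torus_measure.
Context (R : realType) (d : nat).
Local Open Scope ereal_scope.
Local Notation L := (lebesgue_rV R d).
Local Notation Z := (borel (torus R d)).

Let torus_image : exists m : {measure set Z -> \bar R}, forall h, nnmeasurable h ->
  \int[m]_xi h xi = \int[L]_y (h (torus_class y) * (\1_(@cube R d) y)%:E).
Proof.
apply: image_density.
- exact: torus_class_measurable.
- exact: (measurable_indic (@cube_measurable R d)).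
- by move=> y; rewrite indicE.
Qed.

Let torus_imageE (m : {measure set Z -> \bar R}) :
  (forall h, nnmeasurable h ->
    \int[m]_xi h xi = \int[L]_y (h (torus_class y) * (\1_(@cube R d) y)%:E)) ->
  forall A, measurable A -> lebesgue_torus R d A = m A.
Proof.
move=> mE A mA; have := mE _ (nnmeasurable_indic R mA).
rewrite integral_indic// setIT => ->.
have mA' : measurable (@torus_class R d @^-1` A : set (borel 'rV[R]_d)).
  by rewrite -[X in measurable X]setTI; exact: torus_class_measurable.
have mc := @cube_measurable R d.
transitivity (\int[L]_y (\1_(@cube R d `&` @torus_class R d @^-1` A) y)%:E).
  by rewrite integral_indic ?setIT//; exact: measurableI.
apply: eq_integral => y _; rewrite -EFinM; congr EFin.
by rewrite setIC indicI.
Qed.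

Let lebesgue_torus0 : lebesgue_torus R d set0 = 0.
Proof. by have [m /torus_imageE ->] := torus_image; rewrite ?measure0. Qed.

Let lebesgue_torus_ge0 A : 0 <= lebesgue_torus R d A.
Proof. by rewrite /lebesgue_torus. Qed.

Let lebesgue_torus_sigma_additive : semi_sigma_additive (lebesgue_torus R d).
Proof.
have [m /torus_imageE mE] := torus_image => F mF tF mUF.
rewrite mE//; under eq_fun do under eq_bigr do rewrite mE//.
exact: measure_semi_sigma_additive.
Qed.

HB.instance Definition _ := isMeasure.Build _ _ _ (lebesgue_torus R d)
  lebesgue_torus0 lebesgue_torus_ge0 lebesgue_torus_sigma_additive.

Let lebesgue_torusT : lebesgue_torus R d setT = 1.
Proof. by rewrite /lebesgue_torus preimage_setT setIT; exact: lebesgue_cube. Qed.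

HB.instance Definition _ := Measure_isProbability.Build _ _ _
  (lebesgue_torus R d) lebesgue_torusT.

End torus_measure.

(** * Lipschitz approximation of indicators *)

Section truncated_distance.
Context (R : realType) (V : normedModType R).
Implicit Types (C : set V) (x y : V).

(* min(1, dist(x, C)), which makes sense for empty C as well *)
Definition dist1 C x : R := inf [set r | r = 1 \/ exists2 c, C c & r = `|x - c|].

Let S C x := [set r : R | r = 1 \/ exists2 c, C c & r = `|x - c|].

Let S0 C x : S C x !=set0.
Proof. by exists 1; left. Qed.

Let Slb C x : lbound (S C x) 0.
Proof. by move=> r [->|[c _ ->]]//; exact: ler01. Qed.

Let Sinf C x : has_inf (S C x).
Proof. by split; [exact: S0|exists 0; exact: Slb]. Qed.

Lemma dist1_ge0 C x : 0 <= dist1 C x.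
Proof. by apply: lb_le_inf; [exact: S0|exact: Slb]. Qed.

Lemma dist1_le1 C x : dist1 C x <= 1.
Proof. by apply: ge_inf; [exists 0; exact: Slb|left]. Qed.

Lemma dist1_le C x c : C c -> dist1 C x <= `|x - c|.
Proof. by move=> Cc; apply: ge_inf; [exists 0; exact: Slb|right; exists c]. Qed.

Lemma dist1_eq0 C x : C x -> dist1 C x = 0.
Proof.
move=> Cx; apply/eqP; rewrite eq_le dist1_ge0 andbT.
by rewrite (le_trans (dist1_le x Cx))// subrr normr0.
Qed.

Lemma dist1_lip C x y : `|dist1 C x - dist1 C y| <= `|x - y|.
Proof.
suff H u v : dist1 C u - dist1 C v <= `|u - v|.
  by rewrite ler_norml lerNl opprB H distrC H.
rewrite lerBlDr -lerBlDl; apply: lb_le_inf; first exact: S0.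
move=> r [->|[c Cc ->]].
  by rewrite lerBlDr (le_trans (dist1_le1 _ _))// lerDl.
rewrite lerBlDl (le_trans (dist1_le u Cc))//.
by rewrite -(subrKA v) ler_normD.
Qed.

Lemma dist1_gt0 C x : closed C -> ~ C x -> 0 < dist1 C x.
Proof.
move=> cC nCx.
have /nbhs_ballP[e /= e0 eC] : nbhs x (~` C).
  by apply: open_nbhs_nbhs; split => //; exact: closed_openC.
apply: (@lt_le_trans _ _ (Num.min 1 e)); first by rewrite lt_min ltr01.
apply: lb_le_inf; first exact: S0.
move=> r [->|[c Cc ->]]; first by rewrite ge_min lexx.
rewrite ge_min; apply/orP; right; rewrite leNgt; apply/negP => xc.
by apply: (eC c) => //; rewrite -ball_normE.
Qed.

Lemma dist1_continuous C : continuous (dist1 C).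
Proof.
move=> x; apply/cvgrPdist_lt => e e0; near=> y.
apply: (le_lt_trans (dist1_lip _ _ _)).
by near: y; apply: cvgr_dist_lt.
Unshelve. all: by end_near. Qed.

(** For closed [C] these functions are [k]-Lipschitz, vanish on [C] and increase to the indicator of
    its complement. With [C] the complement of an open set they approximate the indicator of that
    open set from below. *)
Definition bump C (k : nat) x : R := Num.min 1 (k%:R * dist1 C x).

Lemma bump_ge0 C k x : 0 <= bump C k x.
Proof. by rewrite le_min ler01 mulr_ge0// dist1_ge0. Qed.

Lemma bump_le1 C k x : bump C k x <= 1.
Proof. by rewrite ge_min lexx. Qed.

Lemma bump_eq0 C k x : C x -> bump C k x = 0.
Proof. by move=> Cx; rewrite /bump dist1_eq0// mulr0 min_r. Qed.

Lemma bump_nd C x : nondecreasing_seq (bump C ^~ x).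
Proof.
move=> k l kl; rewrite /bump le_min ge_min lexx/= ge_min.
by apply/orP; right; rewrite ler_wpM2r ?dist1_ge0// ler_nat.
Qed.

Lemma bump_lip C k x y : `|bump C k x - bump C k y| <= k%:R * `|x - y|.
Proof.
suff H u v : bump C k u - bump C k v <= k%:R * `|u - v|.
  by rewrite ler_norml lerNl opprB H distrC H.
have d := dist1_lip C u v.
have kd : k%:R * (dist1 C u - dist1 C v) <= k%:R * `|u - v|.
  by rewrite ler_wpM2l// (le_trans (ler_norm _)).
rewrite mulrBr in kd.
have p : 0 <= k%:R * `|u - v| by rewrite mulr_ge0.
rewrite /bump; set a := k%:R * dist1 C u in kd *; set b := k%:R * dist1 C v in kd *.
by rewrite !minEle; case: ifP; case: ifP; lra.
Qed.

Lemma bump_continuous C k : continuous (bump C k).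
Proof.
move=> x; apply/cvgrPdist_lt => e e0; near=> y.
rewrite (le_lt_trans (bump_lip _ _ _ _))//.
rewrite (@le_lt_trans _ _ (k.+1%:R * `|x - y|))//.
  by rewrite ler_wpM2r// ler_nat.
rewrite mulrC -ltr_pdivlMr//.
by near: y; apply: cvgr_dist_lt => //; rewrite divr_gt0.
Unshelve. all: by end_near. Qed.

Lemma bump_cvg C x : closed C -> bump C k x @[k --> \oo] --> (\1_(~` C) x : R).
Proof.
move=> cC; rewrite indicE; have [Cx|nCx] := pselect (C x).
  rewrite memNset; last by move=> /(_ Cx).
  by under eq_fun do rewrite bump_eq0//; exact: cvg_cst.
rewrite mem_set//.
apply: cvg_near_cst; have d0 := dist1_gt0 cC nCx.
near=> k; rewrite /bump min_l// -ler_pdivrMr// mul1r.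
near: k; exact: nbhs_infty_ger.
Unshelve. all: by end_near. Qed.

End truncated_distance.

(** * Equidistribution of x / eps in the cube *)

Section equidistribution.
Context (R : realType) (d : nat).
Local Open Scope ereal_scope.
Local Notation L := (lebesgue_rV R d).
Local Notation X := (borel 'rV[R]_d).

Lemma affine_measurable (a b : R) :
  measurable_fun setT (fun p : X * X => (a *: p.1 + b *: p.2)%R : X).
Proof.
apply: measurable_fun_rV => // i.
rewrite (_ : (fun _ => _) = (fun p : X * X => a * p.1 ord0 i + b * p.2 ord0 i)%R).
  apply: measurable_funD; apply: measurable_funM => //.
  - exact: (measurableT_comp (rV_coord_measurable i) measurable_fst).
  - exact: (measurableT_comp (rV_coord_measurable i) measurable_snd).
by apply/funext => p; rewrite !mxE.
Qed.

Lemma scale_measurable (a : R) : measurable_fun setT (fun x : X => (a *: x)%R : X).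
Proof.
apply: measurable_fun_rV => // i.
rewrite (_ : (fun _ => _) = (fun x : X => a * x ord0 i)%R).
  by apply: measurable_funM => //; exact: rV_coord_measurable.
by apply/funext => p; rewrite !mxE.
Qed.

Section fixed_scale.
Variables (e : R) (beta : X -> R).
Hypothesis e_neq0 : e != 0%R.
Hypothesis mbeta : measurable_fun setT beta.
Hypothesis beta_ge0 : forall y, (0 <= beta y)%R.

Let c := \int[L]_y ((beta y)%:E * (\1_(@cube R d) y)%:E).

(** Shifts the argument of [beta] by a point [y] of the cube. Integrating first in [y] or first in
    [x] gives the two quantities that equidistribution compares. *)
Let P (p : X * X) : R := (beta (frac (p.2 + e^-1 *: p.1)) * \1_(@cube R d) p.2)%R.

Let P_ge0 p : (0 <= P p)%R.
Proof. by rewrite mulr_ge0// indicE. Qed.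

Let mP : measurable_fun setT P.
Proof.
apply: measurable_funM.
  apply: (measurableT_comp mbeta); apply: (measurableT_comp (@frac_measurable R d)).
  have := affine_measurable e^-1 1.
  by congr (measurable_fun _ _); apply/funext => p; rewrite scale1r addrC.
apply: (measurableT_comp (measurable_indic (@cube_measurable R d))).
exact: measurable_snd.
Qed.

Let nbeta : nnmeasurable (fun y => (beta y)%:E).
Proof. exact: nnmeasurable_EFin. Qed.

(** For each [x] the integral of [P] in [y] is [c], because [y -> frac (y + x / e)] preserves
    Lebesgue measure on the cube. *)
Lemma integral_separate (a : X -> R) :
  measurable_fun setT a -> (forall x, 0 <= a x)%R ->
  \int[L]_x \int[L]_y (a x * P (x, y))%:E = c * \int[L]_x (a x)%:E.
Proof.
move=> ma a0.
have c0 : 0 <= c by apply: integral_ge0 => y _; rewrite mule_ge0// lee_fin// indicE.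
transitivity (\int[L]_x (c * (a x)%:E)); last first.
  rewrite ge0_integralZl//.
    exact/measurable_EFinP.
  by move=> x _; rewrite lee_fin.
apply: eq_integral => x _.
under eq_integral do rewrite EFinM.
rewrite ge0_integralZl_EFin//; last 2 first.
- by move=> y _; rewrite lee_fin.
- apply/measurable_EFinP; apply: (measurableT_comp mP).
  exact: measurable_pair1.
rewrite muleC; congr (_ * _); rewrite /c.
rewrite -(integral_cube_rotate (e^-1 *: x)%R nbeta).
by apply: eq_integral => y _; rewrite /P EFinM.
Qed.

(** For fixed [y] the argument of [beta] is the fractional part of [(x + e y) / e], so translation
    invariance in [x] removes the shift; the remaining integral in [y] is the measure 1 of the
    cube. *)
Lemma integral_average (a : X -> R) :
  measurable_fun setT a -> (forall x, 0 <= a x)%R ->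
  \int[L]_x \int[L]_y (a (x + e *: y)%R * P (x, y))%:E =
  \int[L]_x (a x * beta (frac (e^-1 *: x)))%:E.
Proof.
move=> ma a0.
have nI : nnmeasurable (fun x => (a x * beta (frac (e^-1 *: x)))%:E).
  apply: nnmeasurable_EFin; last by move=> x; rewrite mulr_ge0.
  apply: measurable_funM => //; apply: (measurableT_comp mbeta).
  exact: (measurableT_comp (@frac_measurable R d) (scale_measurable e^-1)).
set I := (RHS).
have I0 : 0 <= I by apply: integral_ge0 => x _; exact: nI.2.
have mfull : measurable_fun setT (fun p : X * X => (a (p.1 + e *: p.2)%R * P p)%:E).
  apply/measurable_EFinP; apply: measurable_funM => //; apply: (measurableT_comp ma).
  have := affine_measurable 1 e.
  by congr (measurable_fun _ _); apply/funext => p; rewrite scale1r.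
rewrite (fubini_tonelli _ mfull); last first.
  by move=> p; rewrite lee_fin mulr_ge0.
transitivity (\int[L]_y (I * (\1_(@cube R d) y)%:E)); last first.
  have [mC C0] := nnmeasurable_indic R (@cube_measurable R d).
  rewrite ge0_integralZl// integral_indic//; last exact: cube_measurable.
  by rewrite setIT [X in _ * X]lebesgue_cube mule1.
apply: eq_integral => y _.
rewrite -[I](integral_rV_translate (e *: y)%R nI) muleC.
have [mI0 I00] := nnmeasurable_comp (rV_translate_measurable (e *: y)%R) nI.
rewrite -ge0_integralZl_EFin//.
apply: eq_integral => x _; rewrite -EFinM /P/=; congr EFin.
rewrite scalerDr scalerA mulVf// scale1r addrC.
by rewrite mulrA mulrC (addrC y).
Qed.

End fixed_scale.

(** The left sides of [integral_separate] and [integral_average] differ by [alpha x] against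
    [alpha (x + e y)], hence by at most [K e] on a bounded set. All the regularity is borne by
    [alpha]; [beta] may jump. *)
Lemma equidistribution (alpha : X -> R) (K M : R) (beta : X -> R) (B : R)
    (eps : nat -> R) :
  measurable_fun setT alpha ->
  (forall x, 0 <= alpha x)%R ->
  (0 <= K)%R ->
  (forall x y : 'rV[R]_d, `|alpha x - alpha y| <= K * `|x - y|)%R ->
  (forall x : 'rV[R]_d, M < `|x| -> alpha x = 0)%R ->
  measurable_fun setT beta -> (forall y, 0 <= beta y <= B)%R ->
  (forall n, 0 < eps n)%R -> eps @ \oo --> 0%R ->
  \int[L]_x (alpha x * beta (frac ((eps n)^-1 *: x)))%:E @[n --> \oo] -->
  \int[L]_y ((beta y)%:E * (\1_(@cube R d) y)%:E) * \int[L]_x (alpha x)%:E.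
Proof.
move=> malpha alpha0 K0 lip supp mbeta betaB eps0 epscvg.
have beta0 y : (0 <= beta y)%R by have /andP[] := betaB y.
set c := \int[L]_y _.
(* Once [eps n <= 1] the shift [e y] has norm at most 1, so [alpha] and its shift both vanish off
   this ball. *)
pose S : set X := [set x : 'rV[R]_d | `|x| <= M + 1]%R.
have mS : measurable S.
  apply: borel_closed.
  have -> : S = (fun v : 'rV[R]_d => `|v|)%R @^-1` [set x | x <= M + 1]%R by [].
  apply: closed_comp => [v _|]; last exact: closed_le.
  exact: norm_continuous.
have Soo : L S < +oo.
  apply: (lebesgue_bounded (M := (M + 1)%R) mS) => x Sx i; apply: le_trans Sx.
  by rewrite [leRHS]/Num.norm/= mx_normrE; apply/bigmax_geP; right => /=; exists (ord0, i).
have cB : 0 <= c <= B%:E.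
  apply/andP; split; first by apply: integral_ge0 => y _; rewrite mule_ge0// lee_fin// indicE.
  rewrite -[leRHS]mule1 -(@lebesgue_cube R d) -integral_cst; last exact: cube_measurable.
  rewrite integral_mkcond; apply: ge0_le_integral => //.
  - by move=> y _; rewrite mule_ge0// lee_fin// indicE.
  - apply/measurable_EFinP; apply: measurable_funM => //.
    exact: (measurable_indic (@cube_measurable R d)).
  - apply/(measurable_restrictT _ _).1 => //; exact: cube_measurable.
  - move=> y _; rewrite patchE indicE; case: ifP => _; last by rewrite mule0.
    by rewrite mule1 lee_fin; have /andP[] := betaB y.
have c_fin : c \is a fin_num.
  rewrite ge0_fin_numE; last by have /andP[] := cB.
  by have /andP[_ cB'] := cB; rewrite (le_lt_trans cB')// ltry.
pose A := (alpha 0 + K * (M + 1))%R.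
have alphaS x : (alpha x <= A * \1_S x)%R.
  rewrite indicE; have [|/negP xS] := boolP (x \in S).
    rewrite inE /S/= mulr1 => xS; have := lip x 0%R; rewrite subr0.
    rewrite ler_norml => /andP[_]; rewrite lerBlDl => /le_trans; apply.
    by rewrite /A lerD2l ler_wpM2l.
  rewrite mulr0 supp// ltNge; apply/negP => xM; apply: xS; rewrite inE /S/=.
  by rewrite (le_trans xM)// lerDl.
have [ma1 a1] := nnmeasurable_EFin malpha alpha0.
have [mS1 S1] := nnmeasurable_indic R mS.
have alpha_fin : \int[L]_x (alpha x)%:E \is a fin_num.
  rewrite ge0_fin_numE ?integral_ge0//.
  have [A0|A0] := leP 0%R A; last first.
    rewrite integral0_eq// => x _; congr EFin; apply/eqP; rewrite eq_le alpha0 andbT.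
    by rewrite (le_trans (alphaS x))// mulr_le0_ge0 ?(ltW A0)// indicE.
  apply: (@le_lt_trans _ _ (\int[L]_x (A%:E * (\1_S x)%:E))).
    apply: ge0_le_integral => //.
    - exact: measurable_funeM.
    - by move=> x _; rewrite lee_fin.
  rewrite ge0_integralZl_EFin// integral_indic// setIT.
  by rewrite lte_mul_pinfty// lee_fin.
have S_fin : L S \is a fin_num by rewrite ge0_fin_numE.
set t := fine (c * \int[L]_x (alpha x)%:E).
have tE : c * \int[L]_x (alpha x)%:E = t%:E by rewrite fineK// fin_numM.
pose v := fine (c * L S).
have vE : c * L S = v%:E by rewrite fineK// fin_numM.
have bounds n : (eps n <= 1)%R ->
    (t - K * eps n * v)%:E <= \int[L]_x (alpha x * beta (frac ((eps n)^-1 *: x)))%:E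
      <= (t + K * eps n * v)%:E.
  move=> en1; set e := eps n.
  have e0 : e != 0%R by rewrite gt_eqF// eps0.
  pose P (p : X * X) : R := (beta (frac (p.2 + e^-1 *: p.1)) * \1_(@cube R d) p.2)%R.
  have P0 p : (0 <= P p)%R by rewrite mulr_ge0// indicE.
  have mP : measurable_fun setT P.
    apply: measurable_funM.
      apply: (measurableT_comp mbeta); apply: (measurableT_comp (@frac_measurable R d)).
      have := affine_measurable e^-1 1.
      by congr (measurable_fun _ _); apply/funext => p; rewrite scale1r addrC.
    apply: (measurableT_comp (measurable_indic (@cube_measurable R d))).
    exact: measurable_snd.
  have Ke0 : (0 <= K * e)%R by rewrite mulr_ge0// ltW// eps0.
  pose a2 (x : X) : R := (K * e * \1_S x)%R.
  have ma2 : measurable_fun setT a2 by apply: measurable_funM => //; exact: measurable_indic.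
  have a20 x : (0 <= a2 x)%R by rewrite mulr_ge0// indicE.
  have a2E : c * \int[L]_x (a2 x)%:E = (K * e * v)%:E.
    under eq_integral do rewrite EFinM.
    by rewrite ge0_integralZl_EFin// integral_indic// setIT muleCA vE -EFinM.
  have mshift : measurable_fun setT (fun p : X * X => alpha (p.1 + e *: p.2)%R).
    apply: (measurableT_comp malpha); have := affine_measurable 1 e.
    by congr (measurable_fun _ _); apply/funext => p; rewrite scale1r.
  have near_alpha x y : (`|alpha (x + e *: y)%R - alpha x| * P (x, y) <= a2 x * P (x, y))%R.
    rewrite /P/=; rewrite [in leLHS]indicE [X in (_ <= _ * (_ * X))%R]indicE.
    have [|_] := boolP (y \in @cube R d); last by rewrite !mulr0.
    rewrite inE => ycube; rewrite ler_wpM2r// ?mulr1//.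
    have y1 : (`|y| <= 1)%R.
      rewrite [leLHS]/Num.norm/= mx_normrE; apply: bigmax_le => // -[i j] _ /=.
      rewrite (ord1 i) ler_norml; have /andP[] := ycube j; lra.
    have ey : (`|e *: y| <= e)%R.
      by rewrite normrZ gtr0_norm ?eps0// ler_piMr// ltW// eps0.
    rewrite /a2 indicE; have [xS|/negP xS] := boolP (x \in S).
      rewrite mulr1 (le_trans (lip _ _))// addrAC subrr add0r.
      by rewrite ler_wpM2l.
    have xM : (M + 1 < `|x|)%R.
      by rewrite ltNge; apply/negP => xM; apply: xS; rewrite inE.
    rewrite !supp ?subrr ?normr0 ?mulr0//; first by lra.
    have := ler_normB (x + e *: y)%R (e *: y)%R; rewrite addrK.
    by rewrite -/e in en1; lra.
  have up x y : (alpha (x + e *: y)%R * P (x, y) <= (alpha x + a2 x) * P (x, y))%R.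
    have := near_alpha x y; rewrite mulrDl -lerBlDl; apply: le_trans.
    by rewrite -mulrBl ler_wpM2r// ler_norm.
  have dn x y : (alpha x * P (x, y) <= alpha (x + e *: y)%R * P (x, y) + a2 x * P (x, y))%R.
    have := near_alpha x y; rewrite -lerBlDl; apply: le_trans.
    by rewrite -mulrBl ler_wpM2r// distrC ler_norm.
  rewrite -(integral_average e0 mbeta beta0 malpha alpha0).
  set I := (X in _ <= X <= _).
  have m2 (g : X * X -> R) : measurable_fun setT g -> (forall p, 0 <= g p)%R ->
     nnmeasurable (fun x : X => \int[L]_y (g (x, y))%:E).
    move=> mg g0; split; last by move=> x; apply: integral_ge0 => y _; rewrite lee_fin.
    apply: (@measurable_fun_fubini_tonelli_F _ _ X X R L (EFin \o g)) => //.
    exact/measurable_EFinP.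
  have m1 (g : X * X -> R) x : measurable_fun setT g -> (forall p, 0 <= g p)%R ->
     nnmeasurable (fun y : X => (g (x, y))%:E).
    move=> mg g0; apply: nnmeasurable_EFin => //.
    by apply: (measurableT_comp mg); exact: measurable_pair1.
  pose g1 (p : X * X) := (alpha (p.1 + e *: p.2)%R * P p)%R.
  have mg1 : measurable_fun setT g1 by exact: measurable_funM.
  have g10 p : (0 <= g1 p)%R by rewrite mulr_ge0.
  have malpha1 : measurable_fun setT (fun p : X * X => alpha p.1).
    exact: (measurableT_comp malpha measurable_fst).
  have ma21 : measurable_fun setT (fun p : X * X => a2 p.1).
    exact: (measurableT_comp ma2 measurable_fst).
  pose g2 (p : X * X) := (alpha p.1 * P p)%R.
  have mg2 : measurable_fun setT g2 by exact: measurable_funM.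
  have g20 p : (0 <= g2 p)%R by rewrite mulr_ge0.
  pose g3 (p : X * X) := (a2 p.1 * P p)%R.
  have mg3 : measurable_fun setT g3 by exact: measurable_funM.
  have g30 p : (0 <= g3 p)%R by rewrite mulr_ge0.
  have g2E : \int[L]_x \int[L]_y (g2 (x, y))%:E = t%:E.
    by rewrite -tE; exact: (integral_separate e mbeta beta0 malpha alpha0).
  have g3E : \int[L]_x \int[L]_y (g3 (x, y))%:E = (K * e * v)%:E.
    by rewrite -a2E; exact: (integral_separate e mbeta beta0 ma2 a20).
  have ineq (f1 f2 f3 : X * X -> R) :
    measurable_fun setT f1 -> (forall p, 0 <= f1 p)%R ->
    measurable_fun setT f2 -> (forall p, 0 <= f2 p)%R ->
    measurable_fun setT f3 -> (forall p, 0 <= f3 p)%R ->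
    (forall p, f1 p <= f2 p + f3 p)%R ->
    \int[L]_x \int[L]_y (f1 (x, y))%:E <=
    \int[L]_x \int[L]_y (f2 (x, y))%:E + \int[L]_x \int[L]_y (f3 (x, y))%:E.
    move=> mf1 f10 mf2 f20 mf3 f30 f123.
    have [? ?] := m2 _ mf1 f10; have [? ?] := m2 _ mf2 f20; have [? ?] := m2 _ mf3 f30.
    rewrite -ge0_integralD//; apply: ge0_le_integral => //.
      exact: emeasurable_funD.
    move=> x _; have [? ?] := m1 _ x mf1 f10; have [? ?] := m1 _ x mf2 f20.
    have [? ?] := m1 _ x mf3 f30.
    rewrite -ge0_integralD//; apply: ge0_le_integral => //.
      exact: emeasurable_funD.
    by move=> y _; rewrite -EFinD lee_fin.
  apply/andP; split.
    rewrite EFinB leeBlDr// -g2E -g3E.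
    by apply: (ineq g2 g1 g3) => // -[x y]; exact: dn.
  rewrite EFinD -g2E -g3E.
  apply: (ineq g1 g2 g3) => // -[x y].
  by have := up x y; rewrite mulrDl.
rewrite tE.
have cvgb (s : R) : (t + s * (K * eps n * v))%:E @[n --> \oo] --> t%:E.
  apply: cvg_EFin; first by apply: nearW.
  rewrite [X in _ --> X](_ : t = t + s * (K * 0 * v))%R; last by ring.
  apply: cvgD; first exact: cvg_cst.
  apply: cvgM; first exact: cvg_cst.
  apply: cvgM; last exact: cvg_cst.
  by apply: cvgM => //; exact: cvg_cst.
apply: (squeeze_cvge _ (cvgb (-1)%R) (cvgb 1%R)).
near=> n; rewrite mulN1r mul1r; apply: bounds.
near: n; have := cvgr_le 0%R epscvg 1%R ltr01; exact.
Unshelve. all: by end_near. Qed.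

End equidistribution.

(** * Helly's selection theorem *)

Section diagonal_subsequence.
Context (R : realType).

(** The sequences [j -> a j n] have a cluster point in a product of compact intervals. Indices are
    then picked one after the other, the n-th making the first n coordinates 1 / (n + 1)-close to
    it. *)
Lemma diagonal_subsequence (a : nat -> nat -> R) (C : R) :
  (forall j n, 0 <= a j n <= C) ->
  exists k : nat -> nat, exists x : nat -> R,
    (forall m n, (m < n)%N -> (k m < k n)%N) /\
    forall j, a j (k n) @[n --> \oo] --> x j.
Proof.
move=> aC.
pose PT := prod_topology (fun _ : nat => R : topologicalType).
pose b (n : nat) : PT := fun j => a j n.
have cA : compact ([set f : PT | forall j, `[0, C]%classic (f j)]).
  exact: (@tychonoff nat (fun=> R : topologicalType) (fun=> `[0, C]%classic)
    (fun=> @segment_compact R 0 C)).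
have [|x [_ clx]] := cA (b @ \oo) _ _.
  by exists 0%N => // n _ j /=; rewrite in_itv/= aC.
have xP (N m : nat) : exists n, (m < n)%N /\ forall j, (j < N)%N -> `|x j - a j n| < N.+1%:R^-1.
  have : nbhs x [set f : PT | forall j : 'I_N, `|x j - f j| < N.+1%:R^-1].
    have FF : Filter (nbhs (x : PT)) by exact: nbhs_filter.
    have -> : [set f : PT | forall j : 'I_N, `|x j - f j| < N.+1%:R^-1] =
      (fun f : PT => forall j : 'I_N, (fun (j : 'I_N) (f : PT) => `|x j - f j| < N.+1%:R^-1) j f) by [].
    apply: (filter_forall FF) => j.
    have := @proj_continuous nat (fun=> R : topologicalType) j x.
    move=> /(_ [set y | `|x j - y| < N.+1%:R^-1]); apply.
    apply/nbhs_ballP; exists (N.+1%:R^-1) => //=.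
  have Fm : (b @ \oo) [set b n | n in [set n | (m < n)%N]].
    by exists m.+1 => // n /= mn; exists n.
  move=> /(clx _ _ Fm)[_ [[n /= mn <-] nx]]; exists n; split => // j jN.
  exact: (nx (Ordinal jN)).
have [g gP] := choice (fun p : nat * nat => xP p.1 p.2).
pose k := fix k n := if n is n'.+1 then g (n, k n') else g (0%N, 0%N).
exists k, x; split.
  apply: (homo_ltn (@ltn_trans)) => n /=; exact: (gP (n.+1, k n)).1.
move=> j; apply/cvgrPdist_lt => e e0.
near=> n.
have jn : (j < n)%N by near: n; exact: nbhs_infty_gt.
have : `|x j - a j (k n)| < n.+1%:R^-1.
  have nE : n = n.-1.+1 by rewrite prednK// (leq_ltn_trans _ jn).
  by move: jn; rewrite nE => jn; exact: (gP (n.-1.+1, k n.-1)).2.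
move=> /lt_le_trans; apply; apply: ltW.
by near: n; exact: (near_infty_natSinv_lt (PosNum e0)).
Unshelve. all: end_near. Qed.

Lemma uniformly_continuous_itv (f : R -> R) (a b e : R) : continuous f -> 0 < e ->
  exists2 dl : R, 0 < dl &
    forall s t, a <= s <= b -> `|s - t| < dl -> `|f s - f t| < e.
Proof.
move=> cf e0.
have := @segment_compact R a b; rewrite compact_near_coveringP.
move=> /(_ R (0^'+ : set_system R) (fun dl s => forall t, `|s - t| < dl -> `|f s - f t| < e)).
have : forall x : R, `[a, b]%classic x ->
    \forall x' \near x & i \near (0^'+ : set_system R),
      forall t, `|x' - t| < i -> `|f x' - f t| < e.
  move=> x _.
  have /cvgrPdist_lt/(_ _ (divr_gt0 e0 (ltr0n R 2))) := cf x.
  move=> /nbhs_ballP[r /= r0 rP].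
  exists (ball x (r / 2), [set i | i < r / 2]) => /=.
    split; first by apply: nbhsx_ballx; rewrite divr_gt0.
    by apply: nbhs_right_lt; rewrite divr_gt0.
  move=> -[y i] /= [xy ir] t yt.
  have fy : `|f x - f y| < e / 2.
    apply: rP; apply: (le_ball _ xy).
    by rewrite ler_pdivrMr// ler_peMr ?ler1n// ltW.
  have ft : `|f x - f t| < e / 2.
    apply: rP; rewrite -ball_normE/= in xy *.
    have := ler_normD (x - y) (y - t); rewrite subrKA; lra.
  have := ler_normD (f y - f x) (f x - f t).
  rewrite subrKA (distrC (f y) (f x)); lra.
move=> PP H; have {}H := H _ PP.
near (0 : R)^'+ => dl.
exists dl => //.
move=> s t sab st.
have : `[a, b]%classic `<=` (fun s => forall t, `|s - t| < dl -> `|f s - f t| < e).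
  by near: dl; exact: H.
by move=> /(_ s); apply => //=; rewrite in_itv.
Unshelve. all: end_near. Qed.

End diagonal_subsequence.

Section bounded_integrals.
Context d (T : measurableType d) (R : realType) (m : {measure set T -> \bar R}).
Hypothesis m_fin : (m setT < +oo)%E.

Lemma bounded_integrable (f : T -> R) (B : R) :
  measurable_fun setT f -> (forall x, `|f x| <= B) ->
  m.-integrable setT (EFin \o f).
Proof.
move=> mf fB; apply: measurable_bounded_integrable => //.
by exists B; split; [exact: num_real|move=> M BM x _ /=; rewrite (le_trans (fB x))// ltW].
Qed.

Lemma bounded_integralE (f : T -> R) (B : R) :
  measurable_fun setT f -> (forall x, `|f x| <= B) ->
  (\int[m]_x (f x)%:E)%E = (\int[m]_x f x)%:E.
Proof.
move=> mf fB; rewrite /Rintegral fineK//.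
by apply: integrable_fin_num => //; exact: bounded_integrable fB.
Qed.

Lemma Rintegral_dist (f g h : T -> R) (Bf Bg Bh : R) :
  measurable_fun setT f -> (forall x, `|f x| <= Bf) ->
  measurable_fun setT g -> (forall x, `|g x| <= Bg) ->
  measurable_fun setT h -> (forall x, `|h x| <= Bh) ->
  (forall x, `|f x - g x| <= h x) ->
  `|\int[m]_x f x - \int[m]_x g x| <= \int[m]_x h x.
Proof.
move=> mf fB mg gB mh hB fgh.
have If := bounded_integrable mf fB.
have Ig := bounded_integrable mg gB.
have Ih := bounded_integrable mh hB.
have mfg : measurable_fun setT (fun x => f x - g x) by exact: measurable_funB.
have fgB x : `|f x - g x| <= Bf + Bg.
  by rewrite (le_trans (ler_normB _ _))// lerD.
have Ifg := bounded_integrable mfg fgB.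
rewrite -RintegralB//; apply: (le_trans (le_normr_Rintegral _ Ifg)) => //.
apply: le_Rintegral => //.
apply: (@bounded_integrable _ (Bf + Bg)); first exact: measurableT_comp.
by move=> x; rewrite normr_id.
Qed.

Lemma Rintegral_indic (A : set T) : measurable A ->
  \int[m]_x (\1_A x : R) = fine (m A).
Proof. by move=> mA; rewrite /Rintegral integral_indic// setIT. Qed.

Lemma Rintegral_sum_indic n (a : nat -> R) (A : nat -> set T) :
  (forall j, measurable (A j)) ->
  \int[m]_x (\sum_(j < n) a j * \1_(A j) x) = \sum_(j < n) a j * fine (m (A j)).
Proof.
move=> mA; elim: n => [|n IH].
  rewrite big_ord0 -[RHS](_ : \int[m]_x 0 = 0).
    by apply: eq_Rintegral => x _; rewrite big_ord0.
  by rewrite Rintegral_cst// mul0r.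
have mS k : measurable_fun setT (fun x => \sum_(j < k) a j * \1_(A j) x).
  by apply: measurable_sum => j; apply: measurable_funM.
have BS k x : `|\sum_(j < k) a j * \1_(A j) x| <= \sum_(j < k) `|a j|.
  rewrite (le_trans (ler_norm_sum _ _ _))// ler_sum// => j _.
  by rewrite normrM indicE ler_piMr// normr_nat; case: (_ \in _).
rewrite big_ord_recr/= -IH -Rintegral_indic//.
rewrite -RintegralZl//; last first.
  apply: (@bounded_integrable _ 1); first exact: measurable_indic.
  by move=> x; rewrite indicE normr_nat; case: (_ \in _).
rewrite -RintegralD//.
- by apply: eq_Rintegral => x _; rewrite big_ord_recr.
- exact: bounded_integrable (mS n) (BS n).
- apply: (@bounded_integrable _ `|a n|).
    by apply: measurable_funM => //; exact: measurable_indic.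
  by move=> x; rewrite normrM indicE ler_piMr// normr_nat; case: (_ \in _).
Qed.

End bounded_integrals.

(** [D] will be the gap at grid points between the raw limit of distribution functions and its
    regularisation. *)
Lemma abel_summation (R : realType) n (a D : nat -> R) :
  \sum_(j < n) a j.+1 * (D j - D j.+1) =
  \sum_(j < n) (a j.+1 - a j) * D j + a 0%N * D 0%N - a n * D n.
Proof.
elim: n => [|n IH]; first by rewrite !big_ord0; ring.
by rewrite !big_ord_recr/= IH; ring.
Qed.

Section helly.
Context (R : realType).

(** Rational nodes cutting [-1, 2] into [N] equal cells, since the limit of distribution functions
    is first known at rational points. The interval exceeds [0, 1] on both sides, so that this limit
    is constant near both ends. *)
Definition grid (N j : nat) : rat := -1 + 3 * j%:R / N%:R.
Definition rgrid (N j : nat) : R := ratr (grid N j).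

Lemma rgridE N j : rgrid N j = -1 + 3 * j%:R / N%:R.
Proof. by rewrite /rgrid /grid rmorphD rmorphN1 rmorphM fmorphV !rmorphM/= !ratr_nat. Qed.

Lemma rgrid0 N : rgrid N 0 = -1.
Proof. by rewrite rgridE mulr0 mul0r addr0. Qed.

Lemma rgridN N : (0 < N)%N -> rgrid N N = 2.
Proof.
move=> N0; rewrite rgridE mulfK ?pnatr_eq0 -?lt0n//; by ring.
Qed.

Lemma rgridS N j : rgrid N j.+1 - rgrid N j = 3 / N%:R.
Proof. by rewrite !rgridE -addn1 natrD; ring. Qed.

Lemma rgrid_le N : {homo rgrid N : i j / (i <= j)%N >-> i <= j}.
Proof.
apply: homo_leq => // [x y z|j]; first exact: le_trans.
by rewrite -subr_ge0 rgridS divr_ge0.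
Qed.

(** A Riemann-Stieltjes sum: in its cell [psi] is within [eta] of its value at the right end, and
    the complement of ]-1, 2], where only the bound [B] is at hand, is [m]-null. *)
Lemma step_approx (m : {measure set R -> \bar R}) (psi : R -> R) (B eta : R) N :
  (0 < N)%N -> (m setT < +oo)%E -> m (~` `]-1, 2]%classic) = 0%E ->
  measurable_fun setT psi -> (forall x, `|psi x| <= B) -> 0 <= eta ->
  (forall s t : R, -1 <= s <= 2 -> `|s - t| <= 3 / N%:R -> `|psi s - psi t| <= eta) ->
  `|\int[m]_x psi x -
    \sum_(j < N) psi (rgrid N j.+1) * fine (m `]rgrid N j, rgrid N j.+1]%classic)|
  <= eta * fine (m setT).
Proof.
move=> N0 moo msupp mpsi psiB eta0 psieta.
rewrite -(Rintegral_sum_indic moo N (fun j => psi (rgrid N j.+1))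
  (A := fun j => `]rgrid N j, rgrid N j.+1]%classic))//.
set psis := fun x => \sum_(j < N) _.
pose h (x : R) : R := eta + B * \1_(~` `]-1, 2]%classic) x.
have B0 : 0 <= B by rewrite (le_trans _ (psiB 0)).
have mI : measurable (~` `]-1, 2]%classic : set R) by exact: measurableC.
have mh : measurable_fun setT h.
  by apply: measurable_funD => //; apply: measurable_funM => //; exact: measurable_indic.
have i01 (A : set R) x : `|\1_A x| <= 1 :> R.
  by rewrite indicE normr_nat; case: (_ \in _).
have hB x : `|h x| <= eta + B.
  rewrite (le_trans (ler_normD _ _))// ger0_norm// lerD2l normrM ger0_norm//.
  by rewrite ler_piMr.
have <- : \int[m]_x h x = eta * fine (m setT).
  rewrite RintegralD//.
  - rewrite Rintegral_cst// RintegralZl//.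
      by rewrite Rintegral_indic// msupp/= mulr0 addr0.
    by apply: (bounded_integrable moo (B := 1)) => //; exact: measurable_indic.
  - by apply: (bounded_integrable moo (B := `|eta|)).
  - apply: (bounded_integrable moo (B := B)).
      by apply: measurable_funM => //; exact: measurable_indic.
    by move=> x; rewrite normrM ger0_norm// ler_piMr.
apply: (Rintegral_dist moo (Bf := B)
  (Bg := \sum_(j < N) `|psi (rgrid N j.+1)|) (Bh := eta + B)) => //.
- by apply: measurable_sum => j; apply: measurable_funM.
- move=> x; rewrite (le_trans (ler_norm_sum _ _ _))// ler_sum// => j _.
  by rewrite normrM ler_piMr.
move=> x; rewrite /h indicE.
have [|] := boolP (x \in `]-1, 2]%classic).
  rewrite inE => xI; rewrite memNset; last by move=> /(_ xI).
  rewrite mulr0 addr0; move: xI; rewrite /= in_itv/= => /andP[x1 x2].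
  have [j jN xj] : exists2 j, (j < N)%N & x \in `]rgrid N j, rgrid N j.+1].
    have exN : exists j, x <= rgrid N j by exists N; rewrite rgridN.
    have [[|j] xj jmin] := ex_minnP exN; first by move: xj; rewrite rgrid0; lra.
    exists j; first by apply: jmin; rewrite rgridN.
    rewrite in_itv/= xj andbT ltNge; apply/negP => /jmin.
    by rewrite ltnn.
  rewrite /psis (bigD1 (Ordinal jN))//= big1 ?addr0; last first.
    move=> i ij; rewrite indicE memNset ?mulr0//= => xi.
    move: xi xj; rewrite !in_itv/= => /andP[xi1 xi2] /andP[xj1 xj2].
    have [ij'|ji'|ij'] := ltngtP i j; last by move/eqP: ij; apply; exact/val_inj.
      by have := @rgrid_le N _ _ ij'; lra.
    by have := @rgrid_le N _ _ ji'; lra.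
  rewrite indicE mem_set//= mulr1; apply: psieta; first by lra.
  move: xj; rewrite in_itv/= => xj; have := rgridS N j; rewrite ler_norml; lra.
rewrite notin_setE/= => xI; rewrite mem_set// mulr1.
rewrite /psis big1 ?subr0; first by rewrite (le_trans (psiB x))// lerDr.
move=> j _; rewrite indicE memNset ?mulr0//= => xj; apply: xI.
move: xj; rewrite /= !in_itv/=.
have := @rgrid_le N _ _ (leq0n j); have := @rgrid_le N _ _ (ltn_ord j).
by rewrite rgridN// rgrid0; lra.
Qed.

End helly.

Section helly_selection.
Context (R : realType).

Lemma cdf_itv (m : {measure set R -> \bar R}) (a b : R) :
  (m setT < +oo)%E -> a <= b ->
  fine (m `]a, b]%classic) = fine (m `]-oo, b]%classic) - fine (m `]-oo, a]%classic).
Proof.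
move=> moo ab.
have fin (A : set R) : measurable A -> m A \is a fin_num.
  move=> mA; rewrite ge0_fin_numE//; apply: le_lt_trans moo.
  by apply: le_measure => //; rewrite inE.
have -> : `]-oo, b]%classic = `]-oo, a]%classic `|` `]a, b]%classic :> set R.
  by rewrite -itv_bndbnd_setU// bnd_simp.
rewrite measureU//.
- by rewrite fineD ?fin// addrAC subrr add0r.
- apply/seteqP; split=> // x [/=]; rewrite !in_itv/=; lra.
Qed.

(** Along a subsequence the distribution functions converge at all rationals, to [G]; [M] is the
    Stieltjes measure of the right-continuous regularisation [F] of [G]. The gaps between [F] and
    [G] at grid points are absorbed by an Abel summation, so continuity points of [F] never
    enter. *)
Theorem helly_selection (m : nat -> {measure set R -> \bar R}) (C : R) :
  (forall n, m n setT <= C%:E)%E ->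
  (forall n, m n (~` `[0, 1]%classic) = 0%E) ->
  exists k : nat -> nat, exists M : {measure set R -> \bar R},
    [/\ forall i j, (i < j)%N -> (k i < k j)%N,
        (M setT <= C%:E)%E,
        M (~` `]-1, 2]%classic) = 0%E &
        forall (psi : R -> R) (B : R), continuous psi ->
          (forall x, `|psi x| <= B) ->
          \int[m (k n)]_x psi x @[n --> \oo] --> \int[M]_x psi x].
Proof.
move=> mC msupp.
have N12 : -1 <= 2 :> R by lra.
have moo n : (m n setT < +oo)%E by rewrite (le_lt_trans (mC n))// ltry.
have fin n (A : set R) : measurable A -> m n A \is a fin_num.
  move=> mA; rewrite ge0_fin_numE//; apply: le_lt_trans (moo n).
  by apply: le_measure => //; rewrite inE.
have C0 : 0 <= C.
  by rewrite -lee_fin (le_trans _ (mC 0%N)).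
pose Fn n (r : R) := fine (m n `]-oo, r]%classic).
have Fn_ge0 n r : 0 <= Fn n r by rewrite fine_ge0.
have Fn_leC n r : Fn n r <= C.
  rewrite -lee_fin fineK ?fin// (le_trans _ (mC n))//.
  by apply: le_measure => //; rewrite inE.
have Fn_nd n : {homo Fn n : x y / x <= y}.
  move=> x y xy; rewrite fine_le ?fin//.
  by apply: le_measure; rewrite ?inE//; apply: subset_itvl; rewrite bnd_simp.
have msupp' n (A : set R) : measurable A -> A `<=` ~` `[0, 1]%classic -> m n A = 0%E.
  move=> mA A01; apply/eqP; rewrite eq_le measure_ge0 andbT -(msupp n).
  by apply: le_measure => //; rewrite inE//; exact: measurableC.
have Fn_lt0 n r : r < 0 -> Fn n r = 0.
  move=> r0; rewrite /Fn msupp'// => x /=; rewrite !in_itv/=; lra.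
have Fn_ge1 n r : 1 <= r -> Fn n r = fine (m n setT).
  move=> r1; rewrite /Fn; congr fine.
  have -> : setT = `]-oo, r]%classic `|` `]r, +oo[%classic :> set R.
    by rewrite -itv_bndbnd_setU//= set_itvNyy.
  rewrite measureU// ?[X in (_ + X)%E]msupp' ?adde0//.
    by move=> x /=; rewrite !in_itv/=; lra.
  by apply/seteqP; split=> // x [/=]; rewrite !in_itv/=; lra.
(* Rationals are listed by their codes; integers that code no rational are sent to 0. *)
pose a j n := Fn n (ratr (odflt 0 (@unpickle rat j))).
have [k [x [k_incr kx]]] : exists k : nat -> nat, exists x : nat -> R,
    (forall m n, (m < n)%N -> (k m < k n)%N) /\
    forall j, a j (k n) @[n --> \oo] --> x j.
  by apply: (diagonal_subsequence (C := C)) => j n; rewrite Fn_ge0 Fn_leC.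
pose G (q : rat) := x (pickle q).
have GP q : Fn (k n) (ratr q) @[n --> \oo] --> G q.
  have := kx (pickle q); rewrite /a pickleK/=; exact.
have G_ge0 q : 0 <= G q.
  by apply: (cvgr_to_ge (GP q)); apply: nearW.
have G_leC q : G q <= C.
  by apply: (cvgr_to_le (GP q)); apply: nearW.
have G_nd : {homo G : p q / p <= q}.
  move=> p q pq; apply: (ler_cvg_to (GP p) (GP q)); apply: nearW => n.
  by apply: Fn_nd; rewrite ler_rat.
have Glim q l : Fn (k n) (ratr q) @[n --> \oo] --> l -> G q = l.
  exact: (cvg_unique (@Rhausdorff R) (GP q)).
have G_lt0 q : q < 0 -> G q = 0.
  move=> q0; apply: Glim.
  by under eq_fun do rewrite Fn_lt0 ?ltrq0//; exact: cvg_cst.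
have G_ge1 q : 1 <= q -> G q = G 2.
  move=> q1; apply: Glim.
  have -> : (fun n => Fn (k n) (ratr q)) = (fun n => Fn (k n) (ratr 2)).
    have r1 (p : rat) : 1 <= p -> 1 <= ratr p :> R.
      by move=> p1; rewrite -(rmorph1 (@ratr R)) ler_rat.
    by apply/funext => n; rewrite !Fn_ge1// r1.
  exact: GP.
(* The infimum runs over strictly larger rationals, which makes [F] right-continuous and gives
   [G q <= F q], and [F r <= G q] for [r < q]. *)
pose F (r : R) : R := inf [set G q | q in [set q | r < ratr q]].
have Sne (r : R) : [set G q | q in [set q | r < ratr q]] !=set0.
  have rr : r < r + 1 by rewrite ltrDl.
  have [q] := rat_in_itvoo rr.
  by rewrite in_itv/= => /andP[rq _]; exists (G q); exists q.
have Slb (r : R) : lbound [set G q | q in [set q | r < ratr q]] 0 by move=> _ [q _ <-].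
have F_le (r : R) (q : rat) : r < ratr q -> F r <= G q.
  by move=> rq; apply: ge_inf; [exists 0; exact: Slb|exists q].
have F_ge q : G q <= F (ratr q).
  apply: lb_le_inf; first exact: Sne.
  by move=> _ [p /= qp <-]; apply: G_nd; rewrite -(ler_rat R) ltW.
have F_nd : nondecreasing F.
  move=> r s rs; apply: lb_le_inf; first exact: Sne.
  by move=> _ [q /= sq <-]; apply: F_le; exact: le_lt_trans sq.
have F_rc : right_continuous F.
  move=> r; apply/cvgrPdist_lt => e e0.
  have [_ [q /= rq <-] Gq] : exists2 y, [set G q | q in [set q | r < ratr q]] y & y < F r + e.
    by apply: inf_adherent => //; split; [exact: Sne|exists 0; exact: Slb].
  near=> s.
  have rs : r <= s by apply: ltW; near: s; exact: nbhs_right_gt.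
  have sq : s < ratr q by near: s; exact: nbhs_right_lt.
  by rewrite distrC ger0_norm ?subr_ge0 ?F_nd// ltrBlDl (le_lt_trans (F_le _ _ sq)).
pose FC : cumulative R R := HB.pack F (isCumulative.Build R _ R F F_nd F_rc).
pose LS := lebesgue_stieltjes_measure FC.
have LSE (u v : R) : u <= v -> LS `]u, v]%classic = (F v - F u)%:E.
  move=> uv; rewrite /LS/= /lebesgue_stieltjes_measure /measure_extension.
  rewrite measurable_mu_extE/=; last exact: is_ocitv.
  by rewrite wlength_itv_bnd.
have mid : measurable_fun setT (fun t : measurableTypeR R => t : R) by [].
have [M ME] := @image_density R _ _ _ _ LS _ _ mid
  (measurable_indic (measurable_itv (`]-1, 2] : interval R)))
  (fun x => ltac:(by rewrite indicE)).
have MA (A : set R) : measurable A -> M A = LS (A `&` `]-1, 2]%classic).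
  move=> mA; have := ME _ (nnmeasurable_indic R mA).
  rewrite integral_indic// setIT => ->.
  rewrite -[RHS](_ : (\int[LS]_x (\1_(A `&` `]-1, 2]%classic) x)%:E)%E = _); last first.
    by rewrite integral_indic ?setIT//; exact: measurableI.
  by apply: eq_integral => t _; rewrite -EFinM indicI.
have F2 : F 2 = G 2.
  apply/eqP; rewrite eq_le; apply/andP; split.
    by rewrite -(G_ge1 3)//; apply: F_le; rewrite ratr_nat ltr_nat.
  by have := F_ge 2; rewrite ratr_nat.
have G1 : G (-1) = 0 by exact: G_lt0.
have F1 : F (-1) = 0.
  apply/eqP; rewrite eq_le; apply/andP; split.
    have [q] := rat_in_itvoo (ltrN10 R); rewrite in_itv/= ltrq0 => /andP[q1 q0].
    by apply: le_trans (F_le _ _ q1) _; rewrite G_lt0.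
  by have := F_ge (-1); rewrite G1 [ratr _](rmorphN1 (@ratr R)).
have MT : M setT = (G 2)%:E.
  by rewrite MA// setTI LSE// F2 F1 subr0.
have MTC : fine (M setT) <= C by rewrite MT; exact: G_leC.
have Moo : (M setT < +oo)%E by rewrite MT ltry.
have Msupp : M (~` `]-1, 2]%classic) = 0%E.
  rewrite MA; last exact: measurableC.
  by rewrite setICl; exact: (measure0 (lebesgue_stieltjes_measure FC)).
clear ME mid; clearbody LS; clearbody FC F; clearbody G; clear Sne Slb.
exists k, M; split => //; first by rewrite MT lee_fin.
move=> psi B cpsi psiB; apply/cvgrPdist_lt => e e0.
(* Four errors of size [e / 4] will be added. [C + 1] keeps the divisor positive and yields
   [eta * C <= e / 4]. *)
pose eta := e / (4 * (C + 1)).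
have eta0 : 0 < eta by rewrite divr_gt0// mulr_gt0//; lra.
have etaC : eta * C <= e / 4.
  have C1 : 0 < C + 1 by lra.
  have -> : eta * C = e / 4 * (C / (C + 1)) by rewrite /eta; field; rewrite gt_eqF.
  rewrite ler_piMr ?divr_ge0 ?(ltW e0)// ler_pdivrMr//; lra.
have [dl dl0 psidl] := uniformly_continuous_itv (-1) 2 cpsi eta0.
have [N N0 Ndl] : exists2 N, (0 < N)%N & 3 / N%:R < dl.
  exists (Num.truncn (3 / dl)).+1 => //.
  rewrite ltr_pdivrMr// mulrC -ltr_pdivrMr//; exact: truncnS_gt.
have psieta (s t : R) : -1 <= s <= 2 -> `|s - t| <= 3 / N%:R -> `|psi s - psi t| <= eta.
  by move=> s12 st; rewrite ltW// psidl// (le_lt_trans st).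
have mpsi : measurable_fun setT psi by exact: continuous_measurable_fun.
have eta_ge0 := ltW eta0.
have msupp2 n : m n (~` `]-1, 2]%classic) = 0%E.
  apply: msupp'; first exact: measurableC.
  by move=> y /=; rewrite !in_itv/=; lra.
pose p := rgrid R N.
pose Sn n := \sum_(j < N) psi (p j.+1) * fine (m (k n) `]p j, p j.+1]%classic).
pose SG := \sum_(j < N) psi (p j.+1) * (G (grid N j.+1) - G (grid N j)).
pose SF := \sum_(j < N) psi (p j.+1) * fine (M `]p j, p j.+1]%classic).
have A1 n : `|\int[m (k n)]_x psi x - Sn n| <= e / 4.
  apply: le_trans (step_approx N0 (moo _) (msupp2 _) mpsi psiB eta_ge0 psieta) _.
  apply: le_trans etaC; rewrite ler_wpM2l// -lee_fin fineK ?fin//.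
have A3 : `|\int[M]_x psi x - SF| <= e / 4.
  apply: le_trans (step_approx N0 Moo Msupp mpsi psiB eta_ge0 psieta) _.
  by apply: le_trans etaC; rewrite ler_wpM2l.
have pS j : p j <= p j.+1 by exact: rgrid_le.
have SnE n : Sn n = \sum_(j < N) psi (p j.+1) * (Fn (k n) (p j.+1) - Fn (k n) (p j)).
  by apply: eq_bigr => j _; rewrite cdf_itv.
have SFE : SF = \sum_(j < N) psi (p j.+1) * (F (p j.+1) - F (p j)).
  apply: eq_bigr => j _; congr (_ * _); rewrite MA// setIidl.
    by rewrite LSE.
  have := @rgrid_le R N _ _ (leq0n j); have := @rgrid_le R N _ _ (ltn_ord j).
  rewrite rgridN// rgrid0 -/p => p2 p1 y /=; rewrite !in_itv/=; lra.
(* At a node, [F - G] lies between 0 and the increment of [G] to the next node. Abel summation sets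
   these gaps against increments of [psi], at most [eta], and the increments of [G] telescope to at
   most [C]. The boundary terms vanish because the gaps at -1 and 2 are 0. *)
have A2 : `|SG - SF| <= e / 4.
  pose D j := F (p j) - G (grid N j).
  have -> : SG - SF = \sum_(j < N) psi (p j.+1) * (D j - D j.+1).
    by rewrite SFE -sumrB; apply: eq_bigr => j _; rewrite /D; ring.
  rewrite (abel_summation _ (fun j => psi (p j))).
  have -> : D 0%N = 0.
    rewrite /D /p rgrid0 F1 (_ : grid N 0 = -1) ?G1 ?subrr//.
    by rewrite /grid mulr0 mul0r addr0.
  have -> : D N = 0.
    rewrite /D /p rgridN// F2 (_ : grid N N = 2) ?subrr//.
    by rewrite /grid mulfK ?pnatr_eq0 -?lt0n//; ring.
  rewrite !mulr0 addr0 subr0.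
  apply: (@le_trans _ _ (\sum_(j < N) eta * (G (grid N j.+1) - G (grid N j)))).
    rewrite (le_trans (ler_norm_sum _ _ _))// ler_sum// => j _.
    rewrite normrM ler_pM//.
      rewrite distrC; apply: psieta.
        have := @rgrid_le R N _ _ (leq0n j); have := @rgrid_le R N _ _ (ltnW (ltn_ord j)).
        by rewrite rgridN// rgrid0 -/p; lra.
      by rewrite distrC rgridS ger0_norm// divr_ge0.
    have D0 : 0 <= D j by rewrite subr_ge0; exact: F_ge.
    rewrite ger0_norm// /D lerD2r; apply: F_le.
    rewrite -/(rgrid R N j.+1) -subr_gt0 rgridS divr_gt0// ltr0n//.
  rewrite -mulr_sumr -(big_mkord xpredT (fun j => G (grid N j.+1) - G (grid N j))).
  rewrite telescope_sumr//; apply: le_trans etaC; rewrite ler_wpM2l//.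
  by rewrite lerBlDr (le_trans (G_leC _))// lerDl.
have SGcvg : Sn n @[n --> \oo] --> SG.
  under eq_fun do rewrite SnE.
  apply: (@cvg_big R _ +%R 0 xpredT) => [|j _]; first exact: add_continuous.
  apply: cvgM; first exact: cvg_cst.
  by apply: cvgB; exact: GP.
near=> n.
have A4 : `|SG - Sn n| < e / 4.
  by near: n; apply: cvgr_dist_lt => //; rewrite divr_gt0.
have := A1 n; have := A2; have := A3; move: A4.
rewrite !ler_norml !ltr_norml; lra.
Unshelve. all: end_near. Qed.

End helly_selection.

(** * Schoenberg's space-filling curve and a measurable right inverse *)

Section schoenberg_curve.
Context (R : realType).

(** [S] increases and [S + rho] decreases, so every stage brackets the supremum. *)
Lemma nested_limit (S rho : nat -> R) :
  (forall k, S k <= S k.+1) -> (forall k, S k.+1 + rho k.+1 <= S k + rho k) ->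
  (forall k, 0 <= rho k) ->
  forall k, S k <= sup (range S) <= S k + rho k.
Proof.
move=> S1 S2 rho0.
have Snd : {homo S : i j / (i <= j)%N >-> i <= j}.
  by apply: homo_leq => // x y z; exact: le_trans.
have Uni : {homo (fun k => S k + rho k) : i j / (i <= j)%N >-> j <= i}.
  by apply: (homo_leq (r := fun x y => y <= x)) => // x y z yx zy; exact: le_trans zy yx.
have ub k l : S l <= S k + rho k.
  have [kl|lk] := leqP k l.
    by apply: (@le_trans _ _ (S l + rho l)); [rewrite lerDl|exact: Uni].
  by apply: (@le_trans _ _ (S k)); [exact/Snd/ltnW|rewrite lerDl].
move=> k; apply/andP; split.
  apply: ub_le_sup; last by exists k.
  by exists (S 0%N + rho 0%N) => _ [l _ <-].
by apply: ge_sup; [exists (S 0%N), 0%N|move=> _ [l _ <-]].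
Qed.

Lemma squeeze_unique (S rho : nat -> R) (x y : R) :
  rho @ \oo --> 0 -> (forall k, S k <= x <= S k + rho k) ->
  (forall k, S k <= y <= S k + rho k) -> x = y.
Proof.
move=> rho0 Sx Sy; apply/eqP; rewrite -subr_eq0 -normr_eq0 eq_le normr_ge0 andbT.
apply: (cvgr_to_ge rho0); apply: nearW => k.
have := Sx k; have := Sy k; rewrite ler_norml; lra.
Qed.

Let kappa : R := cos (pi / 3).

Let pi0 : 0 < pi :> R. Proof. exact: pi_gt0. Qed.

Let kappa_gt0 : 0 < kappa.
Proof. by apply: cos_gt0_pihalf; have := pi0; lra. Qed.

(** Schoenberg's auxiliary function. The clipping gives 0 where [cos (pi t) >= kappa] and 1 where
    [cos (pi t) <= - kappa]; as [kappa] is the cosine of pi / 3, these contain [0, 1/3] and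
    [2/3, 1]. Continuity and the period 2 come from the cosine. *)
Definition zigzag (t : R) : R :=
  Num.max 0 (Num.min 1 ((kappa - cos (pi * t)) / (2 * kappa))).

Lemma zigzag_itv t : 0 <= zigzag t <= 1.
Proof. by rewrite /zigzag le_max lexx/= ge_max ler01 ge_min lexx. Qed.

Lemma zigzag_continuous : continuous zigzag.
Proof.
move=> t.
pose g (s : R) : R^o := (kappa - cos (pi * s)) / (2 * kappa).
have cg : {for t, continuous g}.
  apply: cvgM; last exact: cvg_cst.
  apply: cvgB; first exact: cvg_cst.
  apply: (@continuous_comp _ _ _ (fun t => pi * t) cos); last exact: continuous_cos.
  by apply: cvgM; [exact: cvg_cst|exact: cvg_id].
have c1 : {for t, continuous ((fun=> 1 : R^o) \min g)}.
  by apply: continuous_min => //; exact: cvg_cst.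
have := @continuous_max _ _ (fun=> 0 : R^o) ((fun=> 1 : R^o) \min g) t _ c1.
by apply; exact: cvg_cst.
Qed.

Let zigzag_periodic n s : zigzag (2 * n%:R + s) = zigzag s.
Proof.
rewrite /zigzag; congr (Num.max _ (Num.min _ ((_ - _) / _))).
elim: n => [|n IH]; first by rewrite mulr0 add0r.
have -> : pi * (2 * n.+1%:R + s) = pi * (2 * n%:R + s) + pi *+ 2 :> R.
  by rewrite -addn1 natrD -mulr_natr; ring.
by rewrite cosD2pi.
Qed.

Let cos_plateau s : 0 <= s <= 3^-1 -> kappa <= cos (pi * s).
Proof.
move=> /andP[s0 s3]; have p0 := pi0.
have ps : pi * s <= pi / 3 by rewrite ler_pM2l.
have i1 : (pi * s : R) \in `[0 : R, pi] by rewrite in_itv/= mulr_ge0 ?(ltW p0)//=; lra.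
have i2 : (pi / 3 : R) \in `[0 : R, pi] by rewrite in_itv/=; apply/andP; split; lra.
by rewrite leNgt /kappa ltr_cos// -leNgt.
Qed.

Let zigzag0 s : 0 <= s <= 3^-1 -> zigzag s = 0.
Proof.
move=> /cos_plateau ks; rewrite /zigzag max_l// ge_min; apply/orP; right.
by rewrite pmulr_lle0 ?subr_le0// invr_gt0 mulr_gt0.
Qed.

Let zigzag1 s : 2 / 3 <= s <= 1 -> zigzag s = 1.
Proof.
move=> s23; have : 0 <= 1 - s <= 3^-1 by lra.
move=> /cos_plateau; have -> : pi * (1 - s) = - (pi * s) + pi by ring.
rewrite cosDpi cosN => ks; rewrite /zigzag min_l ?max_r//.
by rewrite ler_pdivlMr ?mulr_gt0//; lra.
Qed.

Section digits.
Variable b : nat -> bool.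

Let T k : R := \sum_(i < k) 2 * (b i)%:R * 3^-1 ^+ i.+1.
Definition cantor_point : R := sup (range T).

Let b01 i : 0 <= ((b i)%:R : R) <= 1.
Proof. by rewrite ler0n lern1; case: (b i). Qed.

Let p3 k : 0 < 3^-1 ^+ k :> R.
Proof. by rewrite exprn_gt0// invr_gt0. Qed.

Let T_itv k : T k <= cantor_point <= T k + 3^-1 ^+ k.
Proof.
apply: (nested_limit (rho := fun k => 3^-1 ^+ k)) => [{}k|{}k|{}k].
- by rewrite /T big_ord_recr/= lerDl !mulr_ge0 ?(ltW (p3 _)).
- rewrite /T big_ord_recr/= exprS; have := b01 k; have := p3 k.
  set q := 3^-1 ^+ k; nra.
- exact: ltW.
Qed.

Let Tn k : exists n : nat, 3 ^+ k * T k = 2 * n%:R.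
Proof.
elim: k => [|k [n IH]]; first by exists 0%N; rewrite /T big_ord0 !mulr0.
exists (3 * n + b k)%N; rewrite /T big_ord_recr/= -/(T k) mulrDr exprS -mulrA IH.
rewrite natrD natrM; set B := (b k)%:R.
have -> : 3 * 3 ^+ k * (2 * B * 3^-1 ^+ k.+1) = 2 * B.
  rewrite -exprS mulrCA -exprMn mulfV ?expr1n ?mulr1//.
by ring.
Qed.

Lemma cantor_point_itv : 0 <= cantor_point <= 1.
Proof. by have := T_itv 0; rewrite /T big_ord0 expr0 add0r. Qed.

(** [3 ^ k] times the first [k] terms of the series is an even integer, lost by periodicity. The
    rest lies in the third from [2 b / 3] to [2 b / 3 + 1 / 3], with [b] the k-th digit, where
    [zigzag] is constantly [b]. *)
Lemma zigzag_cantor_point k : zigzag (3 ^+ k * cantor_point) = (b k)%:R.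
Proof.
have [n nE] := Tn k.
have p : 0 < 3 ^+ k :> R by rewrite exprn_gt0.
have -> : 3 ^+ k * cantor_point = 2 * n%:R + 3 ^+ k * (cantor_point - T k).
  by rewrite -nE; ring.
rewrite zigzag_periodic; set s := _ * _.
have : 2 * (b k)%:R / 3 <= s <= 2 * (b k)%:R / 3 + 3^-1.
  have := T_itv k.+1; rewrite /T big_ord_recr/= -/(T k) => /andP[t1 t2].
  have e : 3 ^+ k * 3^-1 ^+ k.+1 = 3^-1 :> R.
    by rewrite exprS mulrCA -exprMn mulfV ?expr1n ?mulr1.
  apply/andP; split.
    rewrite -[leLHS](_ : 3 ^+ k * (2 * (b k)%:R * 3^-1 ^+ k.+1) = _).
      by rewrite ler_pM2l// lerBrDl.
    by rewrite mulrCA e.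
  rewrite -[leRHS](_ : 3 ^+ k * (2 * (b k)%:R * 3^-1 ^+ k.+1 + 3^-1 ^+ k.+1) = _).
    by rewrite ler_pM2l// lerBlDl addrA.
  by rewrite mulrDr e mulrCA e.
case: (b k) => /= sb; first by apply: zigzag1; lra.
by apply: zigzag0; lra.
Qed.

End digits.

Definition halves : nat -> R := fun k => 2^-1 ^+ k.

Lemma halves_cvg : halves @ \oo --> 0.
Proof. by apply: cvg_expr; rewrite ger0_norm ?invr_ge0// invf_lt1// ltr1n. Qed.

Let h0 k : 0 < halves k.
Proof. by rewrite exprn_gt0// invr_gt0. Qed.

Let hS k : halves k.+1 = halves k / 2.
Proof. by rewrite /halves exprS mulrC. Qed.

Definition binary_sum (b : nat -> R) (k : nat) : R :=
  \sum_(j < k) b j * halves j.+1.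

Lemma binary_sum_itv (b : nat -> R) : (forall j, 0 <= b j <= 1) ->
  forall k, binary_sum b k <= sup (range (binary_sum b)) <= binary_sum b k + halves k.
Proof.
move=> b01; apply: nested_limit => k.
- rewrite /binary_sum big_ord_recr/= lerDl mulr_ge0 ?(ltW (h0 _))//.
  by have /andP[] := b01 k.
- rewrite /binary_sum big_ord_recr/= hS; have := b01 k; have := h0 k; nra.
- exact: ltW.
Qed.

(** Digits of the doubling map. The remainder [r] stays in the closed interval [0, 1], so 1 is
    included, with all digits equal to 1. *)
Lemma binary_expansion (y : R) : 0 <= y <= 1 ->
  exists b : nat -> bool, forall k,
    binary_sum (fun j => (b j)%:R) k <= y <= binary_sum (fun j => (b j)%:R) k + halves k.
Proof.
move=> y01.
pose r := fix r k : R := if k is k'.+1 then 2 * r k' - (2^-1 <= r k')%R%:R else y.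
have r01 k : 0 <= r k <= 1.
  elim: k => //= k IH; have [] := leP 2^-1 (r k) => /= h; lra.
exists (fun j => 2^-1 <= r j) => k.
suff -> : y = binary_sum (fun j => (2^-1 <= r j)%R%:R) k + r k * halves k.
  have := r01 k; have := h0 k; nra.
elim: k => [|k IH]; first by rewrite /binary_sum big_ord0 add0r /halves expr0 mulr1.
rewrite {1}IH /binary_sum big_ord_recr/= -addrA; congr (_ + _).
by rewrite hS; field.
Qed.

Variable N : nat.
Hypothesis N_gt0 : (0 < N)%N.

(** The digit of index [j N + i] of the parameter serves as the j-th binary digit of coordinate [i]:
    the digits of the [N] coordinates are interleaved. *)
Definition curve_coord (i : nat) (t : R) : R :=
  sup (range (binary_sum (fun j => zigzag (3 ^+ (j * N + i) * t)))).

Lemma curve_coord_continuous i : continuous (curve_coord i).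
Proof.
move=> t; apply/cvgrPdist_lt => e e0.
have [k ke] : exists k, halves k < e / 3.
  have /cvgrPdist_lt/(_ (e / 3)) := halves_cvg.
  have e3 : 0 < e / 3 by rewrite divr_gt0.
  move=> /(_ e3)[k _ /(_ k (leqnn k))]; rewrite sub0r normrN ger0_norm ?(ltW (h0 _))//.
  by exists k.
pose P s := binary_sum (fun j => zigzag (3 ^+ (j * N + i) * s)) k.
have cP : {for t, continuous P}.
  apply: (@cvg_big R _ +%R 0 xpredT) => [|j _]; first exact: add_continuous.
  have cz : {for t, continuous (zigzag \o (fun s => 3 ^+ (j * N + i) * s))}.
    apply: continuous_comp; last exact: zigzag_continuous.
    by apply: cvgM; [exact: cvg_cst|exact: cvg_id].
  by apply: cvgM; [exact: cz|exact: cvg_cst].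
near=> s.
have : `|P t - P s| < e / 3.
  by near: s; apply: cvgr_dist_lt => //; rewrite divr_gt0.
have := @binary_sum_itv (fun j => zigzag (3 ^+ (j * N + i) * t)) (fun j => zigzag_itv _) k.
have := @binary_sum_itv (fun j => zigzag (3 ^+ (j * N + i) * s)) (fun j => zigzag_itv _) k.
rewrite -/(P s) -/(P t) -/(curve_coord i s) -/(curve_coord i t) !ltr_norml; lra.
Unshelve. all: by end_near. Qed.

Definition curve (t : R) : 'rV[R]_N := \row_i curve_coord i t.

Lemma curve_continuous : continuous curve.
Proof.
apply: continuous_rV => i.
have -> : (fun t => curve t ord0 i) = curve_coord i by apply/funext => s; rewrite mxE.
exact: curve_coord_continuous.
Qed.

Lemma curve_surj (y : 'rV[R]_N) : (forall i, 0 <= y ord0 i <= 1) ->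
  exists2 t, 0 <= t <= 1 & curve t = y.
Proof.
move=> y01; have [b bP] := choice (fun i => binary_expansion (y01 i)).
pose beta k := b (Ordinal (ltn_pmod k N_gt0)) (k %/ N)%N.
exists (cantor_point beta); first exact: cantor_point_itv.
apply/rowP => i; rewrite mxE.
apply: (squeeze_unique halves_cvg _ (bP i)) => k.
have := @binary_sum_itv (fun j => zigzag (3 ^+ (j * N + i) * cantor_point beta))
  (fun j => zigzag_itv _) k.
rewrite -/(curve_coord i (cantor_point beta)).
suff -> : binary_sum (fun j => zigzag (3 ^+ (j * N + i) * cantor_point beta)) k =
          binary_sum (fun j => (b i j)%:R) k by [].
apply: eq_bigr => j _; rewrite zigzag_cantor_point /beta.
rewrite divnMDl// (divn_small (ltn_ord i)) addn0.
by congr ((b _ _)%:R * _); apply/val_inj; rewrite /= modnMDl modn_small.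
Qed.

Definition code_spec (y : 'rV[R]_N) (t : R) : Prop :=
  [/\ 0 <= t <= 1, curve t = y & forall s, 0 <= s <= 1 -> curve s = y -> t <= s].

(* the least parameter of a point, so that sublevel sets are compact *)
Definition code (y : 'rV[R]_N) : R := xget 0 [set t | code_spec y t].

Lemma codeP (y : 'rV[R]_N) : (forall i, 0 <= y ord0 i <= 1) -> code_spec y (code y).
Proof.
move=> y01; apply: xgetPex.
pose S := `[0, 1]%classic `&` curve @^-1` [set y].
have cS : compact S.
  apply: compact_closedI; first exact: segment_compact.
  apply: closed_comp => [t _|]; first exact: curve_continuous.
  exact: (accessible_closed_set1 (hausdorff_accessible (@norm_hausdorff _ _))).
have S0 : S !=set0.
  have [t t01 ty] := curve_surj y01; exists t; split; last exact: ty.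
  by rewrite /= in_itv.
have [|c] := @compact_EVT_min _ R id S S0 cS.
  by apply: continuous_subspaceT => t; exact: cvg_id.
rewrite inE => -[c01 cy] cmin; exists c; split; first by move: c01; rewrite /= in_itv.
  exact: cy.
move=> s s01 sy; apply: cmin; rewrite inE; split; last exact: sy.
by rewrite /= in_itv.
Qed.

(** By minimality, [code (u x) <= a] exactly when [u x] lies in the image by the curve of the
    parameters at most [a], a compact set. *)
Lemma code_measurable d (T : measurableType d) (u : T -> borel 'rV[R]_N) :
  measurable_fun setT u -> (forall x i, 0 <= (u x : 'rV[R]_N) ord0 i <= 1) ->
  measurable_fun setT (fun x => code (u x)).
Proof.
move=> mu u01; apply: (measurability _ (RGenOInfty.measurableE R)).
move=> _ [_ [a ->] <-].
have -> : setT `&` (fun x => code (u x)) @^-1` `]a, +oo[ =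
    setT `&` u @^-1` (~` (curve @` (`[0, 1]%classic `&` [set t | t <= a]))).
  rewrite !setTI; apply/seteqP; split=> [x /=|x /= nx].
    rewrite in_itv/= andbT => ax [t [/= t01 ta] tu].
    have [_ _ cmin] := codeP (u01 x).
    have : code (u x) <= t by apply: cmin => //; move: t01; rewrite in_itv.
    by move: ta ax; lra.
  rewrite in_itv/= andbT ltNge; apply/negP => ca; apply: nx.
  have [c01 cu _] := codeP (u01 x).
  by exists (code (u x)); [split; [rewrite /= in_itv|exact: ca]|exact: cu].
apply: mu => //; apply: borel_open; apply: closed_openC.
apply: compact_closed; first exact: norm_hausdorff.
apply: continuous_compact.
  by apply: continuous_subspaceT; exact: curve_continuous.
by apply: compact_closedI; [exact: segment_compact|exact: closed_le].
Qed.

End schoenberg_curve.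

(** * Finite measures and disintegration through conditional quantiles *)

Section finite_measure_of.
Context d (T : measurableType d) (R : realType) (m : {measure set T -> \bar R}).
Hypothesis m_fin : fin_num_fun m.

Let fm : set T -> \bar R := m.
HB.instance Definition _ := Measure.on fm.
HB.instance Definition _ := Measure_isFinite.Build _ _ _ fm m_fin.

Definition finite_measure_of : {finite_measure set T -> \bar R} := fm.

End finite_measure_of.

Lemma measure_fin_num_fun d (T : measurableType d) (R : realType)
    (m : {measure set T -> \bar R}) : (m setT < +oo)%E -> fin_num_fun m.
Proof.
move=> moo A mA; rewrite ge0_fin_numE//; apply: le_lt_trans moo.
by apply: le_measure => //; rewrite inE.
Qed.

Section rational_sequences.
Context (R : realType).

(** The running maximum of 0 and of the rationals below [r], in the order of their codes. It
    exhibits the open half-line below [r] as an increasing union of rational closed ones. *)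
Lemma rat_seq_below (r : R) : 0 < r -> exists q : nat -> rat,
  [/\ forall k, 0 <= q k, forall k, ratr (q k) < r, {homo q : i j / (i <= j)%N >-> i <= j} &
      forall p : rat, ratr p < r -> exists k, p <= q k].
Proof.
move=> r0.
pose q := fix q k : rat := if k is k'.+1 then
  (if unpickle k' is Some p then (if (ratr p < r) && (q k' < p) then p else q k') else q k')
  else 0.
have qS k : q k <= q k.+1.
  rewrite /=; case: unpickle => // p; case: ifP => // /andP[_ qp]; exact: ltW.
have qnd : {homo q : i j / (i <= j)%N >-> i <= j}.
  by apply: homo_leq => // x y z; exact: le_trans.
exists q; split => //.
- by move=> k; exact: (qnd 0%N k).
- elim=> [|k IH] /=; first by rewrite rmorph0.
  by case: unpickle => // p; case: ifP => // /andP[].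
- move=> p pr; exists (pickle p).+1 => /=; rewrite pickleK pr/=.
  by case: ifP => // /negbT; rewrite -leNgt.
Qed.

End rational_sequences.

Lemma ge0_indic (R : realType) (T : Type) (A : set T) (x : T) : 0 <= \1_A x :> R.
Proof. by rewrite indicE. Qed.

Section disintegration.
Context (R : realType) d (T : measurableType d).
Local Open Scope ereal_scope.

(** The hypothesis is tested on the set where [g < f] itself: there [f - g] is positive with
    integral 0. *)
Lemma ae_le_integral (m : {measure set T -> \bar R}) (f g : T -> \bar R) :
  (forall x, f x \is a fin_num) -> (forall x, g x \is a fin_num) ->
  m.-integrable setT f -> m.-integrable setT g ->
  (forall A, measurable A -> \int[m]_(x in A) f x <= \int[m]_(x in A) g x) ->
  measurable [set x | g x < f x] /\ m [set x | g x < f x] = 0.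
Proof.
move=> ffin gfin If Ig fg; set A := [set x | g x < f x].
have mf := measurable_int _ If; have mg := measurable_int _ Ig.
have mA : measurable A.
  by rewrite -[A]setTI; exact: emeasurable_fun_lt.
split => //.
have IfA := integrableS measurableT mA (@subsetT _ A) If.
have IgA := integrableS measurableT mA (@subsetT _ A) Ig.
have I0 : \int[m]_(x in A) `|f x - g x| = 0.
  apply/eqP; rewrite eq_le integral_ge0// andbT.
  rewrite (eq_integral (fun x => (f \- g) x)); last first.
    by move=> x; rewrite inE => gfx; rewrite gee0_abs// sube_ge0 ?ltW// gfin.
  by rewrite integralB// sube_le0// fg.
have mfg : measurable_fun A (f \- g).
  by apply: emeasurable_funB; [exact: measurable_int IfA|exact: measurable_int IgA].
have [N [mN N0 AN]] := (ae_eq_integral_abs m mA mfg).1 I0.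
apply/eqP; rewrite eq_le measure_ge0 andbT -N0.
apply: le_measure; rewrite ?inE// => x Ax; apply: AN => /= /(_ Ax) /eqP.
by rewrite sube_eq ?fin_num_adde_defl// add0e gt_eqF.
Qed.

(** Radon-Nikodym gives conditional distribution functions at rational points; [Q (x, .)] is their
    generalised inverse and pushes Lebesgue measure on [0, 1[ to the conditional law. The identity
    is checked on sets [A] times an open half-line, then extended by uniqueness of measures to
    rectangles and to all measurable sets. *)
Lemma disintegration (M : {measure set (T * R)%type -> \bar R})
    (m : {measure set T -> \bar R}) :
  m setT < +oo ->
  (forall A, measurable A -> M (A `*` setT) = m A) ->
  M (setT `*` ~` `[0%R, 1%R]%classic) = 0 ->
  exists Q : T * R -> R, measurable_fun setT Q /\
    forall G : T * R -> \bar R, nnmeasurable G ->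
      \int[M]_p G p =
      \int[m]_x \int[lebesgue_measure]_u (G (x, Q (x, u)) * (unit_weight u)%:E).
Proof.
move=> moo Mm Msupp.
have fin : fin_num_fun m by exact: measure_fin_num_fun.
pose mf := finite_measure_of fin.
have Mle (A : set T) (B : set R) : measurable A -> measurable B -> M (A `*` B) <= m A.
  move=> mA mB; rewrite -Mm//; apply: le_measure; rewrite ?inE; first exact: measurableX.
    exact: measurableX.
  by move=> [x y] [].
have exf (q : rat) : exists f : T -> \bar R, [/\ forall x, 0 <= f x,
    forall x, f x \is a fin_num, m.-integrable setT f &
    forall A, measurable A -> M (A `*` `]-oo, ratr q]%classic) = \int[m]_(x in A) f x].
  have mI : measurable (`]-oo, ratr q]%classic : set R) by [].
  have [N NE] := @image_density R _ _ _ _ M (fun p : T * R => p.1)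
    (fun p : T * R => \1_(`]-oo, ratr q]%classic) p.2 : R) measurable_fst
    (measurableT_comp (measurable_indic mI) measurable_snd)
    (fun p => ge0_indic _ _ _).
  have NA A : measurable A -> N A = M (A `*` `]-oo, ratr q]%classic).
    move=> mA; have := NE _ (nnmeasurable_indic R mA).
    rewrite integral_indic// setIT => ->.
    rewrite -[RHS](_ : \int[M]_p (\1_(A `*` `]-oo, ratr q]%classic) p)%:E = _); last first.
      by rewrite integral_indic ?setIT//; exact: measurableX.
    apply: eq_integral => -[x y] _; rewrite -EFinM !indicE in_setX/=.
    by case: (x \in A); case: (y \in _); rewrite /= ?mulr1 ?mulr0 ?mul0r.
  have Nfin : fin_num_fun N.
    move=> A mA; rewrite NA// ge0_fin_numE//; apply: le_lt_trans (Mle _ _ mA mI) _.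
    by have := fin A mA; rewrite ge0_fin_numE.
  pose Nf := finite_measure_of Nfin.
  have [|f [f0 ffin If fE]] := @radon_nikodym_sigma_finite _ T R mf Nf.
    apply/null_content_dominatesP => A mA mA0.
    apply/eqP; rewrite eq_le measure_ge0 andbT -mA0 [leLHS]NA//; exact: Mle.
  by exists f; split => // A mA; rewrite -NA// -fE.
have [f fP] := choice exf.
have f0 q x : 0 <= f q x by have [] := fP q.
have ffin q x : f q x \is a fin_num by have [] := fP q.
have If q : m.-integrable setT (f q) by have [] := fP q.
have mfq q : measurable_fun setT (f q) by exact: measurable_int (If q).
have fE q A : measurable A -> M (A `*` `]-oo, ratr q]%classic) = \int[m]_(x in A) f q x.
  by have [_ _ _] := fP q; exact.
have fmono p q : (p <= q)%R ->
    measurable [set x | f q x < f p x] /\ m [set x | f q x < f p x] = 0.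
  move=> pq; apply: ae_le_integral => // A mA; rewrite -!fE//.
  apply: le_measure; rewrite ?inE; [exact: measurableX|exact: measurableX|].
  move=> [x y] [/= Ax]; rewrite !in_itv/= => yp; split => //=.
  by rewrite ?in_itv/= (le_trans yp)// ler_rat.
have fle1 q : measurable [set x | 1 < f q x] /\ m [set x | 1 < f q x] = 0.
  apply: (@ae_le_integral m (f q) (cst 1)) => //.
    by have /= := finite_measure_integrable_cst mf 1%R measurableT.
  by move=> A mA; rewrite -fE// integral_cst// mul1e; exact: Mle.
(* Where monotonicity in the rational parameter or the bound 1 fails. There are countably many
   pairs, so the union is null. *)
pose bad (pq : rat * rat) : set T :=
  (if (pq.1 <= pq.2)%R then [set x | f pq.2 x < f pq.1 x] else set0) `|`
  [set x | 1 < f pq.1 x].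
have mbad pq : measurable (bad pq).
  apply: measurableU; last exact: (fle1 _).1.
  by case: ifP => // /fmono[].
pose Bad := \bigcup_pq bad pq.
have mBad : measurable Bad by exact: countable_bigcupT_measurable.
have Bad0 : m Bad = 0.
  have badN pq : m.-negligible (bad pq).
    apply: negligibleU.
      case: ifP => [pq12|_]; last exact: negligible_set0.
      by have [mb b0] := fmono _ _ pq12; exact/negligibleP.
    by have [mb b0] := fle1 pq.1; exact/negligibleP.
  have : m.-negligible (\bigcup_k (if unpickle k is Some pq then bad pq else set0)).
    by apply: negligible_bigcup => k; case: unpickle => // ; exact: negligible_set0.
  rewrite (_ : \bigcup_k _ = Bad); first by move/negligibleP; exact.
  apply/seteqP; split => [x [k _]|x [pq _ bx]].
    by case: unpickle => // pq bx; exists pq.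
  by exists (pickle pq); [exact: Logic.I|rewrite pickleK].
(* On the null set the constant 1 keeps [g] monotone in [q] with values in [0, 1] at every point. *)
pose g (q : rat) (x : T) : R := if pselect (Bad x) then 1%R else fine (f q x).
have g01 q x : (0 <= g q x <= 1)%R.
  rewrite /g; case: pselect => [_|nB] /=; first by rewrite ler01 lexx.
  rewrite fine_ge0//= -lee_fin fineK// leNgt; apply/negP => f1; apply: nB.
  by exists (q, q) => //; right.
have gmono p q x : (p <= q)%R -> (g p x <= g q x)%R.
  move=> pq; rewrite /g; case: pselect => //= nB; rewrite fine_le//.
  rewrite leNgt; apply/negP => fpq; apply: nB; exists (p, q) => //; left.
  by rewrite /= pq.
have mg q : measurable_fun setT (g q).
  rewrite (_ : g q = fun x => \1_Bad x + \1_(~` Bad) x * fine (f q x))%R.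
    apply: measurable_funD; first exact: measurable_indic.
    apply: measurable_funM; first exact: measurable_indic (measurableC mBad).
    by apply: measurableT_comp => //; exact: mfq.
  apply/funext => x; rewrite /g !indicE in_setC; case: pselect => Bx /=.
    by rewrite mem_set//= mul0r addr0.
  by rewrite memNset//= mul1r add0r.
have gE q A : measurable A -> \int[m]_(x in A) (g q x)%:E = M (A `*` `]-oo, ratr q]%classic).
  move=> mA; rewrite fE//; apply: ae_eq_integral => //.
  - exact/measurable_EFinP/measurable_funTS.
  - exact: measurable_funTS.
  - exists Bad; split => // x /= /not_implyP[_]; rewrite /g; case: pselect => //= nB.
    by rewrite fineK.
(* Adjoining 1 makes the set nonempty and its infimum at most 1; keeping only [q >= 0] makes it
   nonnegative. *)
pose S x u := [set r : R | r = 1%R \/ exists2 q : rat, (0 <= q)%R & (u <= g q x)%R /\ r = ratr q].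
pose Q (p : T * R) : R := inf (S p.1 p.2).
have Sne x u : S x u !=set0 by exists 1%R; left.
have Slb x u : lbound (S x u) 0%R.
  by move=> r [->|[q q0 [_ ->]]]; rewrite ?ler01 ?ler0q.
have Sinf x u : has_inf (S x u) by split => //; exists 0%R; exact: Slb.
have Q_ge0 p : (0 <= Q p)%R by apply: lb_le_inf => //; exact: Slb.
have Q_le1 p : (Q p <= 1)%R by apply: ge_inf; [exists 0%R; exact: Slb|left].
(* The strict inequality turns [Q < r] into a countable union over rationals, whence the half-lines
   open at [r] in the rest of the proof. *)
have Qlt x u r : (0 < r <= 1)%R -> (Q (x, u) < r)%R <->
    exists2 q : rat, (0 <= q)%R /\ (ratr q < r)%R & (u <= g q x)%R.
  move=> /andP[r0 r1]; split.
    move=> Qr; have rQ : (0 < r - Q (x, u))%R by rewrite subr_gt0.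
    have [s Ss] := inf_adherent rQ (Sinf x u).
    rewrite -/(Q (x, u)) addrCA subrr addr0 => sr.
    case: Ss sr => [->|[q q0 [uq ->]] qr]; first by move=> /lt_le_trans/(_ r1); rewrite ltxx.
    by exists q.
  move=> [q [q0 qr] uq]; apply: le_lt_trans qr; apply: ge_inf; first by exists 0%R; exact: Slb.
  by right; exists q.
have mug q : measurable [set p : T * R | (p.2 <= g q p.1)%R].
  rewrite -[X in measurable X]setTI.
  have m2 : measurable_fun setT (fun p : T * R => p.2) := measurable_snd.
  have m1 : measurable_fun setT (fun p : T * R => g q p.1).
    exact: (measurableT_comp (mg q) measurable_fst).
  exact: measurable_fun_le.
have mQ : measurable_fun setT Q.
  apply: (measurability _ (RGenInftyO.measurableE R)) => _ [_ [r ->] <-]; rewrite setTI.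
  have [r0|r0] := leP r 0%R.
    rewrite (_ : _ @^-1` _ = set0)//; apply/seteqP; split => // p /=; rewrite in_itv/=.
    by move=> /lt_le_trans/(_ r0); rewrite ltNge Q_ge0.
  have [r1|r1] := leP r 1%R; last first.
    rewrite (_ : _ @^-1` _ = setT)//; apply/seteqP; split => // p _ /=; rewrite in_itv/=.
    exact: le_lt_trans (Q_le1 p) r1.
  rewrite (_ : _ @^-1` _ = \bigcup_(q : rat)
      (if (0 <= q)%R && (ratr q < r)%R then [set p : T * R | (p.2 <= g q p.1)%R] else set0)).
    by apply: countable_bigcupT_measurable => // q; case: ifP.
  have r01 : (0 < r <= 1)%R by rewrite r0.
  apply/seteqP; split => [[x u] /=|[x u] [q _]].
    rewrite in_itv/= => /(Qlt _ _ _ r01)[q [q0 qr] uq].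
    by exists q => //; rewrite q0 qr.
  case: ifP => // /andP[q0 qr] /= uq; rewrite in_itv/=; apply/(Qlt _ _ _ r01).
  by exists q.
exists Q; split => //.
pose TR := (T * measurableTypeR R)%type.
pose P : {measure set TR -> \bar R} := (mf \x @lebesgue_measure R)%E.
have mPsi : measurable_fun setT (fun p : TR => (p.1, Q p) : T * R).
  apply: measurable_fun_pair; first exact: measurable_fst.
  exact: mQ.
have mw : measurable_fun setT (fun p : TR => unit_weight p.2).
  exact: (measurableT_comp (@unit_weight_measurable R) measurable_snd).
have [Mq MqE] := @image_density R _ _ TR (T * R)%type P _ _ mPsi mw
  (fun p => unit_weight_ge0 p.2).
have MqI G : nnmeasurable G -> \int[Mq]_p G p =
    \int[m]_x \int[lebesgue_measure]_u (G (x, Q (x, u)) * (unit_weight u)%:E).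
  move=> nG; rewrite MqE//.
  have [mH H0] : nnmeasurable (fun p : TR => G (p.1, Q p) * (unit_weight p.2)%:E).
    apply: nnmeasurableM; first exact: (nnmeasurable_comp mPsi nG).
    by apply: nnmeasurable_EFin => // p; exact: unit_weight_ge0.
  by rewrite (fubini_tonelli1 _ mH).
move=> G nG; rewrite -MqI//.
apply: eq_measure_integral => B mB _; move: B mB.
have MqA (A : set T) (B : set R) : measurable A -> measurable B ->
    Mq (A `*` B) = P [set p | A p.1 /\ B (Q p) /\ (0 <= p.2 < 1)%R].
  move=> mA mB; have mAB : measurable (A `*` B) by exact: measurableX.
  have := MqE _ (nnmeasurable_indic R mAB).
  rewrite integral_indic// setIT => ->.
  set S' := [set p | _].
  have mS' : measurable S'.
    have -> : S' = ((fun p : TR => (p.1, Q p) : T * R) @^-1` (A `*` B)) `&`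
                (snd @^-1` `[0%R, 1%R[%classic).
      apply/seteqP; split => p /=; rewrite in_itv/=.
        by move=> [? [? ?]].
      by move=> [[? ?] ?].
    apply: measurableI.
      by rewrite -[X in measurable X]setTI; exact: mPsi.
    rewrite -[X in measurable X]setTI.
    exact: (@measurable_snd _ _ T (measurableTypeR R)).
  rewrite -[RHS](_ : \int[P]_p (\1_S' p)%:E = _); last first.
    by rewrite integral_indic ?setIT.
  apply: eq_integral => p _; rewrite -EFinM; congr EFin.
  rewrite !indicE /unit_weight -natrM mulnb; congr (_%:R); congr nat_of_bool.
  apply/idP/idP; rewrite !inE.
    by move=> /andP[]; rewrite inE => -[/= ? ?] ?; split.
  by move=> [? [? p2]]; apply/andP; split => //; rewrite inE.
have rect (A : set T) (r : R) : measurable A ->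
    M (A `*` `]-oo, r[%classic) = Mq (A `*` `]-oo, r[%classic).
  move=> mA.
  (* The section at [x] is [0, q x] if [q x < 1], but the half-open [0, 1[ if [q x = 1]; both have
     length [q x]. *)
  have unitP (q : T -> R) (mq : measurable_fun setT q) : (forall x, 0 <= q x <= 1)%R ->
      P [set p | A p.1 /\ (p.2 <= q p.1)%R /\ (0 <= p.2 < 1)%R] = \int[m]_(x in A) (q x)%:E.
    move=> q01; rewrite /P/= /product_measure1 [RHS]integral_mkcond.
    apply: eq_integral => x _ /=; rewrite patchE.
    case: ifPn => [|xA]; last first.
      rewrite (_ : xsection _ _ = set0) ?measure0//; apply/seteqP; split => // u.
      by rewrite /xsection/= inE => -[/= Ax]; move: xA; rewrite notin_setE.
    rewrite inE => Ax; have /andP[q0 q1] := q01 x.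
    have [q1'|q1'] := ltP (q x) 1%R.
      rewrite (_ : xsection _ _ = `[0%R, q x]%classic).
        rewrite [LHS]lebesgue_measure_itv/= lte_fin.
        case: ifP => [_|/negbT]; first by rewrite oppr0 adde0.
        by rewrite -leNgt => qx0; congr EFin; apply/eqP; rewrite eq_le q0 qx0.
      apply/seteqP; split => u; rewrite /xsection/= inE in_itv/=.
        by move=> [_ /= [uq /andP[-> _]]].
      by move=> /andP[u0 uq]; split => //=; split => //; rewrite u0 (le_lt_trans uq).
    have -> : q x = 1%R by apply/eqP; rewrite eq_le q1.
    rewrite (_ : xsection _ _ = `[0%R, 1%R[%classic).
      by rewrite [LHS]lebesgue_measure_itv/= lte_fin ltr01 oppr0 adde0.
    apply/seteqP; split => u; rewrite /xsection/= inE in_itv/=.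
      by move=> [_ /= [_ ->]].
    move=> u01; split => //=; split => //; apply: le_trans q1'.
    by have /andP[_ /ltW] := u01.
  rewrite MqA//.
  have [r0|r0] := leP r 0%R.
    set S0 := (X in P X); have -> : S0 = set0.
      apply/seteqP; split; last exact: sub0set.
      move=> p [_ [Qr _]]; move: Qr; rewrite /= in_itv/=.
      by move=> /lt_le_trans/(_ r0); rewrite ltNge Q_ge0.
    rewrite measure0; apply/eqP; rewrite eq_le measure_ge0 andbT -Msupp.
    apply: le_measure; rewrite ?inE; [exact: measurableX| |].
      by apply: measurableX => //; exact: measurableC.
    move=> [x y] [/= Ax]; rewrite !in_itv/= => yr; split => //=.
    rewrite ?in_itv/= => /andP[y0 _].
    by move: (lt_le_trans (le_lt_trans y0 yr) r0); rewrite ltxx.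
  have [r1|r1] := leP r 1%R; last first.
    set S0 := (X in P X).
    have -> : S0 = [set p : TR | A p.1 /\ (p.2 <= 1)%R /\ (0 <= p.2 < 1)%R].
      apply/seteqP; split => p [Ap [h p01]]; split => //; split => //.
        by have /andP[_ /ltW] := p01.
      by rewrite /= in_itv/= (le_lt_trans (Q_le1 p)).
    rewrite (unitP (cst 1%R))//; last by move=> x; rewrite ler01 lexx.
    have -> : \int[m]_(x in A) (cst 1%R x)%:E = m A by rewrite -[RHS]mul1e -integral_cst.
    rewrite -Mm//.
    have -> : A `*` setT = (A `*` `]-oo, r[%classic) `|` (A `*` `[r, +oo[%classic).
      apply/seteqP; split => [[x y] [/= Ax _]|[x y] [|] [/= Ax _]]; [|by split|by split].
      have [yr|ry] := ltP y r; [left|right]; split => //=; by rewrite in_itv/= ?ry.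
    rewrite measureU//; [|exact: measurableX|exact: measurableX|]; last first.
      apply/seteqP; split => // -[x y] [[/= _]] + [/= _]; rewrite !in_itv/=.
      by rewrite andbT => yr ry; move: (lt_le_trans yr ry); rewrite ltxx.
    rewrite [X in _ + X](_ : _ = 0) ?adde0//.
    apply/eqP; rewrite eq_le measure_ge0 andbT -Msupp.
    apply: le_measure; rewrite ?inE; [exact: measurableX| |].
      by apply: measurableX => //; exact: measurableC.
    move=> [x y] [/= Ax]; rewrite !in_itv/= andbT => ry; split => //=.
    rewrite ?in_itv/= => /andP[_ y1].
    by move: (lt_le_trans r1 (le_trans ry y1)); rewrite ltxx.
  (* Both sides are increasing limits along rationals below [r], and for those the values agree
     because [g (q k)] is a density. *)
  have [q [q0 qr qnd qsup]] := rat_seq_below r0.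
  have cvgM : M (A `*` `]-oo, ratr (q k)]%classic) @[k --> \oo] --> M (A `*` `]-oo, r[%classic).
    have -> : A `*` `]-oo, r[%classic = \bigcup_k (A `*` `]-oo, ratr (q k)]%classic).
      apply/seteqP; split => [[x y] [/= Ax]|[x y] [k _ [/= Ax]]]; rewrite in_itv/=.
        move=> yr; have [p] := rat_in_itvoo yr; rewrite in_itv/= => /andP[yp pr].
        have [k pk] := qsup p pr; exists k => //; split => //=.
        by rewrite in_itv/= (le_trans (ltW yp))// ler_rat.
      by move=> yq; split => //=; rewrite in_itv/= (le_lt_trans yq).
    apply: nondecreasing_cvg_mu.
    - by move=> k; exact: measurableX.
    - by apply: bigcupT_measurable => k; exact: measurableX.
    - move=> i j ij; apply/subsetPset => -[x y] [/= Ax]; rewrite in_itv/= => yq.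
      by split => //=; rewrite in_itv/= (le_trans yq)// ler_rat qnd.
  pose Sk k : set TR := [set p : TR | A p.1 /\ (p.2 <= g (q k) p.1)%R /\ (0 <= p.2 < 1)%R].
  have mSk k : measurable (Sk k).
    have -> : Sk k = (fst @^-1` A) `&` ([set p : TR | (p.2 <= g (q k) p.1)%R] `&`
                (snd @^-1` `[0%R, 1%R[%classic)).
      by apply/seteqP; split => p /=; rewrite in_itv/=.
    apply: measurableI.
      by rewrite -[X in measurable X]setTI; exact: (@measurable_fst _ _ T (measurableTypeR R)).
    apply: measurableI; first exact: mug.
    by rewrite -[X in measurable X]setTI; exact: (@measurable_snd _ _ T (measurableTypeR R)).
  have cvgP : P (Sk k) @[k --> \oo] -->
      P [set p | A p.1 /\ `]-oo, r[%classic (Q p) /\ (0 <= p.2 < 1)%R].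
    have -> : [set p : TR | A p.1 /\ `]-oo, r[%classic (Q p) /\ (0 <= p.2 < 1)%R] = \bigcup_k Sk k.
      have r01 : (0 < r <= 1)%R by rewrite r0.
      apply/seteqP; split => [[x u] [/= Ax [Qr u01]]|[x u] [k _ [/= Ax [ug u01]]]].
        move: Qr; rewrite in_itv/= => /(Qlt _ _ _ r01)[p [p0 pr] up].
        have [k pk] := qsup p pr; exists k => //; split => //=; split => //.
        by rewrite (le_trans up)// gmono.
      by split => //=; split => //; rewrite in_itv/=; apply/(Qlt _ _ _ r01); exists (q k).
    apply: nondecreasing_cvg_mu => //.
    - exact: bigcupT_measurable.
    - move=> i j ij; apply/subsetPset => -[x u] [/= Ax [ug u01]].
      by split => //=; split => //; rewrite (le_trans ug)// gmono// qnd.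
  apply: (cvg_unique _ cvgM) => //.
  suff -> : (fun k => M (A `*` `]-oo, ratr (q k)]%classic)) = (fun k => P (Sk k)) by exact: cvgP.
  by apply/funext => k; rewrite /Sk (unitP (g (q k)))// gE.
have rect' (A : set T) (B : set R) : measurable A -> measurable B -> M (A `*` B) = Mq (A `*` B).
  move=> mA mB.
  have mfst : measurable_fun setT (fun p : T * R => \1_A p.1 : R).
    exact: (measurableT_comp (measurable_indic mA) measurable_fst).
  have msnd : measurable_fun setT (fun p : T * R => p.2) by exact: measurable_snd.
  have sec (N : {measure set (T * R)%type -> \bar R}) :
      exists N' : {measure set R -> \bar R}, forall B, measurable B -> N' B = N (A `*` B).
    have [N' N'E] := image_density N msnd mfst (fun p => ge0_indic _ _ _).
    exists N' => C mC; have := N'E _ (nnmeasurable_indic R mC).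
    rewrite integral_indic// setIT => ->.
    rewrite -[RHS](_ : \int[N]_p (\1_(A `*` C) p)%:E = _); last first.
      by rewrite integral_indic ?setIT//; exact: measurableX.
    apply: eq_integral => -[x y] _; rewrite -EFinM !indicE in_setX/=.
    by case: (x \in A); case: (y \in _); rewrite /= ?mulr1 ?mulr0 ?mul0r.
  have [N1 N1E] := sec M; have [N2 N2E] := sec Mq.
  rewrite -N1E// -N2E//.
  apply: (@measure_unique _ R R (@RGenInftyO.G R) (fun n => `]-oo, n%:R[%classic)) => //.
  - exact: RGenInftyO.measurableE.
  - move=> _ _ [a ->] [b ->]; exists (Num.min a b).
    by apply/seteqP; split => y /=; rewrite !in_itv/= lt_min => /andP.
  - by move=> n; exists n%:R.
  - apply/seteqP; split => // y _; exists (Num.truncn `|y|%R).+1 => //=.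
    by rewrite in_itv/= (le_lt_trans (ler_norm y))// truncnS_gt.
  - by move=> _ [a ->]; rewrite N1E// N2E// rect.
  - move=> n; rewrite N1E//; apply: le_lt_trans (Mle _ _ mA _) _ => //.
    by have := fin A mA; rewrite ge0_fin_numE.
pose CC : set (set (T * R)) :=
  [set C | exists A, measurable A /\ exists B, measurable B /\ C = A `*` B].
move=> B mB.
apply: (@measure_unique _ R (T * R)%type CC (fun=> setT)) => //.
- rewrite measurable_prod_measurableType //; congr (<<s _ >>).
  rewrite predeqE; split => [[A mA [B' mB' <-]]|[A [mA [B' [mB' ->]]]]].
    by exists A; split => //; exists B'.
  by exists A => //; exists B'.
- move=> /= _ _ [X1 [mX1 [X2 [mX2 ->]]]] [Y1 [mY1 [Y2 [mY2 ->]]]].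
  rewrite -setXI; exists (X1 `&` Y1); split; first exact: measurableI.
  by exists (X2 `&` Y2); split => //; exact: measurableI.
- by move=> _; exists setT; split => //; exists setT; split => //; rewrite setXTT.
- by rewrite bigcup_const.
- by move=> _ [A [mA [B' [mB' ->]]]]; exact: rect'.
- by move=> _; rewrite -setXTT Mm.
Qed.

End disintegration.

(** * Total variation and bounds for the Lebesgue decomposition *)

Section raw_integral.
Context d (T : measurableType d) (R : realType).
Local Open Scope ereal_scope.
Import HBNNSimple.

(* [integral] only sees the values of a set function on measurable sets *)
Lemma eq_set_function_integral (m1 m2 : set T -> \bar R) D (f : T -> \bar R) :
  (forall A, measurable A -> m1 A = m2 A) ->
  \int[m1]_(x in D) f x = \int[m2]_(x in D) f x.
Proof.
move=> m12; rewrite /integral.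
have si (h : {nnsfun T >-> R}) : sintegral m1 h = sintegral m2 h.
  by rewrite /sintegral; apply: eq_fsbigr => r _; rewrite m12//; exact: measurable_funPTI.
by congr (ereal_sup _ - ereal_sup _); apply/seteqP; split => _ [h hf <-];
  exists h => //; rewrite si.
Qed.

End raw_integral.

Section variation.
Context (R : realType) (E : euclideanType R) disp (T : measurableType disp).
Variable mu : set T -> E.
Hypothesis mu_sigma : forall F : (set T)^nat, (forall i, measurable (F i)) ->
  trivIset setT F -> series (mu \o F) @ \oo --> mu (\bigcup_i F i).
Local Open Scope ereal_scope.
Local Notation v := (variation_measure mu).

Lemma vector_measure0 : mu set0 = 0%R.
Proof.
have := mu_sigma (F := fun=> set0) (fun=> measurable0) (@trivIset_set0 _ _ setT).
move=> /cvgP/cvg_series_cvg_0 h.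
have : (cst (mu set0) : nat -> E) @ \oo --> mu set0 by exact: cvg_cst.
by move=> /cvg_unique; apply => //; exact: norm_hausdorff.
Qed.

Let part2 (A B : set T) : measurable A -> measurable B -> A `&` B = set0 ->
  (forall i, measurable (bigcup2 A B i)) /\ trivIset setT (bigcup2 A B).
Proof.
move=> mA mB AB; split; first by case=> [|[|i]] //=.
by rewrite -trivIset_bigcup2.
Qed.

Lemma vector_measureU A B : measurable A -> measurable B -> A `&` B = set0 ->
  mu (A `|` B) = (mu A + mu B)%R.
Proof.
move=> mA mB AB; have [m2 t2] := part2 mA mB AB.
have := mu_sigma m2 t2; rewrite bigcup2E => h.
apply: (cvg_unique _ h); first exact: norm_hausdorff.
apply: cvg_near_cst; exists 2%N => // -[|[|n]]// _.
rewrite /series/= big_nat_recl// big_nat_recl//= big1 ?addr0// => i _.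
by rewrite vector_measure0.
Qed.

Definition is_partition (A : set T) (F : (set T)^nat) :=
  [/\ forall i, measurable (F i), trivIset setT F & \bigcup_i F i = A].

Lemma variation_ub A F : is_partition A F -> \sum_(0 <= i <oo) `|mu (F i)|%:E <= v A.
Proof. by move=> FA; apply: ereal_sup_ubound; exists F. Qed.

Lemma variation_norm A : measurable A -> `|mu A|%:E <= v A.
Proof.
move=> mA; have [m2 t2] := part2 mA measurable0 (setI0 A).
have := @variation_ub A (bigcup2 A set0).
rewrite /is_partition bigcup2E setU0 => /(_ (And3 m2 t2 erefl)); apply: le_trans.
apply: le_trans (nneseries_lim_ge 1 _) => //.
by rewrite big_nat1.
Qed.

Lemma variation_ge0 A : measurable A -> 0 <= v A.
Proof. by move=> /variation_norm; apply: le_trans; rewrite lee_fin. Qed.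

Lemma variation_set0 : v set0 = 0.
Proof.
apply/eqP; rewrite eq_le variation_ge0// andbT; apply: ge_ereal_sup => _ [F [mF tF FA] <-].
rewrite eseries0// => i _ _; have -> : F i = set0.
  by apply/seteqP; split => // x Fx; rewrite -FA; exists i.
by rewrite vector_measure0 normr0.
Qed.

(** A partition of [A] at even indices and one of [B] at odd indices form a partition of the union.
    If the right side is infinite there is nothing to prove; otherwise finiteness allows taking the
    two suprema one after the other. *)
Lemma variation_superadd A B : measurable A -> measurable B -> A `&` B = set0 ->
  v A + v B <= v (A `|` B).
Proof.
move=> mA mB AB.
have key F G : is_partition A F -> is_partition B G ->
    \sum_(0 <= i <oo) `|mu (F i)|%:E + \sum_(0 <= i <oo) `|mu (G i)|%:E <= v (A `|` B).
  move=> [mF tF FA] [mG tG GB].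
  pose H i := if odd i then G i./2 else F i./2.
  have HP : is_partition (A `|` B) H.
    split.
    - by move=> i; rewrite /H; case: ifP.
    - apply/trivIsetP => i j _ _ ij; rewrite /H.
      have FG k l : F k `&` G l = set0.
        by apply/seteqP; split => // x [Fx Gx]; rewrite -AB -FA -GB; split; [exists k|exists l].
      case: ifP => oi; case: ifP => oj; rewrite ?FG//; last 1 first.
      + move/trivIsetP : tF; apply => //; apply: contra ij => /eqP ij2.
        by rewrite -(odd_double_half i) -(odd_double_half j) oi oj ij2.
      + move/trivIsetP : tG; apply => //; apply: contra ij => /eqP ij2.
        by rewrite -(odd_double_half i) -(odd_double_half j) oi oj ij2.
      + by rewrite setIC FG.
    - apply/seteqP; split => [x [i _]|x [|]].
      + by rewrite /H; case: ifP => _ Hx; [right; rewrite -GB|left; rewrite -FA]; exists i./2.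
      + by rewrite -FA => -[i _ Fx]; exists i.*2 => //; rewrite /H odd_double doubleK.
      + rewrite -GB => -[i _ Gx]; exists i.*2.+1 => //.
        by rewrite /H /= odd_double/= uphalf_double.
  have Hsum n : \sum_(0 <= i < n.*2) `|mu (H i)|%:E =
      \sum_(0 <= i < n) `|mu (F i)|%:E + \sum_(0 <= i < n) `|mu (G i)|%:E.
    elim: n => [|n IH]; first by rewrite !big_geq// adde0.
    rewrite doubleS !big_nat_recr//= IH /H/= odd_double/= doubleK uphalf_double.
    by rewrite -addeA [RHS]addeACA.
  have F0 : cvgn (fun n => \sum_(0 <= i < n) `|mu (F i)|%:E).
    by apply: is_cvg_nneseries => i _ _; rewrite lee_fin.
  have G0 : cvgn (fun n => \sum_(0 <= i < n) `|mu (G i)|%:E).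
    by apply: is_cvg_nneseries => i _ _; rewrite lee_fin.
  rewrite -limeD//; last first.
    by rewrite ge0_adde_def// inE nneseries_ge0// => i _ _; rewrite lee_fin.
  apply: lime_le; first by apply: is_cvgeD => //; rewrite ge0_adde_def// inE nneseries_ge0// => i _ _; rewrite lee_fin.
  apply: nearW => n; rewrite -Hsum; apply: le_trans (variation_ub HP).
  by apply: nneseries_lim_ge => i _ _; rewrite lee_fin.
have [->|vAB] := eqVneq (v (A `|` B)) +oo; first exact: leey.
have vABf : v (A `|` B) \is a fin_num.
  by rewrite ge0_fin_numE ?variation_ge0//; [rewrite ltey|exact: measurableU].
have s0 F : 0 <= \sum_(0 <= i <oo) `|mu (F i)|%:E.
  by apply: nneseries_ge0 => i _ _; rewrite lee_fin.
have vB G : is_partition B G -> v A <= v (A `|` B) - \sum_(0 <= i <oo) `|mu (G i)|%:E.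
  move=> GB; apply: ge_ereal_sup => _ [F FA <-].
  have := key _ _ FA GB; move=> FG.
  rewrite leeBrDr//; rewrite ge0_fin_numE//.
  by apply: le_lt_trans (le_trans _ FG) _; [exact: leeDr|rewrite ltey].
have vA_fin : v A \is a fin_num.
  rewrite ge0_fin_numE ?variation_ge0//.
  have [m2 t2] := part2 mB measurable0 (setI0 B).
  have := vB (bigcup2 B set0); rewrite /is_partition bigcup2E setU0 => /(_ (And3 m2 t2 erefl)).
  move=> h; apply: le_lt_trans h _; apply: le_lt_trans (_ : _ <= v (A `|` B)) _; last by rewrite ltey.
  by rewrite geeDl// oppe_le0.
rewrite addeC -leeBrDr//; apply: ge_ereal_sup => _ [G GB <-].
have sG : \sum_(0 <= i <oo) `|mu (G i)|%:E \is a fin_num.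
  have [m2 t2] := part2 mA measurable0 (setI0 A).
  have := key (bigcup2 A set0) G; rewrite /is_partition bigcup2E setU0.
  move=> /(_ (And3 m2 t2 erefl) GB) FG.
  rewrite ge0_fin_numE//; apply: le_lt_trans (le_trans _ FG) _; [exact: leeDr|by rewrite ltey].
have := vB G GB; rewrite leeBrDr// => h.
by rewrite leeBrDr// addeC.
Qed.

Lemma variation_mono A B : measurable A -> measurable B -> A `<=` B -> v A <= v B.
Proof.
move=> mA mB AB; have mBA : measurable (B `\` A) by exact: measurableD.
have ABD : A `&` (B `\` A) = set0 by rewrite setIC setDKI.
have := variation_superadd mA mBA ABD; rewrite setDUK//.
by apply: le_trans; rewrite leeDl// variation_ge0.
Qed.

(** A partition [F] of the union is refined by the sets [A j]: each [mu (F i)] is bounded by the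
    series over its pieces, and the two series are exchanged. *)
Lemma variation_subadd (A : (set T)^nat) : (forall j, measurable (A j)) -> trivIset setT A ->
  v (\bigcup_j A j) <= \sum_(0 <= j <oo) v (A j).
Proof.
move=> mA tA; apply: ge_ereal_sup => _ [F [mF tF FA] <-].
apply: (@le_trans _ _ (\sum_(0 <= i <oo) \sum_(0 <= j <oo) `|mu (F i `&` A j)|%:E)).
  apply: lee_nneseries => [i _ _|i _]; first by rewrite lee_fin.
  have mFA j : measurable (F i `&` A j) by exact: measurableI.
  have tFA : trivIset setT (fun j => F i `&` A j) by exact: trivIset_setIl.
  have := mu_sigma mFA tFA; rewrite -setI_bigcupr -FA setIidl; last first.
    by move=> x Fx; exists i.
  move=> h; have {}h : (`|series (mu \o (fun j => F i `&` A j)) n| @[n --> \oo] --> `|mu (F i)|)%R.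
    exact: cvg_norm.
  have S0 : 0 <= \sum_(0 <= j <oo) `|mu (F i `&` A j)|%:E.
    by apply: nneseries_ge0 => j _ _; rewrite lee_fin.
  have bd n : (`|series (mu \o (fun j => F i `&` A j)) n|)%R%:E <= \sum_(0 <= j <oo) `|mu (F i `&` A j)|%:E.
    apply: (@le_trans _ _ (\sum_(0 <= j < n) `|mu (F i `&` A j)|%:E)).
      by rewrite sumEFin lee_fin /series/= ler_norm_sum.
    by apply: nneseries_lim_ge => j _ _; rewrite lee_fin.
  have [->|fin] := eqVneq (\sum_(0 <= j <oo) `|mu (F i `&` A j)|%:E) +oo; first exact: leey.
  have fin' : \sum_(0 <= j <oo) `|mu (F i `&` A j)|%:E \is a fin_num.
    by rewrite ge0_fin_numE// ltey.
  rewrite -(fineK fin') lee_fin; apply: (cvgr_to_le h); apply: nearW => n.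
  by rewrite -lee_fin fineK.
rewrite nneseries_interchange; last by move=> i j; rewrite lee_fin.
apply: lee_nneseries => [j _ _|j _].
  by apply: nneseries_ge0 => i _ _; rewrite lee_fin.
apply: (@variation_ub (A j) (fun i => F i `&` A j)); split.
- by move=> i; exact: measurableI.
- exact: trivIset_setIr.
- by rewrite -setI_bigcupl FA setIidr//; exact: bigcup_sup.
Qed.

Lemma variation_sigma_additive (A : (set T)^nat) :
  (forall j, measurable (A j)) -> trivIset setT A ->
  v (\bigcup_j A j) = \sum_(0 <= j <oo) v (A j).
Proof.
move=> mA tA; apply/eqP; rewrite eq_le variation_subadd//=.
apply: lime_le; first by apply: is_cvg_nneseries => j _ _; exact: variation_ge0.
apply: nearW => n.
have mU k : measurable (\big[setU/set0]_(j < k) A j) by exact: bigsetU_measurable.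
apply: (@le_trans _ _ (v (\big[setU/set0]_(j < n) A j))); last first.
  apply: variation_mono => //; first exact: bigcupT_measurable.
  by rewrite -bigcup_mkord; move=> x [i _ Ax]; exists i.
elim: n => [|n IH]; first by rewrite big_geq// big_ord0 variation_set0.
rewrite big_nat_recr//= big_ord_recr/=.
have dis : \big[setU/set0]_(j < n) A j `&` A n = set0.
  apply/seteqP; split; last exact: sub0set.
  rewrite -bigcup_mkord => x [[i /= ni Ai] An].
  by have := tA i n Logic.I Logic.I (ex_intro _ x (conj Ai An)) => ine; rewrite ine ltnn in ni.
by apply: le_trans (variation_superadd (mU n) (mA n) dis); exact: leeD2r.
Qed.

(** A nonmeasurable set has no measurable partition, so its variation is the supremum -oo of the
    empty set; [m] takes the value 0 there instead. *)
Lemma variation_is_measure : exists m : {measure set T -> \bar R},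
  forall A, measurable A -> m A = v A.
Proof.
pose m A := if pselect (measurable A) then v A else 0.
have mE A : measurable A -> m A = v A by rewrite /m; case: pselect.
have m0 : m set0 = 0 by rewrite mE// variation_set0.
have mge0 A : 0 <= m A by rewrite /m; case: pselect => // mA; exact: variation_ge0.
have msig : semi_sigma_additive m.
  move=> F mF tF mU; rewrite mE// variation_sigma_additive//.
  under eq_fun do under eq_bigr do rewrite mE//.
  by apply: is_cvg_nneseries => j _ _; exact: variation_ge0.
pose mm : {measure set T -> \bar R} := HB.pack m (isMeasure.Build _ _ _ m m0 mge0 msig).
by exists mm.
Qed.

End variation.

Section decomposition_bounds.
Context (R : realType) (E : euclideanType R).
Local Open Scope ereal_scope.
Local Notation dE := (\dim (fullv : {vspace E})).

Lemma coords_vector_integral d (T : measurableType d) (m : set T -> \bar R) A (g : T -> E) i :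
  coords (vector_integral m A g) ord0 i = fine (\int[m]_(x in A) (coords (g x) ord0 i)%:E).
Proof.
pose F j := fine (\int[m]_(x in A) (coord (vbasis (fullv : {vspace E})) j (g x))%:E).
have -> : vector_integral m A g = of_coords (\row_j F j).
  by apply: eq_bigr => j _; rewrite mxE.
by rewrite of_coordsK mxE /F; congr (fine (integral _ _ _)); apply/funext => x; rewrite mxE.
Qed.

Lemma norm_le_coords (z : E) :
  (`|z| <= \sum_(i < dE) `|(vbasis (fullv : {vspace E}))`_i| * `|coords z ord0 i|)%R.
Proof.
rewrite -{1}(coordsK z) /of_coords; apply: le_trans (ler_norm_sum _ _ _) _.
by apply: ler_sum => i _; rewrite normrZ mulrC.
Qed.

Lemma coord_le (z : E) (c : R) i : (`|coords z| <= c * `|z| -> `|coords z ord0 i| <= c * `|z|)%R.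
Proof.
apply: le_trans; rewrite [leRHS]/Num.norm/= mx_normrE.
exact: (le_bigmax _ (fun ij => `|coords z ij.1 ij.2|%R) (ord0, i)).
Qed.

Section with_decomposition.
Context d (T : measurableType d) (m : {measure set T -> \bar R}) (D : set T) (mu s : set T -> E)
  (ac p : T -> E) (c : R).
Hypothesis mD : measurable D.
Hypothesis dec : is_lebesgue_decomposition m D mu ac s p.
Hypothesis c0 : (0 < c)%R.
Hypothesis cP : forall z : E, (`|coords z| <= c * `|z|)%R.
Local Notation v := (variation_measure mu).

Let ms : forall F : (set T)^nat, (forall i, measurable (F i)) -> trivIset setT F ->
  (series (s \o F) @ \oo --> s (\bigcup_i F i))%R.
Proof. by have [_ [[]]] := dec. Qed.

Let mci i : measurable_fun D (fun x => coords (ac x) ord0 i).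
Proof.
have [[mac _] _ _ _ _] := dec.
apply: (@measurableT_comp _ _ _ _ _ _ (fun z : borel E => coords z ord0 i)); last exact: mac.
exact: coord_measurable.
Qed.

Let ici i : m.-integrable D (fun x => (coords (ac x) ord0 i)%:E).
Proof.
have [[mac iac] _ _ _ _] := dec.
apply/integrableP; split; first exact/measurable_EFinP.
have nac : measurable_fun D (fun x => (`|ac x|)%R).
  by apply: (@measurableT_comp _ _ _ _ _ _ (fun z : borel E => `|z|%R)); [exact: norm_measurable|exact: mac].
apply: (@le_lt_trans _ _ (\int[m]_(x in D) (c%:E * `|ac x|%:E))).
  apply: ge0_le_integral => //=.
  - by apply/measurable_EFinP; apply/measurableT_comp.
  - by apply/measurable_EFinP; exact: measurable_funM.
  - by move=> x Dx; rewrite -EFinM lee_fin coord_le.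
rewrite ge0_integralZl//.
- by rewrite lte_mul_pinfty// ?lee_fin ltW.
- exact/measurable_EFinP.
- by rewrite lee_fin ltW.
Qed.

(** With [N] the [m]-null set carrying [s], the value of [s] on [F i] is that of [mu] on the trace
    of [F i] on [N]. A partition of [D] thus becomes a partition of the trace of [D], tested with
    [mu]. *)
Lemma singular_variation_le : variation_measure s D <= v D.
Proof.
have [_ [_ [N [mN sN mN0]]] muE _ _] := dec.
apply: ge_ereal_sup => _ [F [mF tF FD] <-].
have FN i : s (F i) = mu (F i `&` N).
  have FiD : F i `<=` D by rewrite -FD; exact: bigcup_sup.
  have mFN : measurable (F i `&` N) by exact: measurableI.
  have mFC : measurable (F i `\` N) by exact: measurableD.
  rewrite muE//; last by move=> x [/FiD].
  have -> : vector_integral m (F i `&` N) ac = 0%R.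
    apply: (can_inj (@coordsK R E)); apply/rowP => k.
    rewrite coords_vector_integral null_set_integral//; first by rewrite /= mxE linear0.
      by apply/measurable_EFinP; apply: measurable_funS (mci k) => // x [/FiD].
    by apply: (subset_measure0 mFN mN _ mN0); exact: subIsetr.
  rewrite add0r -[in LHS](setUIDK (F i) N) vector_measureU//; last first.
    by apply/seteqP; split => // x [[_ Nx] [_]].
  have -> : s (F i `\` N) = 0%R; last by rewrite addr0.
  apply/eqP; rewrite -normr_le0 -lee_fin.
  apply: le_trans (variation_norm s mFC) _.
  apply: (@le_trans _ _ (variation_measure s (~` N))); last by rewrite sN.
  by apply: (variation_mono s) => //; exact: measurableC.
under eq_eseriesr do rewrite FN.
have mDN : measurable (D `&` N) by exact: measurableI.
apply: (@le_trans _ _ (v (D `&` N))); last by apply: (variation_mono mu) => //; exact: subIsetl.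
apply: (@variation_ub _ _ _ _ mu _ (fun i => F i `&` N)); split.
- by move=> i; exact: measurableI.
- exact: trivIset_setIr.
- by rewrite -setI_bigcupl FD.
Qed.

(** On a set not charged by [s], the vector integral of [ac] is [mu A], and a coordinate of [mu A]
    is at most [c] times its norm. *)
Let half_bound i (A : set T) : measurable A -> A `<=` D ->
  variation_measure s A = 0 ->
  `|\int[m]_(x in A) (coords (ac x) ord0 i)%:E| <= c%:E * v D.
Proof.
move=> mA AD sA.
have [[mac iac] _ muE _ _] := dec.
have sA0 : s A = 0%R.
  apply/eqP; rewrite -normr_le0 -lee_fin; apply: le_trans (variation_norm s mA) _.
  by rewrite sA.
have := muE A mA AD; rewrite sA0 addr0 => muA.
have fin : \int[m]_(x in A) (coords (ac x) ord0 i)%:E \is a fin_num.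
  by apply: integrable_fin_num => //; apply: (integrableS mD) => //; exact: ici.
rewrite -(fineK fin) -coords_vector_integral -muA /= .
apply: le_trans (_ : (c * `|mu A|)%:E <= _); first by rewrite lee_fin coord_le.
rewrite EFinM lee_wpmul2l ?lee_fin ?(ltW c0)//.
apply: le_trans (variation_norm mu mA) _.
exact: (variation_mono mu).
Qed.

(** For each coordinate, the set where it is nonnegative and the rest of [D] are stripped of the
    null set carrying [s] and contribute [c] times [v D] each: hence [2 c]. The norms of the basis
    vectors lead back from coordinates to [ac]. *)
Lemma ac_integral_le :
  \int[m]_(x in D) `|ac x|%:E <=
  ((\sum_(i < dE) `|(vbasis (fullv : {vspace E}))`_i|) * (2 * c))%:E * v D.
Proof.
have [[mac iac] [_ [N [mN sN mN0]]] muE _ _] := dec.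
have vD0 : 0 <= v D by exact: (variation_ge0 mu).
have ci i : \int[m]_(x in D) `|coords (ac x) ord0 i|%:E <= (2 * c)%:E * v D.
  pose P := D `&` [set x | (0 <= coords (ac x) ord0 i)%R].
  have mP : measurable P.
    have := mci i mD (measurable_itv `[0%R, +oo[).
    by congr measurable; apply/seteqP; split => x /= [Dx h]; split => //=;
      move: h; rewrite in_itv/= andbT.
  have mDP : measurable (D `\` P) by exact: measurableD.
  have half B : measurable B -> B `<=` D ->
      `|\int[m]_(x in B) (coords (ac x) ord0 i)%:E| <= c%:E * v D.
    move=> mB BD; have mBN : measurable (B `\` N) by exact: measurableD.
    rewrite (_ : \int[m]_(x in B) _ = \int[m]_(x in B `\` N) (coords (ac x) ord0 i)%:E).
      apply: half_bound => //; first by move=> x [/BD].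
      apply/eqP; rewrite eq_le (variation_ge0 s)// andbT -sN.
      by apply: (variation_mono s) => //; exact: measurableC.
    by rewrite (negligible_integral mN mB)//; apply: (integrableS mD) => //; exact: ici.
  have [hP hN] := (half P mP (@subIsetl _ _ _), half _ mDP (@subDsetl _ _ _)).
  rewrite -{1}(setDUK (@subIsetl _ D _ : P `<=` D)) ge0_integral_setU//=; last 2 first.
  - by apply/measurable_EFinP; apply: measurableT_comp => //; rewrite setDUK//; exact: subIsetl.
  - by apply/disj_setPS => x [Px [_]].
  rewrite (_ : (2 * c)%:E * v D = c%:E * v D + c%:E * v D); last first.
    by rewrite mulr_natl mulr2n EFinD ge0_muleDl// lee_fin ltW.
  apply: leeD.
    apply: le_trans hP; rewrite (_ : \int[m]_(x in P) `|_|%:E = \int[m]_(x in P) (coords (ac x) ord0 i)%:E).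
      exact: lee_abs.
    by apply: eq_integral => x; rewrite inE => -[Dx /= x0]; rewrite ger0_norm.
  apply: le_trans hN.
  have -> : \int[m]_(x in D `\` P) (coords (ac x) ord0 i)%:E =
      - \int[m]_(x in D `\` P) `|coords (ac x) ord0 i|%:E.
    rewrite -integral_ge0N//; apply: eq_integral => x; rewrite inE => -[Dx Px].
    have x0 : (coords (ac x) ord0 i < 0)%R.
      by rewrite ltNge; apply/negP => x0; apply: Px.
    by rewrite ltr0_norm// -EFinN opprK.
  by rewrite abseN; exact: lee_abs.
apply: (@le_trans _ _ (\int[m]_(x in D)
   \sum_(i < dE) (`|(vbasis (fullv : {vspace E}))`_i|%:E * `|coords (ac x) ord0 i|%:E))).
  apply: ge0_le_integral => //=.
  - apply/measurable_EFinP.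
    by apply: (@measurableT_comp _ _ _ _ _ _ (fun z : borel E => `|z|%R)); [exact: norm_measurable|exact: mac].
  - apply: emeasurable_sum => i; apply/measurable_EFinP; apply: measurable_funM => //.
    exact: measurableT_comp.
  - move=> x _; under eq_bigr do rewrite -EFinM; rewrite sumEFin lee_fin.
    exact: norm_le_coords.
rewrite ge0_integral_sum//; last first.
  by move=> i; apply/measurable_EFinP; apply: measurable_funM => //; exact: measurableT_comp.
rewrite EFinM -sumEFin -muleA ge0_sume_distrl//.
apply: lee_sum => i _; rewrite ge0_integralZl//.
- by apply: lee_wpmul2l.
- by apply/measurable_EFinP; exact: measurableT_comp.
Qed.

End with_decomposition.

(** The constant depends on [E] only, so the bounds are uniform along the sequence. [sm] is a
    measure on which integration theory applies, equal to the variation of the singular part on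
    measurable sets. *)
Lemma lebesgue_decomposition_bounds : exists2 c : R, (0 <= c)%R &
  forall d (T : measurableType d) (m : {measure set T -> \bar R}) (D : set T) (mu : set T -> E),
    measurable D ->
    [/\ measurable_fun D (ac_density m D mu : T -> borel E),
        \int[m]_(x in D) `|ac_density m D mu x|%:E <= c%:E * variation_measure mu D,
        measurable_fun D (singular_polar m D mu : T -> borel E) &
        exists sm : {measure set T -> \bar R},
        [/\ forall A, measurable A -> sm A = variation_measure (singular_part m D mu) A,
            sm D <= variation_measure mu D &
            sm (D `&` [set x | (`|singular_polar m D mu x| != 1)%R]) = 0]].
Proof.
have [c c0 cP] := coords_bounded E.
exists ((\sum_(i < dE) `|(vbasis (fullv : {vspace E}))`_i|) * (2 * c))%R.
  by rewrite mulr_ge0 ?sumr_ge0// mulr_ge0// ltW.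
move=> d T m D mu mD; rewrite /ac_density /singular_part /singular_polar /lebesgue_decomposition.
have mup : measurable_fun D (cst 0%R : T -> borel E) by exact: measurable_cst.
(* If the set of decompositions is empty, the choice falls back to zero functions and the zero set
   function, for which every bound is immediate. *)
case: xgetP => [[[ac s] p] _ /= dec | _ /=].
  have [[mac _] [[ss _ _] _] _ [mp [N [mN N0 pN]]] _] := dec.
  have [sm smE] := variation_is_measure ss.
  split => //; first exact: (ac_integral_le mD dec c0 cP).
  exists sm; split => //; first by rewrite smE//; exact: (singular_variation_le mD dec).
  have mpn : measurable (D `&` [set x | (`|p x| != 1)%R]).
    have mpn : measurable_fun D (fun x => `|p x|)%R.
      by apply: (@measurableT_comp _ _ _ _ _ _ (fun z : borel E => `|z|%R)); [exact: norm_measurable|exact: mp].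
    have := mpn mD _ (measurableC (measurable_set1 1%R)).
    by congr measurable; apply/seteqP; split => x /= [Dx /eqP].
  have smN : sm N = 0 by rewrite smE.
  apply: (subset_measure0 mpn mN _ smN).
  by move=> x [/= Dx p1]; apply: pN => /= /(_ Dx) /eqP; rewrite (negbTE p1).
have s0 : forall F : (set T)^nat, (forall i, measurable (F i)) -> trivIset setT F ->
    (series (cst 0 \o F : nat -> E) @ \oo --> (cst 0 (\bigcup_i F i) : E))%R.
  move=> F _ _; rewrite (_ : series _ = cst 0%R); first exact: cvg_cst.
  by apply/funext => n; rewrite /series/= big1.
have [sm smE] := variation_is_measure s0.
have sm0 A : measurable A -> sm A = 0.
  move=> mA; apply/eqP; rewrite eq_le measure_ge0 andbT smE//.
  by apply: ge_ereal_sup => _ [F _ <-]; rewrite eseries0// => i _ _; rewrite normr0.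
have vD0 : 0 <= variation_measure mu D by exact: variation_ge0.
split => //.
  rewrite (_ : \int[m]_(x in D) _ = 0); first by rewrite mule_ge0// lee_fin mulr_ge0 ?sumr_ge0// mulr_ge0// ltW.
  by rewrite integral0_eq// => x _; rewrite normr0.
exists sm; split => //; first by rewrite sm0.
rewrite (_ : _ `&` _ = D) ?sm0//; apply/seteqP; split => x //=; first by case.
by move=> Dx; split => //; rewrite normr0 eq_sym oner_eq0.
Qed.

End decomposition_bounds.

(** * The recession function: continuity, homogeneity, growth *)

Section recession_theory.
Context (R : realType) (d : nat) (E : euclideanType R).
Variables (Omega : set 'rV[R]_d) (f : 'rV[R]_d * torus R d * E -> R).
Hypothesis openOmega : open Omega.
Hypothesis boundedOmega : bounded_set Omega.
Hypothesis cf : {within Omega `*` setT `*` setT, continuous f}.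
Hypothesis rf : has_recession Omega f.

Local Notation W := ('rV[R]_d * 'rV[R]_d * E)%type.
Local Notation K := (closure Omega).

(** The torus variable is replaced by a vector of [R^d], whose representatives fill a compact
    cube. *)
Definition lift_fun (q : W) : R := f (q.1.1, torus_class q.1.2, q.2).
Definition lift_rec (q : W) : R := recession Omega f (q.1.1, torus_class q.1.2, q.2).

Let toruslift (q : W) : 'rV[R]_d * torus R d * E := (q.1.1, torus_class q.1.2, q.2).

Let toruslift_continuous : continuous toruslift.
Proof.
move=> [[x y] z].
have h1 : q.1 @[q --> ((x, y, z) : W)] --> (x, y) by exact: cvg_fst.
have hx : q.1.1 @[q --> ((x, y, z) : W)] --> x.
  by apply: (cvg_comp _ _ h1); exact: cvg_fst.
have hy : q.1.2 @[q --> ((x, y, z) : W)] --> y.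
  by apply: (cvg_comp _ _ h1); exact: cvg_snd.
have hz : q.2 @[q --> ((x, y, z) : W)] --> z by exact: cvg_snd.
have hyt : torus_class q.1.2 @[q --> ((x, y, z) : W)] --> torus_class y.
  by apply: (cvg_comp _ _ hy); exact: torus_class_continuous.
exact: (cvg_pair (cvg_pair hx hyt) hz).
Qed.

Lemma lift_fun_continuous (q : W) : Omega q.1.1 -> {for q, continuous lift_fun}.
Proof.
move=> Oq.
have cfq : {for toruslift q, continuous f}.
  have /subspace_continuousP/(_ (toruslift q)) := cf.
  have Oq' : (Omega `*` setT `*` setT) (toruslift q) by [].
  have oO : open (Omega `*` setT `*` setT : set ('rV[R]_d * torus R d * E)).
    rewrite openE => -[[x xi] z] /= [[Ox _] _].
    exists (Omega `*` setT, setT) => /=; last by move=> [[x' xi'] z'] /= [[]].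
    split; last exact: filterT.
    by exists (Omega, setT) => //=; split; [exact: open_nbhs_nbhs|exact: filterT].
  move=> /(_ Oq'); apply: cvg_trans; apply: cvg_app.
  have nO := open_nbhs_nbhs (conj oO Oq').
  move=> P; rewrite /within/= nbhs_simpl => hP.
  by apply: filterS2 nO hP => p Op; apply.
exact: (continuous_comp (@toruslift_continuous q) cfq).
Qed.

(** The limit along the product filter, spelled out: one neighbourhood and one threshold [T] serve
    all [q'] and [t] jointly, which later gives uniformity. *)
Lemma recession_eps (q : W) (e : R) : K q.1.1 -> 0 < e ->
  exists T : R, \forall q' \near q, forall t, T < t -> Omega q'.1.1 ->
    `|lift_rec q - lift_fun (q'.1, t *: q'.2) / t| < e.
Proof.
move=> Kq e0.
have /cvgrPdist_lt/(_ e e0) := @rf q.1.1 (torus_class q.1.2) q.2 Kq.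
move=> [[U V] /= [UU [T [_ TV]]] UV].
have UU' : nbhs q (toruslift @^-1` [set p | (Omega `*` setT `*` setT) p -> U p]).
  exact: (@toruslift_continuous q _ UU).
exists T; apply: filterS UU' => q' Uq' t Tt Oq'.
by have := UV (toruslift q', t); apply; split => /=; [exact: Uq'|exact: TV].
Qed.

Lemma closure_near (x : 'rV[R]_d) (U : set 'rV[R]_d) : K x -> nbhs x U ->
  exists2 x', Omega x' & U x'.
Proof. by move=> Kx Ux; have [x' [Ox' Ux']] := Kx U Ux; exists x'. Qed.

Let near_fst (q : W) (P : set W) : nbhs q P -> \forall x' \near q.1.1, P (x', q.1.2, q.2).
Proof.
move=> [[A B]/= [[[A1 A2]/= [hA1 hA2] sA] hB] sAB].
apply: filterS hA1 => x' A1x'; apply: sAB; split => /=; last exact: nbhs_singleton.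
by apply: sA; split => //=; exact: nbhs_singleton.
Qed.

(* near a point of the closure, the recession values are limits of the same
   quotients, so the value at the base point controls them *)
Lemma lift_rec_continuous (q : W) (e : R) : K q.1.1 -> 0 < e ->
  \forall q' \near q, K q'.1.1 -> `|lift_rec q - lift_rec q'| < e.
Proof.
move=> Kq e0.
have e3 : 0 < e / 3 by rewrite divr_gt0.
have [T /nbhs_interior qT] := recession_eps Kq e3.
move: qT; apply: filterS => q' q'T Kq'.
have [T' q'T'] := recession_eps Kq' e3.
have [x' Ox' [h1 h2]] := closure_near Kq' (near_fst (filterI q'T q'T')).
pose t := Num.max T T' + 1.
have tT : T < t by rewrite /t (le_lt_trans (_ : T <= Num.max T T'))// ?le_max ?lexx// ltrDl.
have tT' : T' < t by rewrite /t (le_lt_trans (_ : T' <= Num.max T T'))// ?le_max ?lexx ?orbT// ltrDl.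
have := h1 t tT Ox'; have := h2 t tT' Ox'; rewrite /=.
set w := lift_fun _ / t; rewrite !ltr_norml; lra.
Qed.

(** For [s > 0] the quotients at [(s z, t)] and at [(z, t s)] involve the same value of [f]. For
    [s = 0] the quotient [f (x', y, 0) / t] tends to 0 with [x'] fixed. *)
Lemma lift_recZ (x y : 'rV[R]_d) (z : E) (s : R) : K x -> 0 <= s ->
  lift_rec (x, y, s *: z) = s * lift_rec (x, y, z).
Proof.
move=> Kx; rewrite le_eqVlt => /predU1P[<-|s0].
  rewrite mul0r scale0r; apply/eqP; rewrite -normr_le0; apply/ler_addgt0Pr => e e0.
  rewrite add0r; have e2 : 0 < e / 2 by rewrite divr_gt0.
  have [T qT] := recession_eps (q := (x, y, 0)) Kx e2.
  have [x' Ox' h] := closure_near Kx (near_fst qT).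
  set c := `|lift_fun (x', y, 0)|.
  pose t := Num.max `|T| (c / (e / 2)) + 1.
  have t0 : 0 < t by rewrite /t ltr_wpDl// le_max normr_ge0.
  have tT : T < t.
    rewrite /t (le_lt_trans (_ : T <= Num.max `|T| (c / (e / 2))))// ?ltrDl//.
    by rewrite le_max ler_norm.
  have tc : c / t < e / 2.
    rewrite ltr_pdivrMr// mulrC -ltr_pdivrMr//.
    rewrite /t (le_lt_trans (_ : _ <= Num.max `|T| (c / (e / 2))))// ?ltrDl//.
    by rewrite le_max lexx orbT.
  have := h t tT Ox'; rewrite /= scaler0 => {}h.
  have : `|lift_fun (x', y, 0) / t| < e / 2.
    by rewrite normrM normfV (gtr0_norm t0).
  by move: h; rewrite !ltr_norml ler_norml; lra.
apply/eqP; rewrite -subr_eq0 -normr_le0; apply/ler_addgt0Pr => e e0; rewrite add0r.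
pose e' := e / (1 + s).
have s1 : 0 < 1 + s by rewrite addr_gt0.
have e'0 : 0 < e' by rewrite divr_gt0.
have [T1 q1] := recession_eps (q := (x, y, s *: z)) Kx e'0.
have [T2 q2] := recession_eps (q := (x, y, z)) Kx e'0.
have [x' Ox' [h1 h2]] := closure_near Kx (filterI (near_fst q1) (near_fst q2)).
pose t := Num.max `|T1| (`|T2| / s) + 1.
have t0 : 0 < t by rewrite /t ltr_wpDl// le_max normr_ge0.
have t1 : T1 < t.
  rewrite /t (le_lt_trans (_ : T1 <= Num.max `|T1| (`|T2| / s)))// ?ltrDl//.
  by rewrite le_max ler_norm.
have t2 : T2 < t * s.
  rewrite -ltr_pdivrMr// /t (le_lt_trans (_ : _ <= Num.max `|T1| (`|T2| / s)))// ?ltrDl//.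
  by rewrite le_max (ler_pM2r (_ : 0 < s^-1)) ?invr_gt0// ler_norm orbT.
have := h1 t t1 Ox'; have := h2 (t * s) t2 Ox'; rewrite /= scalerA.
set w := lift_fun _ => h2' h1'.
have h2'' : `|s * lift_rec (x, y, z) - w / t| < s * e'.
  have -> : s * lift_rec (x, y, z) - w / t = s * (lift_rec (x, y, z) - w / (t * s)).
    by field; rewrite !gt_eqF.
  by rewrite normrM gtr0_norm// ltr_pM2l.
have -> : e = e' + s * e' by rewrite /e'; field; rewrite gt_eqF.
by move: h1' h2''; rewrite !ltr_norml ler_norml; lra.
Qed.

Lemma bounded_closure : bounded_set K.
Proof.
have [M [_ MP]] := boundedOmega; exists M; split => [|r Mr x Kx]; first exact: num_real.
have cr := @closed_closed_ball_ R 'rV[R]_d 0 r.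
have := cr x; rewrite /closed_ball_ /= sub0r normrN; apply => B xB.
have [y [Oy By]] := Kx B xB; exists y; split => //=.
by rewrite sub0r normrN; exact: (MP _ Mr).
Qed.

Let compactW : compact (K `*` [set y : 'rV[R]_d | forall i, `[0, 1]%classic (y ord0 i)] `*` [set z : E | `|z| <= 1]).
Proof.
apply: compact_setX; last exact: closed_ball_compact.
apply: compact_setX; last exact: (@rV_compact R d (fun=> `[0, 1]%classic) (fun=> @segment_compact R 0 1)).
apply: bounded_closed_compact; last exact: closed_closure.
exact: bounded_closure.
Qed.

Let lift_frac x y z : lift_fun (x, y, z) = lift_fun (x, frac y, z) /\
  lift_rec (x, y, z) = lift_rec (x, frac y, z).
Proof. by rewrite /lift_fun /lift_rec /= torus_class_frac. Qed.

Let in_compactW x y z : K x -> `|z| <= 1 ->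
  (K `*` [set y : 'rV[R]_d | forall i, `[0, 1]%classic (y ord0 i)] `*` [set z : E | `|z| <= 1])
    (x, frac y, z).
Proof.
move=> Kx z1; split => //; split => //= i; rewrite in_itv/=.
by have /andP[-> /ltW ->] := frac_itv y i.
Qed.

(** Local bounds and compactness handle [z] in the unit ball and the fast variable in the cube;
    homogeneity gives the linear bound. *)
Lemma lift_rec_bounded : exists2 C : R, 0 <= C &
  forall x y z, K x -> `|lift_rec (x, y, z)| <= C * `|z|.
Proof.
have := compactW; rewrite compact_near_coveringP.
move=> /(_ R (pinfty_nbhs R) (fun C q => K q.1.1 -> `|lift_rec q| <= C)).
have H : forall q : W, (K `*` [set y : 'rV[R]_d | forall i, `[0, 1]%classic (y ord0 i)] `*` [set z : E | `|z| <= 1]) q ->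
    \forall q' \near q & C \near pinfty_nbhs R, K q'.1.1 -> `|lift_rec q'| <= C.
  move=> q [[Kq _] _].
  exists ([set q' : W | K q'.1.1 -> `|lift_rec q - lift_rec q'| < 1], [set C | `|lift_rec q| + 1 < C]) => /=.
    split; first exact: lift_rec_continuous.
    exact: nbhs_pinfty_gt.
  move=> [q' C] /= [h hC] Kq'; have {}h := h Kq'.
  have := ler_normB (lift_rec q) (lift_rec q - lift_rec q').
  rewrite opprB addrCA subrr addr0; lra.
move=> /(_ _ H) {}H.
near (pinfty_nbhs R) => C.
have C0 : 0 <= C by apply: ltW; near: C; exact: nbhs_pinfty_gt.
exists C => // x y z Kx.
have [->|z0] := eqVneq z 0.
  by rewrite -(scale0r (0 : E)) lift_recZ// mul0r normr0 scale0r normr0 mulr0.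
have nz : 0 < `|z| by rewrite normr_gt0.
pose z' := `|z|^-1 *: z.
have zE : z = `|z| *: z' by rewrite scalerA mulfV ?gt_eqF// scale1r.
have z'1 : `|z'| <= 1 by rewrite normrZ normfV normr_id mulVf ?gt_eqF.
rewrite [in lift_rec _]zE lift_recZ// normrM normr_id mulrC.
rewrite ler_pM2r// (lift_frac _ _ _).2.
have : forall q : W, (K `*` [set y : 'rV[R]_d | forall i, `[0, 1]%classic (y ord0 i)] `*` [set z : E | `|z| <= 1]) q ->
   K q.1.1 -> `|lift_rec q| <= C by near: C; exact: H.
by apply => //; exact: in_compactW.
Unshelve. all: by end_near. Qed.

(** Compactness makes the recession limit uniform over the unit ball beyond a threshold [T0]. With
    [t] the maximum of [T0] and [|z|], the vector [z / t] is in the ball and scaling back by [t]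
    gives an error [e t], at most [e |z| + e T0]. *)
Lemma lift_rec_approx (e : R) : 0 < e -> exists2 C : R, 0 <= C &
  forall x y z, Omega x -> `|lift_fun (x, y, z) - lift_rec (x, y, z)| <= e * `|z| + C.
Proof.
move=> e0; have e2 : 0 < e / 2 by rewrite divr_gt0.
have := compactW; rewrite compact_near_coveringP.
move=> /(_ R (pinfty_nbhs R) (fun t q => Omega q.1.1 -> `|lift_rec q - lift_fun (q.1, t *: q.2) / t| < e)).
have OK x : Omega x -> K x by exact: subset_closure.
have H : forall q : W, (K `*` [set y : 'rV[R]_d | forall i, `[0, 1]%classic (y ord0 i)] `*` [set z : E | `|z| <= 1]) q ->
    \forall q' \near q & t \near pinfty_nbhs R,
      Omega q'.1.1 -> `|lift_rec q' - lift_fun (q'.1, t *: q'.2) / t| < e.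
  move=> q [[Kq _] _].
  have [T qT] := recession_eps Kq e2.
  exists ([set q' : W | (forall t, T < t -> Omega q'.1.1 ->
      `|lift_rec q - lift_fun (q'.1, t *: q'.2) / t| < e / 2) /\
      (K q'.1.1 -> `|lift_rec q - lift_rec q'| < e / 2)], [set t | T < t]) => /=.
    split; last by apply: nbhs_pinfty_gt; exact: num_real.
    by apply: filterS2 qT (lift_rec_continuous Kq e2) => q'.
  move=> [q' t] /= [[h1 h2] Tt] Oq'; have {}h1 := h1 t Tt Oq'; have {}h2 := h2 (OK _ Oq').
  by move: h1 h2; rewrite !ltr_norml; lra.
move=> /(_ _ H) [T [_ {}H]].
pose T0 := `|T| + 1.
have T00 : 0 < T0 by rewrite ltr_wpDl.
have TT0 : T < T0 by rewrite (le_lt_trans (ler_norm T))// ltrDl.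
exists (e * T0); first by rewrite mulr_ge0// ltW.
move=> x y z Ox.
pose t := Num.max T0 `|z|.
have t0 : 0 < t by rewrite lt_max T00.
have Tt : T < t by rewrite lt_max TT0.
have inW : (K `*` [set y : 'rV[R]_d | forall i, `[0, 1]%classic (y ord0 i)] `*` [set z : E | `|z| <= 1])
    (x, frac y, t^-1 *: z).
  apply: in_compactW; first exact: OK.
  by rewrite normrZ normfV gtr0_norm// mulrC ler_pdivrMr// mul1r le_max lexx orbT.
have := H t Tt _ inW Ox.
rewrite /= scalerA mulfV ?gt_eqF// scale1r -(lift_frac _ _ _).1 -(lift_frac _ _ _).2 => h.
have zE : lift_rec (x, y, z) = t * lift_rec (x, y, t^-1 *: z).
  by rewrite -lift_recZ ?(ltW t0)// ?scalerA ?mulfV ?gt_eqF// ?scale1r//; exact: OK.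
have -> : lift_fun (x, y, z) - lift_rec (x, y, z) =
    - (t * (lift_rec (x, y, t^-1 *: z) - lift_fun (x, y, z) / t)).
  by rewrite zE; field; rewrite gt_eqF.
rewrite normrN normrM gtr0_norm//.
apply: (@le_trans _ _ (t * e)); first by rewrite ler_pM2l// ltW.
rewrite mulrC -mulrDr ler_pM2l// ge_max lerDr lerDl normr_ge0 ltW//.
Qed.

Lemma lift_fun_bounded : exists2 C : R, 0 <= C &
  forall x y z, Omega x -> `|lift_fun (x, y, z)| <= C * (1 + `|z|).
Proof.
have [C1 C10 h1] := lift_rec_bounded; have [C2 C20 h2] := lift_rec_approx ltr01.
exists (C1 + C2 + 1); first by lra.
move=> x y z Ox; have {}h1 := h1 x y z (subset_closure Ox); have {}h2 := h2 x y z Ox.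
have := ler_normD (lift_fun (x, y, z) - lift_rec (x, y, z)) (lift_rec (x, y, z)).
rewrite subrK; have := normr_ge0 z; nra.
Qed.

End recession_theory.

(** * Extension of continuous functions and weak limits on the line *)

Section normality.
Context (R : realType).

Lemma borel_continuous_within (X : ptopologicalType) (C : set X) (g : X -> R) :
  measurable (C : set (borel X)) -> {within C, continuous g} ->
  measurable_fun (C : set (borel X)) g.
Proof.
move=> mC cg.
apply: (measurability _ (@RGenOpens.measurableE R)) => //.
move=> _ [_ [a [b ->]] <-].
have /continuousP := cg => /(_ `]a, b[%classic (interval_open _ _)).
move=> /(_ isT isT) /open_subspaceP [V oV VC].
rewrite setIC -VC; apply: measurableI => //; exact: borel_open.
Qed.

Lemma normed_normal (V : normedModType R) : normal_space V.
Proof.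
apply/(@normal_openP R) => A B cA cB AB.
pose D x := dist1 B x - dist1 A x.
have cD : continuous D.
  by move=> x; apply: cvgB; exact: dist1_continuous.
exists (D @^-1` [set x | 0 < x]), (D @^-1` [set x | x < 0]); split.
- by apply: open_comp; [move=> x _; exact: cD|exact: open_gt].
- by apply: open_comp; [move=> x _; exact: cD|exact: open_lt].
- move=> x Ax /=; rewrite /D (dist1_eq0 Ax) subr0; apply: dist1_gt0 => // Bx.
  by have : (A `&` B) x by []; rewrite AB.
- move=> x Bx /=; rewrite /D (dist1_eq0 Bx) sub0r oppr_lt0; apply: dist1_gt0 => // Ax.
  by have : (A `&` B) x by []; rewrite AB.
- by apply/seteqP; split => // x [/= h1 h2]; have := lt_trans h1 h2; rewrite ltxx.
Qed.

Lemma continuous_extension (V : normedModType R) (A : set V) (f : V -> R) (B : R) :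
  closed A -> 0 < B -> {within A, continuous f} -> (forall x, A x -> `|f x| <= B) ->
  exists g : V -> R, [/\ forall x, A x -> g x = f x, continuous g & forall x, `|g x| <= B].
Proof.
move=> cA B0 cf fB.
have [g [fg cg gB]] := continuous_bounded_extension (@normed_normal V) cA B0 cf fB.
by exists g; split => // x Ax; rewrite fg// inE.
Qed.

End normality.

Section weak_limit.
Context (R : realType) (m : nat -> {measure set R -> \bar R}) (M : {measure set R -> \bar R}).
Variable C : R.
Hypothesis mC : forall n, (m n setT <= C%:E)%E.
Hypothesis MC : (M setT <= C%:E)%E.
Hypothesis mM : forall (psi : R -> R) (B : R), continuous psi ->
  (forall x, `|psi x| <= B) -> \int[m n]_x psi x @[n --> \oo] --> \int[M]_x psi x.

Let mfin n : (m n setT < +oo)%E.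
Proof. by apply: le_lt_trans (mC n) _; rewrite ltry. Qed.
Let Mfin : (M setT < +oo)%E.
Proof. by apply: le_lt_trans MC _; rewrite ltry. Qed.

(** The functions [bump A k] have integral 0 against every [m n], hence against [M], and increase to
    the indicator of the complement of [A]. *)
Lemma weak_limit_closed (A : set R) : closed A -> (forall n, m n (~` A) = 0%E) ->
  M (~` A) = 0%E.
Proof.
move=> cA mA; have mAC : measurable (~` A) by apply: open_measurable; rewrite openC.
have mb k : measurable_fun setT (bump A k) by apply: continuous_measurable_fun; exact: bump_continuous.
have Mb k : (\int[M]_x (bump A k x)%:E = 0)%E.
  rewrite (bounded_integralE (B := 1) Mfin) => //; last first.
    by move=> x; rewrite ger0_norm ?bump_ge0 ?bump_le1.
  congr EFin.
  have h := mM (bump_continuous (C := A) (k := k)) (B := 1) _.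
  apply: (cvg_unique _ (h _)) => //.
    by move=> x; rewrite ger0_norm ?bump_ge0 ?bump_le1.
  rewrite (_ : (fun n => _) = cst 0); first exact: cvg_cst.
  apply/funext => n; rewrite /Rintegral.
  rewrite (_ : (\int[m n]_x _ = 0)%E)//.
  rewrite (ge0_negligible_integral (N := ~` A))//; last first.
    by move=> x _; rewrite lee_fin bump_ge0.
    exact/measurable_EFinP.
  by apply: integral0_eq => x [_ /contrapT Ax]; rewrite bump_eq0.
have nb k : nnmeasurable (fun x => (bump A k x)%:E).
  by apply: nnmeasurable_EFin => // x; exact: bump_ge0.
have := @integral_monotone _ _ _ M _ nb.
have nd x : nondecreasing_seq (fun k => (bump A k x)%:E).
  by move=> i j ij; rewrite lee_fin; exact: bump_nd.
move=> /(_ nd) cv.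
have c0 : (\int[M]_x (bump A n x)%:E)%E @[n --> \oo] --> 0%E.
  by rewrite (_ : (fun n => _) = cst 0%E); [exact: cvg_cst|apply/funext => n; rewrite Mb].
transitivity (\int[M]_x limn (fun k => (bump A k x)%:E))%E; last first.
  exact: (cvg_unique (@ereal_hausdorff R) cv c0).
transitivity (\int[M]_x (\1_(~` A) x)%:E)%E; first by rewrite integral_indic// setIT.
apply: eq_integral => x _; apply/esym/cvg_lim => //.
by apply: cvg_EFin; [exact: nearW|exact: bump_cvg].
Qed.

Variable A : set R.
Hypothesis cA : closed A.
Hypothesis mA : forall n, m n (~` A) = 0%E.

Lemma Rintegral_patch_null (nu : {measure set R -> \bar R}) (f g : R -> R) :
  nu (~` A) = 0%E -> measurable_fun setT f -> measurable_fun setT g ->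
  (forall x, A x -> f x = g x) -> \int[nu]_x f x = \int[nu]_x g x.
Proof.
move=> nuA mf mg fg; rewrite /Rintegral; congr fine.
apply: ae_eq_integral => //; [exact/measurable_EFinP|exact/measurable_EFinP|].
exists (~` A); split => //.
  by apply: open_measurable; rewrite openC.
by move=> x /= h Ax; apply: h => _; rewrite fg.
Qed.

(** Tietze's theorem replaces a function that is continuous on the common closed carrier by a
    bounded continuous test function with the same integrals. *)
Lemma weak_limit_within (psi : R -> R) (B : R) : measurable_fun setT psi ->
  {within A, continuous psi} -> (forall x, A x -> `|psi x| <= B) ->
  \int[m n]_x psi x @[n --> \oo] --> \int[M]_x psi x.
Proof.
move=> mpsi cpsi psiB.
have B0 : 0 < `|B| + 1 by rewrite ltr_wpDl.
have psiB' x : A x -> `|psi x| <= `|B| + 1.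
  by move=> /psiB /le_trans; apply; rewrite (le_trans (ler_norm _))// lerDl.
have [g [gE cg gB]] := continuous_extension cA B0 cpsi psiB'.
have mg : measurable_fun setT g by exact: continuous_measurable_fun.
have -> : \int[M]_x psi x = \int[M]_x g x.
  by apply: Rintegral_patch_null => //; [exact: weak_limit_closed|move=> x Ax; rewrite gE].
have -> : (fun n => \int[m n]_x psi x) = (fun n => \int[m n]_x g x).
  by apply/funext => n; apply: Rintegral_patch_null => // x Ax; rewrite gE.
exact: mM gB.
Qed.

End weak_limit.

Lemma cvg_approx (R : realType) (a : nat -> R) (l : R) :
  (forall e, 0 < e -> exists2 b : nat -> R, exists2 l', b @ \oo --> l' & `|l - l'| <= e &
    forall n, `|a n - b n| <= e) ->
  a @ \oo --> l.
Proof.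
move=> h; apply/cvgrPdist_lt => e e0.
have e4 : 0 < e / 4 by rewrite divr_gt0.
have [b [l' bl' ll'] ab] := h _ e4.
have /cvgrPdist_lt/(_ _ e4) := bl'.
apply: filterS => n bn; have := ab n; move: ll' bn.
rewrite !ler_norml !ltr_norml; lra.
Qed.

(** * Kernels as laws of measurable maps on the unit interval *)

Section probability_of.
Context d (T : measurableType d) (R : realType) (m : {measure set T -> \bar R}).
Hypothesis m1 : m setT = 1%E.

Let pm : set T -> \bar R := m.
HB.instance Definition _ := Measure.on pm.
HB.instance Definition _ := Measure_isProbability.Build _ _ _ pm m1.

Definition probability_of : probability T R := pm.

End probability_of.

Section law_kernel.
Context (R : realType).
Local Open Scope ereal_scope.

Lemma nnmeasurable_fubini d1 d2 (S : measurableType d1) (T : measurableType d2)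
    (m : {sigma_finite_measure set T -> \bar R}) (G : S * T -> \bar R) :
  nnmeasurable G -> nnmeasurable (fun s => \int[m]_t G (s, t)).
Proof.
move=> [mG G0]; split; last by move=> s; exact: integral_ge0.
exact: (@measurable_fun_fubini_tonelli_F _ _ S T R m G).
Qed.

(** [nu s] is the image of Lebesgue measure on [0, 1[ by [kap (s, .)], so joint measurability of
    [kap] yields measurability in [s] by Tonelli. *)
Lemma law_kernel d1 d2 (S : measurableType d1) (Y : measurableType d2)
    (kap : S * R -> Y) : measurable_fun setT kap ->
  exists nu : S -> probability Y R,
    (forall s h, nnmeasurable h ->
       \int[nu s]_y h y = \int[lebesgue_measure]_u (h (kap (s, u)) * (unit_weight u)%:E)) /\
    (forall G : S * Y -> \bar R, nnmeasurable G ->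
       nnmeasurable (fun s => \int[nu s]_y G (s, y))).
Proof.
move=> mk.
have muw := @unit_weight_measurable R.
have mks s : measurable_fun setT (fun u : R => kap (s, u)).
  apply: (measurableT_comp mk); exact: measurable_pair1.
have uw0 (u : R) : (0 <= unit_weight u)%R by exact: unit_weight_ge0.
have ex s : exists nu : probability Y R, forall h, nnmeasurable h ->
    \int[nu]_y h y = \int[lebesgue_measure]_u (h (kap (s, u)) * (unit_weight u)%:E).
  have [nu nuE] := image_density (@lebesgue_measure R) (mks s) muw uw0.
  have nu1 : nu setT = 1.
    have := nuE _ (nnmeasurable_indic R (@measurableT _ Y)).
    rewrite integral_indic// setIT => ->.
    rewrite -[RHS](integral_unit_weight R); apply: eq_integral => u _.
    by rewrite indicT mul1e.
  by exists (probability_of nu1).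
have [nu nuE] := choice ex.
exists nu; split => // G nnG.
have nnGk : nnmeasurable (fun p : S * R => G (p.1, kap p) * (unit_weight p.2)%:E).
  apply: nnmeasurableM.
    apply: (@nnmeasurable_comp _ _ _ _ _ (fun p : S * R => (p.1, kap p))) => //.
    by apply: measurable_fun_pair.
  by apply: nnmeasurable_EFin => //; apply: measurableT_comp.
have := @nnmeasurable_fubini _ _ S (measurableTypeR R) lebesgue_measure _ nnGk.
congr nnmeasurable; apply/funext => s; rewrite nuE//.
by apply: nnmeasurable_comp => //; exact: measurable_pair1.
Qed.

End law_kernel.

(** A measurable set is its own union with the null set [set0], so the completion contains the
    original sigma-algebra. *)
Lemma weak_star_measurable_borel d1 d2 (X : measurableType d1) (Y : measurableType d2)
    (R : realType) (mu : set X -> \bar R) (D : set X) (k : X -> set Y -> \bar R) :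
  mu set0 = 0%E -> measurable D ->
  (forall B, measurable B -> measurable_fun setT (fun x => k x B)) ->
  weak_star_measurable mu D k.
Proof.
move=> mu0 mD mk B mB.
have sub (A : set X) : measurable A ->
    measurable (A : set (g_sigma_algebraType (completed_algebra_gen mu))).
  move=> mA; apply: sub_sigma_algebra; exists A => //; exists set0; last by rewrite setU0.
  by exists set0; split.
move=> _ U mU; apply: sub; apply: measurableI => //.
by rewrite -[X in measurable X]setTI; exact: mk.
Qed.

(** * The transformed integrand on the line and its limit *)

Section transformed_integrand.
Context (R : realType) (d : nat) (E : euclideanType R).
Variables (Omega : set 'rV[R]_d) (f : 'rV[R]_d * torus R d * E -> R).
Hypothesis openOmega : open Omega.
Hypothesis boundedOmega : bounded_set Omega.
Hypothesis cf : {within Omega `*` setT `*` setT, continuous f}.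
Hypothesis rf : has_recession Omega f.
Variables (d1 d2 : R -> 'rV[R]_d) (d3 : R -> E).
Hypothesis cd1 : continuous d1.
Hypothesis cd2 : continuous d2.
Hypothesis cd3 : continuous d3.
Hypothesis d3_le1 : forall t, `|d3 t| <= 1.
Local Notation K := (closure Omega).
Local Notation W := ('rV[R]_d * 'rV[R]_d * E)%type.

Definition weight t : R := 1 - `|d3 t|.
(* junk value 0 where the weight vanishes *)
Definition zeta t : E := (weight t)^-1 *: d3 t.
Definition rec_part t : R := lift_rec Omega f (d1 t, d2 t, d3 t).
Definition base_domain : set R := d1 @^-1` K.
(** What remains of the perspective [(1 - |w|) f (x, y, w / (1 - |w|))] after subtracting the
    recession function. It makes sense over [Omega] only, and tends to 0 as the weight does, so 0 is
    its continuous value on the sphere. *)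
Definition osc_part t : R :=
  if (d1 t \in Omega) && (weight t != 0) then
    weight t * lift_fun f (d1 t, d2 t, zeta t) - rec_part t else 0.
Definition transformed t : R := (if d1 t \in K then rec_part t else 0) + osc_part t.

Local Notation A := base_domain.

Lemma weight_ge0 t : 0 <= weight t. Proof. by rewrite subr_ge0. Qed.
Lemma weight_le1 t : weight t <= 1. Proof. by rewrite gerBl. Qed.

Lemma weight_continuous : continuous weight.
Proof. by move=> t; apply: cvgB; [exact: cvg_cst|apply: cvg_norm; exact: cd3]. Qed.

Lemma base_domain_closed : closed A.
Proof. by apply: closed_comp => [t _|]; [exact: cd1|exact: closed_closure]. Qed.

Lemma cvg_triple (t : R) :
  ((d1 s, d2 s, d3 s) : W) @[s --> t] --> ((d1 t, d2 t, d3 t) : W).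
Proof.
have h1 : d1 s @[s --> t] --> d1 t by exact: cd1.
have h2 : d2 s @[s --> t] --> d2 t by exact: cd2.
have h3 : d3 s @[s --> t] --> d3 t by exact: cd3.
exact: (cvg_pair (cvg_pair h1 h2) h3).
Qed.

Lemma rec_part_continuous : {within A, continuous rec_part}.
Proof.
apply/subspace_continuousP => t At; apply/cvgrPdist_lt => e e0.
have := lift_rec_continuous rf (q := (d1 t, d2 t, d3 t)) At e0.
move=> h; have h' : nbhs t [set s | A s -> `|rec_part t - rec_part s| < e].
  exact: (@cvg_triple t _ h).
exact: h'.
Qed.

Lemma rec_part_bounded : exists2 C : R, 0 <= C & forall t, A t -> `|rec_part t| <= C.
Proof.
have [C C0 h] := lift_rec_bounded boundedOmega rf; exists C => // t At.
by apply: le_trans (h _ _ _ At) _; rewrite ler_piMr.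
Qed.

Lemma osc_part_out t : ~ Omega (d1 t) -> osc_part t = 0.
Proof. by move=> Ot; rewrite /osc_part memNset. Qed.

Lemma weight_zeta t : weight t != 0 -> weight t *: zeta t = d3 t.
Proof. by move=> w0; rewrite scalerA mulfV// scale1r. Qed.

(** Homogeneity moves the recession part to the point [zeta], where [lift_rec_approx] applies.
    Multiplying its bound by the weight gives [e |d3| + C weight], and [|d3| <= 1]. *)
Lemma osc_part_bound (e : R) : 0 < e -> exists2 C : R, 0 <= C &
  forall t, `|osc_part t| <= e + C * weight t.
Proof.
move=> e0; have [C C0 h] := lift_rec_approx boundedOmega rf e0.
exists C => // t; rewrite /osc_part; case: ifPn => [/andP[]|_]; last first.
  by rewrite normr0 addr_ge0 ?mulr_ge0 ?weight_ge0 ?(ltW e0).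
rewrite inE => Ot w0.
have wp : 0 < weight t by rewrite lt_neqAle eq_sym w0 weight_ge0.
have -> : rec_part t = weight t * lift_rec Omega f (d1 t, d2 t, zeta t).
  rewrite /rec_part -{1}(weight_zeta w0) lift_recZ ?(ltW wp)//.
  exact: subset_closure.
rewrite -mulrBr normrM gtr0_norm//.
apply: (@le_trans _ _ (weight t * (e * `|zeta t| + C))); first by rewrite ler_pM2l// h.
have -> : weight t * (e * `|zeta t| + C) = e * `|weight t *: zeta t| + C * weight t.
  by rewrite (normrZ (weight t) (zeta t)) (gtr0_norm wp); ring.
by rewrite weight_zeta// lerD2r ler_piMr// ltW.
Qed.

Lemma osc_part_bounded : exists2 C : R, 0 <= C & forall t, `|osc_part t| <= C.
Proof.
have [C C0 h] := osc_part_bound ltr01; exists (1 + C); first by rewrite addr_ge0.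
by move=> t; apply: le_trans (h t) _; rewrite lerD2l ler_piMr ?weight_le1.
Qed.

Local Notation b j t := (bump (~` Omega) j (d1 t)).

Let cb j : continuous (fun t => b j t).
Proof. by move=> t; apply: continuous_comp; [exact: cd1|exact: bump_continuous]. Qed.

(** Three regimes: off [Omega] the cut-off tends to 0 against a bounded function; where the weight
    vanishes [osc_part_bound] forces the limit 0; elsewhere the defining formula is continuous. *)
Lemma cut_osc_continuous j : continuous (fun t => b j t * osc_part t).
Proof.
move=> t; have [Ot|Ot] := pselect (Omega (d1 t)); last first.
  have [C C0 h] := osc_part_bounded.
  have b0 : b j t = 0 by apply: bump_eq0.
  rewrite /continuous_at b0 mul0r.
  apply/norm_cvg0P; apply: (@squeeze_cvgr _ _ _ _ (cst 0) (fun s => C * b j s)).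
  - apply: nearW => s /=; rewrite normr_ge0/= normrM mulrC (ger0_norm (bump_ge0 _ _ _)).
    by rewrite ler_wpM2r// bump_ge0.
  - exact: cvg_cst.
  - have : C * b j s @[s --> t] --> C * b j t by apply: cvgM; [exact: cvg_cst|exact: cb].
    by rewrite b0 mulr0.
have [w0|w0] := eqVneq (weight t) 0.
  have H0 : osc_part t = 0 by rewrite /osc_part w0 eqxx andbF.
  rewrite /continuous_at H0 mulr0; apply/cvgrPdist_lt => e e0.
  have e2 : 0 < e / 2 by rewrite divr_gt0.
  have [C C0 h] := osc_part_bound e2.
  have C1 : 0 < C + 1 by rewrite ltr_wpDl.
  have e3 : 0 < e / 2 / (C + 1) by rewrite divr_gt0.
  have /cvgrPdist_lt/(_ _ e3) := @weight_continuous t.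
  apply: filterS => s; rewrite w0 !sub0r !normrN (ger0_norm (weight_ge0 _)) => ws.
  rewrite normrM (ger0_norm (bump_ge0 _ _ _)).
  apply: (@le_lt_trans _ _ (`|osc_part s|)); first by rewrite ler_piMl// bump_le1.
  apply: le_lt_trans (h s) _.
  have : C * weight s <= (C + 1) * weight s by rewrite ler_wpM2r ?weight_ge0// lerDl.
  move: ws; rewrite ltr_pdivlMr// mulrC; lra.
apply: cvgM; first exact: cb.
have nO : \forall s \near t, Omega (d1 s).
  exact: (@cd1 t _ (open_nbhs_nbhs (conj openOmega Ot))).
have nW : \forall s \near t, weight s != 0.
  have wp : 0 < weight t by rewrite lt_neqAle eq_sym w0 weight_ge0.
  have /cvgrPdist_lt/(_ _ wp) := @weight_continuous t.
  apply: filterS => s; apply: contraTneq => ->.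
  by rewrite subr0 gtr0_norm// ltxx.
have E0 : osc_part t = weight t * lift_fun f (d1 t, d2 t, zeta t) - rec_part t.
  by rewrite /osc_part mem_set// w0.
rewrite E0.
have : (weight s * lift_fun f (d1 s, d2 s, zeta s) - rec_part s) @[s --> t] -->
   weight t * lift_fun f (d1 t, d2 t, zeta t) - rec_part t.
  apply: cvgB.
    apply: cvgM; first exact: weight_continuous.
    have cz : zeta s @[s --> t] --> zeta t.
      by apply: cvgZ; [apply: cvgV => //; exact: weight_continuous|exact: cd3].
    have ht : ((d1 s, d2 s, zeta s) : W) @[s --> t] --> ((d1 t, d2 t, zeta t) : W).
      have h1 : d1 s @[s --> t] --> d1 t by exact: cd1.
      have h2 : d2 s @[s --> t] --> d2 t by exact: cd2.
      exact: (cvg_pair (cvg_pair h1 h2) cz).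
    have cl := lift_fun_continuous openOmega cf (q := (d1 t, d2 t, zeta t)) Ot.
    exact: (cvg_comp _ _ ht cl).
  have /subspace_continuousP/(_ t (subset_closure Ot)) := rec_part_continuous.
  apply: cvg_trans; apply: cvg_app => P; rewrite /within/= !nbhs_simpl => hP.
  by apply: filterS2 nO hP => s Os; apply; exact: subset_closure.
apply: cvg_trans; apply: near_eq_cvg.
by apply: filterS2 nO nW => s Os ws; rewrite /osc_part mem_set// ws.
Qed.

Let b_cvg t : Omega (d1 t) -> b j t @[j --> \oo] --> (1 : R).
Proof.
move=> Ot; have cO : closed (~` Omega) by exact: open_closedC.
have := bump_cvg (x := d1 t) cO.
by rewrite indicE setCK mem_set.
Qed.

Lemma osc_part_measurable : measurable_fun setT osc_part.
Proof.
apply: (measurable_fun_cvg (h := fun j t => b j t * osc_part t)).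
  by move=> j; apply: continuous_measurable_fun; exact: cut_osc_continuous.
move=> t _; have [Ot|Ot] := pselect (Omega (d1 t)).
  rewrite -[X in _ --> X]mul1r; apply: cvgM; [exact: b_cvg|exact: cvg_cst].
by rewrite osc_part_out//; under eq_fun do rewrite mulr0; exact: cvg_cst.
Qed.

Let mA : measurable A.
Proof. by apply: closed_measurable; exact: base_domain_closed. Qed.

Lemma within_patch_measurable (g : R -> R) : {within A, continuous g} ->
  measurable_fun setT (fun t => if d1 t \in K then g t else 0).
Proof.
move=> cg; have mg := subspace_continuous_measurable_fun mA cg.
have := (measurable_restrict g mA (@measurableT _ R)).1.
rewrite setTI => /(_ mg).
by [].
Qed.

Lemma transformed_measurable : measurable_fun setT transformed.
Proof.
apply: measurable_funD; last exact: osc_part_measurable.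
by apply: within_patch_measurable; exact: rec_part_continuous.
Qed.

Lemma transformed_bounded : exists2 C : R, 0 <= C & forall t, `|transformed t| <= C.
Proof.
have [C1 C10 h1] := rec_part_bounded; have [C2 C20 h2] := osc_part_bounded.
exists (C1 + C2); first by rewrite addr_ge0.
move=> t; rewrite /transformed; apply: le_trans (ler_normD _ _) _; apply: lerD => //.
by case: ifPn => [|_]; [rewrite inE; exact: h1|rewrite normr0].
Qed.

Lemma transformed_out t : ~ A t -> transformed t = 0.
Proof.
move=> At; rewrite /transformed memNset// add0r osc_part_out// => Ot.
by apply: At; exact: subset_closure.
Qed.

Section convergence.
Variables (m : nat -> {measure set R -> \bar R}) (M : {measure set R -> \bar R}) (C : R).
Hypothesis mC : forall n, (m n setT <= C%:E)%E.
Hypothesis MC : (M setT <= C%:E)%E.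
Hypothesis mM : forall (psi : R -> R) (B : R), continuous psi ->
  (forall x, `|psi x| <= B) -> \int[m n]_x psi x @[n --> \oo] --> \int[M]_x psi x.
Hypothesis mA0 : forall n, m n (~` A) = 0%E.

(** The part of the weight over [Omega] that the cut-off removes near the boundary. The hypothesis
    [mr] bounds its integral uniformly in [n]. *)
Definition rest j t : R := (if d1 t \in Omega then 1 - b j t else 0) * weight t.
Variable r : nat -> R.
Hypothesis r0 : r @ \oo --> (0 : R).
Hypothesis mr : forall n j, \int[m n]_t rest j t <= r j.

Let mfin n : (m n setT < +oo)%E.
Proof. by apply: le_lt_trans (mC n) _; rewrite ltry. Qed.
Let Mfin : (M setT < +oo)%E.
Proof. by apply: le_lt_trans MC _; rewrite ltry. Qed.

Lemma rest_itv j t : 0 <= rest j t <= 1.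
Proof.
rewrite /rest; case: ifP => _; last by rewrite mul0r lexx ler01.
have := bump_ge0 (~` Omega) j (d1 t); have := bump_le1 (~` Omega) j (d1 t).
have := weight_ge0 t; have := weight_le1 t => *; apply/andP; split; nra.
Qed.

Lemma mem_Omega_measurable : measurable (d1 @^-1` Omega : set R).
Proof. by apply: open_measurable; apply: open_comp => // t _; exact: cd1. Qed.

Lemma rest_measurable j : measurable_fun setT (rest j).
Proof.
apply: measurable_funM; last by apply: continuous_measurable_fun; exact: weight_continuous.
have mb : measurable_fun setT (fun t => 1 - b j t).
  apply: continuous_measurable_fun => t.
  by apply: cvgB; [exact: cvg_cst|exact: cb].
have mO := mem_Omega_measurable.
have := measurable_funM (measurable_indic mO : measurable_fun setT (\1_(d1 @^-1` Omega) : R -> R)) mb.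
congr measurable_fun; apply/funext => t /=; rewrite indicE.
have -> : (t \in d1 @^-1` Omega) = (d1 t \in Omega) by apply/idP/idP; rewrite !inE.
by case: ifP => _; rewrite ?mul1r ?mul0r.
Qed.

Lemma rest_limit : \int[M]_t rest j t @[j --> \oo] --> (0 : R).
Proof.
have Mi : M.-integrable setT (fun=> 1%:E).
  by apply: (@bounded_integrable _ _ _ _ Mfin (cst 1) 1) => // x; rewrite normr1.
have c0 (t : R) : setT t -> (rest j t)%:E @[j --> \oo] --> (cst 0%E t : \bar R).
  move=> _; apply: cvg_EFin; first exact: nearW.
  have [Ot|Ot] := pselect (Omega (d1 t)).
    rewrite /rest mem_set//= -[X in _ --> X](mul0r (weight t)) -(subrr 1).
    by apply: cvgM; [apply: cvgB; [exact: cvg_cst|exact: b_cvg]|exact: cvg_cst].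
  by rewrite /rest memNset//=; under eq_fun do rewrite mul0r; exact: cvg_cst.
have c1 (j : nat) (t : R) : setT t -> (`|(rest j t)%:E| <= 1%:E)%E.
  move=> _; rewrite lee_fin; have /andP[h1 h2] := rest_itv j t.
  by rewrite ger0_norm.
have mrest j : measurable_fun setT (fun t => (rest j t)%:E).
  by apply/measurable_EFinP; exact: rest_measurable.
have := @dominated_cvg _ _ _ M setT measurableT (fun j t => (rest j t)%:E) (cst 0%E) (fun=> 1%:E)
  mrest c0 (fun _ _ => isT) Mi c1.
rewrite integral_cst// mul0e => h.
exact: (fine_cvg h).
Qed.

Variable phi : 'rV[R]_d -> R.
Hypothesis cphi : {within K, continuous phi}.

Lemma phi_extension : exists g : R -> R, exists2 B : R, 0 < B &
  [/\ forall t, A t -> g t = phi (d1 t), continuous g & forall t, `|g t| <= B].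
Proof.
have cpA : {within A, continuous (phi \o d1)}.
  apply/subspace_continuousP => t At.
  have /subspace_continuousP/(_ (d1 t) At) := cphi.
  apply: cvg_trans => P /= hP; move: hP; rewrite /within/= !nbhs_simpl => hP.
  exact: (@cd1 t _ hP).
have KC : compact K.
  by apply: bounded_closed_compact; [exact: bounded_closure|exact: closed_closure].
have := continuous_compact cphi KC => /compact_bounded [B [_ hB]].
have B0 : 0 < `|B| + 1 by rewrite ltr_wpDl.
have phiB t : A t -> `|(phi \o d1) t| <= `|B| + 1.
  move=> At; apply: (hB (`|B| + 1)); last by exists (d1 t).
  by rewrite (le_lt_trans (ler_norm _))// ltrDl.
have [g [gE cg gB]] := continuous_extension base_domain_closed B0 cpA phiB.
by exists g, (`|B| + 1).
Qed.

(** The recession part is continuous on the closed carrier, so weak convergence applies. The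
    oscillating part is replaced by its cut-off, a continuous test function, at a cost controlled by
    [rest] for every [m n] and for [M] alike. *)
Lemma transformed_cvg :
  \int[m n]_t (phi (d1 t) * transformed t) @[n --> \oo] -->
  \int[M]_t (phi (d1 t) * transformed t).
Proof.
have [g [B B0 [gE cg gB]]] := phi_extension.
have mg : measurable_fun setT g by exact: continuous_measurable_fun.
have [C2 C20 h2] := osc_part_bounded; have [C1 C10 h1] := rec_part_bounded.
pose rp t := if d1 t \in K then rec_part t else 0.
have mrp : measurable_fun setT rp by apply: within_patch_measurable; exact: rec_part_continuous.
have rpC t : `|rp t| <= C1.
  by rewrite /rp; case: ifPn => [|_]; [rewrite inE; exact: h1|rewrite normr0].
have mo := osc_part_measurable.
have bM (u v : R -> R) (Bu Bv : R) : (forall t, `|u t| <= Bu) -> (forall t, `|v t| <= Bv) ->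
    forall t, `|u t * v t| <= Bu * Bv.
  by move=> hu hv t; rewrite normrM ler_pM.
have split_ (nu : {measure set R -> \bar R}) : (nu setT < +oo)%E ->
    \int[nu]_t (phi (d1 t) * transformed t) = \int[nu]_t (g t * rp t) + \int[nu]_t (g t * osc_part t).
  move=> nufin; rewrite -RintegralD//.
  - apply: eq_Rintegral => t _; have [At|At] := pselect (A t).
      by rewrite -gE// /transformed mulrDr.
    have -> : osc_part t = 0 by apply: osc_part_out => Ot; apply: At; exact: subset_closure.
    by rewrite transformed_out// /rp memNset// !mulr0 addr0.
  - by apply: (bounded_integrable nufin (B := B * C1)); [exact: measurable_funM|exact: bM].
  - by apply: (bounded_integrable nufin (B := B * C2)); [exact: measurable_funM|exact: bM].
rewrite split_//; under eq_fun do rewrite split_//.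
apply: cvgD.
  apply: (@weak_limit_within _ m M C MC mM A base_domain_closed mA0 (fun t => g t * rp t) (B * C1)).
  - exact: measurable_funM.
  - apply/subspace_continuousP => t At; apply: cvgM.
      by apply: cvg_within_filter; exact: cg.
    have /subspace_continuousP/(_ t At) := rec_part_continuous.
    have -> : rp t = rec_part t by rewrite /rp mem_set.
    apply: cvg_trans; apply: near_eq_cvg; rewrite near_withinE.
    by apply: nearW => s As; rewrite /rp mem_set.
  - by move=> t _; exact: bM.
apply: cvg_approx => e e0.
have BC : 0 < 2 * B * (`|C| + 1) by rewrite !mulr_gt0// ltr_wpDl.
(* The constant part of [osc_part_bound] and the part proportional to [rest] are each given [e / 2];
   [B] bounds [phi] and [|C| + 1] the masses. *)
have eta0 : 0 < e / (2 * B * (`|C| + 1)) by rewrite divr_gt0.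
have [Ce Ce0 hCe] := osc_part_bound eta0.
set eta := e / _ in eta0 hCe.
have BCe : 0 < 2 * (B * Ce + 1) by rewrite mulr_gt0// ltr_wpDl// mulr_ge0// ltW.
have rho0 : 0 < e / (2 * (B * Ce + 1)) by rewrite divr_gt0.
have BCrho (x : R) : 0 <= x -> x < e / (2 * (B * Ce + 1)) -> B * Ce * x <= e / 2.
  move=> x0; rewrite ltr_pdivlMr// => hx.
  have : B * Ce * x <= (B * Ce + 1) * x by rewrite ler_wpM2r// lerDl.
  by move: hx; lra.
have Beta (x : R) : 0 <= x <= C -> B * eta * x <= e / 2.
  move=> /andP[x0 xC].
  have xC1 : x <= `|C| + 1 by rewrite (le_trans xC)// (le_trans (ler_norm _))// lerDl.
  have -> : e / 2 = B * eta * (`|C| + 1).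
    by rewrite /eta; field; rewrite !gt_eqF// ltr_wpDl.
  by rewrite ler_wpM2l// mulr_ge0// ltW.
have [j [hj1 hj2]] : exists j, r j < e / (2 * (B * Ce + 1)) /\
    \int[M]_t rest j t < e / (2 * (B * Ce + 1)).
  have /cvgrPdist_lt/(_ _ rho0) h1' := r0; have /cvgrPdist_lt/(_ _ rho0) h2' := rest_limit.
  have [j _ hj] := filterI h1' h2'; exists j; have [] := hj j (leqnn j).
  by rewrite !sub0r !normrN => hr hM; split; apply: le_lt_trans (ler_norm _) _.
have key (nu : {measure set R -> \bar R}) : (nu setT <= C%:E)%E ->
    \int[nu]_t rest j t < e / (2 * (B * Ce + 1)) ->
    `|\int[nu]_t (g t * osc_part t) - \int[nu]_t (g t * (b j t * osc_part t))| <= e.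
  move=> nuC nur.
  have nufin : (nu setT < +oo)%E by apply: le_lt_trans nuC _; rewrite ltry.
  have restb t : `|rest j t| <= 1.
    by have /andP[? ?] := rest_itv j t; rewrite ger0_norm.
  have cutb t : `|b j t * osc_part t| <= C2.
    rewrite normrM (ger0_norm (bump_ge0 _ _ _)) (le_trans _ (h2 t))//.
    by rewrite ler_piMl// bump_le1.
  have mcut : measurable_fun setT (fun t => b j t * osc_part t).
    by apply: continuous_measurable_fun; exact: cut_osc_continuous.
  have mre := rest_measurable j.
  have mh : measurable_fun setT (fun t => B * eta + B * Ce * rest j t).
    by apply: measurable_funD => //; exact: measurable_funM.
  have BCe0 : 0 <= B * Ce by rewrite mulr_ge0// ltW.
  have Beta0 : 0 <= B * eta by rewrite mulr_ge0// ltW.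
  apply: (@le_trans _ _ (\int[nu]_t (B * eta + B * Ce * rest j t))).
    apply: (@Rintegral_dist _ _ _ _ nufin _ _ _ (B * C2) (B * C2) (B * eta + B * Ce)) => //.
    - exact: measurable_funM.
    - exact: bM.
    - exact: measurable_funM.
    - exact: bM.
    - move=> t; have /andP[? ?] := rest_itv j t; rewrite ger0_norm.
        by rewrite lerD2l ler_piMr.
      by rewrite addr_ge0// mulr_ge0.
    - move=> t; have [Ot|Ot] := pselect (Omega (d1 t)); last first.
        by rewrite osc_part_out// !mulr0 subrr normr0 addr_ge0// mulr_ge0//; case/andP: (rest_itv j t).
      rewrite -mulrBr -{1}[osc_part t]mul1r -mulrBl 2!normrM.
      have b1 : 0 <= 1 - b j t by rewrite subr_ge0 bump_le1.
      have b1' : 1 - b j t <= 1 by rewrite gerBl bump_ge0.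
      rewrite (ger0_norm b1) /rest mem_set//.
      apply: (@le_trans _ _ (B * ((1 - b j t) * (eta + Ce * weight t)))).
        by rewrite ler_pM// ?mulr_ge0// ler_wpM2l.
      have := weight_ge0 t; rewrite -[B * Ce * _]mulrA -mulrDr => w0.
      rewrite ler_pM2l// mulrDr [X in _ + X <= _]mulrCA lerD2r ler_piMl//.
      exact: ltW.
  rewrite RintegralD//; last 2 first.
  - by apply: (bounded_integrable nufin (B := B * eta)) => // t; rewrite ger0_norm.
  - apply: (bounded_integrable nufin (B := B * Ce)); first exact: measurable_funM.
    by move=> t; rewrite normrM (ger0_norm BCe0) ler_piMr.
  rewrite Rintegral_cst// RintegralZl//; last exact: (bounded_integrable nufin mre restb).
  have x0 : 0 <= fine (nu setT) <= C.
    by rewrite fine_ge0//= -lee_fin fineK// ge0_fin_numE.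
  have y0 : 0 <= \int[nu]_t rest j t.
    by apply: Rintegral_ge0 => t _; case/andP: (rest_itv j t).
  by rewrite [leRHS]splitr; exact: lerD (Beta _ x0) (BCrho _ y0 nur).
exists (fun n => \int[m n]_t (g t * (b j t * osc_part t))).
  exists (\int[M]_t (g t * (b j t * osc_part t))); last exact: key.
  apply: (mM (B := B * C2)).
    by move=> t; apply: cvgM; [exact: cg|exact: cut_osc_continuous].
  apply: bM => // t; rewrite normrM (ger0_norm (bump_ge0 _ _ _)) (le_trans _ (h2 t))//.
  by rewrite ler_piMl// bump_le1.
by move=> n; apply: key => //; apply: le_lt_trans (mr n j) hj1.
Qed.

End convergence.
End transformed_integrand.

(** * Coding a position, a fast variable and a direction by one real parameter *)

Section coding.
Context (R : realType) (d : nat) (E : euclideanType R).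
Local Notation dE := (\dim (fullv : {vspace E})).
Hypothesis dimE : (0 < dE)%N.

Lemma coord_norm_le n (v : 'rV[R]_n) i : `|v ord0 i| <= `|v|.
Proof.
rewrite [leRHS]/Num.norm/= mx_normrE.
exact: (le_bigmax _ (fun ij => `|v ij.1 ij.2|%R) (ord0, i)).
Qed.

(* Lebesgue-type space-filling coordinates reduce weak-* compactness on a cube
   to measures on the line. *)
Lemma coding (r : R) : 0 < r ->
  exists (d1 d2 : R -> 'rV[R]_d) (d3 : R -> E),
  [/\ continuous d1, continuous d2, continuous d3, forall t, `|d3 t| <= 1 &
    forall disp (T : measurableType disp) (u y : T -> 'rV[R]_d) (w : T -> E),
      measurable_fun setT (u : T -> borel 'rV[R]_d) ->
      measurable_fun setT (y : T -> borel 'rV[R]_d) ->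
      measurable_fun setT (w : T -> borel E) ->
      (forall x, `|u x| <= r) -> (forall x i, 0 <= y x ord0 i <= 1) ->
      (forall x, `|w x| <= 1) ->
      exists c : T -> R, [/\ measurable_fun setT c, forall x, 0 <= c x <= 1,
        forall x, d1 (c x) = u x, forall x, d2 (c x) = y x & forall x, d3 (c x) = w x]].
Proof.
move=> r0; have [b b0 bP] := coords_bounded E.
pose N := (d + (d + dE))%N.
have N0 : (0 < N)%N by rewrite /N addnA ltn_addl.
pose e1 i : 'I_N := lshift (d + dE) i.
pose e2 i : 'I_N := rshift d (lshift dE i).
pose e3 i : 'I_N := rshift d (rshift d i).
pose g (t : R) : 'rV[R]_N := curve N t.
have cg i : continuous (fun t => g t ord0 i).
  by move=> t; rewrite /g /curve; under eq_fun do rewrite mxE; exact: curve_coord_continuous.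
pose D1 t : 'rV[R]_d := \row_i (2 * r * g t ord0 (e1 i) - r).
pose D2 t : 'rV[R]_d := \row_i g t ord0 (e2 i).
pose v t : 'rV[R]_dE := \row_i (2 * b * g t ord0 (e3 i) - b).
(* This retracts onto the closed unit ball, so that the bound holds at every parameter, also at
   those that code no point of the ball. *)
pose D3 t : E := (Num.max 1 `|of_coords (v t)|)^-1 *: of_coords (v t).
have caff (a c : R) i : continuous (fun t => a * g t ord0 i - c).
  by move=> t; apply: cvgB; [apply: cvgM; [exact: cvg_cst|exact: cg]|exact: cvg_cst].
have cv : continuous v.
  by apply: continuous_rV => i t; rewrite /v; under eq_fun do rewrite mxE; exact: caff.
have cov : continuous (fun t => of_coords (v t)).
  by move=> t; apply: continuous_comp; [exact: cv|exact: of_coords_continuous].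
have max0 t : 0 < Num.max 1 `|of_coords (v t)| by rewrite lt_max ltr01.
exists D1, D2, D3; split.
- by apply: continuous_rV => i t; rewrite /D1; under eq_fun do rewrite mxE; exact: caff.
- by apply: continuous_rV => i t; rewrite /D2; under eq_fun do rewrite mxE; exact: cg.
- move=> t; apply: cvgZ; last exact: cov.
  apply: cvgV; first by rewrite gt_eqF.
  apply: (@continuous_max R R (cst 1) (fun t => `|of_coords (v t)|)); first exact: cvg_cst.
  exact: (cvg_norm (cov t)).
- move=> t; rewrite normrZ normfV gtr0_norm// mulrC ler_pdivrMr// mul1r.
  by rewrite le_max lexx orbT.
move=> disp T u y w mu my mw ur y01 w1.
(* All coordinates are rescaled to [0, 1]: those of [u] are at most [r] in absolute value, those of
   [w] at most [b] by [coords_bounded]. *)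
pose Y x : 'rV[R]_N := row_mx (\row_i ((u x ord0 i + r) / (2 * r)))
   (row_mx (y x) (\row_i ((coords (w x) ord0 i + b) / (2 * b)))).
have r2 : 0 < 2 * r by rewrite mulr_gt0.
have b2 : 0 < 2 * b by rewrite mulr_gt0.
have unitb (a c : R) : 0 < c -> `|a| <= c -> 0 <= (a + c) / (2 * c) <= 1.
  move=> c0; rewrite ler_norml => /andP[h1 h2].
  have c2 : 0 < 2 * c by rewrite mulr_gt0.
  rewrite divr_ge0 ?(ltW c2)//=; last lra.
  rewrite ler_pdivrMr// mul1r; lra.
have Y01 x i : 0 <= Y x ord0 i <= 1.
  rewrite /Y; case: (split_ordP i) => [j ->|j ->]; rewrite ?row_mxEl ?row_mxEr.
    by rewrite mxE; apply: unitb => //; exact: le_trans (coord_norm_le _ _) (ur x).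
  case: (split_ordP j) => [k ->|k ->]; rewrite ?row_mxEl ?row_mxEr//.
  rewrite mxE; apply: unitb => //; apply: le_trans (coord_norm_le _ _) _.
  by apply: le_trans (bP _) _; rewrite ler_piMr// ltW.
have mY : measurable_fun setT (Y : T -> borel 'rV[R]_N).
  apply: measurable_fun_rV => // i; rewrite /Y.
  have mcu k : measurable_fun setT (fun x => u x ord0 k).
    exact: (measurableT_comp (rV_coord_measurable k) mu).
  have mcy k : measurable_fun setT (fun x => y x ord0 k).
    exact: (measurableT_comp (rV_coord_measurable k) my).
  have mcw k : measurable_fun setT (fun x => coords (w x) ord0 k).
    exact: (measurableT_comp (coord_measurable k) mw).
  case: (split_ordP i) => [j ->|j ->].
    under eq_fun do rewrite row_mxEl mxE.
    by apply: measurable_funM => //; exact: measurable_funD.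
  case: (split_ordP j) => [k ->|k ->].
    by under eq_fun do rewrite row_mxEr row_mxEl; exact: mcy.
  under eq_fun do rewrite row_mxEr row_mxEr mxE.
  by apply: measurable_funM => //; exact: measurable_funD.
exists (fun x => code (Y x)); split.
- exact: (code_measurable N0 mY Y01).
- by move=> x; have [] := codeP N0 (Y01 x).
- move=> x; have [_ gE _] := codeP N0 (Y01 x).
  apply/rowP => i; rewrite /D1 /g mxE gE /Y row_mxEl mxE.
  by field; rewrite gt_eqF.
- move=> x; have [_ gE _] := codeP N0 (Y01 x).
  by apply/rowP => i; rewrite /D2 /g mxE gE /Y row_mxEr row_mxEl.
- move=> x; have [_ gE _] := codeP N0 (Y01 x).
  have vE : of_coords (v (code (Y x))) = w x.
    rewrite -[RHS]coordsK; congr of_coords; apply/rowP => i.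
    rewrite /v /g mxE gE /Y row_mxEr row_mxEr mxE.
    by field; rewrite gt_eqF.
  by rewrite /D3 vE (max_idPl (w1 x)) invr1 scale1r.
Qed.

End coding.

Lemma continuous_rV_measurable (R : realType) n (u : R -> 'rV[R]_n) :
  continuous u -> measurable_fun setT (u : R -> borel 'rV[R]_n).
Proof.
move=> cu; apply: measurable_fun_rV => // i; apply: continuous_measurable_fun => t.
by apply: (@continuous_comp _ _ _ u (fun v : 'rV[R]_n => v ord0 i)); [exact: cu|exact: coord_continuous].
Qed.

(** * The weighted limit projects to Lebesgue measure on [Omega] times the torus *)

Section marginal.
Context (R : realType) (d : nat) (E : euclideanType R).
Local Notation L := (lebesgue_rV R d).
Local Notation X := (borel 'rV[R]_d).
Local Notation Z := (borel (torus R d)).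
Variables (Omega : set 'rV[R]_d).
Hypothesis openOmega : open Omega.
Hypothesis boundedOmega : bounded_set Omega.
Variables (d1 d2 : R -> 'rV[R]_d) (d3 : R -> E).
Hypothesis cd1 : continuous d1.
Hypothesis cd2 : continuous d2.
Hypothesis cd3 : continuous d3.
Hypothesis d3_le1 : forall t, `|d3 t| <= 1.
Variables (m : nat -> {measure set R -> \bar R}) (M : {measure set R -> \bar R}) (C : R).
Hypothesis mC : forall n, (m n setT <= C%:E)%E.
Hypothesis MC : (M setT <= C%:E)%E.
Hypothesis mM : forall (psi : R -> R) (B : R), continuous psi ->
  (forall x, `|psi x| <= B) -> \int[m n]_x psi x @[n --> \oo] --> \int[M]_x psi x.
Variables (eps : nat -> R) (c : nat -> X -> R).
Hypothesis eps_gt0 : forall n, 0 < eps n.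
Hypothesis eps_cvg0 : eps @ \oo --> (0 : R).
Hypothesis mc : forall n, measurable_fun setT (c n).
Hypothesis c1 : forall n x, Omega x -> d1 (c n x) = x.
Hypothesis c2 : forall n x, Omega x -> d2 (c n x) = frac ((eps n)^-1 *: x).
Hypothesis mE : forall n h, nnmeasurable h ->
  (\int[m n]_t (h t * (weight d3 t)%:E) = \int[L]_x (h (c n x) * (\1_Omega x)%:E))%E.
Variable LO : {finite_measure set X -> \bar R}.
Hypothesis LOE : forall h : X -> \bar R, nnmeasurable h ->
  (\int[LO]_x h x = \int[L]_x (h x * (\1_Omega x)%:E))%E.

Let mfin n : (m n setT < +oo)%E.
Proof. by apply: le_lt_trans (mC n) _; rewrite ltry. Qed.
Let Mfin : (M setT < +oo)%E.
Proof. by apply: le_lt_trans MC _; rewrite ltry. Qed.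
Let mO : measurable (Omega : set X). Proof. exact: borel_open. Qed.
Let md1 : measurable_fun setT (d1 : R -> X). Proof. exact: continuous_rV_measurable. Qed.
Let md2 : measurable_fun setT (d2 : R -> X). Proof. exact: continuous_rV_measurable. Qed.
Let w := weight d3.
Let w0 t : 0 <= w t. Proof. exact: weight_ge0. Qed.
Let w1 t : w t <= 1. Proof. exact: weight_le1. Qed.
Let cw : continuous w. Proof. exact: weight_continuous. Qed.
Let mw : measurable_fun setT w. Proof. exact: continuous_measurable_fun. Qed.

(** By [mE] the left side is the integral of [g w] against [m n], and [g w] is a bounded continuous
    test function. *)
Lemma weight_test (g : R -> R) : continuous g -> (forall t, 0 <= g t <= 1) ->
  (\int[L]_x ((g (c n x))%:E * (\1_Omega x)%:E))%E @[n --> \oo] -->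
  (\int[M]_t (g t * w t)%:E)%E.
Proof.
move=> cg g01.
have gw t : `|g t * w t| <= 1.
  have /andP[g0 g1] := g01 t; rewrite ger0_norm ?mulr_ge0//.
  by rewrite mulr_ile1.
have cgw : continuous (fun t => g t * w t).
  by move=> t; apply: cvgM; [exact: cg|exact: cw].
have mgw : measurable_fun setT (fun t => g t * w t) by exact: continuous_measurable_fun.
have mg : measurable_fun setT g by exact: continuous_measurable_fun.
have g0 t : 0 <= g t by case/andP: (g01 t).
rewrite (bounded_integralE Mfin mgw gw).
have -> : (fun n => \int[L]_x ((g (c n x))%:E * (\1_Omega x)%:E))%E =
    (fun n => (\int[m n]_t (g t * w t))%:E).
  apply/funext => n; rewrite -(bounded_integralE (mfin n) mgw gw).
  rewrite -(mE n (h := fun t => (g t)%:E)) //; exact: nnmeasurable_EFin.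
by apply: cvg_EFin; [exact: nearW|exact: (mM cgw gw)].
Qed.

Let bumpc (U : set 'rV[R]_d) (dd : R -> 'rV[R]_d) k : continuous dd ->
  continuous (fun t => bump U k (dd t)).
Proof. by move=> cdd t; apply: continuous_comp; [exact: cdd|exact: bump_continuous]. Qed.

Let mbump (U : set 'rV[R]_d) k : measurable_fun setT (fun x : X => bump U k x).
Proof. by apply: borel_continuousT_real; exact: bump_continuous. Qed.

Lemma marginal_bump (U V : set 'rV[R]_d) k : U `<=` Omega ->
  (\int[M]_t (bump (~` U) k (d1 t) * bump (~` V) k (d2 t) * w t)%:E =
   \int[L]_y ((bump (~` V) k y)%:E * (\1_(@cube R d) y)%:E) *
   \int[L]_x (bump (~` U) k x)%:E)%E.
Proof.
move=> UO.
have [B0 [_ OB]] := boundedOmega.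
have h : (\int[L]_x ((bump (~` U) k (d1 (c n x)) * bump (~` V) k (d2 (c n x)))%:E *
    (\1_Omega x)%:E))%E @[n --> \oo] -->
    (\int[M]_t (bump (~` U) k (d1 t) * bump (~` V) k (d2 t) * w t)%:E)%E.
  apply: (@weight_test (fun t => bump (~` U) k (d1 t) * bump (~` V) k (d2 t))).
    by move=> t; apply: cvgM; exact: bumpc.
  by move=> t; rewrite mulr_ge0 ?bump_ge0//= mulr_ile1 ?bump_ge0 ?bump_le1.
apply: (cvg_unique (@ereal_hausdorff R) h).
have -> : (fun n => \int[L]_x ((bump (~` U) k (d1 (c n x)) * bump (~` V) k (d2 (c n x)))%:E *
    (\1_Omega x)%:E))%E =
    (fun n => \int[L]_x (bump (~` U) k x * bump (~` V) k (frac ((eps n)^-1 *: x)))%:E)%E.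
  apply/funext => n; apply: eq_integral => x _.
  have [Ox|Ox] := pselect (Omega x); first by rewrite c1// c2// indicE mem_set// mule1.
  rewrite indicE memNset// mule0 bump_eq0 ?mul0r// => Ux.
  by apply: Ox; exact: UO.
have zero x : `|B0| + 1 < `|x| -> bump (~` U) k x = 0.
  move=> Bx; apply: bump_eq0 => /= /UO Ox.
  have : `|x| <= `|B0| + 1 by apply: OB => //; rewrite (le_lt_trans (ler_norm _))// ltrDl.
  by rewrite leNgt Bx.
have le01 y : 0 <= bump (~` V) k y <= 1 by rewrite bump_ge0 bump_le1.
exact: (@equidistribution R d (bump (~` U) k) k%:R (`|B0| + 1) (bump (~` V) k) 1 eps
  (mbump _ k) (bump_ge0 _ k) (ler0n _ _) (bump_lip _ k) zero (mbump _ k) le01 eps_gt0 eps_cvg0).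
Qed.

Local Open Scope ereal_scope.

Let bumpE_nd U (x : 'rV[R]_d) : nondecreasing_seq (fun k => (bump U k x)%:E).
Proof. by move=> i j ij; rewrite lee_fin; exact: bump_nd. Qed.

Let bump_limit U (x : 'rV[R]_d) : open U -> bump (~` U) k x @[k --> \oo] --> (\1_U x : R)%R.
Proof.
by move=> oU; have := bump_cvg (x := x) (open_closedC oU); rewrite setCK.
Qed.

Let L_fin (U : set X) : measurable U -> U `<=` Omega -> L U \is a fin_num.
Proof.
move=> mU UO; rewrite ge0_fin_numE//.
have [B0 [_ OB]] := boundedOmega.
apply: (@lebesgue_bounded R d U (`|B0| + 1)%R) => // x Ux i.
apply: le_trans (coord_norm_le _ _) _.
by apply: (OB (`|B0| + 1)%R _ x (UO x Ux)); rewrite (le_lt_trans (ler_norm _))// ltrDl.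
Qed.

Let Lc_fin (V : set X) : measurable V -> L (V `&` @cube R d) \is a fin_num.
Proof.
move=> mV; have mcu := @cube_measurable R d.
rewrite ge0_fin_numE//; apply: (@le_lt_trans _ _ (L (@cube R d))); last by rewrite lebesgue_cube ltry.
by apply: le_measure; rewrite ?inE//; exact: measurableI.
Qed.

(** Increasing limit in [k] of both sides of [marginal_bump]; the two Lebesgue measures are finite,
    which allows multiplying the limits. *)
Lemma marginal_open (U V : set 'rV[R]_d) : open U -> U `<=` Omega -> open V ->
  \int[M]_t (\1_U (d1 t) * \1_V (d2 t) * w t)%:E = L (V `&` @cube R d) * L U.
Proof.
move=> oU UO oV.
have mU : measurable (U : set X) by exact: borel_open.
have mV : measurable (V : set X) by exact: borel_open.
have mcu := @cube_measurable R d.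
pose h k (t : R) := (bump (~` U) k (d1 t) * bump (~` V) k (d2 t) * w t)%:E.
have nh k : nnmeasurable (h k).
  apply: nnmeasurable_EFin; last by move=> t; rewrite !mulr_ge0 ?bump_ge0.
  apply: continuous_measurable_fun => t.
  by apply: cvgM; [apply: cvgM; exact: bumpc|exact: cw].
have ndh t : nondecreasing_seq (h^~ t).
  move=> i j ij; rewrite lee_fin ler_wpM2r// ler_pM ?bump_ge0//; exact: bump_nd.
have cvM := @integral_monotone _ _ _ M _ nh ndh.
have limh t : limn (h^~ t) = (\1_U (d1 t) * \1_V (d2 t) * w t)%:E.
  apply/cvg_lim => //; apply: cvg_EFin; first exact: nearW.
  by apply: cvgM; [apply: cvgM; exact: bump_limit|exact: cvg_cst].
have nbU k : nnmeasurable (fun x : X => (bump (~` U) k x)%:E).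
  by apply: nnmeasurable_EFin => [|x]; [exact: mbump|exact: bump_ge0].
have nbV k : nnmeasurable (fun x : X => (bump (~` V) k x)%:E * (\1_(@cube R d) x)%:E).
  apply: nnmeasurableM; last exact: nnmeasurable_indic.
  by apply: nnmeasurable_EFin => [|x]; [exact: mbump|exact: bump_ge0].
have cvU : \int[L]_x (bump (~` U) k x)%:E @[k --> \oo] --> L U.
  have := @integral_monotone _ _ _ L _ nbU (bumpE_nd (~` U)).
  rewrite (_ : \int[L]_x limn _ = L U)//.
  transitivity (\int[L]_x (\1_U x)%:E); last by rewrite integral_indic// setIT.
  apply: eq_integral => x _; apply/cvg_lim => //.
  by apply: cvg_EFin; [exact: nearW|exact: bump_limit].
have cvV : \int[L]_x ((bump (~` V) k x)%:E * (\1_(@cube R d) x)%:E) @[k --> \oo] --> L (V `&` @cube R d).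
  have ndV (x : X) : nondecreasing_seq (fun k => (bump (~` V) k x)%:E * (\1_(@cube R d) x)%:E).
    by move=> i j ij; rewrite lee_wpmul2r ?lee_fin// ?indicE//; exact: bump_nd.
  have := @integral_monotone _ _ _ L _ nbV ndV.
  rewrite (_ : \int[L]_x limn _ = L (V `&` @cube R d))//.
  transitivity (\int[L]_x (\1_(V `&` @cube R d) x)%:E).
    apply: eq_integral => x _; apply/cvg_lim => //.
    rewrite indicI /=; under eq_fun do rewrite -EFinM.
    apply: cvg_EFin; first exact: nearW.
    by apply: cvgM; [exact: bump_limit|exact: cvg_cst].
  by rewrite integral_indic ?setIT//; exact: measurableI.
have cvP := cvgeM (_ : L (V `&` @cube R d) *? L U) cvV cvU.
have {}cvP : \int[M]_t h k t @[k --> \oo] --> L (V `&` @cube R d) * L U.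
  have -> : (fun k => \int[M]_t h k t) =
     (fun k => \int[L]_x ((bump (~` V) k x)%:E * (\1_(@cube R d) x)%:E)) \*
     (fun k => \int[L]_x (bump (~` U) k x)%:E).
    by apply/funext => k; exact: marginal_bump.
  by apply: cvP; apply: mule_def_fin; [exact: Lc_fin|exact: L_fin].
rewrite -(cvg_unique (@ereal_hausdorff R) cvM cvP).
by apply: eq_integral => t _; rewrite limh.
Qed.

Lemma marginal_total : \int[M]_t (w t)%:E = L Omega.
Proof.
have one01 (t : R) : (0 <= (cst 1 t : R) <= 1)%R by rewrite /= ler01 lexx.
have cc1 : continuous (cst 1%R : R -> R) by move=> t; exact: cvg_cst.
have := @weight_test (cst 1%R) cc1 one01.
have -> : (fun n => \int[L]_x ((cst 1%R (c n x))%:E * (\1_Omega x)%:E)) = cst (L Omega).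
  apply/funext => n; transitivity (\int[L]_x (\1_Omega x)%:E).
    by apply: eq_integral => x _; rewrite mul1e.
  by rewrite integral_indic// setIT.
move=> h; have := cvg_unique (@ereal_hausdorff R) h (cvg_cst _) => <-.
by apply: eq_integral => t _; rewrite mul1r.
Qed.

Let mdi (A : set X) (dd : R -> X) : measurable_fun setT dd -> measurable A ->
  measurable_fun setT (fun t => \1_A (dd t) : R).
Proof. by move=> mdd mA; apply: (measurableT_comp _ mdd); exact: measurable_indic. Qed.

(** The weighted mass of [M] is [L Omega] in total and also over [Omega], and it is finite: nothing
    is left for the boundary. *)
Lemma marginal_out : \int[M]_t ((\1_(~` Omega) (d1 t))%:E * (w t)%:E) = 0.
Proof.
have mOt : measurable (d1 @^-1` Omega) by rewrite -[X in measurable X]setTI; exact: md1.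
have nw : nnmeasurable (fun t => (w t)%:E) by exact: nnmeasurable_EFin.
have nO : nnmeasurable (fun t => (\1_Omega (d1 t) : R)%:E).
  by apply: nnmeasurable_EFin => [|t]; [exact: mdi|rewrite indicE].
have nOc : nnmeasurable (fun t => (\1_(~` Omega) (d1 t) : R)%:E).
  by apply: nnmeasurable_EFin => [|t]; [apply: mdi => //; exact: (measurableC mO)|rewrite indicE].
have := marginal_open openOmega (@subset_refl _ _) (@openT _).
rewrite setTI lebesgue_cube mul1e => hO.
have : \int[M]_t (w t)%:E = \int[M]_t (\1_Omega (d1 t) * \1_setT (d2 t) * w t)%:E +
   \int[M]_t ((\1_(~` Omega) (d1 t))%:E * (w t)%:E).
  rewrite -ge0_integralD//; last 4 first.
  - by move=> t _; rewrite lee_fin indicT mulr1 mulr_ge0// indicE.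
  - have [h _] := nnmeasurableM nO nw; move: h.
    by congr measurable_fun; apply/funext => t; rewrite indicT mulr1 EFinM.
  - by move=> t _; have [_ ->] := nnmeasurableM nOc nw.
  - by have [] := nnmeasurableM nOc nw.
  apply: eq_integral => t _; rewrite indicT mulr1 -EFinM -EFinD -mulrDl.
  by rewrite [\1_(~` _) _]indicE in_setC indicE; case: (_ \in _); rewrite /= ?addr0 ?add0r mul1r.
rewrite marginal_total hO.
have fO := L_fin mO (@subset_refl _ _); set y := \int[M]_t _ => e.
have : L Omega - L Omega = L Omega + y - L Omega by rewrite -e.
by rewrite subee// addeAC subee// add0e.
Qed.

Let LintE (S : set X) : measurable S -> L S = \int[L]_x (\1_S x)%:E.
Proof. by move=> mS; rewrite integral_indic// setIT. Qed.

Let LOA (A : set X) : measurable A -> LO A = L (A `&` Omega).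
Proof.
move=> mA; have := LOE (nnmeasurable_indic R mA); rewrite integral_indic// setIT => ->.
rewrite (LintE (measurableI _ _ mA mO)).
by apply: eq_integral => x _; rewrite -EFinM indicI.
Qed.

(** Uniqueness of measures from open sets, used twice: in the first variable with [V] open, then in
    the second with [A] arbitrary. *)
Let mE1 : forall A B : set X, measurable A -> measurable B ->
  \int[M]_t ((\1_A (d1 t))%:E * (\1_B (d2 t) * w t)%:E) = L (B `&` @cube R d) * LO A.
Proof.
have ind0 T (A : set T) x : (0 <= \1_A x :> R)%R by rewrite indicE.
have step1 (V : set 'rV[R]_d) (A : set X) : open V -> measurable A ->
    \int[M]_t ((\1_A (d1 t))%:E * (\1_V (d2 t) * w t)%:E) = L (V `&` @cube R d) * LO A.
  move=> oV; have mV : measurable (V : set X) by exact: borel_open.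
  have mVw : measurable_fun setT (fun t => \1_V (d2 t) * w t)%R.
    by apply: measurable_funM => //; exact: mdi.
  have [P PE] := image_density M md1 mVw (fun t => mulr_ge0 (ind0 _ _ _) (w0 t)).
  pose cV := fine (L (V `&` @cube R d)).
  have cV0 : (0 <= cV)%R by exact: fine_ge0.
  have mcO : measurable_fun setT (fun x : X => cV * \1_Omega x)%R.
    by apply: measurable_funM => //; exact: measurable_indic.
  have [P' PE'] := image_density L (@measurable_id _ X setT) mcO (fun t => mulr_ge0 cV0 (ind0 _ _ _)).
  have PA (B : set X) : measurable B -> P B = \int[M]_t ((\1_B (d1 t))%:E * (\1_V (d2 t) * w t)%:E).
    by move=> mB; rewrite -(PE _ (nnmeasurable_indic R mB)) integral_indic// setIT.
  have PA' (B : set X) : measurable B -> P' B = L (V `&` @cube R d) * LO B.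
    move=> mB; transitivity (\int[P']_x (\1_B x)%:E); first by rewrite integral_indic// setIT.
    rewrite (PE' _ (nnmeasurable_indic R mB)) -[L (V `&` _)](fineK (Lc_fin mV)) -/cV.
    rewrite LOA// (LintE (measurableI _ _ mB mO)).
    rewrite -ge0_integralZl//; last first.
      by apply/measurable_EFinP; apply: measurable_indic; exact: measurableI.
    by apply: eq_integral => x _; rewrite -!EFinM indicI /=; congr EFin; rewrite mulrCA.
  move=> mA; rewrite -PA// -PA'//.
  apply: measure_eq_open => //.
    rewrite PA//; apply: (@le_lt_trans _ _ (\int[M]_t 1%:E)); last by rewrite integral_cst// mul1e.
    apply: ge0_le_integral => //.
    - by move=> t _; rewrite -EFinM lee_fin !mulr_ge0.
    - by apply/measurable_EFinP; apply: measurable_funM => //; exact: mdi.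
    - move=> t _; rewrite -EFinM lee_fin indicT mul1r.
      have V1 : (\1_V (d2 t) <= 1 :> R)%R by rewrite indicE; case: (_ \in _).
      exact: mulr_ile1.
  move=> U oU; have mU : measurable (U : set X) by exact: borel_open.
  rewrite PA// PA'// LOA// -marginal_open//; last exact: openI.
  have nn1 : nnmeasurable (fun t => (\1_(U `&` Omega) (d1 t) * \1_V (d2 t) * w t)%:E).
    apply: nnmeasurable_EFin; last by move=> t; rewrite !mulr_ge0.
    by do !apply: measurable_funM => //; apply: mdi => //; exact: measurableI.
  have nn2 : nnmeasurable (fun t => (\1_U (d1 t))%:E * (\1_V (d2 t) * w t)%:E).
    split; last by move=> t; rewrite -EFinM lee_fin !mulr_ge0.
    by apply/measurable_EFinP; apply: measurable_funM => //; exact: mdi.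
  have nn3 : nnmeasurable (fun t => (\1_(~` Omega) (d1 t))%:E * (w t)%:E).
    split; last by move=> t; rewrite -EFinM lee_fin !mulr_ge0.
    by apply/measurable_EFinP; apply: measurable_funM => //; apply: mdi => //; exact: measurableC.
  (* The integrals over [U] and over its trace on [Omega] agree because the weight has no mass off
     [Omega]. *)
  apply/eqP; rewrite eq_le; apply/andP; split.
    rewrite -[leRHS]adde0 -marginal_out -ge0_integralD//; last 4 first.
    - by move=> t _; case: nn1.
    - by case: nn1.
    - by move=> t _; case: nn3.
    - by case: nn3.
    apply: ge0_le_integral => //.
    - by move=> t _; case: nn2.
    - by case: nn2.
    - by apply: emeasurable_funD; [case: nn1|case: nn3].
    move=> t _; rewrite -!EFinM -EFinD lee_fin.
    have := w0 t; rewrite !indicE in_setI in_setC.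
    by case: (_ \in U); case: (_ \in Omega); case: (_ \in V); rewrite /= => *; lra.
  apply: ge0_le_integral => //.
  - by move=> t _; case: nn1.
  - by case: nn1.
  - by case: nn2.
  - move=> t _; rewrite -!EFinM lee_fin.
    have := w0 t; rewrite !indicE in_setI.
    by case: (_ \in U); case: (_ \in Omega); case: (_ \in V); rewrite /= => *; lra.
move=> A B mA mB.
have mAw : measurable_fun setT (fun t => \1_A (d1 t) * w t)%R.
  by apply: measurable_funM => //; exact: mdi.
have [P PE] := image_density M md2 mAw (fun t => mulr_ge0 (ind0 _ _ _) (w0 t)).
have LOf : LO A \is a fin_num by exact: fin_num_measure.
pose cA := fine (LO A).
have cA0 : (0 <= cA)%R by exact: fine_ge0.
have mcO : measurable_fun setT (fun x : X => cA * \1_(@cube R d) x)%R.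
  by apply: measurable_funM => //; apply: measurable_indic; exact: cube_measurable.
have [P' PE'] := image_density L (@measurable_id _ X setT) mcO (fun t => mulr_ge0 cA0 (ind0 _ _ _)).
have PA (V : set X) : measurable V -> P V = \int[M]_t ((\1_A (d1 t))%:E * (\1_V (d2 t) * w t)%:E).
  move=> mV; transitivity (\int[P]_x (\1_V x)%:E); first by rewrite integral_indic// setIT.
  rewrite (PE _ (nnmeasurable_indic R mV)); apply: eq_integral => t _.
  by rewrite -!EFinM mulrCA.
have PA' (V : set X) : measurable V -> P' V = L (V `&` @cube R d) * LO A.
  move=> mV; have mcu := @cube_measurable R d.
  transitivity (\int[P']_x (\1_V x)%:E); first by rewrite integral_indic// setIT.
  rewrite (PE' _ (nnmeasurable_indic R mV)) -[LO A](fineK LOf) -/cA muleC.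
  rewrite (LintE (measurableI _ _ mV mcu)).
  rewrite -ge0_integralZl//; last first.
    by apply/measurable_EFinP; apply: measurable_indic; exact: measurableI.
  by apply: eq_integral => x _; rewrite -!EFinM indicI /=; congr EFin; rewrite mulrCA.
rewrite -PA// -PA'//; apply: measure_eq_open => //.
  by rewrite PA// (step1 setT A (@openT _) mA) -[LO A](fineK LOf) -[L _](fineK (Lc_fin (@measurableT _ X))) -EFinM ltry.
move=> V oV; have mV : measurable (V : set X) by exact: borel_open.
by rewrite PA// PA'// step1.
Qed.

Lemma marginal_product (h : X * Z -> \bar R) : nnmeasurable h ->
  \int[M]_t (h (d1 t, torus_class (d2 t)) * (w t)%:E) = \int[LO \x lebesgue_torus R d]_p h p.
Proof.
move=> nh.
have mcl := @torus_class_measurable R d.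
have mcd2 : measurable_fun setT (fun t => torus_class (d2 t) : Z).
  exact: (measurableT_comp mcl md2).
have mp : measurable_fun setT (fun t => (d1 t, torus_class (d2 t)) : X * Z).
  exact: measurable_fun_pair.
have [P PE] := image_density M mp mw w0.
rewrite -PE//; apply/esym; apply: eq_measure_integral => A mA _.
apply: (@product_measure_unique _ _ X Z R LO (lebesgue_torus R d) P) => // {mA}A B mA mB.
transitivity (\int[P]_p (\1_(A `*` B) p)%:E).
  by rewrite integral_indic ?setIT//; exact: measurableX.
rewrite (PE _ (nnmeasurable_indic R (measurableX mA mB))).
have mB' : measurable (@torus_class R d @^-1` B : set X).
  by rewrite -[X in measurable X]setTI; exact: mcl.
transitivity (\int[M]_t ((\1_A (d1 t))%:E * (\1_(@torus_class R d @^-1` B) (d2 t) * w t)%:E)).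
  apply: eq_integral => t _; rewrite -!EFinM mulrA; congr (_ * _)%:E.
  rewrite !indicE -natrM mulnb; congr (nat_of_bool _)%:R.
  by apply/idP/andP; rewrite !inE.
rewrite mE1// muleC; congr (_ * _).
by rewrite /lebesgue_torus setIC.
Qed.

End marginal.

(** * Construction of the Young measure by disintegration *)

Lemma nn_tonelli (R : realType) dd1 dd2 (T1 : measurableType dd1) (T2 : measurableType dd2)
    (m1 : {sigma_finite_measure set T1 -> \bar R}) (m2 : {sigma_finite_measure set T2 -> \bar R})
    (G : T1 * T2 -> \bar R) : nnmeasurable G ->
  (\int[m1 \x m2]_p G p = \int[m1]_x \int[m2]_y G (x, y))%E.
Proof. by move=> [mG G0]; rewrite (fubini_tonelli1 _ mG). Qed.

Section null_sets.
Context d (T : measurableType d) (R : realType) (m : {measure set T -> \bar R}).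
Local Open Scope ereal_scope.

Lemma nnintegral_eq_off_null (f g : T -> \bar R) (N : set T) :
  nnmeasurable f -> nnmeasurable g -> measurable N -> m N = 0 ->
  (forall x, ~ N x -> f x = g x) -> \int[m]_x f x = \int[m]_x g x.
Proof.
move=> [mf f0] [mg g0] mN N0 fg.
rewrite (ge0_negligible_integral mN)// [RHS](ge0_negligible_integral mN)//.
by apply: eq_integral => x; rewrite inE => -[_ Nx]; exact: fg.
Qed.

Lemma null_infinite (f : T -> \bar R) : nnmeasurable f -> \int[m]_x f x < +oo ->
  measurable [set x | f x = +oo] /\ m [set x | f x = +oo] = 0.
Proof.
move=> [mf f0] foo.
have mS : measurable [set x | f x = +oo].
  have := emeasurable_fin_num measurableT mf => /measurableC.
  congr measurable; rewrite setTI; apply/seteqP; split => x /=.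
    by have := f0 x; case: (f x).
  by move=> ->.
split => //.
have fi : m.-integrable setT f.
  apply/integrableP; split => //.
  by under eq_integral do rewrite gee0_abs//.
have [N [mN N0 fN]] := integrable_ae measurableT fi.
apply: (subset_measure0 mS mN _ N0) => x /= fx; apply: fN => /= /(_ Logic.I).
by rewrite fx.
Qed.

End null_sets.

(** At 0, where the inverse is 0 by convention, the continuous approximations vanish too. *)
Lemma measurable_invr (R : realType) : measurable_fun setT (fun x : R => x^-1).
Proof.
apply: (@measurable_fun_cvg _ _ R setT (fun n (x : R) => x / (x ^+ 2 + (n.+1%:R)^-1))).
  move=> n; apply: continuous_measurable_fun => x.
  apply: cvgM; first exact: cvg_id.
  apply: cvgV; first by rewrite gt_eqF// ltr_wpDl ?sqr_ge0// invr_gt0.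
  by apply: cvgD; [exact: exprn_continuous|exact: cvg_cst].
move=> x _; have [->|x0] := eqVneq x 0.
  by under eq_fun do rewrite mul0r; rewrite invr0; exact: cvg_cst.
rewrite (_ : x^-1 = x / (x ^+ 2 + 0)); last by rewrite addr0 expr2 invfM mulrA mulfV// mul1r.
apply: cvgM; first exact: cvg_cst.
apply: cvgV; first by rewrite addr0 expf_neq0.
by apply: cvgD; [exact: cvg_cst|exact: cvg_harmonic].
Qed.

Section young_measure_of.
Context (R : realType) (d : nat) (E : euclideanType R).
Local Notation L := (lebesgue_rV R d).
Local Notation X := (borel 'rV[R]_d).
Local Notation Z := (borel (torus R d)).
Local Notation Lt := (lebesgue_torus R d).
Hypothesis dimE : (0 < \dim (fullv : {vspace E}))%N.
Variables (Omega : set 'rV[R]_d).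
Hypothesis openOmega : open Omega.
Variables (d1 d2 : R -> 'rV[R]_d) (d3 : R -> E).
Hypothesis cd1 : continuous d1.
Hypothesis cd2 : continuous d2.
Hypothesis cd3 : continuous d3.
Hypothesis d3_le1 : forall t, `|d3 t| <= 1.
Variables (M : {measure set R -> \bar R}).
Hypothesis Mfin : (M setT < +oo)%E.
Hypothesis M01 : M (~` `[0, 1]%classic) = 0%E.
Hypothesis MA : M (~` (d1 @^-1` closure Omega)) = 0%E.
Variable LO : {finite_measure set X -> \bar R}.
Hypothesis LOE : forall h : X -> \bar R, nnmeasurable h ->
  (\int[LO]_x h x = \int[L]_x (h x * (\1_Omega x)%:E))%E.
Hypothesis marginal : forall h : X * Z -> \bar R, nnmeasurable h ->
  (\int[M]_t (h (d1 t, torus_class (d2 t)) * (weight d3 t)%:E) = \int[LO \x Lt]_p h p)%E.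

Local Notation w := (weight d3).
Let mw : measurable_fun setT w.
Proof. by apply: continuous_measurable_fun; exact: weight_continuous. Qed.
Let w0 t : 0 <= w t. Proof. exact: weight_ge0. Qed.
Let w1 t : w t <= 1. Proof. exact: weight_le1. Qed.
Let mO : measurable (Omega : set X). Proof. exact: borel_open. Qed.
Let mK : measurable (closure Omega : set X).
Proof. by apply: borel_closed; exact: closed_closure. Qed.
Let md1 : measurable_fun setT (d1 : R -> X). Proof. exact: continuous_rV_measurable. Qed.
Let md2 : measurable_fun setT (d2 : R -> X). Proof. exact: continuous_rV_measurable. Qed.
Let mcd2 : measurable_fun setT (fun t => torus_class (d2 t) : Z).
Proof. exact: (measurableT_comp (@torus_class_measurable R d) md2). Qed.
Let mp : measurable_fun setT (fun t => (d1 t, torus_class (d2 t)) : X * Z).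
Proof. exact: measurable_fun_pair. Qed.

Lemma euclid_measurable : measurable_fun setT (d3 : R -> borel E).
Proof.
apply: measurable_fun_euclidean => // i; apply: continuous_measurable_fun => t.
apply: (@continuous_comp _ _ _ d3 (fun z => coords z ord0 i)); first exact: cd3.
apply: (@continuous_comp _ _ _ (@coords R E) (fun v => v ord0 i)); first exact: coords_continuous.
exact: coord_continuous.
Qed.

Lemma scale_euclid_measurable disp (T : measurableType disp) (a : T -> R) (u : T -> E) :
  measurable_fun setT a -> measurable_fun setT (u : T -> borel E) ->
  measurable_fun setT ((fun x => a x *: u x) : T -> borel E).
Proof.
move=> ma mu; apply: measurable_fun_euclidean => // i.
under eq_fun do rewrite coordsZ mxE.
by apply: measurable_funM => //; exact: (measurableT_comp (coord_measurable i) mu).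
Qed.

Lemma zeta_measurable : measurable_fun setT (zeta d3 : R -> borel E).
Proof.
apply: scale_euclid_measurable; last exact: euclid_measurable.
exact: (measurableT_comp (@measurable_invr R) mw).
Qed.

Local Open Scope ereal_scope.

Lemma zeta_weight_le1 t : (`|zeta d3 t| * w t <= 1)%R.
Proof.
rewrite /zeta normrZ normfV ger0_norm//.
have [->|w_neq0] := eqVneq (w t) 0%R; first by rewrite mulr0 ler01.
by rewrite mulrC mulrA mulfV// mul1r.
Qed.

(** The parameter [t] itself is disintegrated over [pi t], so that any function of [t], such as
    [zeta] or [d3], can afterwards be evaluated under the conditional law. *)
Lemma disintegrate_over disp (S : measurableType disp) (pi : R -> S) (g : R -> R)
    (ms : {measure set S -> \bar R}) :
  measurable_fun setT pi -> measurable_fun setT g -> (forall t, 0 <= g t <= 1)%R ->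
  (forall A, measurable A -> \int[M]_t ((\1_A (pi t))%:E * (g t)%:E) = ms A) ->
  exists Q : S * R -> R, measurable_fun setT Q /\
    forall G : S * R -> \bar R, nnmeasurable G ->
      \int[M]_t (G (pi t, t) * (g t)%:E) =
      \int[ms]_s \int[lebesgue_measure]_u (G (s, Q (s, u)) * (unit_weight u)%:E).
Proof.
move=> mpi mg g01 msE.
have g0 t : (0 <= g t)%R by case/andP: (g01 t).
have mpt : measurable_fun setT (fun t => (pi t, t)) by exact: measurable_fun_pair.
have [P PE] := image_density M mpt mg g0.
have gM (B : set R) : measurable B -> \int[M]_t ((\1_B t)%:E * (g t)%:E) <= M B.
  move=> mB; apply: (@le_trans _ _ (\int[M]_t (\1_B t)%:E)); last by rewrite integral_indic// setIT.
  apply: ge0_le_integral => //.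
  - by move=> t _; rewrite -EFinM lee_fin mulr_ge0// indicE.
  - by apply/measurable_EFinP; apply: measurable_funM => //; exact: measurable_indic.
  - by apply/measurable_EFinP; exact: measurable_indic.
  - by move=> t _; rewrite -EFinM lee_fin ler_piMr ?indicE//; case/andP: (g01 t).
have msfin : ms setT < +oo.
  rewrite -msE//; apply: le_lt_trans Mfin; apply: le_trans (gM setT measurableT).
  rewrite le_eqVlt; apply/orP; left; apply/eqP.
  by apply: eq_integral => t _; rewrite !indicT.
have P1 A : measurable A -> P (A `*` setT) = ms A.
  move=> mA; rewrite -msE//.
  transitivity (\int[P]_p (\1_(A `*` setT) p)%:E).
    by rewrite integral_indic ?setIT//; exact: measurableX.
  rewrite (PE _ (nnmeasurable_indic R (measurableX mA measurableT))).
  apply: eq_integral => t _; congr (_%:E * _); rewrite !indicE; congr (nat_of_bool _)%:R.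
  by apply/idP/idP; rewrite !inE => // -[].
have mI : measurable (~` `[0%R, 1%R]%classic : set R) by exact: measurableC.
have P2 : P (setT `*` ~` `[0%R, 1%R]%classic) = 0.
  transitivity (\int[P]_p (\1_(setT `*` ~` `[0%R, 1%R]%classic) p)%:E).
    by rewrite integral_indic ?setIT//; exact: measurableX.
  rewrite (PE _ (nnmeasurable_indic R (measurableX measurableT mI))).
  apply/eqP; rewrite eq_le; apply/andP; split; last first.
    by apply: integral_ge0 => t _; rewrite -EFinM lee_fin mulr_ge0// indicE.
  have := gM _ mI; rewrite M01; apply: le_trans.
  rewrite le_eqVlt; apply/orP; left; apply/eqP; apply: eq_integral => t _.
  congr (_%:E * _); rewrite !indicE; congr (nat_of_bool _)%:R.
  by apply/idP/idP; rewrite !inE => // -[].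
have [Q [mQ QE]] := disintegration msfin P1 P2.
by exists Q; split => // G nG; rewrite -QE// PE.
Qed.

Lemma ex_unit_vector : exists e0 : E, (`|e0| = 1)%R.
Proof.
have [z z0] : exists z : E, z != 0%R.
  exists (vbasis (fullv : {vspace E}))`_0.
  have := basis_free (vbasisP (fullv : {vspace E})) => /free_not0; apply.
  by apply: mem_nth; rewrite size_tuple.
exists (`|z|^-1 *: z)%R; rewrite normrZ normfV normr_id mulVf//.
by rewrite normr_eq0.
Qed.

(** The measure [w M] projects to a product of Lebesgue measures, and [nu] is the conditional law of
    [zeta]. The kernel is altered on a null set to make first moments finite at every point, because
    signed integrands will be split into two parts pointwise. *)
Lemma ex_oscillation : exists nu : X * Z -> probability (borel E) R,
  [/\ forall G : X * Z * borel E -> \bar R, nnmeasurable G ->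
        nnmeasurable (fun p => \int[nu p]_z G (p, z)),
      (forall p, \int[nu p]_z `|z|%:E < +oo) /\
      (forall x, \int[Lt]_xi \int[nu (x, xi)]_z `|z|%:E < +oo),
      \int[L \x Lt]_(p in closure Omega `*` setT) \int[nu p]_z `|z|%:E < +oo &
      forall G : X * Z * borel E -> \bar R, nnmeasurable G ->
        \int[M]_t (G (d1 t, torus_class (d2 t), zeta d3 t) * (w t)%:E) =
        \int[L]_x (\int[Lt]_xi \int[nu (x, xi)]_z G (x, xi, z) * (\1_Omega x)%:E)].
Proof.
pose m0 : {measure set (X * Z) -> \bar R} := LO \x Lt.
have m0E (A : set (X * Z)%type) : measurable A ->
    \int[M]_t ((\1_A (d1 t, torus_class (d2 t)))%:E * (w t)%:E) = m0 A.
  move=> mA; rewrite (marginal (nnmeasurable_indic R mA)).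
  by rewrite integral_indic// setIT.
have w01 t : (0 <= w t <= 1)%R by rewrite w0 w1.
have [Q [mQ QE]] := disintegrate_over mp mw w01 m0E.
have mzQ : measurable_fun setT (fun q : X * Z * R => zeta d3 (Q q) : borel E).
  exact: (measurableT_comp zeta_measurable mQ).
have muw : nnmeasurable (fun u : R => (unit_weight u)%:E).
  by apply: nnmeasurable_EFin; [exact: unit_weight_measurable|exact: unit_weight_ge0].
have nnorm : nnmeasurable (fun z : borel E => (`|z|%R)%:E).
  by apply: nnmeasurable_EFin => //; exact: norm_measurable.
pose a p := \int[lebesgue_measure]_u (`|zeta d3 (Q (p, u))|%:E * (unit_weight u)%:E).
have na : nnmeasurable a.
  apply: (@nnmeasurable_fubini _ _ _ _ (measurableTypeR R) lebesgue_measure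
    (fun q : X * Z * R => (`|zeta d3 (Q q)|%R)%:E * (unit_weight q.2)%:E)).
  apply: nnmeasurableM.
    exact: (@nnmeasurable_comp _ _ _ _ _ _ _ mzQ nnorm).
  exact: (@nnmeasurable_comp _ _ _ _ _ _ _ (@measurable_snd _ _ _ _) muw).
pose b x := \int[Lt]_xi a (x, xi).
have nb : nnmeasurable b by exact: (@nnmeasurable_fubini _ _ _ _ _ Lt).
(* Since [|zeta| w <= 1], the total first moment is at most the mass of [M]. *)
have ia : \int[m0]_p a p < +oo.
  rewrite -(QE (fun q => (`|zeta d3 q.2|%R)%:E)); last first.
    by apply: (@nnmeasurable_comp _ _ _ _ _ snd (fun t => (`|zeta d3 t|%R)%:E)) => //;
      exact: (@nnmeasurable_comp _ _ _ _ _ _ _ zeta_measurable nnorm).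
  apply: (@le_lt_trans _ _ (\int[M]_t 1%:E)); last by rewrite integral_cst// mul1e.
  apply: ge0_le_integral => //.
  - by move=> t _; rewrite -EFinM lee_fin mulr_ge0.
  - apply/measurable_EFinP; apply: measurable_funM => //.
    exact: (measurableT_comp (@norm_measurable R E) zeta_measurable).
  - by move=> t _; rewrite -EFinM lee_fin zeta_weight_le1.
have ib : \int[LO]_x b x < +oo.
  by rewrite -(nn_tonelli LO Lt na).
have [mNa Na0] := null_infinite na ia.
have [mNb Nb0] := null_infinite nb ib.
(* On [bad] the kernel becomes the Dirac mass at 0. Including the complement of [Omega] makes the
   moment vanish over the boundary, so integrability over the closure follows from that over
   [Omega]. *)
pose bad : set (X * Z) := [set p | a p = +oo] `|` ([set x | b x = +oo] `|` ~` Omega) `*` setT.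
have mOc : measurable (~` Omega : set X) by exact: (measurableC mO).
have mS : measurable ([set x | b x = +oo] `|` ~` Omega : set X) by exact: measurableU.
have mST : measurable (([set x | b x = +oo] `|` ~` Omega) `*` setT : set (X * Z)%type).
  exact: measurableX.
have mbad : measurable bad by exact: measurableU.
have LOc : LO (~` Omega) = 0.
  have := LOE (nnmeasurable_indic R mOc).
  rewrite integral_indic ?setIT// => ->.
  apply: integral0_eq => x _; rewrite -EFinM !indicE in_setC.
  by case: (_ \in _); rewrite /= ?mul0r ?mulr0.
have bad0 : m0 bad = 0.
  have U2 : m0 bad <= m0 [set p | a p = +oo] + m0 (([set x | b x = +oo] `|` ~` Omega) `*` setT).
    exact: measureU2.
  apply/eqP; rewrite -measure_le0; apply: (le_trans U2).
  rewrite Na0 add0e.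
  have -> : m0 (([set x | b x = +oo] `|` ~` Omega) `*` setT) =
      LO ([set x | b x = +oo] `|` ~` Omega) * Lt setT by exact: product_measure1E.
  have -> : LO ([set x | b x = +oo] `|` ~` Omega) = 0; last by rewrite mul0e.
  have U3 : LO ([set x | b x = +oo] `|` ~` Omega) <= LO [set x | b x = +oo] + LO (~` Omega).
    exact: measureU2.
  apply/eqP; rewrite -measure_le0; apply: (le_trans U3).
  by rewrite Nb0 LOc adde0.
have mgood : measurable_fun setT (fun p => \1_(~` bad) p : R).
  by apply: measurable_indic; exact: measurableC.
pose kap (q : X * Z * R) : borel E := (\1_(~` bad) q.1 *: zeta d3 (Q q))%R.
have mkap : measurable_fun setT kap.
  apply: scale_euclid_measurable => //.
  exact: (measurableT_comp mgood (@measurable_fst _ _ _ _)).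
have kapE p u : ~ bad p -> kap (p, u) = zeta d3 (Q (p, u)).
  by move=> pb; rewrite /kap /= indicE mem_set// scale1r.
have kap0 p u : bad p -> kap (p, u) = 0%R.
  by move=> pb; rewrite /kap /= indicE memNset ?scale0r//; exact.
have [nu [nuE nuM]] := law_kernel mkap.
have al p : \int[nu p]_z `|z|%:E = if p \in bad then 0 else a p.
  rewrite nuE//; case: ifPn => [|]; rewrite ?inE ?notin_setE => pb.
    by rewrite integral0_eq// => u _; rewrite kap0// normr0 mul0e.
  by apply: eq_integral => u _; rewrite kapE.
have a0 p : 0 <= a p by case: na.
have al_le p : \int[nu p]_z `|z|%:E <= a p by rewrite al; case: ifP.
have nal : nnmeasurable (fun p => \int[nu p]_z `|z|%:E).
  apply: (nuM (fun q => (`|q.2|%R)%:E)).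
  exact: (@nnmeasurable_comp _ _ _ _ _ _ _ (@measurable_snd _ _ _ _) nnorm).
exists nu; split => //.
- split.
    move=> p; rewrite al; case: ifPn; rewrite ?ltry// notin_setE => pb.
    by rewrite ltey; apply/eqP => ap; apply: pb; left.
  move=> x; have [bx|bx] := eqVneq (b x) +oo.
    rewrite integral0_eq ?ltry// => xi _; rewrite al mem_set//.
    by right; split => //; left.
  apply: (@le_lt_trans _ _ (b x)); last by rewrite ltey.
  apply: ge0_le_integral => //.
  + by move=> xi _; exact: integral_ge0.
  + by case: nal => [h _]; apply: (measurableT_comp h); exact: measurable_pair1.
  + by case: na => [h _]; apply: (measurableT_comp h); exact: measurable_pair1.
- have [mal al0] := nal.
  apply: (@le_lt_trans _ _ (\int[L \x Lt]_p \int[nu p]_z `|z|%:E)).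
    by apply: ge0_subset_integral => //; exact: measurableX.
  rewrite (nn_tonelli L Lt nal); apply: le_lt_trans ib.
  rewrite LOE//; apply: ge0_le_integral => //.
  + by move=> x _; exact: integral_ge0.
  + by case: (nnmeasurable_fubini Lt nal).
  + have nO := nnmeasurable_indic R mO.
    by have [] := nnmeasurableM nb nO.
  + move=> x _; have [Ox|Ox] := pselect (Omega x); last first.
      rewrite integral0_eq; first by rewrite mule_ge0 ?lee_fin ?indicE//; case: nb.
      by move=> xi _; rewrite al mem_set//; right; split => //; right.
    rewrite indicE mem_set// mule1; apply: ge0_le_integral => //.
    * by case: nal => [h _]; apply: (measurableT_comp h); exact: measurable_pair1.
    * by case: na => [h _]; apply: (measurableT_comp h); exact: measurable_pair1.
move=> G nG.
have nnuG := nuM _ nG.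
pose G' (q : X * Z * R) := G (q.1, zeta d3 q.2).
have nG' : nnmeasurable G'.
  apply: (@nnmeasurable_comp _ _ _ _ _ (fun q : X * Z * R => (q.1, zeta d3 q.2 : borel E))) => //.
  apply: measurable_fun_pair => //.
  exact: (measurableT_comp zeta_measurable (@measurable_snd _ _ _ _)).
rewrite (QE G')//.
transitivity (\int[m0]_p \int[nu p]_z G (p, z)).
  apply: (nnintegral_eq_off_null (N := bad)) => //.
    apply: (@nnmeasurable_fubini _ _ _ _ (measurableTypeR R) lebesgue_measure
      (fun q : X * Z * R => G (q.1, zeta d3 (Q q)) * (unit_weight q.2)%:E)).
    apply: nnmeasurableM.
      apply: (@nnmeasurable_comp _ _ _ _ _ (fun q : X * Z * R => (q.1, zeta d3 (Q q) : borel E))) => //.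
      exact: measurable_fun_pair.
    exact: (@nnmeasurable_comp _ _ _ _ _ _ _ (@measurable_snd _ _ _ _) muw).
  move=> p pb; rewrite nuE.
    by apply: eq_integral => u _; rewrite kapE.
  by apply: nnmeasurable_comp nG; exact: measurable_pair1.
have [mnuG nuG0] := nnuG.
rewrite /m0 (nn_tonelli LO Lt nnuG) LOE//.
exact: (@nnmeasurable_fubini _ _ _ _ _ Lt _ nnuG).
Qed.


(** The restriction of [M] to the sphere is disintegrated over the position, which gives [lam] and
    [rho], and over position and fast variable, which gives [nui]. The projection [m2] used in the
    second is recovered from [lam] and [rho] by the first. *)
Lemma ex_concentration : exists (lam : {finite_measure set X -> \bar R})
    (rho : X -> probability Z R) (nui : X * Z -> probability (borel E) R),
  [/\ lam (~` closure Omega) = 0,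
      forall G : X * Z -> \bar R, nnmeasurable G ->
        nnmeasurable (fun x => \int[rho x]_xi G (x, xi)),
      (forall G : X * Z * borel E -> \bar R, nnmeasurable G ->
        nnmeasurable (fun p => \int[nui p]_z G (p, z))) /\
      (forall p, nui p (unit_sphere E) = 1) &
      forall G : X * Z * borel E -> \bar R, nnmeasurable G ->
        \int[M]_t (G (d1 t, torus_class (d2 t), d3 t) * (\1_[set t | `|d3 t|%R = 1%R] t)%:E) =
        \int[lam]_x \int[rho x]_xi \int[nui (x, xi)]_z G (x, xi, z)].
Proof.
pose S := [set t | `|d3 t|%R = 1%R].
have md3 := euclid_measurable.
have mUS := @unit_sphere_measurable R E.
have mS : measurable S by have := md3 measurableT _ mUS; rewrite setTI.
have mg : measurable_fun setT (\1_S : R -> R) by exact: measurable_indic.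
have g01 t : (0 <= (\1_S t : R) <= 1)%R by rewrite indicE; case: (_ \in _); rewrite ?ler01 ?lexx.
have g0 t : (0 <= \1_S t :> R)%R by case/andP: (g01 t).
have [lam0 lam0E] := image_density M md1 mg g0.
have lam0A (A : set X) : measurable A -> \int[M]_t ((\1_A (d1 t))%:E * (\1_S t)%:E) = lam0 A.
  by move=> mA; rewrite -(lam0E _ (nnmeasurable_indic R mA)) integral_indic// setIT.
have le_M (A : set X) (B : set R) : measurable A -> measurable B -> d1 @^-1` A `<=` B -> lam0 A <= M B.
  move=> mA mB AB; rewrite -lam0A//.
  apply: (@le_trans _ _ (\int[M]_t (\1_B t)%:E)); last by rewrite integral_indic// setIT.
  have mi : measurable_fun setT (fun t => \1_A (d1 t) : R).
    by apply: (measurableT_comp _ md1); exact: measurable_indic.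
  apply: ge0_le_integral => //.
  - by apply/measurable_EFinP; exact: measurable_funM.
  - by apply/measurable_EFinP; exact: measurable_indic.
  - move=> t _; rewrite -EFinM lee_fin; have /andP[_ S1] := g01 t.
    have [At|At] := pselect (A (d1 t)); last by rewrite [\1_A _]indicE memNset// mul0r indicE.
    have Bt : B t by exact: AB.
    by rewrite [\1_A _]indicE (mem_set At) mul1r [\1_B _]indicE (mem_set Bt).
have lam0fin : lam0 setT < +oo by apply: le_lt_trans Mfin; exact: le_M.
pose lam := finite_measure_of (measure_fin_num_fun lam0fin).
have lamA (A : set X) : measurable A -> \int[M]_t ((\1_A (d1 t))%:E * (\1_S t)%:E) = lam A by exact: lam0A.
have [Q2 [mQ2 Q2E]] := disintegrate_over md1 mg g01 lamA.
have mkap2 : measurable_fun setT (fun q : X * R => torus_class (d2 (Q2 q)) : Z).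
  exact: (measurableT_comp mcd2 mQ2).
have [rho [rhoE rhoM]] := law_kernel mkap2.
have [m2 m2E] := image_density M mp mg g0.
have m2A (A : set (X * Z)%type) : measurable A ->
    \int[M]_t ((\1_A (d1 t, torus_class (d2 t)))%:E * (\1_S t)%:E) = m2 A.
  by move=> mA; rewrite -(m2E _ (nnmeasurable_indic R mA)) integral_indic// setIT.
have [Q3 [mQ3 Q3E]] := disintegrate_over mp mg g01 m2A.
have [e0 e01] := ex_unit_vector.
(* Equal to [d3] on the sphere and to the unit vector [e0] elsewhere, so that every [nui p] is
   carried by the unit sphere. *)
pose nrm t : borel E := (e0 - \1_S t *: (e0 - d3 t))%R.
have mnrm : measurable_fun setT nrm.
  apply: measurable_fun_euclidean => // i.
  under eq_fun do rewrite coordsB coordsZ coordsB !mxE.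
  apply: measurable_funB => //; apply: measurable_funM => //; apply: measurable_funB => //.
  have := measurableT_comp (coord_measurable i) md3.
  by congr measurable_fun; apply/funext => t; rewrite /= mxE.
have nrmS t : S t -> nrm t = d3 t.
  by move=> St; rewrite /nrm indicE mem_set// scale1r opprB addrC subrK.
have nrm1 t : unit_sphere E (nrm t).
  have [St|St] := pselect (S t); first by rewrite nrmS.
  by rewrite /nrm indicE memNset// scale0r subr0.
have mkap3 : measurable_fun setT (fun q : X * Z * R => nrm (Q3 q)).
  exact: (measurableT_comp mnrm mQ3).
have [nui [nuiE nuiM]] := law_kernel mkap3.
exists lam, rho, nui; split => //.
- apply/eqP; rewrite -measure_le0 -MA; apply: le_M => //; first exact: (measurableC mK).
  by apply: measurableC; rewrite -[X in measurable X]setTI; exact: md1.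
- split => // p.
  have := nuiE p _ (nnmeasurable_indic R mUS); rewrite integral_indic// setIT => ->.
  rewrite -(integral_unit_weight R); apply: eq_integral => u _.
  by rewrite indicE mem_set ?mul1e//; exact: nrm1.
move=> G nG.
pose G' (q : X * Z * R) := G (q.1, nrm q.2).
have nG' : nnmeasurable G'.
  apply: (@nnmeasurable_comp _ _ _ _ _ (fun q : X * Z * R => (q.1, nrm q.2))) => //.
  by apply: measurable_fun_pair => //; exact: (measurableT_comp mnrm (@measurable_snd _ _ _ _)).
have nH := nuiM _ nG.
transitivity (\int[M]_t (G' (d1 t, torus_class (d2 t), t) * (\1_S t)%:E)).
  apply: eq_integral => t _; rewrite /G' /=.
  have [St|St] := pselect (S t); first by rewrite nrmS.
  by rewrite indicE memNset// !mule0.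
rewrite (Q3E G')//.
transitivity (\int[m2]_p \int[nui p]_z G (p, z)).
  apply: eq_integral => p _; rewrite nuiE//.
  by apply: nnmeasurable_comp nG; exact: measurable_pair1.
rewrite m2E//.
pose G'' (q : X * R) := \int[nui (q.1, torus_class (d2 q.2))]_z G (q.1, torus_class (d2 q.2), z).
have nG'' : nnmeasurable G''.
  apply: (@nnmeasurable_comp _ _ _ _ _ (fun q : X * R => (q.1, torus_class (d2 q.2) : Z))
    (fun p => \int[nui p]_z G (p, z))) => //.
  by apply: measurable_fun_pair => //; exact: (measurableT_comp mcd2 (@measurable_snd _ _ _ _)).
rewrite (Q2E G'')//; apply: eq_integral => x _; rewrite rhoE//.
apply: (@nnmeasurable_comp _ _ _ _ _ (fun xi : Z => (x, xi)) (fun p => \int[nui p]_z G (p, z))) => //.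
exact: measurable_pair1.
Qed.

Lemma ex_young_measure : exists nu : two_scale_young_measure E Omega,
  [/\ forall G : X * Z * borel E -> \bar R, nnmeasurable G ->
        nnmeasurable (fun p => \int[young_osc nu p.1 p.2]_z G (p, z)),
      (forall x xi, \int[young_osc nu x xi]_z `|z|%:E < +oo) /\
      (forall x, \int[Lt]_xi \int[young_osc nu x xi]_z `|z|%:E < +oo),
      forall G : X * Z * borel E -> \bar R, nnmeasurable G ->
        \int[M]_t (G (d1 t, torus_class (d2 t), zeta d3 t) * (w t)%:E) =
        \int[L]_x (\int[Lt]_xi \int[young_osc nu x xi]_z G (x, xi, z) * (\1_Omega x)%:E),
      (forall G : X * Z -> \bar R, nnmeasurable G ->
        nnmeasurable (fun x => \int[young_scale nu x]_xi G (x, xi))) /\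
      (forall G : X * Z * borel E -> \bar R, nnmeasurable G ->
        nnmeasurable (fun p => \int[young_conc nu p.1 p.2]_z G (p, z))) &
      forall G : X * Z * borel E -> \bar R, nnmeasurable G ->
        \int[M]_t (G (d1 t, torus_class (d2 t), d3 t) * (\1_[set t | `|d3 t|%R = 1%R] t)%:E) =
        \int[young_mass nu]_x \int[young_scale nu x]_xi \int[young_conc nu x xi]_z G (x, xi, z)].
Proof.
have [nu [nuM [nuf nuff] nui nuE]] := ex_oscillation.
have [lam [rho [nc [lam0 rhoM [ncM nc1] ncE]]]] := ex_concentration.
have mKT : measurable (closure Omega `*` setT : set (X * Z)%type) by exact: measurableX.
have kM (dS dY : measure_display) (S : measurableType dS) (Y : measurableType dY)
    (k : S -> probability Y R) : (forall G : S * Y -> \bar R, nnmeasurable G ->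
      nnmeasurable (fun s => \int[k s]_y G (s, y))) ->
    forall B, measurable B -> measurable_fun setT (fun s => k s B).
  move=> h B mB; have [] := h (fun q => (\1_B q.2)%:E) _.
    exact: (@nnmeasurable_comp _ _ _ _ _ _ _ (@measurable_snd _ _ _ _) (nnmeasurable_indic R mB)).
  move=> + _; congr measurable_fun; apply/funext => s.
  by rewrite integral_indic// setIT.
have eta (k : X * Z -> probability (borel E) R) : (fun p => k (p.1, p.2)) = k.
  by apply/funext => -[].
have P1 : weak_star_measurable (L \x Lt) (closure Omega `*` setT) (fun p => nu (p.1, p.2)).
  rewrite (_ : (fun p => _) = (fun p => nu p : set (borel E) -> \bar R)); last by apply/funext => -[].
  by apply: weak_star_measurable_borel => //; exact: kM.
have P2 : \int[L \x Lt]_(p in closure Omega `*` setT) \int[nu (p.1, p.2)]_z `|z|%:E < +oo.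
  apply: le_lt_trans nui; rewrite le_eqVlt; apply/orP; left; apply/eqP.
  by apply: eq_integral => -[].
have P3 : weak_star_measurable lam (closure Omega) (fun x => rho x).
  by apply: weak_star_measurable_borel => //; exact: kM.
have P4 x xi : closure Omega x -> nc (x, xi) (unit_sphere E) = 1 by [].
have P5 : weak_star_measurable (semidirect_product lam (fun x => rho x))
    (closure Omega `*` setT) (fun p => nc (p.1, p.2)).
  rewrite (_ : (fun p => nc _ : set (borel E) -> \bar R) = (fun p => nc p : set (borel E) -> \bar R)); last by apply/funext => -[].
  apply: weak_star_measurable_borel => //; last exact: kM.
  rewrite /semidirect_product integral0_eq// => x _; rewrite integral0_eq// => xi _.
  by rewrite indic0.
pose Y := @TwoScaleYoungMeasure R d E Omega (fun x xi => nu (x, xi)) lam rho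
  (fun x xi => nc (x, xi)) P1 P2 lam0 P3 P4 P5.
exists Y; split => //=.
- move=> G nG; have := nuM G nG.
  by congr nnmeasurable; apply/funext => -[].
- split => // G nG; have := ncM G nG.
  by congr nnmeasurable; apply/funext => -[].
Qed.

End young_measure_of.

(** * Measurability of the integrand and of its recession function *)

Section integrand_measurability.
Context (R : realType) (d : nat) (E : euclideanType R).
Local Notation X := (borel 'rV[R]_d).
Local Notation Z := (borel (torus R d)).
Local Notation dE := (\dim (fullv : {vspace E})).
Local Notation N := (d + (d + dE))%N.
Local Notation W := ('rV[R]_d * 'rV[R]_d * E)%type.

(** [X * Z * borel E] carries a product sigma-algebra, whereas continuity yields measurability for
    Borel sets of a topology. One row space joins the two: [pack] is measurable for the product and
    [unpack] is continuous. *)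
Definition unpack (v : 'rV[R]_N) : W :=
  (\row_i v ord0 (lshift (d + dE) i), \row_i v ord0 (rshift d (lshift dE i)),
   of_coords (\row_i v ord0 (rshift d (rshift d i)))).
Definition pack (p : X * Z * borel E) : 'rV[R]_N :=
  row_mx p.1.1 (row_mx (torus_repr p.1.2) (coords p.2)).

Lemma packK p : unpack (pack p) = (p.1.1, torus_repr p.1.2, p.2 : E).
Proof.
rewrite /unpack; congr (_, _, _); last rewrite -[RHS]coordsK; last congr of_coords;
  by apply/rowP => i; rewrite mxE /pack ?row_mxEl ?row_mxEr ?row_mxEl ?row_mxEr.
Qed.

Lemma unpack_continuous : continuous unpack.
Proof.
move=> v.
have sub_cont (n n' : nat) (g : 'I_n' -> 'I_n) :
    continuous (fun u : 'rV[R]_n => \row_i u ord0 (g i)).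
  by apply: continuous_rV => i u; under eq_fun do rewrite mxE; exact: coord_continuous.
have h1 := @sub_cont _ _ (fun i => lshift (d + dE) i) v.
have h2 := @sub_cont _ _ (fun i => rshift d (lshift dE i)) v.
have h3 := @sub_cont _ _ (fun i => rshift d (rshift d i)) v.
have {}h3 := cvg_comp _ _ h3 (@of_coords_continuous R E _).
exact: (cvg_pair (cvg_pair h1 h2) h3).
Qed.

Lemma pack_measurable : measurable_fun setT (pack : X * Z * borel E -> borel 'rV[R]_N).
Proof.
have m1 : measurable_fun setT (fun p : X * Z * borel E => p.1.1).
  exact: (measurableT_comp (@measurable_fst _ _ _ _) (@measurable_fst _ _ _ _)).
have m2 : measurable_fun setT (fun p : X * Z * borel E => torus_repr p.1.2 : X).
  apply: (measurableT_comp (@torus_repr_measurable R d)).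
  exact: (measurableT_comp (@measurable_snd _ _ _ _) (@measurable_fst _ _ _ _)).
apply: measurable_fun_rV => // i; rewrite /pack.
case: (split_ordP i) => [j ->|j ->].
  under eq_fun do rewrite row_mxEl.
  exact: (measurableT_comp (rV_coord_measurable j) m1).
case: (split_ordP j) => [k ->|k ->].
  under eq_fun do rewrite row_mxEr row_mxEl.
  exact: (measurableT_comp (rV_coord_measurable k) m2).
under eq_fun do rewrite row_mxEr row_mxEr.
exact: (measurableT_comp (coord_measurable k) (@measurable_snd _ _ _ _)).
Qed.

Variables (Omega : set 'rV[R]_d) (f : 'rV[R]_d * torus R d * E -> R).
Hypothesis openOmega : open Omega.
Hypothesis cf : {within Omega `*` setT `*` setT, continuous f}.
Hypothesis rf : has_recession Omega f.

(** [h] factors through [pack], so measurability on the row space, available over [D], is pulled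
    back and extended by 0. *)
Let patch_pack (D : set 'rV[R]_d) (g : W -> R) (h : X * Z * borel E -> R) :
  measurable (D : set X) ->
  measurable_fun ([set v | D (unpack v).1.1] : set (borel 'rV[R]_N)) (fun v => g (unpack v)) ->
  (forall p, h p = g (unpack (pack p))) ->
  measurable_fun setT (fun p : X * Z * borel E => if p.1.1 \in D then h p else 0).
Proof.
move=> mD mg hE.
have m1 : measurable_fun setT (fun p : X * Z * borel E => p.1.1).
  exact: (measurableT_comp (@measurable_fst _ _ _ _) (@measurable_fst _ _ _ _)).
pose D' := [set p : X * Z * borel E | D p.1.1].
have mD' : measurable D' by rewrite -[X in measurable X]setTI; exact: m1.
have mh : measurable_fun D' h.
  move=> _ B mB.
  have mul : measurable_fun setT (fun v : borel 'rV[R]_N => (unpack v).1.1 : X).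
    apply: borel_continuous => v.
    have c11 : (fun q : W => q.1.1) @ unpack v --> (unpack v).1.1.
      apply: (@cvg_comp _ _ _ (fun q : W => q.1) (fun q => q.1)); first exact: cvg_fst.
      exact: cvg_fst.
    exact: (cvg_comp _ _ (@unpack_continuous v) c11).
  have mDv : measurable ([set v | D (unpack v).1.1] : set (borel 'rV[R]_N)).
    by rewrite -[X in measurable X]setTI; exact: mul.
  have mS := mg mDv B mB.
  have := pack_measurable measurableT mS; rewrite setTI; congr measurable.
  have eD p : (unpack (pack p)).1.1 = p.1.1 by rewrite packK.
  apply/seteqP; split => p [Dp Bp]; split.
  - by change (D p.1.1); rewrite -(eD p); exact: Dp.
  - by change (B (h p)); rewrite hE; exact: Bp.
  - by change (D (unpack (pack p)).1.1); rewrite eD; exact: Dp.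
  - by change (B (g (unpack (pack p)))); rewrite -hE; exact: Bp.
have := (measurable_restrict h mD' (@measurableT _ _)).1; rewrite setTI => /(_ mh).
by [].
Qed.

Lemma integrand_measurable : measurable_fun setT
  (fun p : X * Z * borel E => if p.1.1 \in Omega then f (p.1.1, p.1.2, p.2 : E) else 0).
Proof.
apply: (@patch_pack Omega (lift_fun f)) => //.
- exact: borel_open.
- apply: borel_continuous_real.
    rewrite openE => v /= Ov.
    have c11 : (fun q : W => q.1.1) @ unpack v --> (unpack v).1.1.
      apply: (@cvg_comp _ _ _ (fun q : W => q.1) (fun q => q.1)); first exact: cvg_fst.
      exact: cvg_fst.
    exact: (cvg_comp _ _ (@unpack_continuous v) c11 _ (open_nbhs_nbhs (conj openOmega Ov))).
  move=> v; rewrite inE => Ov.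
  have cl := lift_fun_continuous openOmega cf Ov.
  exact: (cvg_comp _ _ (@unpack_continuous v) cl).
- by move=> p; rewrite packK /lift_fun /= torus_reprK.
Qed.

Lemma recession_measurable : measurable_fun setT
  (fun p : X * Z * borel E => if p.1.1 \in closure Omega then
     recession Omega f (p.1.1, p.1.2, p.2 : E) else 0).
Proof.
apply: (@patch_pack (closure Omega) (lift_rec Omega f)).
- by apply: borel_closed; exact: closed_closure.
- have c11 (v : 'rV[R]_N) : (unpack u).1.1 @[u --> v] --> (unpack v).1.1.
    have c11 : (fun q : W => q.1.1) @ unpack v --> (unpack v).1.1.
      apply: (@cvg_comp _ _ _ (fun q : W => q.1) (fun q => q.1)); first exact: cvg_fst.
      exact: cvg_fst.
    exact: (cvg_comp _ _ (@unpack_continuous v) c11).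
  apply: borel_continuous_within.
    by apply: borel_closed; apply: closed_comp => [v _|]; [exact: c11|exact: closed_closure].
  apply/subspace_continuousP => v Kv; apply/cvgrPdist_lt => e e0.
  have h := lift_rec_continuous rf (q := unpack v) Kv e0.
  have h' : nbhs v [set u | closure Omega (unpack u).1.1 ->
      `|lift_rec Omega f (unpack v) - lift_rec Omega f (unpack u)| < e].
    exact: (@unpack_continuous v _ h).
  exact: h'.
- by move=> p; rewrite packK /lift_rec /= torus_reprK.
Qed.

End integrand_measurability.

(** * Signed integrals and charges *)

Section signed_integrals.
Context (R : realType).
Local Open Scope ereal_scope.

Lemma funepos_EFin T (f : T -> R) x : (EFin \o f)^\+ x = (Num.max (f x) 0)%:E.
Proof. by rewrite funeposE/= EFin_max. Qed.

Lemma funeneg_EFin T (f : T -> R) x : (EFin \o f)^\- x = (Num.max (- f x) 0)%:E.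
Proof. by rewrite funenegE/= EFin_max. Qed.

Lemma integral_EFinE d (T : measurableType d) (m : {measure set T -> \bar R}) (f : T -> R) :
  \int[m]_x (f x)%:E = \int[m]_x (Num.max (f x) 0)%:E - \int[m]_x (Num.max (- f x) 0)%:E.
Proof.
rewrite -[LHS]/(\int[m]_x ((EFin \o f) x)) integralE; congr (_ - _).
  by apply: eq_integral => x _; rewrite funepos_EFin.
by apply: eq_integral => x _; rewrite funeneg_EFin.
Qed.

Lemma nn_integralB d (T : measurableType d) (m : {measure set T -> \bar R}) (D : set T)
    (f g : T -> \bar R) : measurable D -> nnmeasurable f -> nnmeasurable g ->
  \int[m]_(x in D) f x < +oo -> \int[m]_(x in D) g x < +oo ->
  \int[m]_(x in D) (f x - g x) = \int[m]_(x in D) f x - \int[m]_(x in D) g x.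
Proof.
move=> mD [mf f0] [mg g0] fi gi; rewrite integralB//; apply/integrableP; split.
- by apply: measurable_funS mf.
- by under eq_integral do rewrite gee0_abs//.
- by apply: measurable_funS mg.
- by under eq_integral do rewrite gee0_abs//.
Qed.

Lemma nnmeasurable_max0 d (T : measurableType d) (f : T -> R) : measurable_fun setT f ->
  nnmeasurable (fun x => (Num.max (f x) 0)%:E).
Proof.
move=> mf; apply: nnmeasurable_EFin; last by move=> x; rewrite le_max lexx orbT.
by apply: measurable_maxr.
Qed.

Lemma nn_fin_sub (a1 a2 b1 b2 : \bar R) : 0 <= a1 -> 0 <= a2 -> 0 <= b1 -> 0 <= b2 ->
  a1 + a2 < +oo -> b1 + b2 < +oo -> (a1 + a2) - (b1 + b2) = (a1 - b1) + (a2 - b2).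
Proof.
case: a1 a2 b1 b2 => [a1| |] [a2| |] [b1| |] [b2| |] //= _ _ _ _ _ _.
have E0 : ((a1 + a2) - (b1 + b2) = (a1 - b1) + (a2 - b2))%R by lra.
exact: (congr1 EFin E0).
Qed.

(** Positive and negative parts of [psi] commute with multiplication by the nonnegative [g1] and
    [g2], so the identity for nonnegative functions applies to each part; boundedness of [psi] makes
    the differences finite. *)
Lemma signed_integral_formula d d1 d2 (T : measurableType d) (T1 : measurableType d1)
    (T2 : measurableType d2) (m : {measure set T -> \bar R}) (m1 : {measure set T1 -> \bar R})
    (m2 : {measure set T2 -> \bar R}) (c1 : T1 -> T) (c2 : T2 -> T) (g1 : T1 -> R) (g2 : T2 -> R)
    (psi : T -> R) (B : R) :
  m setT < +oo -> (forall x, 0 <= g1 x)%R -> (forall x, 0 <= g2 x)%R ->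
  (forall h, nnmeasurable h -> \int[m]_t h t =
     \int[m1]_x (h (c1 x) * (g1 x)%:E) + \int[m2]_x (h (c2 x) * (g2 x)%:E)) ->
  measurable_fun setT psi -> (forall t, `|psi t| <= B)%R ->
  \int[m]_t (psi t)%:E =
    \int[m1]_x (psi (c1 x) * g1 x)%:E + \int[m2]_x (psi (c2 x) * g2 x)%:E.
Proof.
move=> mfin g10 g20 mE mpsi psiB.
have mx (a g : R) : (0 <= g -> Num.max (a * g) 0 = Num.max a 0 * g)%R.
  by move=> g0; rewrite maxr_pMl// mul0r.
have mxn (a g : R) : (0 <= g -> Num.max (- (a * g)) 0 = Num.max (- a) 0 * g)%R.
  by move=> g0; rewrite -mulNr mx.
have np := nnmeasurable_max0 mpsi.
have mN : measurable_fun setT (fun t => - psi t)%R by exact: measurable_funN.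
have nn := nnmeasurable_max0 mN.
have fin (q : T -> R) : measurable_fun setT q -> (forall t, `|q t| <= B)%R ->
    \int[m]_t (Num.max (q t) 0)%:E < +oo.
  move=> mq qB.
  apply: (@le_lt_trans _ _ (\int[m]_t (`|B|)%:E)).
    have [mh h0] := nnmeasurable_max0 mq.
    apply: ge0_le_integral => //.
    move=> t _; rewrite lee_fin ge_max normr_ge0 andbT.
    by rewrite (le_trans (ler_norm _))// (le_trans (qB t))// ler_norm.
  by rewrite integral_cst// lte_mul_pinfty.
have finp := fin _ mpsi psiB.
have finn : \int[m]_t (Num.max (- psi t) 0)%:E < +oo.
  by apply: fin => // t; rewrite normrN.
rewrite [LHS]integral_EFinE [X in _ = X + _]integral_EFinE [X in _ = _ + X]integral_EFinE.
move: finp finn; rewrite (mE _ np) (mE _ nn).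
have e1 : \int[m1]_x ((Num.max (psi (c1 x)) 0)%:E * (g1 x)%:E) =
    \int[m1]_x (Num.max (psi (c1 x) * g1 x) 0)%:E.
  by apply: eq_integral => x _; rewrite mx// EFinM.
have e2 : \int[m2]_x ((Num.max (psi (c2 x)) 0)%:E * (g2 x)%:E) =
    \int[m2]_x (Num.max (psi (c2 x) * g2 x) 0)%:E.
  by apply: eq_integral => x _; rewrite mx// EFinM.
have e3 : \int[m1]_x ((Num.max (- psi (c1 x)) 0)%:E * (g1 x)%:E) =
    \int[m1]_x (Num.max (- (psi (c1 x) * g1 x)) 0)%:E.
  by apply: eq_integral => x _; rewrite mxn// EFinM.
have e4 : \int[m2]_x ((Num.max (- psi (c2 x)) 0)%:E * (g2 x)%:E) =
    \int[m2]_x (Num.max (- (psi (c2 x) * g2 x)) 0)%:E.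
  by apply: eq_integral => x _; rewrite mxn// EFinM.
rewrite e1 e2 e3 e4 => finp finn.
by apply: nn_fin_sub => //; apply: integral_ge0 => x _; rewrite lee_fin le_max lexx orbT.
Qed.

Lemma fin_num_transpose (x y z t : \bar R) : x \is a fin_num -> y \is a fin_num ->
  z \is a fin_num -> t \is a fin_num -> x - y = z - t -> x + t = y + z.
Proof.
case: x y z t => [x| |] [y| |] [z| |] [t| |] // _ _ _ _ /(congr1 fine) e.
have e' : (x - y = z - t)%R := e.
have E1 : (x + t = y + z)%R by lra.
exact: (congr1 EFin E1).
Qed.

(** The Jordan parts [jp], [jn] may differ from [mp], [mm], but [mp + jn] and [mm + jp] coincide on
    measurable sets and hence have the same integrals. *)
Lemma charge_integral_sub d (T : measurableType d) (mp mm : {finite_measure set T -> \bar R})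
    (D : set T) (phi : T -> R) (B : R) : measurable D ->
  measurable_fun setT (phi \_ D) -> (forall x, `|(phi \_ D) x| <= B)%R ->
  charge_integral (cadd (charge_of_finite_measure mp) (copp (charge_of_finite_measure mm))) D phi =
  ((\int[mp]_x (phi \_ D) x)%R - (\int[mm]_x (phi \_ D) x)%R)%:E.
Proof.
move=> mD mpsi psiB; rewrite /charge_integral; cbv zeta.
set nu := cadd _ _; set h := (X in jordan_pos X).
set jp := jordan_pos h; set jn := jordan_neg h.
have res (m : {measure set T -> \bar R}) : m setT < +oo ->
    \int[m]_(x in D) (phi x)%:E = (\int[m]_x (phi \_ D) x)%R%:E.
  move=> mfin; rewrite -(bounded_integralE mfin mpsi psiB) integral_mkcond.
  by apply: eq_integral => x _; rewrite restrict_EFin.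
have fin (m : {finite_measure set T -> \bar R}) : m setT < +oo.
  by rewrite -ge0_fin_numE//; exact: fin_num_measure.
rewrite (res jp (fin jp)) (res jn (fin jn)) -EFinB; congr EFin.
have [m1 m1E] := ex_measure_add mp jn; have [m2 m2E] := ex_measure_add mm jp.
have sumE (m m' m'' : {measure set T -> \bar R}) A : (forall h, nnmeasurable h ->
    \int[m]_y h y = \int[m']_y h y + \int[m'']_y h y) -> measurable A -> m A = m' A + m'' A.
  move=> mE mA; have := mE _ (nnmeasurable_indic R mA).
  by rewrite !integral_indic// !setIT.
have m12 A : measurable A -> m1 A = m2 A.
  move=> mA; rewrite (sumE _ _ _ _ m1E mA) (sumE _ _ _ _ m2E mA).
  have E0 : mp A - mm A = jp A - jn A.
    by have := jordan_decomp h mA; rewrite [in X in _ = X -> _]/cadd/= cscaleN1.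
  by apply: fin_num_transpose E0; exact: fin_num_measure.
have key (psi : T -> R) : nnmeasurable (fun x => (psi x)%:E) ->
    \int[mp]_x (psi x)%:E + \int[jn]_x (psi x)%:E = \int[mm]_x (psi x)%:E + \int[jp]_x (psi x)%:E.
  by move=> npsi; rewrite -m1E// -m2E//; apply: eq_measure_integral => A mA _; exact: m12.
pose psi := phi \_ D.
(* The bound [B] is known to be nonnegative only if [T] has a point. *)
have [x0|T0] := pselect (exists x : T, True); last first.
  have R0 (m : {measure set T -> \bar R}) : (\int[m]_x (phi \_ D) x = 0)%R.
    rewrite /Rintegral (_ : setT = set0) ?integral_set0//.
    by apply/seteqP; split => // x _; apply: T0; exists x.
  by rewrite !R0.
have B0 : (0 <= B)%R by have [x _] := x0; exact: le_trans (normr_ge0 _) (psiB x).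
have nB : nnmeasurable (fun x : T => (cst B x)%:E) by exact: nnmeasurable_EFin.
(* The shift by [B] makes [psi] nonnegative, as [key] demands; it is removed afterwards by comparing
   total masses. *)
have npB : nnmeasurable (fun x => (psi x + B)%:E).
  apply: nnmeasurable_EFin; first exact: measurable_funD.
  by move=> x; have := psiB x; rewrite -/psi ler_norml => /andP[]; lra.
have sh (m : {finite_measure set T -> \bar R}) :
    \int[m]_x (psi x + B)%:E = ((\int[m]_x psi x)%R + B * fine (m setT))%:E.
  have mf := fin m.
  have b2 x : (`|psi x + B| <= B + B)%R.
    by apply: le_trans (ler_normD _ _) _; rewrite lerD ?psiB// ger0_norm.
  rewrite (bounded_integralE mf _ b2); last exact: measurable_funD.
  congr EFin; rewrite RintegralD//.
  - by rewrite Rintegral_cst.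
  - exact: (bounded_integrable mf mpsi psiB).
  - by apply: (bounded_integrable mf (B := B)) => // x; rewrite ger0_norm.
have k1 := key _ npB; have k2 := key (cst 1%R) (nnmeasurable_EFin (measurable_cst _) (fun=> ler01)).
move: k1; rewrite !sh -!EFinD => -[k1].
have ff (m : {finite_measure set T -> \bar R}) :
    \int[m]_x (cst 1%R x : R)%:E = (fine (m setT))%:E.
  rewrite fineK; last by rewrite ge0_fin_numE// fin.
  by rewrite -[RHS]mul1e -integral_cst.
move: k2; rewrite (ff mp) (ff mm) (ff jp) (ff jn) -!EFinD => -[k2].
have {}k2 : (B * fine (mp setT) + B * fine (jn setT) = B * fine (mm setT) + B * fine (jp setT))%R.
  by rewrite -!mulrDr k2.
move: k1 k2; rewrite -/psi.
move: (\int[mp]_x psi x)%R (\int[jn]_x psi x)%R (\int[mm]_x psi x)%R (\int[jp]_x psi x)%R.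
move: (B * fine (mp setT))%R (B * fine (jn setT))%R (B * fine (mm setT))%R (B * fine (jp setT))%R.
by move=> *; lra.
Qed.

End signed_integrals.

(** * Coding the given measures on the line *)

Section coded_measures.
Context (R : realType) (d : nat) (E : euclideanType R).
Local Notation L := (lebesgue_rV R d).
Local Notation X := (borel 'rV[R]_d).
Hypothesis dimE : (0 < \dim (fullv : {vspace E}))%N.
Variables (Omega : set 'rV[R]_d).
Hypothesis openOmega : open Omega.
Hypothesis boundedOmega : bounded_set Omega.
Variables (d1 d2 : R -> 'rV[R]_d) (d3 : R -> E) (r : R).
Hypothesis cd1 : continuous d1.
Hypothesis r0 : 0 < r.
Hypothesis Omega_r : forall x, Omega x -> `|x| <= r.
Hypothesis cod : forall disp (T : measurableType disp) (u y : T -> 'rV[R]_d) (w : T -> E),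
  measurable_fun setT (u : T -> borel 'rV[R]_d) ->
  measurable_fun setT (y : T -> borel 'rV[R]_d) ->
  measurable_fun setT (w : T -> borel E) ->
  (forall x, `|u x| <= r) -> (forall x i, 0 <= y x ord0 i <= 1) ->
  (forall x, `|w x| <= 1) ->
  exists c : T -> R, [/\ measurable_fun setT c, forall x, 0 <= c x <= 1,
    forall x, d1 (c x) = u x, forall x, d2 (c x) = y x & forall x, d3 (c x) = w x].
Local Open Scope ereal_scope.

(* [m] is the image on the line, under the coding, of the measure
   (1 + |mu^ac|) L + |mu^s| on Omega with fast variable x / eps and direction
   mu^ac / (1 + |mu^ac|), resp. the polar density of mu^s *)
Record coded (eps : R) (mu : set X -> E) (B : R) (m : {measure set R -> \bar R})
    (sm : {measure set X -> \bar R}) (c c' : X -> R) : Prop := Coded {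
  coded_c : measurable_fun setT c ;
  coded_c' : measurable_fun setT c' ;
  coded_d1 : forall x, Omega x -> d1 (c x) = x /\ d1 (c' x) = x ;
  coded_d2 : forall x, Omega x ->
    d2 (c x) = frac (eps^-1 *: x)%R /\ d2 (c' x) = frac (eps^-1 *: x)%R ;
  coded_d3 : forall x, Omega x ->
    d3 (c x) = ((1 + `|ac_density L Omega mu x|)^-1 *: ac_density L Omega mu x)%R ;
  coded_d3' : forall x, Omega x -> (`|singular_polar L Omega mu x| = 1)%R ->
    d3 (c' x) = singular_polar L Omega mu x ;
  coded_norm : forall x, (`|d3 (c' x)| = 1)%R ;
  coded_sm : forall A, measurable A -> sm A = variation_measure (singular_part L Omega mu) A ;
  coded_polar : sm (Omega `&` [set x | (`|singular_polar L Omega mu x| != 1)%R]) = 0 ;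
  coded_p : measurable_fun (Omega : set X) (singular_polar L Omega mu : X -> borel E) ;
  coded_E : forall h, nnmeasurable h -> \int[m]_t h t =
    \int[L]_x (h (c x) * (\1_Omega x * (1 + `|ac_density L Omega mu x|))%:E) +
    \int[sm]_x (h (c' x) * (\1_Omega x)%:E) ;
  coded_mass : m setT <= B%:E ;
  coded_01 : m (~` `[0%R, 1%R]%classic) = 0 ;
  coded_A : m (~` (d1 @^-1` closure Omega)) = 0
}.

Lemma restrict_euclid (D : set X) (u : X -> E) : measurable D ->
  measurable_fun D (u : X -> borel E) ->
  measurable_fun setT ((fun x => \1_D x *: u x)%R : X -> borel E).
Proof.
move=> mD mu; apply: measurable_fun_euclidean => // i.
have mui : measurable_fun D (fun x => coords (u x) ord0 i).
  exact: (measurableT_comp (coord_measurable i) mu).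
have := (measurable_restrict (fun x => coords (u x) ord0 i) mD measurableT).1.
rewrite setTI => /(_ mui); congr measurable_fun; apply/funext => x.
rewrite patchE coordsZ [RHS]mxE indicE.
by case: (x \in D); rewrite ?mul1r ?mul0r.
Qed.

Lemma coded_measure : exists2 K : R, (0 <= K)%R & forall (eps V : R) (mu : set X -> E),
  (0 <= V)%R -> variation_measure mu Omega <= V%:E ->
  exists q : {measure set R -> \bar R} * {measure set X -> \bar R} * (X -> R) * (X -> R),
    coded eps mu (fine (L Omega) + K * V) q.1.1.1 q.1.1.2 q.1.2 q.2.
Proof.
have [K K0 KP] := lebesgue_decomposition_bounds E.
exists (K + 1)%R; first by rewrite addr_ge0.
move=> eps V mu V0 muV.
have mO : measurable (Omega : set X) by exact: borel_open.
have [mac iac mpol [sm [smE smV smp]]] := KP _ X L Omega mu mO.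
set ac := ac_density L Omega mu in mac iac *.
set p := singular_polar L Omega mu in mpol smp *.
have [e0 e01] := ex_unit_vector dimE.
pose ac' x : E := (\1_Omega x *: ac x)%R.
have mac' : measurable_fun setT (ac' : X -> borel E) by exact: restrict_euclid.
pose p1 x : E := (\1_Omega x *: p x)%R.
have mp1 : measurable_fun setT (p1 : X -> borel E) by exact: restrict_euclid.
have mnac' : measurable_fun setT (fun x : X => `|ac' x|%R).
  exact: (measurableT_comp (@norm_measurable R E) mac').
have mnp1 : measurable_fun setT (fun x : X => `|p1 x|%R).
  exact: (measurableT_comp (@norm_measurable R E) mp1).
pose S : set X := [set x | `|p1 x|%R = 1%R].
have mS : measurable S.
  by have := mnp1 measurableT _ (measurable_set1 1%R); rewrite setTI.
(* The unit vector [e0] replaces the polar density wherever its norm is not 1, so that the singular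
   part is coded on the sphere without exception. *)
pose p' x : E := (e0 - \1_S x *: (e0 - p1 x))%R.
have mp' : measurable_fun setT (p' : X -> borel E).
  apply: measurable_fun_euclidean => // i.
  under eq_fun do rewrite coordsB coordsZ coordsB !mxE.
  apply: measurable_funB => //; apply: measurable_funM.
    exact: measurable_indic.
  apply: measurable_funB => //.
  have := measurableT_comp (coord_measurable i) mp1.
  by congr measurable_fun; apply/funext => t; rewrite /= mxE.
have p'S x : S x -> p' x = p1 x.
  by move=> Sx; rewrite /p' indicE mem_set// scale1r opprB addrC subrK.
have p'1 x : (`|p' x| = 1)%R.
  have [Sx|Sx] := pselect (S x); first by rewrite p'S.
  by rewrite /p' indicE memNset// scale0r subr0.
have p1O x : Omega x -> p1 x = p x by move=> Ox; rewrite /p1 indicE mem_set// scale1r.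
have acO x : Omega x -> ac' x = ac x by move=> Ox; rewrite /ac' indicE mem_set// scale1r.
have p'le x : (`|p' x| <= 1)%R by rewrite p'1.
(* The coding asks for the bound [r] at every point; points off [Omega] are sent to 0 and later
   discarded by the density. *)
pose u (x : X) : 'rV[R]_d := (\1_Omega x *: (x : 'rV[R]_d))%R.
have mu' : measurable_fun setT (u : X -> X).
  apply: measurable_fun_rV => // i; rewrite /u.
  under eq_fun do rewrite mxE.
  by apply: measurable_funM; [exact: (measurable_indic mO)|exact: rV_coord_measurable].
have ur x : (`|u x| <= r)%R.
  rewrite /u indicE; have [Ox|Ox] := pselect (Omega x).
    by rewrite mem_set// scale1r; exact: Omega_r.
  by rewrite memNset// scale0r normr0 ltW.
have uO x : Omega x -> u x = x by move=> Ox; rewrite /u indicE mem_set// scale1r.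
pose y (x : X) : 'rV[R]_d := frac (eps^-1 *: (x : 'rV[R]_d))%R.
have my : measurable_fun setT (y : X -> X).
  exact: (measurableT_comp (@frac_measurable R d) (scale_measurable eps^-1%R)).
have y01 x i : (0 <= y x ord0 i <= 1)%R.
  by have /andP[-> /ltW ->] := frac_itv (eps^-1 *: (x : 'rV[R]_d))%R i.
have ac1 x : (0 < 1 + `|ac' x|)%R by rewrite ltr_pwDl.
pose w x : E := ((1 + `|ac' x|)^-1 *: ac' x)%R.
have mw : measurable_fun setT (w : X -> borel E).
  apply: scale_euclid_measurable => //.
  by apply: (measurableT_comp (@measurable_invr R)); exact: measurable_funD.
have w1 x : (`|w x| <= 1)%R.
  rewrite /w normrZ normfV gtr0_norm// mulrC ler_pdivrMr// mul1r.
  by rewrite lerDr.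
have [c [mc c01 c1 c2 c3]] := cod mu' my mw ur y01 w1.
have [c' [mc' c'01 c'1 c'2 c'3]] := cod mu' my mp' ur y01 p'le.
pose g (x : X) : R := (\1_Omega x * (1 + `|ac' x|))%R.
have g0 x : (0 <= g x)%R by rewrite mulr_ge0 ?indicE// ltW.
have mg : measurable_fun setT g.
  by apply: measurable_funM; [exact: measurable_indic|exact: measurable_funD].
have gE x : g x = (\1_Omega x * (1 + `|ac x|))%R.
  have [Ox|Ox] := pselect (Omega x); first by rewrite /g acO.
  by rewrite /g indicE memNset// !mul0r.
have mi : measurable_fun setT (\1_Omega : X -> R) by exact: measurable_indic.
have i0 x : (0 <= \1_Omega x :> R)%R by rewrite indicE.
have [ma maE] := image_density L mc mg g0.
have [mb mbE] := image_density sm mc' mi i0.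
have [m mE] := ex_measure_add ma mb.
have mE' h : nnmeasurable h -> \int[m]_t h t =
    \int[L]_x (h (c x) * (g x)%:E) + \int[sm]_x (h (c' x) * (\1_Omega x)%:E).
  by move=> nh; rewrite mE// maE// mbE.
have mA A : measurable A -> m A =
    \int[L]_x ((\1_A (c x))%:E * (g x)%:E) + \int[sm]_x ((\1_A (c' x))%:E * (\1_Omega x)%:E).
  by move=> mA; rewrite -(mE' _ (nnmeasurable_indic R mA)) integral_indic// setIT.
have null (A : set R) : measurable A -> (forall x, Omega x -> ~ A (c x) /\ ~ A (c' x)) -> m A = 0.
  move=> mA' nA; rewrite mA// !integral0_eq ?adde0// => x _.
    have [Ox|Ox] := pselect (Omega x); last by rewrite /g [\1_Omega _]indicE memNset// mul0r mule0.
    by rewrite indicE memNset ?mul0e//; have [] := nA x Ox.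
  have [Ox|Ox] := pselect (Omega x); last by rewrite [\1_Omega _]indicE memNset// mule0.
  by rewrite indicE memNset ?mul0e//; have [] := nA x Ox.
have LOfin : L Omega \is a fin_num.
  rewrite ge0_fin_numE//; apply: (@lebesgue_bounded R d Omega r) => // x Ox i.
  by apply: le_trans (coord_norm_le _ _) _; exact: Omega_r.
exists (m, sm, c, c'); split => //=.
- by move=> x Ox; rewrite c1 c'1 uO.
- by move=> x Ox; rewrite c3 /w acO.
- by move=> x Ox px; rewrite c'3 p'S ?p1O//; rewrite /S /= p1O.
- by move=> x; rewrite c'3 p'1.
- by move=> h nh; rewrite mE'//; congr (_ + _); apply: eq_integral => x _; rewrite gE.
- rewrite mA// EFinD.
  have -> : \int[sm]_x ((\1_setT (c' x))%:E * (\1_Omega x)%:E) = sm Omega.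
    transitivity (\int[sm]_x (\1_Omega x)%:E); last by rewrite integral_indic// setIT.
    by apply: eq_integral => x _; rewrite indicT mul1e.
  have -> : \int[L]_x ((\1_setT (c x))%:E * (g x)%:E) =
      L Omega + \int[L]_(x in Omega) `|ac x|%:E.
    have -> : L Omega = \int[L]_x (\1_Omega x)%:E by rewrite integral_indic// setIT.
    have -> : \int[L]_(x in Omega) `|ac x|%:E = \int[L]_x ((fun x => `|ac x|%:E) \_ Omega) x.
      by rewrite integral_mkcond.
    rewrite -ge0_integralD//.
    + apply: eq_integral => x _; rewrite indicT mul1e gE patchE indicE.
      by case: (x \in Omega); rewrite ?mul1r ?mul0r ?adde0// EFinD.
    + by apply/measurable_EFinP.
    + by move=> x _; rewrite patchE; case: ifP.
    + apply/measurable_restrict => //; rewrite setTI; apply/measurable_EFinP.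
      exact: (measurableT_comp (@norm_measurable R E) mac).
  rewrite -addeA fineK//; apply: leeD2l.
  rewrite mulrDl mul1r EFinD EFinM.
  apply: leeD; last exact: le_trans smV muV.
  by apply: le_trans iac _; rewrite lee_wpmul2l// lee_fin.
- apply: null; first exact: measurableC.
  move=> x _; rewrite /= !in_itv/= c01 c'01; split; exact.
- apply: null.
    apply: measurableC; apply: closed_measurable; apply: closed_comp => [t _|]; first exact: cd1.
    exact: closed_closure.
  by move=> x Ox; rewrite /= c1 c'1 uO//; split => h; apply: h; exact: subset_closure.
Qed.

End coded_measures.

(** * Integrals against the coded measures *)

Section coded_identities.
Context (R : realType) (d : nat) (E : euclideanType R).
Local Notation L := (lebesgue_rV R d).
Local Notation X := (borel 'rV[R]_d).
Local Notation Z := (borel (torus R d)).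
Variables (Omega : set 'rV[R]_d).
Hypothesis openOmega : open Omega.
Hypothesis boundedOmega : bounded_set Omega.
Variables (d1 d2 : R -> 'rV[R]_d) (d3 : R -> E).
Hypothesis cd1 : continuous d1.
Hypothesis cd2 : continuous d2.
Hypothesis cd3 : continuous d3.
Hypothesis d3_le1 : forall t, `|d3 t| <= 1.
Variables (eps : R) (mu : set X -> E) (B : R) (m : {measure set R -> \bar R})
  (sm : {measure set X -> \bar R}) (c c' : X -> R).
Hypothesis cm : coded Omega d1 d2 d3 eps mu B m sm c c'.
Local Notation ac := (ac_density L Omega mu).
Local Notation p := (singular_polar L Omega mu).
Local Open Scope ereal_scope.

Let mO : measurable (Omega : set X). Proof. exact: borel_open. Qed.

(** The identity [1 - |a| / (1 + |a|) = 1 / (1 + |a|)] is the reason for coding the direction as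
    [a / (1 + |a|)]: the weight inverts the density. *)
Let wc x : Omega x -> weight d3 (c x) = ((1 + `|ac x|)^-1)%R.
Proof.
move=> Ox; have a0 : (0 < 1 + `|ac x|)%R by rewrite ltr_pwDl.
rewrite /weight (coded_d3 cm Ox) normrZ normfV (gtr0_norm a0).
by field; rewrite gt_eqF.
Qed.

Let wc' x : weight d3 (c' x) = 0%R.
Proof. by rewrite /weight (coded_norm cm) subrr. Qed.

(** The weight cancels the density [1 + |ac|], and it is 0 on the sphere, where the singular part is
    coded. *)
Lemma coded_weight h : nnmeasurable h ->
  \int[m]_t (h t * (weight d3 t)%:E) = \int[L]_x (h (c x) * (\1_Omega x)%:E).
Proof.
move=> nh.
have nw : nnmeasurable (fun t => (weight d3 t)%:E).
  apply: nnmeasurable_EFin; last by move=> t; exact: weight_ge0.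
  by apply: continuous_measurable_fun; exact: weight_continuous.
rewrite (coded_E cm (nnmeasurableM nh nw)) [X in _ + X]integral0_eq ?adde0; last first.
  by move=> x _; rewrite wc' mule0 mul0e.
apply: eq_integral => x _; have [Ox|Ox] := pselect (Omega x); last first.
  by rewrite !indicE memNset// mul0r !mule0.
by rewrite wc// indicE mem_set// mul1r -muleA -EFinM mulVf ?mule1//.
Qed.

Variable f : 'rV[R]_d * torus R d * E -> R.
Hypothesis cf : {within Omega `*` setT `*` setT, continuous f}.
Hypothesis rf : has_recession Omega f.
Variable phi : 'rV[R]_d -> R.
Hypothesis cphi : {within closure Omega, continuous phi}.

(** Inside the ball over [Omega] the recession terms of [transformed] cancel, and [zeta] recovers
    [ac] from its normalisation. *)
Lemma transformed_ac x : Omega x ->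
  (transformed Omega f d1 d2 d3 (c x) * (1 + `|ac x|) =
   f (x, torus_class (eps^-1 *: x), ac x))%R.
Proof.
move=> Ox; have [e1 _] := coded_d1 cm Ox; have [e2 _] := coded_d2 cm Ox.
have a0 : (1 + `|ac x| != 0)%R by rewrite gt_eqF// ltr_pwDl.
have w0 : weight d3 (c x) != 0%R by rewrite wc// invr_eq0.
have Kx : closure Omega x by exact: subset_closure.
rewrite /transformed /osc_part e1 (mem_set Kx) (mem_set Ox) w0/= addrC subrK.
have -> : zeta d3 (c x) = ac x.
  by rewrite /zeta wc// invrK (coded_d3 cm Ox) scalerA mulfV// scale1r.
by rewrite wc// mulrAC mulVf// mul1r /lift_fun /= e2 torus_class_frac.
Qed.

Lemma transformed_sing x : Omega x -> (`|p x| = 1)%R ->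
  transformed Omega f d1 d2 d3 (c' x) = recession Omega f (x, torus_class (eps^-1 *: x)%R, p x).
Proof.
move=> Ox px; have [_ e1] := coded_d1 cm Ox; have [_ e2] := coded_d2 cm Ox.
have Kx : closure Omega x by exact: subset_closure.
rewrite /transformed /osc_part wc' eqxx andbF addr0 e1 (mem_set Kx) /rec_part e1 e2.
by rewrite (coded_d3' cm Ox px) /lift_rec /= torus_class_frac.
Qed.

(** [phi] is exchanged for a bounded continuous [g] on the line that agrees with it over the closure
    of [Omega]; outside, [transformed] is 0. *)
Lemma coded_action : two_scale_action Omega eps mu f phi =
  (\int[m]_t (phi (d1 t) * transformed Omega f d1 d2 d3 t))%R%:E.
Proof.
have mfin : m setT < +oo by apply: le_lt_trans (coded_mass cm) _; rewrite ltry.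
have [g [Bg Bg0 [gE cg gB]]] := phi_extension boundedOmega cd1 cphi.
have mF := transformed_measurable openOmega boundedOmega cf rf cd1 cd2 cd3 d3_le1.
have [C C0 FC] := transformed_bounded boundedOmega rf d1 d2 d3_le1.
set F := transformed Omega f d1 d2 d3 in mF FC *.
have eq_psi t : (phi (d1 t) * F t = g t * F t)%R.
  have [At|At] := pselect (closure Omega (d1 t)); first by rewrite gE.
  by rewrite /F transformed_out// !mulr0.
have mpsi : measurable_fun setT (fun t => g t * F t)%R.
  by apply: measurable_funM => //; exact: continuous_measurable_fun.
have psiB t : (`|g t * F t| <= Bg * C)%R by rewrite normrM ler_pM.
have -> : (\int[m]_t (phi (d1 t) * F t) = \int[m]_t (g t * F t))%R.
  by apply: eq_Rintegral => t _; rewrite eq_psi.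
rewrite -(bounded_integralE mfin mpsi psiB).
have g10 (x : X) : (0 <= \1_Omega x * (1 + `|ac x|) :> R)%R.
  by rewrite mulr_ge0 ?indicE// addr_ge0.
have i0 (x : X) : (0 <= \1_Omega x :> R)%R by rewrite indicE.
rewrite (@signed_integral_formula R _ _ _ _ X X m L sm c c'
  (fun x : X => (\1_Omega x * (1 + `|ac x|))%R) (fun x : X => \1_Omega x) _ _
  mfin g10 i0 (coded_E cm) mpsi psiB).
have E1 : \int[L]_x (g (c x) * F (c x) * (\1_Omega x * (1 + `|ac x|)))%:E =
    \int[L]_(x in Omega) (phi x * f (x, torus_class (eps^-1 *: x)%R, ac x))%:E.
  rewrite [RHS]integral_mkcond; apply: eq_integral => x _; rewrite patchE.
  case: ifPn => [|]; rewrite ?inE ?notin_setE => Ox; last by rewrite indicE memNset// mul0r mulr0.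
  rewrite indicE mem_set// mul1r -transformed_ac// -eq_psi; congr EFin.
  by have [-> _] := coded_d1 cm Ox; rewrite mulrA.
rewrite E1 /two_scale_action; cbv zeta; congr (_ + _).
(* The action integrates against the bare set function [variation_measure]; it is traded for the
   measure [sm], which agrees with it on measurable sets. *)
rewrite (@eq_set_function_integral _ _ _ _ sm); last by move=> A mA; rewrite (coded_sm cm).
have mK : measurable (closure Omega : set X) by apply: borel_closed; exact: closed_closure.
have mphi : measurable_fun (Omega : set X) phi.
  apply: (measurable_funS mK) => //; first exact: subset_closure.
  exact: borel_continuous_within.
have mcl : measurable_fun setT (fun x : X => torus_class (eps^-1 *: x)%R : Z).
  exact: (measurableT_comp (@torus_class_measurable R d) (scale_measurable eps^-1%R)).
have mp1 : measurable_fun setT (fun x : X => (\1_Omega x *: p x)%R : borel E).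
  by apply: restrict_euclid => //; exact: (coded_p cm).
have mx : measurable_fun setT (fun x : X => x : X) by exact: measurable_id.
have mxc : measurable_fun setT (fun x : X => (x, torus_class (eps^-1 *: x)%R) : X * Z).
  exact: (measurable_fun_pair mx mcl).
have mtr : measurable_fun setT (fun x : X =>
    ((x, torus_class (eps^-1 *: x)%R), (\1_Omega x *: p x)%R) : X * Z * borel E).
  exact: (measurable_fun_pair mxc mp1).
have mrec : measurable_fun (Omega : set X)
    (fun x : X => (recession Omega f (x, torus_class (eps^-1 *: x), p x))%R).
  have := measurable_funTS (D := (Omega : set X))
    (measurableT_comp (recession_measurable (E := E) rf) mtr).
  apply: eq_measurable_fun => x; rewrite inE => Ox /=.
  by rewrite mem_set ?indicE ?mem_set ?scale1r//; exact: subset_closure.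
have -> : \int[sm]_x (g (c' x) * F (c' x) * \1_Omega x)%:E =
    \int[sm]_(x in Omega) (g (c' x) * F (c' x))%:E.
  rewrite [RHS]integral_mkcond; apply: eq_integral => x _; rewrite patchE indicE.
  by case: (x \in Omega); rewrite ?mulr1 ?mulr0.
(* Here the code carries [e0] instead of the polar density; the set is [sm]-null. *)
pose N := (Omega `&` [set x | (`|p x| != 1)%R]) : set X.
have mN : measurable N.
  have mpn : measurable_fun (Omega : set X) (fun x => `|p x|)%R.
    exact: (measurableT_comp (@norm_measurable R E) (coded_p cm)).
  have := mpn mO _ (measurableC (measurable_set1 1%R)).
  by congr measurable; apply/seteqP; split => x /= [Dx /eqP].
have eqN x : (Omega `\` N) x -> (phi x * recession Omega f (x, torus_class (eps^-1 *: x), p x))%R =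
    (g (c' x) * F (c' x))%R.
  move=> [Ox Nx]; have px : (`|p x| = 1)%R.
    by apply/eqP; apply: contrapT => /negP h; apply: Nx; split.
  rewrite -eq_psi /F transformed_sing//.
  by have [_ ->] := coded_d1 cm Ox.
have mG : measurable_fun (Omega : set X)
    (fun x : X => (phi x * recession Omega f (x, torus_class (eps^-1 *: x), p x))%R%:E).
  by apply/measurable_EFinP; exact: measurable_funM.
apply/esym; apply: ae_eq_integral => //.
- apply/measurable_EFinP; apply: measurable_funTS.
  exact: (measurableT_comp mpsi (coded_c' cm)).
- exists N; split => //; first exact: (coded_polar cm).
  move=> x /= nx; apply: contrapT => Nx; apply: nx => Ox.
  by rewrite eqN.
Qed.

End coded_identities.

(** A signed iterated integral is a difference of nonnegative ones only if no level produces
    [oo - oo], whence one finiteness condition per level, the inner ones at every point of [D]. *)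
Lemma iterated_integral_sub (R : realType) dd1 dd2 dd3 (T1 : measurableType dd1)
    (T2 : measurableType dd2) (T3 : measurableType dd3) (m1 : {measure set T1 -> \bar R})
    (m2 : T1 -> {measure set T2 -> \bar R}) (m3 : T1 -> T2 -> {measure set T3 -> \bar R})
    (D : set T1) (G1 G2 : T1 * T2 * T3 -> \bar R) (g : T1 -> T2 -> \bar R) :
  measurable D -> nnmeasurable G1 -> nnmeasurable G2 ->
  (forall G : T1 * T2 * T3 -> \bar R, nnmeasurable G ->
    nnmeasurable (fun p => \int[m3 p.1 p.2]_z G (p, z))%E) ->
  (forall G : T1 * T2 -> \bar R, nnmeasurable G ->
    nnmeasurable (fun x => \int[m2 x]_y G (x, y))%E) ->
  (forall x y, D x -> g x y = \int[m3 x y]_z G1 (x, y, z) - \int[m3 x y]_z G2 (x, y, z))%E ->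
  (forall x, D x -> \int[m2 x]_y \int[m3 x y]_z G1 (x, y, z) < +oo)%E ->
  (forall x, D x -> \int[m2 x]_y \int[m3 x y]_z G2 (x, y, z) < +oo)%E ->
  (\int[m1]_(x in D) \int[m2 x]_y \int[m3 x y]_z G1 (x, y, z) < +oo)%E ->
  (\int[m1]_(x in D) \int[m2 x]_y \int[m3 x y]_z G2 (x, y, z) < +oo)%E ->
  (\int[m1]_(x in D) \int[m2 x]_y g x y =
   \int[m1]_(x in D) \int[m2 x]_y \int[m3 x y]_z G1 (x, y, z) -
   \int[m1]_(x in D) \int[m2 x]_y \int[m3 x y]_z G2 (x, y, z))%E.
Proof.
move=> mD nG1 nG2 M3 M2 gE f1 f2 F1 F2.
have n1 := M3 _ nG1; have n2 := M3 _ nG2.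
have N1 := M2 _ n1; have N2 := M2 _ n2.
rewrite -nn_integralB//; apply: eq_integral => x; rewrite inE => Dx.
rewrite -nn_integralB//; [|by apply: (nnmeasurable_comp (measurable_pair1 x)) n1
  |by apply: (nnmeasurable_comp (measurable_pair1 x)) n2|exact: f1|exact: f2].
by apply: eq_integral => y _; rewrite gE.
Qed.

Lemma le_nnintegral (R : realType) dd (T : measurableType dd) (m : {measure set T -> \bar R})
    (f g : T -> \bar R) : nnmeasurable f -> nnmeasurable g -> (forall x, f x <= g x)%E ->
  (\int[m]_x f x <= \int[m]_x g x)%E.
Proof. by move=> [mf f0] [mg g0] fg; apply: ge0_le_integral. Qed.

Lemma nnmeasurable_affine (R : realType) dd (T : measurableType dd) (C : R) (q : T -> \bar R) :
  (0 <= C)%R -> nnmeasurable q -> nnmeasurable (fun y => C%:E + C%:E * q y)%E.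
Proof.
move=> C0 nq; have nC : nnmeasurable (fun _ : T => C%:E).
  exact: (nnmeasurable_EFin (g := fun=> C)).
by apply: nnmeasurableD => //; exact: nnmeasurableM.
Qed.

Lemma nnintegral_affine (R : realType) dd (T : measurableType dd) (m : {measure set T -> \bar R})
    (C : R) (q : T -> \bar R) : m setT = 1%E -> (0 <= C)%R -> nnmeasurable q ->
  (\int[m]_x (C%:E + C%:E * q x) = C%:E + C%:E * \int[m]_x q x)%E.
Proof.
move=> m1 C0 [mq q0].
have nCq : nnmeasurable (fun x => C%:E * q x)%E.
  by apply: nnmeasurableM => //; exact: (nnmeasurable_EFin (g := fun=> C)).
have [mCq Cq0] := nCq.
by rewrite ge0_integralD// integral_cst// m1 mule1 ge0_integralZl.
Qed.

Lemma probability_cst (R : realType) dd (T : measurableType dd) (P : probability T R) (C : R) :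
  (\int[P]_x C%:E = C%:E)%E.
Proof.
rewrite integral_cst//.
exact: (etrans (congr1 (fun y => C%:E * y)%E (@probability_setT _ _ _ P)) (mule1 _)).
Qed.

(** * The formula characterising the limit measure *)

Section young_identity.
Context (R : realType) (d : nat) (E : euclideanType R).
Local Notation L := (lebesgue_rV R d).
Local Notation X := (borel 'rV[R]_d).
Local Notation Z := (borel (torus R d)).
Local Notation Lt := (lebesgue_torus R d).
Variables (Omega : set 'rV[R]_d) (f : 'rV[R]_d * torus R d * E -> R).
Hypothesis openOmega : open Omega.
Hypothesis boundedOmega : bounded_set Omega.
Hypothesis cf : {within Omega `*` setT `*` setT, continuous f}.
Hypothesis rf : has_recession Omega f.
Variables (d1 d2 : R -> 'rV[R]_d) (d3 : R -> E).
Hypothesis cd1 : continuous d1.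
Hypothesis cd2 : continuous d2.
Hypothesis cd3 : continuous d3.
Hypothesis d3_le1 : forall t, `|d3 t| <= 1.
Variables (M : {measure set R -> \bar R}) (nu : two_scale_young_measure E Omega).
Local Open Scope ereal_scope.
Hypothesis Mfin : M setT < +oo.
Hypothesis Mout : \int[M]_t ((\1_(~` Omega) (d1 t))%:E * (weight d3 t)%:E) = 0.
Hypothesis oscM : forall G : X * Z * borel E -> \bar R, nnmeasurable G ->
  nnmeasurable (fun p => \int[young_osc nu p.1 p.2]_z G (p, z)).
Hypothesis osc1 : forall x xi, \int[young_osc nu x xi]_z `|z|%:E < +oo.
Hypothesis osc2 : forall x, \int[Lt]_xi \int[young_osc nu x xi]_z `|z|%:E < +oo.
Hypothesis oscE : forall G : X * Z * borel E -> \bar R, nnmeasurable G ->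
  \int[M]_t (G (d1 t, torus_class (d2 t), zeta d3 t) * (weight d3 t)%:E) =
  \int[L]_x (\int[Lt]_xi \int[young_osc nu x xi]_z G (x, xi, z) * (\1_Omega x)%:E).
Hypothesis scaleM : forall G : X * Z -> \bar R, nnmeasurable G ->
  nnmeasurable (fun x => \int[young_scale nu x]_xi G (x, xi)).
Hypothesis concM : forall G : X * Z * borel E -> \bar R, nnmeasurable G ->
  nnmeasurable (fun p => \int[young_conc nu p.1 p.2]_z G (p, z)).
Hypothesis concE : forall G : X * Z * borel E -> \bar R, nnmeasurable G ->
  \int[M]_t (G (d1 t, torus_class (d2 t), d3 t) * (\1_[set t | `|d3 t|%R = 1%R] t)%:E) =
  \int[young_mass nu]_x \int[young_scale nu x]_xi \int[young_conc nu x xi]_z G (x, xi, z).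
Variable omega : set X.
Hypothesis momega : measurable omega.
Hypothesis omegaK : omega `<=` closure Omega.

Local Notation F := (transformed Omega f d1 d2 d3).
Let fO (p : X * Z * borel E) : R := if p.1.1 \in Omega then f (p.1.1, p.1.2, p.2 : E) else 0%R.
Let fK (p : X * Z * borel E) : R :=
  if p.1.1 \in closure Omega then recession Omega f (p.1.1, p.1.2, p.2 : E) else 0%R.
(** The sign [s] is taken to be 1 or -1 and selects the positive or the negative part of the
    integrand. *)
Let G (s : R) (p : X * Z * borel E) : \bar R := (\1_omega p.1.1 * Num.max (s * fO p) 0)%:E.
Let H (s : R) (p : X * Z * borel E) : \bar R :=
  (\1_omega p.1.1 * (\1_(unit_sphere E) p.2 * Num.max (s * fK p) 0))%:E.

Let m11 : measurable_fun setT (fun p : X * Z * borel E => p.1.1).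
Proof. exact: (measurableT_comp (@measurable_fst _ _ _ _) (@measurable_fst _ _ _ _)). Qed.
Let mo : measurable_fun setT (fun p : X * Z * borel E => \1_omega p.1.1 : R).
Proof. by apply: (measurableT_comp _ m11); exact: measurable_indic. Qed.
Let mu : measurable_fun setT (fun p : X * Z * borel E => \1_(unit_sphere E) p.2 : R).
Proof.
apply: (measurableT_comp _ (@measurable_snd _ _ _ _)).
exact: (measurable_indic (@unit_sphere_measurable R E)).
Qed.
Let ind0 T (A : set T) x : (0 <= \1_A x :> R)%R. Proof. by rewrite indicE. Qed.
Let max0 (a : R) : (0 <= Num.max a 0)%R. Proof. by rewrite le_max lexx orbT. Qed.

Let nG s : nnmeasurable (G s).
Proof.
apply: nnmeasurable_EFin; last by move=> p; rewrite mulr_ge0.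
apply: measurable_funM => //; apply: measurable_maxr => //; apply: measurable_funM => //.
exact: integrand_measurable.
Qed.

Let nH s : nnmeasurable (H s).
Proof.
apply: nnmeasurable_EFin; last by move=> p; rewrite !mulr_ge0.
apply: measurable_funM => //; apply: measurable_funM => //.
apply: measurable_maxr => //; apply: measurable_funM => //.
exact: recession_measurable.
Qed.

Let md1 : measurable_fun setT (d1 : R -> X). Proof. exact: continuous_rV_measurable. Qed.
Let mF : measurable_fun setT F.
Proof. exact: (transformed_measurable openOmega boundedOmega cf rf cd1 cd2 cd3 d3_le1). Qed.
Let mw : measurable_fun setT (weight d3).
Proof. by apply: continuous_measurable_fun; exact: weight_continuous. Qed.

(** Up to a null set, a parameter [t] is of one of two types. On the sphere the weight is 0 and
    [transformed] is the recession value; inside the ball, over [Omega], it is the weight times [f]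
    at [zeta]. Each type feeds exactly one of the two terms. *)
Lemma transformed_split (s : R) :
  \int[M]_t ((\1_omega (d1 t))%:E * (Num.max (s * F t) 0)%:E) =
  \int[L]_x (\int[Lt]_xi \int[young_osc nu x xi]_z G s (x, xi, z) * (\1_Omega x)%:E) +
  \int[young_mass nu]_x \int[young_scale nu x]_xi \int[young_conc nu x xi]_z H s (x, xi, z).
Proof.
pose S : set R := [set t | `|d3 t|%R = 1%R].
have md3 := euclid_measurable cd3.
have mS : measurable S.
  by have := md3 measurableT _ (@unit_sphere_measurable R E); rewrite setTI.
have mcd2 : measurable_fun setT (fun t => torus_class (d2 t) : Z).
  exact: (measurableT_comp (@torus_class_measurable R d) (continuous_rV_measurable cd2)).
have mp : measurable_fun setT (fun t => (d1 t, torus_class (d2 t)) : X * Z).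
  exact: measurable_fun_pair.
have n1 : nnmeasurable (fun t => G s (d1 t, torus_class (d2 t), zeta d3 t) * (weight d3 t)%:E).
  apply: nnmeasurableM; last by apply: nnmeasurable_EFin => // t; exact: weight_ge0.
  apply: (@nnmeasurable_comp _ _ _ _ _
    (fun t : R => (d1 t, torus_class (d2 t), zeta d3 t) : X * Z * borel E)) => //.
  by apply: measurable_fun_pair => //; exact: (zeta_measurable cd3).
have n2 : nnmeasurable (fun t => H s (d1 t, torus_class (d2 t), d3 t) * (\1_S t)%:E).
  apply: nnmeasurableM; last exact: nnmeasurable_indic.
  apply: (@nnmeasurable_comp _ _ _ _ _
    (fun t : R => (d1 t, torus_class (d2 t), d3 t) : X * Z * borel E)) => //.
  exact: measurable_fun_pair.
have n3 : nnmeasurable (fun t => (\1_omega (d1 t))%:E * (Num.max (s * F t) 0)%:E).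
  apply: nnmeasurableM; last first.
    by apply: nnmeasurable_EFin => //; apply: measurable_maxr => //; exact: measurable_funM.
  by apply: nnmeasurable_EFin => //; apply: (measurableT_comp _ md1); exact: measurable_indic.
rewrite -oscE// -concE// -/S -ge0_integralD//; last 4 first.
- by move=> t _; case: n1.
- by case: n1.
- by move=> t _; case: n2.
- by case: n2.
(* Positive weight off [Omega] is excluded almost everywhere by [Mout]. *)
pose N := [set t | (\1_(~` Omega) (d1 t) * weight d3 t != 0 :> R)%R].
have mq : measurable_fun setT (fun t => \1_(~` Omega) (d1 t) * weight d3 t : R)%R.
  apply: measurable_funM => //; apply: (measurableT_comp _ md1).
  by apply: measurable_indic; apply: measurableC; exact: borel_open.
have mN : measurable N.
  have := mq measurableT _ (measurableC (measurable_set1 0%R)); rewrite setTI.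
  by congr measurable; apply/seteqP; split => t /= /eqP.
have N0 : M N = 0.
  have mqE : measurable_fun setT (fun t => (\1_(~` Omega) (d1 t) * weight d3 t)%:E : \bar R).
    exact/measurable_EFinP.
  have /(ae_eq_integral_abs M measurableT mqE) : \int[M]_t `|(\1_(~` Omega) (d1 t) * weight d3 t)%:E| = 0.
    rewrite -[RHS]Mout; apply: eq_integral => t _.
    by rewrite gee0_abs ?lee_fin ?mulr_ge0 ?weight_ge0// EFinM.
  move=> [A [mA A0 NA]]; apply: (subset_measure0 mN mA _ A0) => t Nt.
  by apply: NA => /= /(_ Logic.I) [] h; move: Nt; rewrite /N /= h eqxx.
apply: (nnintegral_eq_off_null n3 _ mN N0); first exact: nnmeasurableD.
move=> t /= /negP; rewrite negbK => /eqP Nt.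
have [w0|w0] := eqVneq (weight d3 t) 0%R.
  have d31 : (`|d3 t| = 1)%R by apply/eqP; rewrite eq_sym -subr_eq0; apply/eqP.
  rewrite w0 mule0 add0e.
  have -> : \1_S t = 1%R :> R by rewrite indicE mem_set.
  rewrite mule1 /H /=.
  have -> : \1_(unit_sphere E) (d3 t) = 1%R :> R by rewrite indicE mem_set.
  rewrite mul1r -EFinM.
  congr (_ * Num.max (s * _) _)%:E.
  by rewrite /transformed /osc_part w0 eqxx andbF addr0 /fK /= /rec_part /lift_rec.
have Ot : Omega (d1 t).
  apply: contrapT => Ot; move: Nt; rewrite indicE mem_set// mul1r => h.
  by rewrite h eqxx in w0.
have Kt : closure Omega (d1 t) by exact: subset_closure.
have wp : (0 <= weight d3 t)%R by exact: weight_ge0.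
have -> : \1_S t = 0%R :> R.
  by rewrite indicE memNset// => St; move: w0; rewrite /weight St subrr eqxx.
rewrite mule0 adde0 /G /fO /= (mem_set Ot) -!EFinM -mulrA; congr (_ * _)%:E.
rewrite /transformed /osc_part (mem_set Kt) (mem_set Ot) w0/= addrC subrK /lift_fun /=.
by rewrite maxr_pMl// mul0r mulrCA mulrC.
Qed.

Lemma transformed_split_fin (s : R) :
  \int[M]_t ((\1_omega (d1 t))%:E * (Num.max (s * F t) 0)%:E) < +oo.
Proof.
have [C C0 FC] := transformed_bounded boundedOmega rf d1 d2 d3_le1.
apply: (@le_lt_trans _ _ (\int[M]_t (`|s| * C)%:E)); last first.
  by rewrite integral_cst// lte_mul_pinfty// lee_fin mulr_ge0.
apply: ge0_le_integral => //.
- by move=> t _; rewrite -EFinM lee_fin mulr_ge0.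
- apply/measurable_EFinP; apply: measurable_funM.
    by apply: (measurableT_comp _ md1); exact: measurable_indic.
  by apply: measurable_maxr => //; exact: measurable_funM.
- move=> t _; rewrite -EFinM lee_fin.
  apply: (@le_trans _ _ (Num.max (s * F t) 0)%R).
    by rewrite ler_piMl// indicE; case: (_ \in _).
  rewrite ge_max mulr_ge0// andbT (le_trans (ler_norm _))// normrM.
  by rewrite ler_wpM2l.
Qed.

Let slice (q : X * Z -> \bar R) (x : X) : nnmeasurable q -> nnmeasurable (fun xi : Z => q (x, xi)).
Proof. by move=> nq; apply: nnmeasurable_comp nq; exact: measurable_pair1. Qed.

Let b s x := \int[Lt]_xi \int[young_osc nu x xi]_z G s (x, xi, z).

Let h s := \int[young_mass nu]_x \int[young_scale nu x]_xi
  \int[young_conc nu x xi]_z H s (x, xi, z).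

Let b_out s x : ~ omega x -> b s x = 0.
Proof.
move=> ox; apply: integral0_eq => xi _; apply: integral0_eq => z _.
by rewrite /G /= indicE memNset// mul0r.
Qed.

Let bE s : \int[L]_(x in omega `&` Omega) b s x = \int[L]_x (b s x * (\1_Omega x)%:E).
Proof.
rewrite integral_mkcond; apply: eq_integral => x _; rewrite patchE indicE in_setI.
have [ox|ox] := pselect (omega x); last by rewrite b_out// mul0e; case: ifP.
by rewrite (mem_set ox)/=; case: (x \in Omega); rewrite ?mule1 ?mule0.
Qed.

Let mO : measurable (Omega : set X). Proof. exact: borel_open. Qed.

(** [transformed_split] for the signs 1 and -1 is recombined by [iterated_integral_sub]. The linear
    growth of [f] with the pointwise first moments of [nu], and the boundedness of the recession
    function on the sphere, supply the inner finiteness. *)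
Lemma young_identity :
  \int[M]_t ((\1_omega (d1 t))%:E * (Num.max (F t) 0)%:E) -
  \int[M]_t ((\1_omega (d1 t))%:E * (Num.max (- F t) 0)%:E) =
  \int[L]_(x in omega `&` Omega) \int[Lt]_xi \int[young_osc nu x xi]_z (f (x, xi, z))%:E +
  \int[young_mass nu]_(x in omega) \int[young_scale nu x]_xi
    \int[young_conc nu x xi]_(z in unit_sphere E) (recession Omega f (x, xi, z))%:E.
Proof.
have sp : \int[M]_t ((\1_omega (d1 t))%:E * (Num.max (1 * F t) 0)%:E) =
    \int[L]_(x in omega `&` Omega) b 1 x + h 1 by rewrite bE; exact: transformed_split.
have sn : \int[M]_t ((\1_omega (d1 t))%:E * (Num.max (- 1 * F t) 0)%:E) =
    \int[L]_(x in omega `&` Omega) b (-1) x + h (-1) by rewrite bE; exact: transformed_split.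
have fp : \int[L]_(x in omega `&` Omega) b 1 x + h 1 < +oo.
  by rewrite -sp; exact: transformed_split_fin.
have fn : \int[L]_(x in omega `&` Omega) b (-1) x + h (-1) < +oo.
  by rewrite -sn; exact: transformed_split_fin.
have b0 s x : 0 <= b s x.
  by apply: integral_ge0 => xi _; apply: integral_ge0 => z _; case: (nG s).
have h0 s : 0 <= h s.
  apply: integral_ge0 => x _; apply: integral_ge0 => xi _; apply: integral_ge0 => z _.
  by case: (nH s).
have ib0 s : 0 <= \int[L]_(x in omega `&` Omega) b s x.
  by apply: integral_ge0 => x _; exact: b0.
have E1 : \int[M]_t ((\1_omega (d1 t))%:E * (Num.max (F t) 0)%:E) =
    \int[L]_(x in omega `&` Omega) b 1 x + h 1.
  by apply: etrans sp; apply: eq_integral => t _; rewrite mul1r.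
have E2 : \int[M]_t ((\1_omega (d1 t))%:E * (Num.max (- F t) 0)%:E) =
    \int[L]_(x in omega `&` Omega) b (-1) x + h (-1).
  by apply: etrans sn; apply: eq_integral => t _; rewrite mulN1r.
apply: (etrans (congr2 (fun x y => x - y) E1 E2)).
apply: (etrans (nn_fin_sub (ib0 1%R) (h0 1%R) (ib0 (-1)%R) (h0 (-1)%R) fp fn)).
apply: (congr2 (fun x y => x + y)).
- have [C C0 fC] := lift_fun_bounded boundedOmega rf.
  have bf s x : (`|s| <= 1)%R -> Omega x -> b s x < +oo.
    move=> s1 Ox.
    have nz : nnmeasurable (fun z : borel E => (`|z|%R)%:E).
      by apply: nnmeasurable_EFin => //; exact: norm_measurable.
    have nosc : nnmeasurable (fun xi => \int[young_osc nu x xi]_z `|z|%:E).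
      have nz2 : nnmeasurable (fun q : X * Z * borel E => (`|q.2|%R)%:E).
        exact: (@nnmeasurable_comp _ _ _ _ _ _ _ (@measurable_snd _ _ _ _) nz).
      exact: (slice x (oscM nz2)).
    have nGx xi : nnmeasurable (fun z => G s (x, xi, z)).
      by apply: (nnmeasurable_comp (measurable_pair1 _)) (nG s).
    have nbx : nnmeasurable (fun xi => \int[young_osc nu x xi]_z G s (x, xi, z)).
      exact: (slice x (oscM (nG s))).
    apply: (@le_lt_trans _ _ (\int[Lt]_xi (C%:E + C%:E * \int[young_osc nu x xi]_z `|z|%:E))).
      apply: le_nnintegral; [exact: nbx|exact: nnmeasurable_affine|move=> xi].
      have P1 : young_osc nu x xi setT = 1 by exact: (@probability_setT _ _ _ (young_osc nu x xi)).
      rewrite -(@nnintegral_affine _ _ _ (young_osc nu x xi) _ _ P1 C0 nz).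
      apply: le_nnintegral; [exact: nGx|exact: nnmeasurable_affine|move=> z].
      rewrite /G /fO /= (mem_set Ox) -EFinM -EFinD lee_fin.
      apply: (@le_trans _ _ (Num.max (s * f (x, xi, z)) 0)%R).
        by rewrite ler_piMl// indicE; case: (_ \in _).
      rewrite ge_max addr_ge0 ?mulr_ge0// andbT (le_trans (ler_norm _))// normrM.
      rewrite (le_trans (_ : _ <= `|f (x, xi, z)|)%R) ?ler_piMl//.
      have := fC x (torus_repr xi) z Ox; rewrite /lift_fun /= torus_reprK.
      by rewrite mulrDr mulr1.
    have Lt1 : Lt setT = 1 by exact: (@probability_setT _ _ _ Lt).
    have e : \int[Lt]_xi (C%:E + C%:E * \int[young_osc nu x xi]_z `|z|%:E) =
        C%:E + C%:E * \int[Lt]_xi \int[young_osc nu x xi]_z `|z|%:E.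
      exact: (nnintegral_affine Lt1 C0 nosc).
    have fin : C%:E + C%:E * \int[Lt]_xi \int[young_osc nu x xi]_z `|z|%:E < +oo.
      by rewrite lte_add_pinfty ?ltry// lte_mul_pinfty.
    exact: (eq_ind_r (fun y => y < +oo) fin e).
  apply/esym; apply: (@iterated_integral_sub _ _ _ _ X Z (borel E) L (fun=> Lt)
    (fun x xi => young_osc nu x xi) (omega `&` Omega) (G 1) (G (-1))) => //.
  + exact: measurableI.
  + by move=> G' nG'; exact: (nnmeasurable_fubini Lt nG').
  + move=> x xi [ox Ox]; rewrite integral_EFinE; congr (_ - _); apply: eq_integral => z _.
      by rewrite /G /fO /= indicE (mem_set ox) (mem_set Ox) !mul1r.
    by rewrite /G /fO /= indicE (mem_set ox) (mem_set Ox) mul1r mulN1r.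
  + by move=> x [ox Ox]; apply: bf => //; rewrite normr1.
  + by move=> x [ox Ox]; apply: bf => //; rewrite normrN1.
  + by apply: le_lt_trans fp; rewrite leeDl.
  + by apply: le_lt_trans fn; rewrite leeDl.
- have [C C0 fC] := lift_rec_bounded boundedOmega rf.
  have hE s : h s = \int[young_mass nu]_(x in omega) \int[young_scale nu x]_xi
      \int[young_conc nu x xi]_z H s (x, xi, z).
    rewrite [RHS]integral_mkcond; apply: eq_integral => x _; rewrite patchE.
    case: ifPn => //; rewrite notin_setE => ox.
    apply: integral0_eq => xi _; apply: integral0_eq => z _.
    by rewrite /H /= indicE memNset// mul0r.
  have hf s x : (`|s| <= 1)%R -> omega x ->
      \int[young_scale nu x]_xi \int[young_conc nu x xi]_z H s (x, xi, z) < +oo.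
    move=> s1 ox; have Kx := omegaK ox.
    have nHx xi : nnmeasurable (fun z => H s (x, xi, z)).
      by apply: (nnmeasurable_comp (measurable_pair1 _)) (nH s).
    have nhx : nnmeasurable (fun xi => \int[young_conc nu x xi]_z H s (x, xi, z)).
      exact: (slice x (concM (nH s))).
    apply: (@le_lt_trans _ _ (\int[young_scale nu x]_xi C%:E)); last first.
      exact: (eq_ind_r (fun y => y < +oo) (ltry C) (probability_cst (young_scale nu x) C)).
    have nC dY (Y : measurableType dY) : nnmeasurable (fun _ : Y => C%:E).
      exact: (nnmeasurable_EFin (g := fun=> C)).
    apply: le_nnintegral; [exact: nhx|exact: nC|move=> xi].
    rewrite (_ : C%:E = \int[young_conc nu x xi]_z C%:E); last first.
      exact: (esym (probability_cst (young_conc nu x xi) C)).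
    apply: le_nnintegral; [exact: nHx|exact: nC|move=> z].
    rewrite /H /fK /= (mem_set Kx) lee_fin.
    have i1 T (A : set T) y : (\1_A y <= 1 :> R)%R by rewrite indicE; case: (_ \in _).
    apply: (@le_trans _ _ (\1_(unit_sphere E) z * Num.max (s * recession Omega f (x, xi, z)) 0)%R).
        by rewrite ler_piMl// mulr_ge0.
      have [z1|z1] := pselect (unit_sphere E z); last by rewrite indicE memNset// mul0r.
      rewrite indicE mem_set// mul1r ge_max C0 andbT (le_trans (ler_norm _))// normrM.
      rewrite (le_trans (_ : _ <= `|recession Omega f (x, xi, z)|)%R) ?ler_piMl//.
      have := fC x (torus_repr xi) z Kx; rewrite /lift_rec /= torus_reprK.
      by rewrite (z1 : `|z| = 1)%R mulr1.
  rewrite (hE 1%R) (hE (-1)%R).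
  apply/esym; apply: (@iterated_integral_sub _ _ _ _ X Z (borel E) (young_mass nu)
    (fun x => young_scale nu x) (fun x xi => young_conc nu x xi) omega (H 1) (H (-1))) => //.
  + move=> x xi ox; have Kx := omegaK ox.
    rewrite (_ : \int[young_conc nu x xi]_(z in unit_sphere E) _ =
      \int[young_conc nu x xi]_z ((\1_(unit_sphere E) z * recession Omega f (x, xi, z))%R)%:E); last first.
      rewrite integral_mkcond; apply: eq_integral => z _; rewrite patchE indicE.
      by case: (z \in _); rewrite ?mul1r ?mul0r.
    have mxi (a c : R) : (0 <= a -> a * Num.max c 0 = Num.max (a * c) 0)%R.
      by move=> a0; rewrite maxr_pMr// mulr0.
    rewrite integral_EFinE; congr (_ - _); apply: eq_integral => z _.
      by rewrite /H /fK /= [\1_omega _]indicE (mem_set ox) (mem_set Kx) !mul1r mxi.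
    by rewrite /H /fK /= [\1_omega _]indicE (mem_set ox) (mem_set Kx) mul1r mulN1r mxi// mulrN.
  + by move=> x ox; apply: hf => //; rewrite normr1.
  + by move=> x ox; apply: hf => //; rewrite normrN1.
  + by rewrite -hE; apply: le_lt_trans fp; rewrite leeDr.
  + by rewrite -hE; apply: le_lt_trans fn; rewrite leeDr.
Qed.

End young_identity.

(** * Assembly of the limit measure, the Young measure and the convergence *)

Theorem theorem1p2 (R : realType) (d : nat) (E : euclideanType R)
  (dimE : (0 < \dim (fullv : {vspace E}))%N)
  (Omega : set 'rV[R]_d)
  (openOmega : open Omega) (boundedOmega : bounded_set Omega)
  (boundaryOmega : lebesgue_rV R d (closure Omega `\` interior Omega) = 0%E)
  (eps : nat -> R)
  (eps_gt0 : forall n, 0 < eps n) (eps_dec : nonincreasing_seq eps)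
  (eps_cvg0 : eps @ \oo --> (0 : R))
  (mu : nat -> set (borel 'rV[R]_d) -> E)
  (mu_meas : forall n, bounded_measure_on (T := borel 'rV[R]_d) Omega (mu n))
  (mu_bounded :
    (ereal_sup (range (fun n => variation_measure (mu n) Omega)) < +oo)%E) :
  exists (k : nat -> nat) (nu : two_scale_young_measure E Omega),
    (forall m n, (m < n)%N -> (k m < k n)%N) /\
    forall f : 'rV[R]_d * torus R d * E -> R,
      {within Omega `*` setT `*` setT, continuous f} ->
      has_recession Omega f ->
      exists mu_f : {charge set (borel 'rV[R]_d) -> \bar R},
        [/\ (* mu_f is a measure on the closure of Omega *)
            forall A : set (borel 'rV[R]_d), measurable A ->
              mu_f A = mu_f (A `&` closure Omega),
            weak_star_cvg (closure Omega)
              (fun n => two_scale_action Omega (eps (k n)) (mu (k n)) f) mu_f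
          & forall omega : set (borel 'rV[R]_d), measurable omega ->
              omega `<=` closure Omega ->
              mu_f omega =
                (\int[lebesgue_rV R d]_(x in omega `&` Omega)
                   \int[lebesgue_torus R d]_xi
                     \int[young_osc nu x xi]_z (f (x, xi, z))%:E +
                 \int[young_mass nu]_(x in omega)
                   \int[young_scale nu x]_xi
                     \int[young_conc nu x xi]_(z in unit_sphere E)
                       (recession Omega f (x, xi, z))%:E)%E].
Proof.
pose X := borel 'rV[R]_d; pose L := lebesgue_rV R d.
have mO : measurable (Omega : set X) by exact: borel_open.
have mK : measurable (closure Omega : set X) by apply: borel_closed; exact: closed_closure.
have [B0 [_ OB]] := boundedOmega.
pose r := `|B0| + 1.
have r0 : 0 < r by rewrite ltr_wpDl.
have Or x : Omega x -> `|x| <= r.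
  by move=> Ox; apply: (OB r _ x Ox); rewrite (le_lt_trans (ler_norm _))// ltrDl.
have [V V0 muV] : exists2 V : R, 0 <= V &
    forall n, (variation_measure (mu n) Omega <= V%:E)%E.
  set s := ereal_sup _ in mu_bounded.
  have us n : (variation_measure (mu n) Omega <= s)%E by apply: ereal_sup_ubound; exists n.
  have s0 : (0 <= s)%E by apply: le_trans (us 0%N); exact: variation_ge0.
  have sf : s \is a fin_num by rewrite ge0_fin_numE.
  by exists (fine s); [exact: fine_ge0|move=> n; rewrite fineK].
have [d1 [d2 [d3 [cd1 cd2 cd3 d3le cod]]]] := coding d dimE r0.
have [K K0 KP] := coded_measure dimE openOmega cd1 r0 Or cod.
have [q qP] := choice (fun n => KP (eps n) V (mu n) V0 (muV n)).
(* Independent of [n]: the uniform mass bound that the selection theorem asks for. *)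
pose C := fine (L Omega) + K * V.
have mC n : ((q n).1.1.1 setT <= C%:E)%E by exact: (coded_mass (qP n)).
have [k [M [kinc MC _ mM]]] := helly_selection mC (fun n => coded_01 (qP n)).
have Mfin : (M setT < +oo)%E by apply: le_lt_trans MC _; rewrite ltry.
pose m n := (q (k n)).1.1.1.
have mkC n : (m n setT <= C%:E)%E by exact: mC.
(* The selection theorem places [M] in ]-1, 2]; closedness of [0, 1], which carries every coded
   measure, refines this. *)
have M01 : M (~` `[0, 1]%classic) = 0%E.
  by apply: (weak_limit_closed MC mM); [exact: interval_closed|move=> n; exact: (coded_01 (qP (k n)))].
have mA n : m n (~` (base_domain Omega d1)) = 0%E by exact: (coded_A (qP (k n))).
have MA : M (~` (base_domain Omega d1)) = 0%E.
  by apply: (weak_limit_closed MC mM); [exact: base_domain_closed|exact: mA].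
have i0 (x : X) : 0 <= (\1_Omega x : R) by rewrite indicE.
(* Lebesgue measure restricted to [Omega], made into a finite measure for the product with the
   torus. *)
have [LO0 LO0E] := image_density L (@measurable_id _ X setT) (measurable_indic mO) i0.
have LOfin : (LO0 setT < +oo)%E.
  have -> : LO0 setT = L Omega.
    have := LO0E _ (nnmeasurable_indic R (@measurableT _ X)).
    rewrite integral_indic// setIT => ->.
    transitivity (\int[L]_x (\1_Omega x)%:E)%E; last by rewrite integral_indic// setIT.
    by apply: eq_integral => x _; rewrite indicT mul1e.
  apply: (@lebesgue_bounded R d Omega r) => // x Ox i.
  by apply: le_trans (coord_norm_le _ _) _; exact: Or.
pose LO := finite_measure_of (measure_fin_num_fun LOfin).
have LOE (h : X -> \bar R) : nnmeasurable h ->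
    (\int[LO]_x h x = \int[L]_x (h x * (\1_Omega x)%:E))%E by move=> nh; exact: LO0E.
have k_ge n : (n <= k n)%N.
  by elim: n => // n IH; apply: leq_ltn_trans IH _; exact: kinc.
have keps : eps (k n) @[n --> \oo] --> (0 : R).
  have kk : k @ \oo --> \oo.
    by move=> P [N _ hN]; exists N => // n /= Nn; apply: hN; exact: leq_trans Nn (k_ge n).
  exact: (cvg_comp _ _ kk eps_cvg0).
have ceps n : 0 < eps (k n) by exact: eps_gt0.
have c1 n x : Omega x -> d1 ((q (k n)).1.2 x) = x by move=> /(coded_d1 (qP (k n)))[].
have c2 n x : Omega x -> d2 ((q (k n)).1.2 x) = frac ((eps (k n))^-1 *: x).
  by move=> /(coded_d2 (qP (k n)))[].
have mE n h (nh : nnmeasurable h) := coded_weight cd3 d3le (qP (k n)) nh.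
have marg h (nh : nnmeasurable h) := marginal_product openOmega boundedOmega cd1 cd2 cd3 d3le
  mkC MC mM ceps keps c1 c2 mE LOE nh.
have Mout := marginal_out openOmega boundedOmega cd1 cd2 cd3 d3le mkC MC mM ceps keps c1 c2 mE.
(* The Young measure depends on [M] and the coding only and is fixed before any integrand is
   chosen. *)
have [nu [oscM [osc1 osc2] oscE [scaleM concM] concE]] :=
  ex_young_measure dimE openOmega cd1 cd2 cd3 d3le Mfin M01 MA LOE marg.
exists k, nu; split => // f cf rf.
have mF := transformed_measurable openOmega boundedOmega cf rf cd1 cd2 cd3 d3le.
have [CF CF0 FC] := transformed_bounded boundedOmega rf d1 d2 d3le.
have Fout t : ~ closure Omega (d1 t) -> transformed Omega f d1 d2 d3 t = 0.
  by move=> At; rewrite transformed_out.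
have md1 : measurable_fun setT (d1 : R -> X) by exact: continuous_rV_measurable.
(* [mu_f] will be the image under [d1] of [F] times [M], obtained as the difference of the images
   for the positive and negative parts of [F]. *)
have part (F : R -> R) : measurable_fun setT F -> (forall t, `|F t| <= CF) ->
    exists mp : {finite_measure set X -> \bar R}, forall h, nnmeasurable h ->
      (\int[mp]_x h x = \int[M]_t (h (d1 t) * (Num.max (F t) 0)%:E))%E.
  move=> mF' FC'; have [nF nF0] := nnmeasurable_max0 mF'.
  have mmax : measurable_fun setT (fun t => Num.max (F t) 0) by exact: measurable_maxr.
  have max0 t : 0 <= Num.max (F t) 0 by rewrite le_max lexx orbT.
  have [mp mpE] := image_density M md1 mmax max0.
  have fin : (mp setT < +oo)%E.
    have := mpE _ (nnmeasurable_indic R (@measurableT _ X)).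
    rewrite integral_indic// setIT => ->.
    apply: (@le_lt_trans _ _ (\int[M]_t CF%:E)%E); last first.
      by rewrite integral_cst// lte_mul_pinfty.
    apply: ge0_le_integral => //.
    - by move=> t _; rewrite indicT mul1e.
    - by under eq_fun do rewrite indicT mul1e.
    - move=> t _; rewrite indicT mul1e lee_fin ge_max CF0 andbT.
      by rewrite (le_trans (ler_norm _)).
  by exists (finite_measure_of (measure_fin_num_fun fin)).
set F := transformed Omega f d1 d2 d3 in mF FC Fout.
have mFN : measurable_fun setT (fun t => - F t) by exact: measurable_funN.
have [mp mpE] := part F mF FC.
have [mn mnE] : exists mp : {finite_measure set X -> \bar R}, forall h, nnmeasurable h ->
      (\int[mp]_x h x = \int[M]_t (h (d1 t) * (Num.max (- F t) 0)%:E))%E.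
  by apply: (part (fun t => - F t)) => // t; rewrite normrN.
have mpA (A : set X) : measurable A ->
    mp A = (\int[M]_t ((\1_A (d1 t))%:E * (Num.max (F t) 0)%:E))%E.
  by move=> mA'; rewrite -(mpE _ (nnmeasurable_indic R mA')) integral_indic// setIT.
have mnA (A : set X) : measurable A ->
    mn A = (\int[M]_t ((\1_A (d1 t))%:E * (Num.max (- F t) 0)%:E))%E.
  by move=> mA'; rewrite -(mnE _ (nnmeasurable_indic R mA')) integral_indic// setIT.
exists (cadd (charge_of_finite_measure mp) (copp (charge_of_finite_measure mn))); split.
- move=> A mA'; have mAK : measurable (A `&` closure Omega : set X) by exact: measurableI.
  have eqI t : (\1_(A `&` closure Omega) (d1 t) : R) = \1_A (d1 t) * \1_(closure Omega) (d1 t).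
    by rewrite indicI.
  have e1 : mp A = mp (A `&` closure Omega).
    rewrite (mpA _ mA') (mpA _ mAK); apply: eq_integral => t _; rewrite eqI.
    have [At|At] := pselect (closure Omega (d1 t)).
      by rewrite [\1_(closure _) _]indicE mem_set// mulr1.
    by rewrite Fout// maxxx !mule0.
  have e2 : mn A = mn (A `&` closure Omega).
    rewrite (mnA _ mA') (mnA _ mAK); apply: eq_integral => t _; rewrite eqI.
    have [At|At] := pselect (closure Omega (d1 t)).
      by rewrite [\1_(closure _) _]indicE mem_set// mulr1.
    by rewrite Fout// oppr0 maxxx !mule0.
  exact: (congr2 (fun x y => x - y)%E e1 e2).
- move=> phi cphi.
  have actE n : two_scale_action Omega (eps (k n)) (mu (k n)) f phi =
      (\int[m n]_t (phi (d1 t) * F t))%:E.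
    exact: (coded_action openOmega boundedOmega cd1 cd2 cd3 d3le (qP (k n)) cf rf cphi).
  rewrite (_ : (fun n => _) = (fun n => (\int[m n]_t (phi (d1 t) * F t))%:E)); last first.
    by apply/funext => n; exact: actE.
  have KC : compact (closure Omega).
    by apply: bounded_closed_compact; [exact: bounded_closure|exact: closed_closure].
  have [B1 [_ hB1]] := compact_bounded (continuous_compact cphi KC).
  pose Bp := `|B1| + 1.
  have phiB x : closure Omega x -> `|phi x| <= Bp.
    move=> Kx; apply: (hB1 Bp); last by exists x.
    by rewrite (le_lt_trans (ler_norm _))// ltrDl.
  have mphi : measurable_fun setT ((phi : X -> R) \_ (closure Omega : set X)).
    have := (measurable_restrict (phi : X -> R) mK (@measurableT _ X)).1.
    by rewrite setTI; apply; exact: borel_continuous_within.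
  have Bp0 : 0 <= Bp by rewrite addr_ge0.
  have psiB (x : X) : `|((phi : X -> R) \_ (closure Omega : set X)) x| <= Bp.
    by rewrite patchE; case: ifPn => [|_]; [rewrite inE; exact: phiB|rewrite normr0].
  set psi := ((phi : X -> R) \_ (closure Omega : set X)) in mphi psiB.
  have -> : charge_integral
      (cadd (charge_of_finite_measure mp) (copp (charge_of_finite_measure mn)))
      (closure Omega) phi = (\int[M]_t (phi (d1 t) * F t))%:E.
    rewrite (charge_integral_sub mp mn mK mphi psiB); congr EFin; rewrite -/psi.
    have fin (n0 : {finite_measure set X -> \bar R}) : (n0 setT < +oo)%E.
      by rewrite -ge0_fin_numE//; exact: fin_num_measure.
    have transfer (n0 : {finite_measure set X -> \bar R}) (G : R -> R) :
        measurable_fun setT G -> (forall t, `|G t| <= CF) ->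
        (forall h, nnmeasurable h ->
          (\int[n0]_x h x = \int[M]_t (h (d1 t) * (Num.max (G t) 0)%:E))%E) ->
        \int[n0]_x psi x = \int[M]_t (psi (d1 t) * Num.max (G t) 0).
      move=> mG GC nE.
      have mx0 t : 0 <= Num.max (G t) 0 by rewrite le_max lexx orbT.
      (* The zero measure fills the second slot of [signed_integral_formula]. *)
      have nE' h : nnmeasurable h -> (\int[n0]_x h x =
          \int[M]_t (h (d1 t) * (Num.max (G t) 0)%:E) +
          \int[@mzero _ R R]_t (h (d1 t) * (0 : R)%:E))%E.
        by move=> nh; rewrite nE// integral_measure_zero adde0.
      rewrite /Rintegral.
      rewrite (signed_integral_formula (fin n0) mx0 (fun=> lexx 0) nE' mphi psiB).
      by rewrite integral_measure_zero adde0.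
    rewrite (transfer mp F)// (transfer mn (fun t => - F t))//; last by move=> t; rewrite normrN.
    have mpsid : measurable_fun setT (fun t => psi (d1 t)) by exact: (measurableT_comp mphi md1).
    have intg (G : R -> R) : measurable_fun setT G -> (forall t, `|G t| <= CF) ->
        M.-integrable setT (EFin \o (fun t => psi (d1 t) * Num.max (G t) 0)).
      move=> mG GC; apply: (bounded_integrable Mfin (B := Bp * CF)).
        by apply: measurable_funM => //; exact: measurable_maxr.
      move=> t; rewrite normrM ler_pM// ger0_norm ?le_max ?lexx ?orbT//.
      by rewrite ge_max CF0 andbT (le_trans (ler_norm _)).
    rewrite -RintegralB//; [|exact: intg|by apply: intg => // t; rewrite normrN].
    apply: eq_Rintegral => t _; rewrite -mulrBr.
    have -> : Num.max (F t) 0 - Num.max (- F t) 0 = F t.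
      have [h|h] := leP 0 (F t).
        by rewrite [Num.max (- _) _]max_r ?subr0// oppr_le0.
      by rewrite [Num.max (- _) _]max_l ?sub0r ?opprK// oppr_ge0 ltW.
    have [At|At] := pselect (closure Omega (d1 t)); last by rewrite Fout// !mulr0.
    by rewrite /psi patchE mem_set.
  apply: cvg_EFin; first exact: nearW.
  (* The Lebesgue mass of a boundary layer of [Omega]. It bounds [rest] for all [n] at once, because
     the weighted coded measures integrate functions of the position as Lebesgue measure on [Omega]
     does. *)
  pose rr j := \int[LO]_x (1 - bump (~` Omega) j x).
  have LOf : (LO setT < +oo)%E by exact: LOfin.
  have mb j : measurable_fun setT (fun x : X => 1 - bump (~` Omega) j x).
    apply: measurable_funB => //.
    by apply: borel_continuousT_real; exact: bump_continuous.
  have b01 j (x : X) : 0 <= 1 - bump (~` Omega) j x <= 1.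
    by rewrite subr_ge0 bump_le1 gerBl bump_ge0.
  have bn j (x : X) : `|1 - bump (~` Omega) j x| <= 1.
    by have /andP[h1 h2] := b01 j x; rewrite ger0_norm.
  have rr0 : rr @ \oo --> (0 : R).
    have Li : LO.-integrable setT (fun=> 1%:E).
      by apply: (@bounded_integrable _ _ _ _ LOf (cst 1) 1) => // x; rewrite normr1.
    have c0 (x : X) : setT x -> (1 - bump (~` Omega) j x)%:E @[j --> \oo] -->
        ((\1_(~` Omega) x : R)%:E : \bar R).
      move=> _; apply: cvg_EFin; first exact: nearW.
      have -> : (\1_(~` Omega) x : R) = 1 - \1_(~` (~` Omega)) x.
        by rewrite setCK !indicE in_setC; case: (_ \in _); rewrite /= ?subrr ?subr0.
      by apply: cvgB; [exact: cvg_cst|apply: bump_cvg; exact: open_closedC].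
    have b1 j (x : X) : setT x -> (`|(1 - bump (~` Omega) j x)%:E| <= 1%:E)%E.
      by move=> _; rewrite lee_fin; exact: bn.
    have mbE j : measurable_fun setT (fun x : X => (1 - bump (~` Omega) j x)%:E).
      by apply/measurable_EFinP; exact: mb.
    have := @dominated_cvg _ _ _ LO setT measurableT (fun j x => (1 - bump (~` Omega) j x)%:E)
      (fun x => (\1_(~` Omega) x)%:E) (fun=> 1%:E) mbE c0 (fun _ _ => isT) Li b1.
    have -> : (\int[LO]_x (\1_(~` Omega) x)%:E = 0)%E.
      rewrite LOE; last exact: (nnmeasurable_indic R (measurableC mO)).
      apply: integral0_eq => x _; rewrite -EFinM !indicE in_setC.
      by case: (_ \in _); rewrite /= ?mul0r ?mulr0.
    by move=> h; exact: (fine_cvg h).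
  have mr n j : \int[m n]_t rest Omega d1 d3 j t <= rr j.
    have mfin : (m n setT < +oo)%E by apply: le_lt_trans (mkC n) _; rewrite ltry.
    have mrest := rest_measurable openOmega cd1 cd3 j.
    have rb t : `|rest Omega d1 d3 j t| <= 1.
      by have /andP[h1 h2] := rest_itv Omega d1 d3le j t; rewrite ger0_norm.
    rewrite -lee_fin -(bounded_integralE mfin mrest rb) -(bounded_integralE LOf (mb j) (bn j)).
    rewrite LOE; last by apply: nnmeasurable_EFin => // x; case/andP: (b01 j x).
    pose hh t : R := if d1 t \in Omega then 1 - bump (~` Omega) j (d1 t) else 0.
    have nhh : nnmeasurable (fun t => (hh t)%:E).
      apply: nnmeasurable_EFin; last by move=> t; rewrite /hh; case: ifP => // _; case/andP: (b01 j (d1 t)).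
      have mOt : measurable (d1 @^-1` Omega : set R) by rewrite -[Y in measurable Y]setTI; exact: md1.
      have := (measurable_restrict (fun t => 1 - bump (~` Omega) j (d1 t)) mOt (@measurableT _ R)).1.
      by rewrite setTI; apply; apply: measurable_funTS; exact: (measurableT_comp (mb j) md1).
    have -> : (\int[m n]_t (rest Omega d1 d3 j t)%:E = \int[m n]_t ((hh t)%:E * (weight d3 t)%:E))%E.
      by apply: eq_integral => t _; rewrite -EFinM.
    rewrite mE// le_eqVlt; apply/orP; left; apply/eqP; apply: eq_integral => x _.
    have [Ox|Ox] := pselect (Omega x); last by rewrite indicE memNset// !mule0.
    by rewrite /hh c1// mem_set.
  exact: (transformed_cvg openOmega boundedOmega cf rf cd1 cd2 cd3 d3le mkC MC mM mA rr0 mr cphi).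
- move=> omega momega omegaK.
  apply: (etrans (congr2 (fun x y => x - y)%E (mpA _ momega) (mnA _ momega))).
  exact: (young_identity openOmega boundedOmega cf rf cd1 cd2 cd3 d3le Mfin Mout
    oscM osc2 oscE scaleM concM concE momega omegaK).
Qed.
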